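(* Let $n\in\omega$. For every true $\Pi_{2n+1}$ sentence $\varphi$ of first-order arithmetic there exists a computable $\mathsf{PA}$-verifiable linear order $\mathcal L$ of order-type $\omega^n+1$ such that $$\mathsf{RFN}^{\mathcal L}(\mathsf{PA})\vdash\varphi .$$
   Context: $\mathsf{PA}$ is first-order Peano arithmetic; ''true'' means true in the standard model $\mathbb N$. Computable linear orders. A linear order $\mathcal L$ is a set $L\subseteq\mathbb N$ with a binary relation $\preceq^{\mathcal L}$ (coded as a set of numbers via a standard pairing function) satisfying the axioms of (non-strict) linear orders; $L=\{x: x\preceq^{\mathcal L}x\}$. Inside first-order arithmetic a computable linear order is represented by a natural number coding a pair consisting of an index of a $\Pi_1$-set and an index of a $\Sigma_1$-set which define the same set $\preceq^{\mathcal L}$, this set being a linear order. $\mathsf{LO}(\mathcal L)$ is the first-order arithmetical formula expressing that $\mathcal L$ is a computable linear order in this sense. $\mathcal L$ is $\mathsf{PA}$-verifiable if $\mathsf{PA}\vdash\mathsf{LO}(\mathcal L)$. Uniform reflection. Let $T$ be a c.e. axiomatizable arithmetical theory given by a $\Sigma_1$-formula $\mathsf{Ax}_T(x)$ saying that $x$ is the Gödel number of an axiom of $T$, and let $\mathsf{Prv}_T(x)$ be the natural provability predicate (there is a first-order proof of $x$ from premises satisfying $\mathsf{Ax}_T$). $\mathsf{RFN}(T)$ is the extension of $T$ by all sentences $\forall x\,(\mathsf{Prv}_T(\ulcorner\varphi(\dot x)\urcorner)\to\varphi(x))$, for $\varphi(x)$ an arbitrary arithmetical formula ($\dot x$ denotes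 substitution of the numeral of $x$). Iteration. For a $\mathsf{PA}$-verifiable computable linear order $\mathcal L$ and $a\in L$, $$\mathsf{RFN}^{(\mathcal L,a)}(T)=T+\bigcup_{b\prec^{\mathcal L}a}\mathsf{RFN}(\mathsf{RFN}^{(\mathcal L,b)}(T)),\qquad \mathsf{RFN}^{\mathcal L}(T)=T+\bigcup_{a\in L}\mathsf{RFN}(\mathsf{RFN}^{(\mathcal L,a)}(T)).$$ Formally, the axioms of $\mathsf{RFN}^{(\mathcal L,a)}(T)$ are recognized by the $\Sigma_1$-formula $\mathsf{Ax}_T^{\mathcal L}(\underline a,y)$, where $\mathsf{Ax}_T^{\mathcal L}(x,y)$ is obtained by the Diagonal Lemma so as to be $\mathsf{PA}$-provably equivalent to: ''$x\in\mathcal L$, and either $y$ is an axiom of $T$ or for some $z\prec^{\mathcal L}x$, $y$ is an instance of the uniform reflection scheme for the theory whose axioms are defined by $\mathsf{Ax}_T^{\mathcal L}(\underline z,\cdot)$''. *)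

(* Defs.v *)
From mathcomp Require Import all_boot all_order.

Set Implicit Arguments.
Unset Strict Implicit.
Unset Printing Implicit Defensive.

(* Variables are de Bruijn indices: [All] binds index 0. *)
Inductive term : Type :=
| Var (i : nat)
| Zero
| Succ (t : term)
| Add (t u : term)
| Mul (t u : term).

Inductive form : Type :=
| Eq (t u : term)
| Le (t u : term)
| Bot
| Imp (a b : form)
| All (a : form).

Definition Neg a := Imp a Bot.
Definition And a b := Neg (Imp a (Neg b)).
Definition Or a b := Imp (Neg a) b.
Definition Iff a b := And (Imp a b) (Imp b a).
Definition Ex a := Neg (All (Neg a)).

Fixpoint tsubst (s : nat -> term) (t : term) : term :=
  match t with
  | Var i => s i
  | Zero => Zero
  | Succ t => Succ (tsubst s t)
  | Add t u => Add (tsubst s t) (tsubst s u)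
  | Mul t u => Mul (tsubst s t) (tsubst s u)
  end.

Definition shift (i : nat) : term := Var i.+1.

Definition up (s : nat -> term) (i : nat) : term :=
  if i is j.+1 then tsubst shift (s j) else Var 0.

Fixpoint fsubst (s : nat -> term) (a : form) : form :=
  match a with
  | Eq t u => Eq (tsubst s t) (tsubst s u)
  | Le t u => Le (tsubst s t) (tsubst s u)
  | Bot => Bot
  | Imp a b => Imp (fsubst s a) (fsubst s b)
  | All a => All (fsubst (up s) a)
  end.

Definition inst (t : term) (i : nat) : term :=
  if i is j.+1 then Var j else t.

Definition inst_succ (i : nat) : term :=
  if i is 0 then Succ (Var 0) else Var i.

Definition num (n : nat) : term := iter n Succ Zero.

Fixpoint tscoped (k : nat) (t : term) : bool :=
  match t with
  | Var i => i < k
  | Zero => true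
  | Succ t => tscoped k t
  | Add t u | Mul t u => tscoped k t && tscoped k u
  end.

Fixpoint fscoped (k : nat) (a : form) : bool :=
  match a with
  | Eq t u | Le t u => tscoped k t && tscoped k u
  | Bot => true
  | Imp a b => fscoped k a && fscoped k b
  | All a => fscoped k.+1 a
  end.

Definition sentence (a : form) : bool := fscoped 0 a.

Fixpoint eval (r : nat -> nat) (t : term) : nat :=
  match t with
  | Var i => r i
  | Zero => 0
  | Succ t => (eval r t).+1
  | Add t u => eval r t + eval r u
  | Mul t u => eval r t * eval r u
  end.

Definition scons (x : nat) (r : nat -> nat) (i : nat) : nat :=
  if i is j.+1 then r j else x.

Fixpoint sat (r : nat -> nat) (a : form) : Prop :=
  match a with
  | Eq t u => eval r t = eval r u
  | Le t u => eval r t <= eval r u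
  | Bot => False
  | Imp a b => sat r a -> sat r b
  | All a => forall x, sat (scons x r) a
  end.

Definition true_in_N (a : form) : Prop := sat (fun _ => 0) a.

(* Shifting the bound of the quantifier makes it independent of the bound
   variable.  Bounded existential quantifiers, and the other connectives, are
   covered through their definitions from [Imp], [Bot] and [All]. *)
Inductive delta0 : form -> Prop :=
| delta0_eq t u : delta0 (Eq t u)
| delta0_le t u : delta0 (Le t u)
| delta0_bot : delta0 Bot
| delta0_imp a b : delta0 a -> delta0 b -> delta0 (Imp a b)
| delta0_all t a :
    delta0 a -> delta0 (All (Imp (Le (Var 0) (tsubst shift t)) a)).

Inductive is_Sigma : nat -> form -> Prop :=
| Sigma_delta0 a : delta0 a -> is_Sigma 0 a
| Sigma_Pi n a : is_Pi n a -> is_Sigma n.+1 a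
| Sigma_ex n a : is_Sigma n.+1 a -> is_Sigma n.+1 (Ex a)
with is_Pi : nat -> form -> Prop :=
| Pi_delta0 a : delta0 a -> is_Pi 0 a
| Pi_Sigma n a : is_Sigma n a -> is_Pi n.+1 a
| Pi_all n a : is_Pi n.+1 a -> is_Pi n.+1 (All a).

Inductive logical_axiom : form -> Prop :=
| LK a b : logical_axiom (Imp a (Imp b a))
| LS a b c :
    logical_axiom (Imp (Imp a (Imp b c)) (Imp (Imp a b) (Imp a c)))
| LDN a : logical_axiom (Imp (Neg (Neg a)) a)
| LInst a t : logical_axiom (Imp (All a) (fsubst (inst t) a))
| LDist a b : logical_axiom (Imp (All (Imp a b)) (Imp (All a) (All b)))
| LVac a : logical_axiom (Imp a (All (fsubst shift a)))
| LRefl t : logical_axiom (Eq t t)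
| LLeib a t u :
    logical_axiom
      (Imp (Eq t u) (Imp (fsubst (inst t) a) (fsubst (inst u) a))).

Inductive proves (T : form -> Prop) : form -> Prop :=
| proves_ax a : T a -> proves T a
| proves_log a : logical_axiom a -> proves T a
| proves_mp a b : proves T (Imp a b) -> proves T a -> proves T b
| proves_gen a : proves T a -> proves T (All a).

Definition basic_axioms : seq form :=
  [:: All (Neg (Eq (Succ (Var 0)) Zero));
      All (All (Imp (Eq (Succ (Var 1)) (Succ (Var 0))) (Eq (Var 1) (Var 0))));
      All (Eq (Add (Var 0) Zero) (Var 0));
      All (All (Eq (Add (Var 1) (Succ (Var 0))) (Succ (Add (Var 1) (Var 0)))));
      All (Eq (Mul (Var 0) Zero) Zero);
      All (All (Eq (Mul (Var 1) (Succ (Var 0)))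
                   (Add (Mul (Var 1) (Var 0)) (Var 1))));
      All (All (Iff (Le (Var 1) (Var 0))
                    (Ex (Eq (Add (Var 0) (Var 2)) (Var 1)))))].

(* [a] may have parameters besides variable 0; the generalization rule makes
   the open instance equivalent to its universal closure. *)
Definition induction_axiom (a : form) : form :=
  Imp (fsubst (inst Zero) a)
      (Imp (All (Imp a (fsubst inst_succ a))) (All a)).

Inductive PA : form -> Prop :=
| PA_basic i : i < size basic_axioms -> PA (nth Bot basic_axioms i)
| PA_induction a : PA (induction_axiom a).

Definition cpair (x y : nat) : nat := ((x + y) * (x + y).+1)./2 + y.

Fixpoint tcode (t : term) : nat :=
  match t with
  | Var i => cpair 0 i
  | Zero => cpair 1 0
  | Succ t => cpair 2 (tcode t)
  | Add t u => cpair 3 (cpair (tcode t) (tcode u))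
  | Mul t u => cpair 4 (cpair (tcode t) (tcode u))
  end.

Fixpoint fcode (a : form) : nat :=
  match a with
  | Eq t u => cpair 0 (cpair (tcode t) (tcode u))
  | Le t u => cpair 1 (cpair (tcode t) (tcode u))
  | Bot => cpair 2 0
  | Imp a b => cpair 3 (cpair (fcode a) (fcode b))
  | All a => cpair 4 (fcode a)
  end.

(* To avoid explicit de Bruijn indices, formulas are written as functions of
   the number [d] of variables in scope.  The variable introduced by the
   [l]-th enclosing binder has index [d - l.+1] at depth [d]. *)
Definition bterm := nat -> term.
Definition bform := nat -> form.

Definition lev (l : nat) : bterm := fun d => Var (d - l.+1).

Definition bnum (n : nat) : bterm := fun _ => num n.
Definition bS (t : bterm) : bterm := fun d => Succ (t d).
Definition badd (t u : bterm) : bterm := fun d => Add (t d) (u d).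
Definition bmul (t u : bterm) : bterm := fun d => Mul (t d) (u d).

Definition beq (t u : bterm) : bform := fun d => Eq (t d) (u d).
Definition ble (t u : bterm) : bform := fun d => Le (t d) (u d).
Definition bbot : bform := fun _ => Bot.
Definition bneg (a : bform) : bform := fun d => Neg (a d).
Definition bimp (a b : bform) : bform := fun d => Imp (a d) (b d).
Definition band (a b : bform) : bform := fun d => And (a d) (b d).
Definition bor (a b : bform) : bform := fun d => Or (a d) (b d).
Definition biff (a b : bform) : bform := fun d => Iff (a d) (b d).
Definition ball (f : bterm -> bform) : bform :=
  fun d => All (f (lev d) d.+1).
Definition bex (f : bterm -> bform) : bform :=
  fun d => Ex (f (lev d) d.+1).

(* [a] must have no free variable other than 0. *)
Definition bsub (a : form) (t : bterm) : bform :=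
  fun d => fsubst (fun _ => t d) a.

(* The last argument becomes variable 0, the one before it variable 1, ... *)
Definition build1 (f : bterm -> bform) : form := f (lev 0) 1.
Definition build2 (f : bterm -> bterm -> bform) : form :=
  f (lev 0) (lev 1) 2.
Definition build3 (f : bterm -> bterm -> bterm -> bform) : form :=
  f (lev 0) (lev 1) (lev 2) 3.
Definition build4 (f : bterm -> bterm -> bterm -> bterm -> bform) : form :=
  f (lev 0) (lev 1) (lev 2) (lev 3) 4.

Declare Scope arith_scope.
Delimit Scope arith_scope with A.
Bind Scope arith_scope with bform.
Local Open Scope arith_scope.

Notation "t ≐ u" := (beq t u) (at level 70, no associativity) : arith_scope.
Notation "t ≦ u" := (ble t u) (at level 70, no associativity) : arith_scope.
Notation "t ⋖ u" := (ble (bS t) u) (at level 70, no associativity)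
  : arith_scope.
Notation "a ∧ b" := (band a b) (at level 80, right associativity)
  : arith_scope.
Notation "a ∨ b" := (bor a b) (at level 85, right associativity)
  : arith_scope.
Notation "a ⇒ b" := (bimp a b) (at level 90, right associativity)
  : arith_scope.
Notation "a ⇔ b" := (biff a b) (at level 95, no associativity)
  : arith_scope.
Notation "¬ a" := (bneg a) (at level 75, right associativity) : arith_scope.
Notation "∃ x .. y , a" := (bex (fun x => .. (bex (fun y => a)) ..))
  (at level 200, x binder, y binder, right associativity) : arith_scope.
Notation "∀ x .. y , a" := (ball (fun x => .. (ball (fun y => a)) ..))
  (at level 200, x binder, y binder, right associativity) : arith_scope.

(* Iterated pairs are not terms of the language; a [bpoly] is a description of
   a number, eliminated by [c k], which says that the number satisfies [k]. *)
Definition bpoly := (bterm -> bform) -> bform.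

Definition bret (t : bterm) : bpoly := fun k => k t.
Coercion bret : bterm >-> bpoly.

Definition bpair (c e : bpoly) : bpoly := fun k =>
  c (fun x => e (fun y =>
    ∃ z, badd z z ≐ badd (bmul (badd x y) (bS (badd x y))) (badd y y) ∧ k z)).

Notation "⟨ c , e ⟩" := (bpair c e) (at level 0, c, e at level 99)
  : arith_scope.

Definition bis (t : bterm) (c : bpoly) : bform := c (fun x => t ≐ x).
Notation "t ≗ c" := (bis t c) (at level 70, no associativity) : arith_scope.

(* Goedel's beta function: y = a mod (1 + (i + 1) b). *)
Definition beta (a b i y : bterm) : bform :=
  (∃ q, a ≐ badd (bmul q (bS (bmul (bS i) b))) y) ∧ y ≦ bmul (bS i) b.

(* Membership in the set inductively defined by the monotone operator [Phi]:
   there is a finite sequence ending in the given element each of whose entries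
   is in [Phi] of the set of the preceding ones. *)
Definition lfp (Phi : (bpoly -> bform) -> bterm -> bform) (c : bpoly) : bform :=
  c (fun x => ∃ a b n, beta a b n x ∧
    ∀ i, i ≦ n ⇒ ∃ y, beta a b i y ∧
      Phi (fun e => e (fun z => ∃ j, j ⋖ i ∧ beta a b j z)) y).

Definition tag (n : nat) (c : bpoly) : bpoly := ⟨ bnum n, c ⟩.

Definition cVar (i : bpoly) := tag 0 i.
Definition cZero := tag 1 (bnum 0).
Definition cSucc (t : bpoly) := tag 2 t.
Definition cAdd (t u : bpoly) := tag 3 ⟨ t, u ⟩.
Definition cMul (t u : bpoly) := tag 4 ⟨ t, u ⟩.

Definition cEq (t u : bpoly) := tag 0 ⟨ t, u ⟩.
Definition cLe (t u : bpoly) := tag 1 ⟨ t, u ⟩.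
Definition cBot := tag 2 (bnum 0).
Definition cImp (a b : bpoly) := tag 3 ⟨ a, b ⟩.
Definition cAll (a : bpoly) := tag 4 a.
Definition cNeg a := cImp a cBot.
Definition cAnd a b := cNeg (cImp a (cNeg b)).
Definition cEx a := cNeg (cAll (cNeg a)).

Definition cterm (t : term) : bpoly := bnum (tcode t).
Definition cform (a : form) : bpoly := bnum (fcode a).

Definition b_tscoped (k t : bpoly) : bform :=
  lfp (fun In x =>
       (∃ k i, x ≗ ⟨ k, cVar i ⟩ ∧ i ⋖ k)
     ∨ (∃ k, x ≗ ⟨ k, cZero ⟩)
     ∨ (∃ k t, x ≗ ⟨ k, cSucc t ⟩ ∧ In ⟨ k, t ⟩)
     ∨ (∃ k t u, (x ≗ ⟨ k, cAdd t u ⟩ ∨ x ≗ ⟨ k, cMul t u ⟩)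
          ∧ In ⟨ k, t ⟩ ∧ In ⟨ k, u ⟩))
    ⟨ k, t ⟩.

Definition b_fscoped (k a : bpoly) : bform :=
  lfp (fun In x =>
       (∃ k t u, (x ≗ ⟨ k, cEq t u ⟩ ∨ x ≗ ⟨ k, cLe t u ⟩)
          ∧ b_tscoped k t ∧ b_tscoped k u)
     ∨ (∃ k, x ≗ ⟨ k, cBot ⟩)
     ∨ (∃ k a b, x ≗ ⟨ k, cImp a b ⟩ ∧ In ⟨ k, a ⟩ ∧ In ⟨ k, b ⟩)
     ∨ (∃ k a, x ≗ ⟨ k, cAll a ⟩ ∧ In ⟨ bS k, a ⟩))
    ⟨ k, a ⟩.

Definition b_isterm (t : bpoly) : bform := ∃ k, b_tscoped k t.
Definition b_isform (a : bpoly) : bform := ∃ k, b_fscoped k a.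

(* The substitution mapping variable 0 to [t] and variable i+1 to variable i+r
   is [inst t] for r = 0, [inst_succ] for r = 1 and [t] = S(x_0), and [shift]
   for r = 2 and [t] = x_1.  [b_tsubst r k t u v] says that v is the result of
   applying to u that substitution lifted under k binders, where t is the term
   [t] already shifted k times. *)
Definition b_tsubst (r : nat) (k t u v : bpoly) : bform :=
  lfp (fun In x =>
       (∃ k t i, x ≗ ⟨ k, ⟨ t, ⟨ cVar i, cVar i ⟩ ⟩ ⟩ ∧ i ⋖ k)
     ∨ (∃ k t, x ≗ ⟨ k, ⟨ t, ⟨ cVar k, t ⟩ ⟩ ⟩)
     ∨ (∃ k t j, x ≗ ⟨ k, ⟨ t, ⟨ cVar (bS (badd k j)),
                               cVar (badd (badd k j) (bnum r)) ⟩ ⟩ ⟩)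
     ∨ (∃ k t, x ≗ ⟨ k, ⟨ t, ⟨ cZero, cZero ⟩ ⟩ ⟩)
     ∨ (∃ k t u v, x ≗ ⟨ k, ⟨ t, ⟨ cSucc u, cSucc v ⟩ ⟩ ⟩
          ∧ In ⟨ k, ⟨ t, ⟨ u, v ⟩ ⟩ ⟩)
     ∨ (∃ k t u u' v v',
          (x ≗ ⟨ k, ⟨ t, ⟨ cAdd u u', cAdd v v' ⟩ ⟩ ⟩
           ∨ x ≗ ⟨ k, ⟨ t, ⟨ cMul u u', cMul v v' ⟩ ⟩ ⟩)
          ∧ In ⟨ k, ⟨ t, ⟨ u, v ⟩ ⟩ ⟩ ∧ In ⟨ k, ⟨ t, ⟨ u', v' ⟩ ⟩ ⟩))
    ⟨ k, ⟨ t, ⟨ u, v ⟩ ⟩ ⟩.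

Definition b_tshift (u v : bpoly) : bform :=
  b_tsubst 2 (bnum 0) (cterm (Var 1)) u v.

Definition b_fsubst (r : nat) (k t a b : bpoly) : bform :=
  lfp (fun In x =>
       (∃ k t u u' v v',
          (x ≗ ⟨ k, ⟨ t, ⟨ cEq u u', cEq v v' ⟩ ⟩ ⟩
           ∨ x ≗ ⟨ k, ⟨ t, ⟨ cLe u u', cLe v v' ⟩ ⟩ ⟩)
          ∧ b_tsubst r k t u v ∧ b_tsubst r k t u' v')
     ∨ (∃ k t, x ≗ ⟨ k, ⟨ t, ⟨ cBot, cBot ⟩ ⟩ ⟩)
     ∨ (∃ k t a a' b b', x ≗ ⟨ k, ⟨ t, ⟨ cImp a a', cImp b b' ⟩ ⟩ ⟩
          ∧ In ⟨ k, ⟨ t, ⟨ a, b ⟩ ⟩ ⟩ ∧ In ⟨ k, ⟨ t, ⟨ a', b' ⟩ ⟩ ⟩)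
     ∨ (∃ k t a b t', x ≗ ⟨ k, ⟨ t, ⟨ cAll a, cAll b ⟩ ⟩ ⟩
          ∧ b_tshift t t' ∧ In ⟨ bS k, ⟨ t', ⟨ a, b ⟩ ⟩ ⟩))
    ⟨ k, ⟨ t, ⟨ a, b ⟩ ⟩ ⟩.

Definition b_finst (t a b : bpoly) : bform := b_fsubst 0 (bnum 0) t a b.
Definition b_fshift (a b : bpoly) : bform :=
  b_fsubst 2 (bnum 0) (cterm (Var 1)) a b.

Definition b_num (x y : bpoly) : bform :=
  lfp (fun In z =>
       z ≗ ⟨ bnum 0, cZero ⟩
     ∨ (∃ x y, z ≗ ⟨ bS x, cSucc y ⟩ ∧ In ⟨ x, y ⟩))
    ⟨ x, y ⟩.

Definition b_logical_axiom (x : bterm) : bform :=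
  b_isform x ∧
  (  (∃ a b, x ≗ cImp a (cImp b a))
   ∨ (∃ a b c,
        x ≗ cImp (cImp a (cImp b c)) (cImp (cImp a b) (cImp a c)))
   ∨ (∃ a, x ≗ cImp (cNeg (cNeg a)) a)
   ∨ (∃ a t b, b_isterm t ∧ b_finst t a b ∧ x ≗ cImp (cAll a) b)
   ∨ (∃ a b, x ≗ cImp (cAll (cImp a b)) (cImp (cAll a) (cAll b)))
   ∨ (∃ a b, b_fshift a b ∧ x ≗ cImp a (cAll b))
   ∨ (∃ t, x ≗ cEq t t)
   ∨ (∃ a t u b c, b_isform a ∧ b_finst t a b ∧ b_finst u a c
        ∧ x ≗ cImp (cEq t u) (cImp b c))).

(* x is derivable from the premises beta(a,b,0), ..., beta(a,b,n-1). *)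
Definition b_derivable (x a b n : bterm) : bform :=
  lfp (fun In y =>
       (∃ i, i ⋖ n ∧ beta a b i y)
     ∨ b_logical_axiom y
     ∨ (∃ z, In (cImp z y) ∧ In z)
     ∨ (∃ z, y ≗ cAll z ∧ In z))
    x.

Definition derivable_form : form := build4 b_derivable.

(* For tau(x_0) defining the axioms of a theory, the provability predicate
     exists a b n, derivable(x_0, a, b, n) /\
                   forall i < n, exists y, y = beta(a,b,i) /\ tau(y).
   Variables are numbered so that [tau] occurs in it without renaming, as does
   [prv tau] in [rfn] below; this keeps the arithmetization of [rfn] simple. *)
Definition premise_form : form :=
  beta (lev 1) (lev 2) (lev 4) (lev 5) 6.

Definition prv (tau : form) : form :=
  Ex (Ex (Ex (And derivable_form
    (All (Imp (Le (Succ (Var 0)) (Var 1))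
      (Ex (And premise_form tau))))))).

Definition cprv (tau : bpoly) : bpoly :=
  cEx (cEx (cEx (cAnd (cform derivable_form)
    (cAll (cImp (cform (Le (Succ (Var 0)) (Var 1)))
      (cEx (cAnd (cform premise_form) tau))))))).

(* w is the code of the formula with code p with the numeral of x substituted
   for variable 0. *)
Definition b_subst_num (x p w : bterm) : bform :=
  ∃ n, b_num x n ∧ b_finst n p w.

Definition subst_num_form : form := build3 b_subst_num.

(* forall x, (exists p, p = code a /\ exists w, w = p(numeral of x) /\
              prv_tau(w)) -> a(x) *)
Definition rfn (tau a : form) : form :=
  All (Imp (Ex (And (Eq (Var 0) (num (fcode a)))
                    (Ex (And subst_num_form (prv tau)))))
           a).

(* y is an instance of uniform reflection for the theory whose axioms are
   defined by the formula with code tau. *)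
Definition b_is_rfn (tau y : bpoly) : bform :=
  ∃ a n, b_fscoped (bnum 1) a ∧ b_num a n ∧
    y (fun y => y ≗
      cAll (cImp (cEx (cAnd (cEq (cterm (Var 0)) n)
                            (cEx (cAnd (cform subst_num_form) (cprv tau)))))
                 a)).

(* RFN(T), for the theory T whose set of axioms is defined by tau. *)
Definition RFN (tau : form) (a : form) : Prop :=
  true_in_N (fsubst (inst (num (fcode a))) tau) \/
  exists b, fscoped 1 b /\ a = rfn tau b.

(* The value of the term t when the variables are assigned the entries of e,
   where e = <e_0, <e_1, ...>>; as <0, 0> = 0, every number e codes an
   assignment with finite support. *)
Definition b_eval (t e v : bpoly) : bform :=
  lfp (fun In x =>
       (∃ v e, x ≗ ⟨ cVar (bnum 0), ⟨ ⟨ v, e ⟩, v ⟩ ⟩)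
     ∨ (∃ i w e v, x ≗ ⟨ cVar (bS i), ⟨ ⟨ w, e ⟩, v ⟩ ⟩
          ∧ In ⟨ cVar i, ⟨ e, v ⟩ ⟩)
     ∨ (∃ e, x ≗ ⟨ cZero, ⟨ e, bnum 0 ⟩ ⟩)
     ∨ (∃ t e v, x ≗ ⟨ cSucc t, ⟨ e, bS v ⟩ ⟩ ∧ In ⟨ t, ⟨ e, v ⟩ ⟩)
     ∨ (∃ t u e v w,
          (x ≗ ⟨ cAdd t u, ⟨ e, badd v w ⟩ ⟩
           ∨ x ≗ ⟨ cMul t u, ⟨ e, bmul v w ⟩ ⟩)
          ∧ In ⟨ t, ⟨ e, v ⟩ ⟩ ∧ In ⟨ u, ⟨ e, w ⟩ ⟩))
    ⟨ t, ⟨ e, v ⟩ ⟩.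

(* Sigma_1 satisfaction: verification (s = 1) and refutation (s = 0) of the
   formula a under the assignment e.  A Sigma_1 formula is verified iff it
   holds, and a Pi_1 formula is refuted iff it fails. *)
Definition b_sat (s : nat) (a e : bpoly) : bform :=
  lfp (fun In x =>
     let T a e := In ⟨ bnum 1, ⟨ a, e ⟩ ⟩ in
     let F a e := In ⟨ bnum 0, ⟨ a, e ⟩ ⟩ in
     let isT a e := x ≗ ⟨ bnum 1, ⟨ a, e ⟩ ⟩ in
     let isF a e := x ≗ ⟨ bnum 0, ⟨ a, e ⟩ ⟩ in
       (∃ t u e v w, b_eval t e v ∧ b_eval u e w ∧
          (  (isT (cEq t u) e ∧ v ≐ w)
           ∨ (isF (cEq t u) e ∧ ¬ v ≐ w)
           ∨ (isT (cLe t u) e ∧ v ≦ w)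
           ∨ (isF (cLe t u) e ∧ ¬ v ≦ w)))
     ∨ (∃ e, isF cBot e)
     ∨ (∃ a b e, isT (cImp a b) e ∧ (F a e ∨ T b e))
     ∨ (∃ a b e, isF (cImp a b) e ∧ T a e ∧ F b e)
     ∨ (∃ a e, isF (cAll a) e ∧ ∃ y, F a ⟨ y, e ⟩)
     ∨ (∃ a t t' e v, isT (cAll (cImp (cLe (cterm (Var 0)) t') a)) e
          ∧ b_tshift t t' ∧ b_eval t e v ∧ ∀ y, y ≦ v ⇒ T a ⟨ y, e ⟩))
    ⟨ bnum s, ⟨ a, e ⟩ ⟩.

(* Indices are codes of formulas with free variable 0; arbitrary numbers are
   allowed and also index a Sigma_1, respectively Pi_1, set. *)
Definition b_in_Sigma1 (i x : bpoly) : bform := b_sat 1 i ⟨ x, bnum 0 ⟩.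
Definition b_in_Pi1 (i x : bpoly) : bform := ¬ b_sat 0 i ⟨ x, bnum 0 ⟩.

(* x precedes or equals y in the order l = <Pi_1 index, Sigma_1 index>. *)
Definition b_le (l x y : bterm) : bform :=
  ∃ p s, l ≗ ⟨ p, s ⟩ ∧ b_in_Sigma1 s ⟨ x, y ⟩.

Definition b_dom (l x : bterm) : bform := b_le l x x.

Definition b_LO (l : bterm) : bform :=
    (∃ p s, l ≗ ⟨ p, s ⟩ ∧ ∀ z, b_in_Pi1 p z ⇔ b_in_Sigma1 s z)
  ∧ (∀ x y, b_le l x y ⇒ b_dom l x ∧ b_dom l y)
  ∧ (∀ x y, b_le l x y ∧ b_le l y x ⇒ x ≐ y)
  ∧ (∀ x y z, b_le l x y ∧ b_le l y z ⇒ b_le l x z)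
  ∧ (∀ x y, b_dom l x ∧ b_dom l y ⇒ b_le l x y ∨ b_le l y x).

Definition LO (l : nat) : form := fsubst (inst (num l)) (build1 b_LO).

Definition computable_LO (l : nat) : Prop := true_in_N (LO l).
Definition PA_verifiable (l : nat) : Prop := proves PA (LO l).

Definition lo_le (l x y : nat) : Prop :=
  true_in_N (b_le (bnum l) (bnum x) (bnum y) 0).

Definition lo_dom (l x : nat) : Prop := lo_le l x x.

(* The ordinal omega^n + 1: [Some] of an n-tuple of natural numbers, ordered
   lexicographically with the first entry the most significant, and [None]
   above all of these. *)
Definition omega_pow_succ_le (n : nat) (u v : option (n.-tuplelexi nat)) : bool :=
  match u, v with
  | Some s, Some t => (s <= t)%O
  | _, None => true
  | None, Some _ => false
  end.

Definition has_order_type_omega_pow_succ (l n : nat) : Prop :=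
  exists g : option (n.-tuplelexi nat) -> nat,
    [/\ injective g,
        forall x, lo_dom l x <-> exists u, g u = x &
        forall u v, lo_le l (g u) (g v) <-> omega_pow_succ_le u v].

(* "x is in l, and either tau(y) or, for some z strictly below x, y is an
   instance of uniform reflection for the theory whose axioms are defined by
   the formula with code p with the numeral of z substituted for variable 1". *)
Definition b_iter_step (tau : form) (l : nat) (p x y : bterm) : bform :=
  b_dom (bnum l) x ∧
  (bsub tau y ∨
   ∃ z, b_le (bnum l) z x ∧ ¬ z ≐ x ∧
     ∃ n q, b_num z n ∧ b_fsubst 0 (bnum 1) n p q ∧ b_is_rfn q y).

(* [iter_diag] is the step applied to the code of the formula coded by variable
   2 with its own numeral substituted for variable 2; [iter_ax], where variable
   0 is y and variable 1 is x, is its diagonalization, so that [iter_ax] is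
   provably equivalent to [b_iter_step] at p = the numeral of its own code. *)
Definition iter_diag (tau : form) (l : nat) : form :=
  build3 (fun d x y =>
    ∃ n p, b_num d n ∧ b_fsubst 0 (bnum 2) n d p ∧ b_iter_step tau l p x y).

Definition iter_ax (tau : form) (l : nat) : form :=
  fsubst (up (up (inst (num (fcode (iter_diag tau l)))))) (iter_diag tau l).

(* The formula, with free variable 0, defining the axioms of RFN^(l,a)(T). *)
Definition iter_ax_at (tau : form) (l a : nat) : form :=
  fsubst (up (inst (num a))) (iter_ax tau l).

(* RFN^l(T), where the formula tau defines the set T of axioms. *)
Definition RFN_iter (T : form -> Prop) (tau : form) (l : nat) (b : form)
    : Prop :=
  T b \/
  exists2 a, lo_dom l a & RFN (iter_ax_at tau l a) b.

Definition b_axPA (x : bterm) : bform :=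
    foldr (fun a f => x ≗ cform a ∨ f) bbot basic_axioms
  ∨ (∃ a b c, b_isform a ∧ b_finst cZero a b
       ∧ b_fsubst 1 (bnum 0) (cterm (Succ (Var 0))) a c
       ∧ x ≗ cImp b (cImp (cAll (cImp a c)) (cAll a))).

Definition axPA : form := build1 b_axPA.

(* Main.v *)
Require Import Defs.
From mathcomp Require Import all_boot all_order zify.
From Stdlib Require Import Ring Ring_theory.
From Stdlib Require Import Classical ClassicalEpsilon FunctionalExtensionality.
From Stdlib Require Import PropExtensionality ProofIrrelevance.

(** A Pi_(2n+1) sentence phi fails in a model of PA if and only if some x satisfies B(x),
    where B arises from a bounded formula by n alternations of a universal and an
    existential quantifier.  The witnesses for the existential quantifiers can be made
    unique without leaving this class ([alt_uniformize], [sentence_witness]): one takes the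
    least witness together with the least counterexamples to all smaller numbers.

    The order.  Start from the tree of the sequences that repeat some x with B(x), and n
    times replace a tree by the tree of its paths, each node being accompanied by witnesses
    for all challenges up to its own code ([NextM], [tower]).  Every step removes one
    alternation, so that the last tree is defined by a bounded formula.  The order consists
    of this tree and of the sequences of n odd numbers, with the Kleene-Brouwer order
    ([OrderM]) and an additional least element.  It is linear in every model of PA, by
    elementary properties of sequences, and therefore provably so.

    The order type.  If phi is true, then B is empty in the standard model.  A candidate for
    a node that does not belong to a tree has finitely many nodes of the next tree over it:
    a challenge without a witness bounds their codes, and as witnesses are unique there is
    at most one list of them for each candidate.  Hence ranks rise by at most one power of
    omega at each step ([rank_lt_lift]), and the subtrees at the children of the root of the
    last tree have types below omega^n.  So the elements below the root embed into omega^n;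
    conversely omega^n embeds into them by sequences of odd numbers, and well-orders that
    embed into each other are isomorphic ([collapse]).

    Reflection.  Suppose that phi fails in a model, so that B has an element there.  The true
    witnesses define a class D of elements of the order that contains the root, which is
    the greatest element, and has no least element ([tower_path]).  That D descends in this
    way is provable in PA.  Let chi say that for all x and all v below x the theory of x proves
    that v is not in D.  If chi is provable in PA, then it is provable in the theory of x, together
    with reflection for the theory of v; arguing in the theory of x, if v is in D then so is
    some w below v, which the theory of v refutes, so that by reflection w is not in D.
    Thus chi follows from its own provability, and Loeb's theorem shows that chi holds
    ([refutes_valid]).  One more application of reflection shows that the root is not in D,
    which proves phi ([reflection_refutes], [order_proves]).

    Provability in PA is established by working in an arbitrary model, nonstandard ones
    included ([completeness]).  The arithmetized syntax is studied there as well; codes with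
    numerals of arbitrary elements of the model ([fcl]) take the role of formulas with an
    assignment. *)

Set Implicit Arguments.
Unset Strict Implicit.
Unset Printing Implicit Defensive.

(** * Substitution *)

Lemma tsubst_ext s s' t : (forall i, s i = s' i) -> tsubst s t = tsubst s' t.
Proof. by move=> E; elim: t => //= [t ->|t -> u ->|t -> u ->]. Qed.

Lemma up_ext s s' : (forall i, s i = s' i) -> forall i, up s i = up s' i.
Proof. by move=> E [|i] //=; rewrite E. Qed.

Lemma fsubst_ext s s' a : (forall i, s i = s' i) -> fsubst s a = fsubst s' a.
Proof.
elim: a s s' => [t u|t u||a IHa b IHb|a IHa] s s' E //=.
- by rewrite !(tsubst_ext _ E).
- by rewrite !(tsubst_ext _ E).
- by rewrite (IHa _ _ E) (IHb _ _ E).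
- by rewrite (IHa _ _ (up_ext E)).
Qed.

Lemma tsubst_comp s s' t :
  tsubst s (tsubst s' t) = tsubst (fun i => tsubst s (s' i)) t.
Proof. by elim: t => //= [t ->|t -> u ->|t -> u ->]. Qed.

Lemma up_comp s s' i :
  tsubst (up s) (up s' i) = up (fun j => tsubst s (s' j)) i.
Proof. by case: i => [|i] //=; rewrite !tsubst_comp; apply: tsubst_ext. Qed.

Lemma fsubst_comp s s' a :
  fsubst s (fsubst s' a) = fsubst (fun i => tsubst s (s' i)) a.
Proof.
elim: a s s' => [t u|t u||a IHa b IHb|a IHa] s s' //=.
- by rewrite !tsubst_comp.
- by rewrite !tsubst_comp.
- by rewrite IHa IHb.
- by rewrite IHa; congr All; apply: fsubst_ext => i; exact: up_comp.
Qed.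

Lemma tsubst_Var t : tsubst Var t = t.
Proof. by elim: t => //= [t ->|t -> u ->|t -> u ->]. Qed.

Lemma fsubst_id s a : (forall i, s i = Var i) -> fsubst s a = a.
Proof.
elim: a s => [t u|t u||a IHa b IHb|a IHa] s E //=.
- by rewrite !(tsubst_ext _ E) !tsubst_Var.
- by rewrite !(tsubst_ext _ E) !tsubst_Var.
- by rewrite IHa // IHb.
- by rewrite IHa // => -[|i] //=; rewrite E.
Qed.

Lemma tsubst_scoped k s s' t :
  tscoped k t -> (forall i, i < k -> s i = s' i) -> tsubst s t = tsubst s' t.
Proof.
move=> + E; elim: t => //= [t IH ht|t IHt u IHu|t IHt u IHu].
- by rewrite IH.
- by case/andP=> /IHt -> /IHu ->.
- by case/andP=> /IHt -> /IHu ->.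
Qed.

Lemma fsubst_scoped k s s' a :
  fscoped k a -> (forall i, i < k -> s i = s' i) -> fsubst s a = fsubst s' a.
Proof.
elim: a k s s' => [t u|t u||a IHa b IHb|a IHa] k s s' //=.
- by case/andP=> ht hu E; rewrite (tsubst_scoped ht E) (tsubst_scoped hu E).
- by case/andP=> ht hu E; rewrite (tsubst_scoped ht E) (tsubst_scoped hu E).
- by case/andP=> ha hb E; rewrite (IHa _ _ _ ha E) (IHb _ _ _ hb E).
- by move=> ha E; rewrite (IHa _ _ (up s') ha) // => -[|i] //= hi; rewrite E.
Qed.

Lemma tscoped_leq k k' t : k <= k' -> tscoped k t -> tscoped k' t.
Proof.
move=> le; elim: t => //= [i hi|t IHt u IHu|t IHt u IHu].
- exact: leq_trans hi le.
- by case/andP=> /IHt -> /IHu ->.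
- by case/andP=> /IHt -> /IHu ->.
Qed.

Lemma fscoped_leq k k' a : k <= k' -> fscoped k a -> fscoped k' a.
Proof.
elim: a k k' => [t u|t u||a IHa b IHb|a IHa] k k' le //=.
- by case/andP=> ht hu; rewrite (tscoped_leq le ht) (tscoped_leq le hu).
- by case/andP=> ht hu; rewrite (tscoped_leq le ht) (tscoped_leq le hu).
- by case/andP=> ha hb; rewrite (IHa _ _ le ha) (IHb _ _ le hb).
- exact: IHa.
Qed.

Lemma tscoped_ex t : exists k, tscoped k t.
Proof.
elim: t => [i||t [k h]|t [k h] u [k' h']|t [k h] u [k' h']].
- by exists i.+1 => /=.
- by exists 0.
- by exists k.
- by exists (maxn k k') => /=; rewrite (tscoped_leq (leq_maxl _ _) h)
    (tscoped_leq (leq_maxr _ _) h').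
- by exists (maxn k k') => /=; rewrite (tscoped_leq (leq_maxl _ _) h)
    (tscoped_leq (leq_maxr _ _) h').
Qed.

Lemma fscoped_ex a : exists k, fscoped k a.
Proof.
elim: a => [t u|t u||a [k h] b [k' h']|a [k h]].
- have [k h] := tscoped_ex t; have [k' h'] := tscoped_ex u.
  by exists (maxn k k') => /=; rewrite (tscoped_leq (leq_maxl _ _) h)
    (tscoped_leq (leq_maxr _ _) h').
- have [k h] := tscoped_ex t; have [k' h'] := tscoped_ex u.
  by exists (maxn k k') => /=; rewrite (tscoped_leq (leq_maxl _ _) h)
    (tscoped_leq (leq_maxr _ _) h').
- by exists 0.
- by exists (maxn k k') => /=; rewrite (fscoped_leq (leq_maxl _ _) h)
    (fscoped_leq (leq_maxr _ _) h').
- by exists k => /=; exact: fscoped_leq (leqnSn k) h.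
Qed.

Lemma fsubst_inst s t a :
  fsubst s (fsubst (inst t) a) = fsubst (inst (tsubst s t)) (fsubst (up s) a).
Proof.
rewrite !fsubst_comp; apply: fsubst_ext => -[|i] //=.
by rewrite tsubst_comp tsubst_Var.
Qed.

Lemma fsubst_shift s a :
  fsubst (up s) (fsubst shift a) = fsubst shift (fsubst s a).
Proof. by rewrite !fsubst_comp; apply: fsubst_ext. Qed.

(** * Completeness of the calculus *)

Definition subst_closed (T : form -> Prop) :=
  forall s a, T a -> T (fsubst s a).

(** The basic axioms are closed, and replacing the parameters of an instance of
    induction gives another instance. *)
Lemma PA_subst_closed : subst_closed PA.
Proof.
move=> s a [i lt|b].
- have -> : fsubst s (nth Bot basic_axioms i) = nth Bot basic_axioms i.
    rewrite (@fsubst_scoped 0 _ Var) ?fsubst_id //.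
    by do 7?[case: i lt => //= i lt].
  exact: PA_basic.
- have -> : fsubst s (induction_axiom b) = induction_axiom (fsubst (up s) b).
    rewrite /induction_axiom /= fsubst_inst; congr (Imp _ (Imp (All (Imp _ _)) _)).
    by rewrite !fsubst_comp; apply: fsubst_ext => -[|j] //=;
       rewrite tsubst_comp; apply: tsubst_ext.
  exact: PA_induction.
Qed.

Lemma proves_subst T s a :
  subst_closed T -> proves T a -> proves T (fsubst s a).
Proof.
move=> cT pa; elim: pa s => {a} [a Ta|a la|a b _ IHab _ IHa|a _ IHa] s.
- exact/proves_ax/cT.
- apply: proves_log; case: la => {a} /=.
  + by move=> *; exact: LK.
  + by move=> *; exact: LS.
  + by move=> *; exact: LDN.
  + by move=> a t; rewrite fsubst_inst; exact: LInst.
  + by move=> *; exact: LDist.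
  + by move=> a; rewrite fsubst_shift; exact: LVac.
  + by move=> *; exact: LRefl.
  + by move=> a t u; rewrite !fsubst_inst; exact: LLeib.
- exact: proves_mp (IHab s) (IHa s).
- exact/proves_gen/IHa.
Qed.

(** Derivability from hypotheses whose free variables act as constants: no
    generalization is allowed, so that the deduction theorem holds. *)
Inductive ded (T G : form -> Prop) : form -> Prop :=
| ded_hyp a : G a -> ded T G a
| ded_thm a : proves T a -> ded T G a
| ded_mp a b : ded T G (Imp a b) -> ded T G a -> ded T G b.

Definition extend (G : form -> Prop) (a b : form) : Prop := G b \/ b = a.

Section Deduction.
Variables (T : form -> Prop).
Implicit Type G : form -> Prop.

Lemma ded_log G a : logical_axiom a -> ded T G a.
Proof. by move=> h; apply/ded_thm/proves_log. Qed.

Lemma ded_weaken G H a : (forall b, G b -> ded T H b) -> ded T G a -> ded T H a.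
Proof.
move=> GH; elim=> {a} [a /GH //|a|a b _ ab _ ha]; first exact: ded_thm.
exact: ded_mp ab ha.
Qed.

Lemma ded_imp_refl G a : ded T G (Imp a a).
Proof.
apply: ded_mp (ded_log _ (LK a a)).
exact: ded_mp (ded_log _ (LS a (Imp a a) a)) (ded_log _ (LK a (Imp a a))).
Qed.

Lemma ded_K G a b : ded T G b -> ded T G (Imp a b).
Proof. exact/ded_mp/ded_log/LK. Qed.

Lemma deduction G a b : ded T (extend G a) b -> ded T G (Imp a b).
Proof.
elim=> {b} [b [Gb|->]|b pb|b c _ IHbc _ IHb].
- exact/ded_K/ded_hyp.
- exact: ded_imp_refl.
- exact/ded_K/ded_thm.
- exact: ded_mp (ded_mp (ded_log _ (LS a b c)) IHbc) IHb.
Qed.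

Lemma ded_ext G a : ded T (extend G a) a.
Proof. by apply: ded_hyp; right. Qed.

Lemma ded_extW G a b : ded T G b -> ded T (extend G a) b.
Proof. by apply: ded_weaken => c h; apply: ded_hyp; left. Qed.

Lemma ded_raa G a : ded T (extend G (Neg a)) Bot -> ded T G a.
Proof. by move=> h; apply: ded_mp (ded_log _ (LDN a)) (deduction h). Qed.

Lemma ded_exfalso G a : ded T G Bot -> ded T G a.
Proof. by move=> h; exact/ded_raa/ded_extW. Qed.

Lemma ded_gen G a :
  ded T (fun b => exists2 c, G c & b = fsubst shift c) a -> ded T G (All a).
Proof.
elim=> {a} [a [c Gc ->]|a pa|a b _ ab _ ha].
- exact: ded_mp (ded_log _ (LVac c)) (ded_hyp _ Gc).
- exact/ded_thm/proves_gen.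
- exact: ded_mp (ded_mp (ded_log _ (LDist a b)) ab) ha.
Qed.

Lemma ded_subst G s a : subst_closed T ->
  ded T G a -> ded T (fun b => exists2 c, G c & b = fsubst s c) (fsubst s a).
Proof.
move=> cT; elim=> {a} [a Ga|a pa|a b _ ab _ ha].
- by apply: ded_hyp; exists a.
- exact/ded_thm/proves_subst.
- exact: ded_mp ab ha.
Qed.

(** A variable [c] that occurs in no hypothesis may be renamed to the variable
    that is about to be bound. *)
Lemma ded_gen_fresh G c a : subst_closed T ->
  (forall b, G b -> fscoped c b) -> fscoped c.+1 a ->
  ded T G (fsubst (inst (Var c)) a) -> ded T G (All a).
Proof.
move=> cT fG fa h; apply: ded_gen.
pose s i := if i == c then Var 0 else Var i.+1.
have -> : a = fsubst s (fsubst (inst (Var c)) a).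
  rewrite fsubst_comp -[LHS](@fsubst_id Var) //.
  apply: (fsubst_scoped fa) => -[|i] /= hi; first by rewrite /s eqxx.
  by rewrite /s ltn_eqF.
apply: ded_weaken (ded_subst s cT h) => b [d Gd ->].
apply: ded_hyp; exists d => //.
by apply: fsubst_scoped (fG _ Gd) _ => i hi; rewrite /s ltn_eqF.
Qed.

End Deduction.

Record structure := Structure {
  car :> Type;
  s_zero : car;
  s_succ : car -> car;
  s_add : car -> car -> car;
  s_mul : car -> car -> car;
  s_le : car -> car -> Prop }.

Definition pcons (A : Type) (x : A) (r : nat -> A) (i : nat) : A :=
  if i is j.+1 then r j else x.

Fixpoint meval (S : structure) (r : nat -> S) (t : term) : S :=
  match t with
  | Var i => r i
  | Zero => s_zero S
  | Succ t => s_succ (meval r t)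
  | Add t u => s_add (meval r t) (meval r u)
  | Mul t u => s_mul (meval r t) (meval r u)
  end.

Fixpoint msat (S : structure) (r : nat -> S) (a : form) : Prop :=
  match a with
  | Eq t u => meval r t = meval r u
  | Le t u => s_le (meval r t) (meval r u)
  | Bot => False
  | Imp a b => msat r a -> msat r b
  | All a => forall x, msat (pcons x r) a
  end.

Lemma meval_ext (S : structure) (r r' : nat -> S) t :
  (forall i, r i = r' i) -> meval r t = meval r' t.
Proof. by move=> E; elim: t => //= [t ->|t -> u ->|t -> u ->]. Qed.

Lemma msat_ext (S : structure) (r r' : nat -> S) a :
  (forall i, r i = r' i) -> msat r a <-> msat r' a.
Proof.
elim: a r r' => [t u|t u||a IHa b IHb|a IHa] r r' E //=.
- by rewrite !(meval_ext _ E).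
- by rewrite !(meval_ext _ E).
- by rewrite (IHa _ _ E) (IHb _ _ E).
- by split=> h x; [rewrite -(IHa (pcons x r))|rewrite (IHa _ (pcons x r'))] => //;
     case.
Qed.

Lemma meval_subst (S : structure) (r : nat -> S) s t :
  meval r (tsubst s t) = meval (fun i => meval r (s i)) t.
Proof. by elim: t => //= [t ->|t -> u ->|t -> u ->]. Qed.

Lemma msat_subst (S : structure) (r : nat -> S) s a :
  msat r (fsubst s a) <-> msat (fun i => meval r (s i)) a.
Proof.
elim: a r s => [t u|t u||a IHa b IHb|a IHa] r s //=.
- by rewrite !meval_subst.
- by rewrite !meval_subst.
- by rewrite IHa IHb.
- have E x : msat (pcons x r) (fsubst (up s) a) <->
      msat (pcons x (fun i => meval r (s i))) a.
    rewrite IHa; apply: msat_ext => -[|i] //=.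
    by rewrite meval_subst; apply: meval_ext.
  by split=> h x; apply/E.
Qed.

Lemma meval_scoped (S : structure) k (r r' : nat -> S) t :
  tscoped k t -> (forall i, i < k -> r i = r' i) -> meval r t = meval r' t.
Proof.
move=> + E; elim: t => //= [t IH ht|t IHt u IHu|t IHt u IHu].
- by rewrite IH.
- by case/andP=> /IHt -> /IHu ->.
- by case/andP=> /IHt -> /IHu ->.
Qed.

Lemma msat_scoped (S : structure) k (r r' : nat -> S) a :
  fscoped k a -> (forall i, i < k -> r i = r' i) -> msat r a <-> msat r' a.
Proof.
elim: a k r r' => [t u|t u||a IHa b IHb|a IHa] k r r' //=.
- by case/andP=> ht hu E; rewrite (meval_scoped ht E) (meval_scoped hu E).
- by case/andP=> ht hu E; rewrite (meval_scoped ht E) (meval_scoped hu E).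
- by case/andP=> ha hb E; rewrite (IHa _ _ _ ha E) (IHb _ _ _ hb E).
- move=> ha E; split=> h x.
  + by rewrite -(IHa k.+1 (pcons x r)) // => -[|i] //= /E.
  + by rewrite (IHa k.+1 _ (pcons x r')) // => -[|i] //= /E.
Qed.

Definition models (S : structure) (T : form -> Prop) :=
  forall a (r : nat -> S), T a -> msat r a.

Section Henkin.
Variables (T : form -> Prop) (cT : subst_closed T) (phi : form).
Hypothesis unprovable : ~ proves T phi.

Let consistent (G : form -> Prop) := ~ ded T G Bot.

Let nth_form (n : nat) : form := epsilon (inhabits Bot) (fun a => fcode a = n).

Let scope_of (G : seq form) : nat :=
  epsilon (inhabits 0) (fun k => forall a, List.In a G -> fscoped k a).

Let scope_ofP G a : List.In a G -> fscoped (scope_of G) a.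
Proof.
move: a; apply: (epsilon_spec (inhabits 0)
  (fun k => forall a, List.In a G -> fscoped k a)).
elim: G => [|a G [k hk]]; first by exists 0.
have [k' hk'] := fscoped_ex a.
exists (maxn k k') => b /= [<-|/hk hb].
- exact: fscoped_leq (leq_maxr _ _) hk'.
- exact: fscoped_leq (leq_maxl _ _) hb.
Qed.

Let inG (G : seq form) (a : form) : Prop := List.In a G.

(* A counterexample to [b] is named by a variable that is fresh for the stage
   and for [All b]. *)
Let witness (G : seq form) (a : form) : seq form :=
  if a is Imp (All b) Bot
  then [:: Neg (fsubst (inst (Var (scope_of (a :: G)))) b)] else [::].

Let add_form (G : seq form) (a : form) : seq form :=
  if excluded_middle_informative (consistent (inG (a :: G)))
  then witness G a ++ a :: G else G.

Let Fixpoint stage (n : nat) : seq form :=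
  if n is m.+1 then add_form (stage m) (nth_form m) else [:: Neg phi].

Let limit (a : form) : Prop := exists n, inG (stage n) a.
Let Th (a : form) : Prop := ded T limit a.

Let stage0_consistent : consistent (inG (stage 0)).
Proof.
move=> h; apply: unprovable.
have: ded T (fun _ => False) phi.
  by apply: ded_raa; apply: ded_weaken h => b [<-|//]; apply: ded_ext.
by elim=> // a b _ ab _ ha; exact: proves_mp ab ha.
Qed.

Let add_consistent G a :
  consistent (inG G) -> consistent (inG (add_form G a)).
Proof.
rewrite /add_form; case: excluded_middle_informative => // h _.
case: a h => //= c d; case: c => // b; case: d => // h.
set c := scope_of _ => bad; apply: h.
have hb : ded T (inG (Neg (All b) :: G)) (fsubst (inst (Var c)) b).
  apply: ded_raa; apply: ded_weaken bad => e [<-|he]; first exact: ded_ext.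
  by apply: ded_hyp; left.
have sc e : inG (Neg (All b) :: G) e -> fscoped c e by exact: scope_ofP.
apply: ded_mp (ded_gen_fresh cT sc _ hb); first by apply: ded_hyp; left.
by have := sc (Neg (All b)) (or_introl erefl); rewrite /= andbT.
Qed.

Let stage_consistent n : consistent (inG (stage n)).
Proof. by elim: n => [|n IH]; [exact: stage0_consistent|exact: add_consistent]. Qed.

Let stage_mono n a : inG (stage n) a -> inG (stage n.+1) a.
Proof.
move=> h; rewrite /= /add_form.
case: excluded_middle_informative => // hc.
by apply/List.in_or_app; right; right.
Qed.

Let stage_le m n a : m <= n -> inG (stage m) a -> inG (stage n) a.
Proof. by move/subnK <-; elim: (n - m) => //= k IH /IH /stage_mono. Qed.

Let limit_compact a : Th a -> exists n, ded T (inG (stage n)) a.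
Proof.
elim=> {a} [a [n hn]|a pa|a b _ [m hm] _ [n hn]].
- by exists n; exact: ded_hyp.
- by exists 0; exact: ded_thm.
- exists (maxn m n); apply: ded_mp.
  + apply: ded_weaken hm => c h; apply: ded_hyp.
    exact: stage_le (leq_maxl _ _) h.
  + apply: ded_weaken hn => c h; apply: ded_hyp.
    exact: stage_le (leq_maxr _ _) h.
Qed.

Let Th_consistent : ~ Th Bot.
Proof. by case/limit_compact=> n; exact: stage_consistent. Qed.

Let stage_ded n a : ded T (inG (stage n)) a -> Th a.
Proof. by apply: ded_weaken => b h; apply: ded_hyp; exists n. Qed.

Hypothesis fcode_inj : forall a b, fcode a = fcode b -> a = b.

Let decide a : (exists n, inG (stage n.+1) a /\
     stage n.+1 = witness (stage n) a ++ a :: stage n) \/ Th (Neg a).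
Proof.
have Ea : nth_form (fcode a) = a.
  apply: fcode_inj; apply: (epsilon_spec (inhabits Bot)
    (fun b => fcode b = fcode a)); by exists a.
have : stage (fcode a).+1 = add_form (stage (fcode a)) a by rewrite /= Ea.
rewrite /add_form; case: excluded_middle_informative => [h|h] /= E.
- left; exists (fcode a); split; last by rewrite -E.
  by rewrite E; apply/List.in_or_app; right; left.
- right; apply: (@stage_ded (fcode a)).
  have [bad|//] := classic (ded T (inG (a :: stage (fcode a))) Bot).
  apply: deduction; apply: ded_weaken bad => b [<-|hb]; first exact: ded_ext.
  by apply: ded_hyp; left.
Qed.

Let Th_neg a : Th (Neg a) <-> ~ Th a.
Proof.
split=> [h ha|h]; first exact/Th_consistent/(ded_mp h ha).
by case: (decide a) => // -[n [hn _]]; case: h; apply: ded_hyp; exists n.+1.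
Qed.

Let Th_imp a b : Th (Imp a b) <-> (Th a -> Th b).
Proof.
split=> [h ha|h]; first exact: ded_mp h ha.
have [ha|/Th_neg ha] := classic (Th a); first exact/ded_K/h.
apply: deduction; apply: ded_exfalso.
exact: ded_mp (ded_extW _ ha) (ded_ext _ _ _).
Qed.

Let Th_all a : Th (All a) <-> forall t, Th (fsubst (inst t) a).
Proof.
split=> [h t|h]; first exact: ded_mp (ded_log _ _ (LInst a t)) h.
apply: NNPP => /Th_neg h1.
case: (decide (Neg (All a))) => [[n [hn E]]|/Th_neg //].
set c := scope_of (Neg (All a) :: stage n).
have : Th (Neg (fsubst (inst (Var c)) a)).
  by apply: ded_hyp; exists n.+1; rewrite E; left.
by move/Th_neg; apply.
Qed.

Let Th_refl t : Th (Eq t t).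
Proof. exact/ded_log/LRefl. Qed.

Let Th_leib a t u :
  Th (Eq t u) -> Th (fsubst (inst t) a) -> Th (fsubst (inst u) a).
Proof. by move=> h; apply/ded_mp/(ded_mp _ h)/ded_log/LLeib. Qed.

Let Th_sym t u : Th (Eq t u) -> Th (Eq u t).
Proof.
move=> h; have := @Th_leib (Eq (Var 0) (tsubst shift t)) t u h.
by rewrite /= !tsubst_comp /= !tsubst_Var; apply.
Qed.

Let Th_trans t u v : Th (Eq t u) -> Th (Eq u v) -> Th (Eq t v).
Proof.
move=> h1 h2; have := @Th_leib (Eq (tsubst shift t) (Var 0)) u v h2.
by rewrite /= !tsubst_comp /= !tsubst_Var; apply.
Qed.

(* The elements of the model are the chosen representatives of the classes of
   provably equal terms. *)
Let rep (t : term) : term := epsilon (inhabits Zero) (fun u => Th (Eq t u)).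

Let rep_eq t : Th (Eq t (rep t)).
Proof.
by apply: (epsilon_spec (inhabits Zero) (fun u => Th (Eq t u))); exists t.
Qed.

Let rep_inj t u : Th (Eq t u) -> rep t = rep u.
Proof.
move=> h; rewrite /rep.
have -> : (fun v => Th (Eq t v)) = (fun v => Th (Eq u v)).
  apply: functional_extensionality => v; apply: propositional_extensionality.
  by split=> h1; [exact: Th_trans (Th_sym h) h1|exact: Th_trans h h1].
by [].
Qed.

Let M : Type := {t : term | rep t = t}.
Let cls (t : term) : M :=
  exist _ (rep t) (esym (rep_inj (rep_eq t))).

Let valK (x : M) : cls (sval x) = x.
Proof. by case: x => t h; apply: subset_eq_compat => /=. Qed.

Let cls_eq t u : cls t = cls u <-> Th (Eq t u).
Proof.
split=> [/(f_equal (@sval _ _)) /= h|h].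
- by apply: Th_trans (rep_eq t) _; rewrite h; exact/Th_sym/rep_eq.
- by apply: subset_eq_compat; exact: rep_inj.
Qed.

Let HM : structure := @Structure M (cls Zero) (fun x => cls (Succ (sval x)))
  (fun x y => cls (Add (sval x) (sval y)))
  (fun x y => cls (Mul (sval x) (sval y)))
  (fun x y => Th (Le (sval x) (sval y))).

Let congr1 (f : term -> term) t u :
  (forall s v, tsubst s (f v) = f (tsubst s v)) ->
  Th (Eq t u) -> Th (Eq (f t) (f u)).
Proof.
move=> nf h.
have := @Th_leib (Eq (tsubst shift (f t)) (f (Var 0))) t u h.
by rewrite /= !nf !tsubst_comp /= !tsubst_Var; apply.
Qed.

Let congr2 (f : term -> term -> term) t u t' u' :
  (forall s v w, tsubst s (f v w) = f (tsubst s v) (tsubst s w)) ->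
  Th (Eq t u) -> Th (Eq t' u') -> Th (Eq (f t t') (f u u')).
Proof.
move=> nf h h'; apply: (@Th_trans _ (f u t')).
- have := @Th_leib (Eq (tsubst shift (f t t')) (f (Var 0) (tsubst shift t'))) t u h.
  by rewrite /= !nf !tsubst_comp /= !tsubst_Var; apply.
- have := @Th_leib (Eq (tsubst shift (f u t')) (f (tsubst shift u) (Var 0))) t' u' h'.
  by rewrite /= !nf !tsubst_comp /= !tsubst_Var; apply.
Qed.

Let rep_val t : Th (Eq (sval (cls t)) t).
Proof. exact/Th_sym/rep_eq. Qed.

Let meval_cls s t : @meval HM (fun i => cls (s i)) t = cls (tsubst s t).
Proof.
elim: t => //= [t ->|t -> u ->|t -> u ->]; apply/cls_eq.
- exact/congr1.
- exact: congr2 (rep_val _) (rep_val _).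
- exact: congr2 (rep_val _) (rep_val _).
Qed.

Let Th_le t u t' u' :
  Th (Eq t t') -> Th (Eq u u') -> Th (Le t u) -> Th (Le t' u').
Proof.
move=> h1 h2 h.
have /= := @Th_leib (Le (Var 0) (tsubst shift u)) t t' h1.
rewrite !tsubst_comp /= !tsubst_Var => /(_ h) h3.
have /= := @Th_leib (Le (tsubst shift t') (Var 0)) u u' h2.
by rewrite !tsubst_comp /= !tsubst_Var; apply.
Qed.

Let truth s a : @msat HM (fun i => cls (s i)) a <-> Th (fsubst s a).
Proof.
elim: a s => [t u|t u||a IHa b IHb|a IHa] s.
- by rewrite [msat _ _]/= !meval_cls cls_eq.
- rewrite [msat _ _]/= !meval_cls /=; split.
  + exact: Th_le (rep_val _) (rep_val _).
  + exact: Th_le (rep_eq _) (rep_eq _).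
- by split=> // /Th_consistent.
- by rewrite [msat _ _]/= IHa IHb -Th_imp.
- rewrite [fsubst _ _]/= Th_all [msat _ _]/=.
  have E t : fsubst (inst t) (fsubst (up s) a) = fsubst (pcons t s) a.
    rewrite fsubst_comp; apply: fsubst_ext => -[|i] //=.
    by rewrite tsubst_comp tsubst_Var.
  split=> h t.
  + rewrite E -IHa -(@msat_ext HM (pcons (cls t) (fun i => cls (s i)))); last by case.
    exact: h.
  + rewrite -(valK t) (@msat_ext HM _ (fun i => cls (pcons (sval t) s i)));
      last by case.
    by rewrite IHa -E.
Qed.

(** The formulas derivable from the limit of the stages form a complete theory with
    witnesses, whose term model refutes [phi]. *)
Lemma henkin_model : exists2 S : structure, models S T &
  exists r : nat -> S, ~ msat r phi.
Proof.
exists HM.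
- move=> a r Ta.
  rewrite (@msat_ext HM _ (fun i => cls (sval (r i)))); last by move=> i; rewrite valK.
  by rewrite truth; exact/ded_thm/proves_subst/proves_ax.
- exists (fun i => cls (Var i)); rewrite truth fsubst_id // -Th_neg.
  by apply: ded_hyp; exists 0; left.
Qed.

End Henkin.

Lemma cpairE x y : (cpair x y).*2 = (x + y) * (x + y).+1 + y.*2.
Proof.
rewrite /cpair doubleD -[in RHS](odd_double_half ((x + y) * (x + y).+1)).
by rewrite oddM /= andbN.
Qed.

Lemma cpair_inj x y x' y' : cpair x y = cpair x' y' -> x = x' /\ y = y'.
Proof.
move=> /(congr1 double); rewrite !cpairE => E.
have lt a b c d : c + d > a + b ->
    (a + b) * (a + b).+1 + b.*2 < (c + d) * (c + d).+1 + d.*2.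
  move=> h; apply: leq_trans (leq_addr _ _).
  apply: (@leq_trans ((a + b).+1 * (a + b).+2)); last exact: leq_mul.
  rewrite -[(a + b).+2]addn2 mulnDr muln2 mulnC ltn_add2l ltn_double ltnS.
  exact: leq_addl.
have [h|h|h] := ltngtP (x + y) (x' + y').
- by have := lt _ _ _ _ h; rewrite E ltnn.
- by have := lt _ _ _ _ h; rewrite E ltnn.
- move: E; rewrite h => /addnI /double_inj Ey; split=> //.
  by move: h; rewrite Ey => /addIn.
Qed.

Lemma tcode_inj t u : tcode t = tcode u -> t = u.
Proof.
elim: t u => [i||t IH|t IHt t' IHt'|t IHt t' IHt'] [j||u|u u'|u u'] /=
  /cpair_inj [] // _; first by move->.
- by move/IH->.
- by case/cpair_inj=> /IHt -> /IHt' ->.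
- by case/cpair_inj=> /IHt -> /IHt' ->.
Qed.

Lemma fcode_inj a b : fcode a = fcode b -> a = b.
Proof.
elim: a b => [t u|t u||a IHa a' IHa'|a IHa] [t' u'|t' u'||b b'|b] /=
  /cpair_inj [] // _.
- by case/cpair_inj=> /tcode_inj -> /tcode_inj ->.
- by case/cpair_inj=> /tcode_inj -> /tcode_inj ->.
- by case/cpair_inj=> /IHa -> /IHa' ->.
- by move/IHa->.
Qed.

(** Through this theorem the provability of a formula in PA is always established by
    proving it in an arbitrary model. *)
Theorem completeness T a : subst_closed T ->
  (forall S : structure, models S T -> forall r : nat -> S, msat r a) ->
  proves T a.
Proof.
move=> cT h; apply: NNPP => np.
have [S mS [r nr]] := henkin_model cT np fcode_inj.
exact/nr/h.
Qed.

(** * Models of arithmetic and the meaning of higher-order formulas *)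

Record PAmodel := PAModel { pa_str :> structure; paP : models pa_str PA }.

Declare Scope pa_scope.
Delimit Scope pa_scope with M.
Notation "0" := (s_zero _) : pa_scope.
Notation "1" := (s_succ (s_zero _)) : pa_scope.
Notation "x + y" := (s_add x y) : pa_scope.
Notation "x * y" := (s_mul x y) : pa_scope.
Notation "x <= y" := (s_le x y) : pa_scope.
Notation "x < y" := (s_le (s_succ x) y) : pa_scope.
Notation sS := s_succ.
Local Open Scope pa_scope.

Section Connectives.
Variables (S : structure) (r : nat -> S).

Lemma msat_And a b : msat r (And a b) <-> msat r a /\ msat r b.
Proof.
split=> /= [h|[ha hb]]; last by apply.
by split; apply: NNPP => n; apply: h => ha // ; case: n.
Qed.

Lemma msat_Or a b : msat r (Or a b) <-> msat r a \/ msat r b.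
Proof.
split=> /= [h|[ha|hb]] //.
by case: (classic (msat r a)) => [|/h]; [left|right].
Qed.

Lemma msat_Iff a b : msat r (Iff a b) <-> (msat r a <-> msat r b).
Proof. by rewrite msat_And /=; split=> -[]. Qed.

Lemma msat_Ex a : msat r (Ex a) <-> exists x, msat (pcons x r) a.
Proof.
split=> /= [h|[x hx] h]; last exact: h hx.
by apply: NNPP => n; apply: h => x hx; apply: n; exists x.
Qed.

End Connectives.

(** The state of the evaluation of a higher-order formula: the number of
    binders passed, and the values of the variables. *)
Record ctx (S : structure) := Ctx { depth : nat; env : nat -> S }.

Definition deeper (S : structure) (c c' : ctx S) : Prop :=
  (depth c <= depth c')%N /\
  forall i, (i < depth c)%N -> env c' (depth c' - depth c + i)%N = env c i.
Notation "c ⊑ c'" := (deeper c c') (at level 70).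

Definition push (S : structure) (x : S) (c : ctx S) : ctx S :=
  Ctx (depth c).+1 (pcons x (env c)).

(** [tden c t v]: the term [t] has value [v] in [c] and below further binders.
    [fden] is the analogue for formulas.  A [bpoly] denotes [v] when it feeds
    its continuation with terms of value [v]. *)
Definition tden (S : structure) (c : ctx S) (t : bterm) (v : S) : Prop :=
  forall c', c ⊑ c' -> meval (env c') (t (depth c')) = v.
Definition fden (S : structure) (c : ctx S) (f : bform) (K : Prop) : Prop :=
  forall c', c ⊑ c' -> (msat (env c') (f (depth c')) <-> K).
Definition pden (S : structure) (c : ctx S) (p : bpoly) (v : S) : Prop :=
  forall c' k K, c ⊑ c' ->
    (forall c'' t, c' ⊑ c'' -> tden c'' t v -> fden c'' (k t) K) ->
    fden c' (p k) K.
Definition inden (S : structure) (c : ctx S) (In : bpoly -> bform) (Z : S -> Prop)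
    : Prop :=
  forall c' p v, c ⊑ c' -> pden c' p v -> fden c' (In p) (Z v).

Definition pred1 (S : structure) (c : ctx S) (F : bterm -> bform) (Q : S -> Prop)
    : Prop :=
  forall c' t x, c ⊑ c' -> tden c' t x -> fden c' (F t) (Q x).
Definition pred2 (S : structure) (c : ctx S) (F : bterm -> bterm -> bform)
    (Q : S -> S -> Prop) : Prop :=
  forall c' t x u y, c ⊑ c' -> tden c' t x -> tden c' u y ->
    fden c' (F t u) (Q x y).

Definition natM (S : structure) (n : nat) : S := iter n (@s_succ S) (s_zero S).

Section Denotation.
Variable S : structure.
Implicit Types (c : ctx S) (x y v : S).

Lemma deeper_refl c : c ⊑ c.
Proof. by split=> // i hi; rewrite subnn. Qed.

Lemma deeper_trans c1 c2 c3 : c1 ⊑ c2 -> c2 ⊑ c3 -> c1 ⊑ c3.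
Proof.
move=> [h1 e1] [h2 e2]; split=> [|i hi]; first exact: leq_trans h2.
rewrite -(e1 i hi) -(e2 (depth c2 - depth c1 + i)%N); last by lia.
by congr env; lia.
Qed.

Lemma deeper_push x c : c ⊑ push x c.
Proof. by split=> [|i hi] /=; rewrite ?leqnSn // subSnn. Qed.

Lemma tden_mono c c' t v : c ⊑ c' -> tden c t v -> tden c' t v.
Proof. by move=> h ht c2 h2; apply: ht; exact: deeper_trans h2. Qed.

Lemma pden_mono c c' p v : c ⊑ c' -> pden c p v -> pden c' p v.
Proof. by move=> h ht c2 k K h2; apply: ht; exact: deeper_trans h2. Qed.

Lemma inden_mono c c' In Z : c ⊑ c' -> inden c In Z -> inden c' In Z.
Proof. by move=> h ht c2 p v h2; apply: ht; exact: deeper_trans h2. Qed.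

Lemma pred1_mono c c' F Q : c ⊑ c' -> pred1 c F Q -> pred1 c' F Q.
Proof. by move=> h ht c2 t x h2; apply: ht; exact: deeper_trans h2. Qed.

Lemma pred2_mono c c' F Q : c ⊑ c' -> pred2 c F Q -> pred2 c' F Q.
Proof. by move=> h ht c2 t x u y h2; apply: ht; exact: deeper_trans h2. Qed.

Lemma inden_use c In Z p v : inden c In Z -> pden c p v -> fden c (In p) (Z v).
Proof. by apply; exact: deeper_refl. Qed.

Lemma pred1_use c F Q t x : pred1 c F Q -> tden c t x -> fden c (F t) (Q x).
Proof. by apply; exact: deeper_refl. Qed.

Lemma pred2_use c F Q t x u y :
  pred2 c F Q -> tden c t x -> tden c u y -> fden c (F t u) (Q x y).
Proof. by apply; exact: deeper_refl. Qed.

Lemma fden_here c f K : fden c f K -> (msat (env c) (f (depth c)) <-> K).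
Proof. by apply; exact: deeper_refl. Qed.

Lemma tden_lev x c : tden (push x c) (lev (depth c)) x.
Proof.
by move=> c' [/= h1 h2]; have := h2 0%N erefl; rewrite addn0 /=.
Qed.

(** Parameters of inductions are made into values of additional variables. *)
Lemma tden_param c x : exists c' t, c ⊑ c' /\ tden c' t x.
Proof.
exists (push x c), (lev (depth c)); split; [exact: deeper_push|exact: tden_lev].
Qed.

Lemma tden_num c n : tden c (bnum n) (natM S n).
Proof. by move=> c' _; elim: n => //= n; rewrite /num /= => ->. Qed.

Lemma tden_S c t v : tden c t v -> tden c (bS t) (sS v).
Proof. by move=> h c' /h /= ->. Qed.

Lemma tden_add c t u v w : tden c t v -> tden c u w -> tden c (badd t u) (v + w).
Proof. by move=> h h' c' l /=; rewrite h // h'. Qed.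

Lemma tden_mul c t u v w : tden c t v -> tden c u w -> tden c (bmul t u) (v * w).
Proof. by move=> h h' c' l /=; rewrite h // h'. Qed.

Lemma fden_eq c t u v w : tden c t v -> tden c u w -> fden c (beq t u) (v = w).
Proof. by move=> h h' c' l /=; rewrite h // h'. Qed.

Lemma fden_le c t u v w : tden c t v -> tden c u w -> fden c (ble t u) (v <= w).
Proof. by move=> h h' c' l /=; rewrite h // h'. Qed.

Lemma fden_bot c : fden c bbot False.
Proof. by []. Qed.

Lemma fden_neg c f K : fden c f K -> fden c (bneg f) (~ K).
Proof. by move=> h c' l /=; rewrite h. Qed.

Lemma fden_imp c f g K L : fden c f K -> fden c g L -> fden c (bimp f g) (K -> L).
Proof. by move=> h h' c' l /=; rewrite h // h'. Qed.

Lemma fden_and c f g K L : fden c f K -> fden c g L -> fden c (band f g) (K /\ L).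
Proof. by move=> h h' c' l; rewrite msat_And h // h'. Qed.

(** The second conjunct may be interpreted under the assumption of the first. *)
Lemma fden_guard c f g K L :
  fden c f K -> (K -> fden c g L) -> fden c (band f g) (K /\ L).
Proof.
move=> h h' c' l; rewrite msat_And h //.
by split=> -[k]; have := h' k _ l => ->.
Qed.

Lemma fden_or c f g K L : fden c f K -> fden c g L -> fden c (bor f g) (K \/ L).
Proof. by move=> h h' c' l; rewrite msat_Or h // h'. Qed.

Lemma fden_iff c f g K L : fden c f K -> fden c g L -> fden c (biff f g) (K <-> L).
Proof. by move=> h h' c' l; rewrite msat_Iff h // h'. Qed.

Lemma fden_all c f (K : S -> Prop) :
  (forall x c' t, c ⊑ c' -> tden c' t x -> fden c' (f t) (K x)) ->
  fden c (ball f) (forall x, K x).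
Proof.
move=> h c' l.
have E x : msat (pcons x (env c')) (f (lev (depth c')) (depth c').+1) <-> K x.
  apply: (fden_here (c := push x c')); apply: h;
    [exact: deeper_trans l (deeper_push x c')|exact: tden_lev].
by split=> h1 x; apply/E.
Qed.

Lemma fden_ex c f (K : S -> Prop) :
  (forall x c' t, c ⊑ c' -> tden c' t x -> fden c' (f t) (K x)) ->
  fden c (bex f) (exists x, K x).
Proof.
move=> h c' l.
have E x : msat (pcons x (env c')) (f (lev (depth c')) (depth c').+1) <-> K x.
  apply: (fden_here (c := push x c')); apply: h;
    [exact: deeper_trans l (deeper_push x c')|exact: tden_lev].
by rewrite msat_Ex; split=> -[x h1]; exists x; apply/E.
Qed.

Lemma fden_sub c a t v :
  tden c t v -> fden c (bsub a t) (msat (fun _ => v) a).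
Proof.
by move=> h c' l; rewrite msat_subst; apply: msat_ext => i; rewrite h.
Qed.

Lemma pden_ret c t v : tden c t v -> pden c (bret t) v.
Proof.
move=> h c' k K l hk; apply: hk; [exact: deeper_refl|exact: tden_mono h].
Qed.

Lemma fden_is c t p v w : tden c t v -> pden c p w -> fden c (bis t p) (v = w).
Proof.
move=> ht hp; apply: (hp c); first exact: deeper_refl.
by move=> c' u l hu; apply: fden_eq hu; exact: tden_mono ht.
Qed.

(* A continuation applied to a denoting [bpoly], as in [bpoly] arguments of
   defined predicates. *)
Lemma fden_bind c p v k K : pden c p v ->
  (forall c' t, c ⊑ c' -> tden c' t v -> fden c' (k t) K) -> fden c (p k) K.
Proof. by move=> hp; apply: hp; exact: deeper_refl. Qed.

Lemma fden_iffK c f K L : (K <-> L) -> fden c f K -> fden c f L.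
Proof. by move=> e h c' l; rewrite h. Qed.

Lemma fden_build1 f (r : nat -> S) K :
  fden (Ctx 1 r) (f (lev 0)) K -> msat r (build1 f) <-> K.
Proof. exact: fden_here. Qed.

Lemma tden_lev_lt d r l : (l < d)%N -> tden (S := S) (Ctx d r) (lev l) (r (d - l.+1)%N).
Proof.
move=> h c' [/= h1 h2]; rewrite -(h2 (d - l.+1)%N); last by lia.
by congr env; lia.
Qed.

End Denotation.

(** Hypotheses about terms are carried to the current context. *)
Ltac lift_den :=
  repeat match goal with
  | L : ?c ⊑ ?c', H : tden ?c _ _ |- _ => apply (tden_mono L) in H
  | L : ?c ⊑ ?c', H : pden ?c _ _ |- _ => apply (pden_mono L) in H
  | L : ?c ⊑ ?c', H : inden ?c _ _ |- _ => apply (inden_mono L) in H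
  | L : ?c ⊑ ?c', H : pred1 ?c _ _ |- _ => apply (pred1_mono L) in H
  | L : ?c ⊑ ?c', H : pred2 ?c _ _ |- _ => apply (pred2_mono L) in H
  end;
  repeat match goal with L : _ ⊑ _ |- _ => clear L end.

Ltac den_intro := intros; lift_den; cbv beta.

(** The tactic [den] proves that a formula denotes a given proposition,
    following the shape of the proposition; the formula may be unknown, and is
    then synthesized.  [den_atom] and [den_poly] are extended as predicates and
    functions are defined. *)
Ltac den_atom K := fail.
Ltac den_poly v := fail.

Ltac tdn :=
  lazymatch goal with
  | |- tden _ _ (natM _ _) => first [eassumption | apply tden_num]
  | |- tden _ _ (s_zero _) => exact (@tden_num _ _ 0%N)
  | |- tden _ _ (s_succ _) => apply tden_S; tdn
  | |- tden _ _ (s_add _ _) => apply tden_add; [tdn|tdn]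
  | |- tden _ _ (s_mul _ _) => apply tden_mul; [tdn|tdn]
  | |- _ => eassumption
  end.

Ltac pdn :=
  lazymatch goal with
  | |- pden _ _ ?v => first [den_poly v | eassumption | apply pden_ret; tdn]
  end.

Ltac den :=
  lazymatch goal with
  | |- tden _ _ _ => tdn
  | |- pden _ _ _ => pdn
  | |- inden _ _ _ => eassumption
  | |- pred1 _ _ _ => eassumption
  | |- pred2 _ _ _ => eassumption
  | |- fden _ _ ?K =>
    lazymatch K with
    | ex _ => apply fden_ex; den_intro; den
    | _ /\ _ => apply fden_and; [den|den]
    | _ \/ _ => apply fden_or; [den|den]
    | _ <-> _ => apply fden_iff; [den|den]
    | ~ _ => apply fden_neg; den
    | False => exact (@fden_bot _ _)
    | ?A -> ?B => apply fden_imp; [den|den]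
    | forall x, _ => apply fden_all; den_intro; den
    | _ = _ => first [ apply fden_eq; [tdn|tdn] | apply fden_is; [tdn|pdn] ]
    | s_le _ _ => apply fden_le; [tdn|tdn]
    | _ => first
      [ den_atom K
      | eassumption
      | match goal with
        | H : inden ?c _ ?Z |- fden ?c _ (?Z ?v) =>
          let h := fresh in eassert (h : pden c _ v) by pdn; exact (inden_use H h)
        | H : pred1 ?c _ ?Z |- fden ?c _ (?Z ?v) =>
          let h := fresh in eassert (h : tden c _ v) by tdn; exact (pred1_use H h)
        | H : pred2 ?c _ ?Z |- fden ?c _ (?Z ?v ?w) =>
          let h := fresh in eassert (h : tden c _ v) by tdn;
          let k := fresh in eassert (k : tden c _ w) by tdn;
          exact (pred2_use H h k)
        end ]
    end
  end.

Section Arithmetic.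
Variable M : PAmodel.
Implicit Types x y z : M.

Let ax i (h : (i < size basic_axioms)%N) r := @paP M _ r (PA_basic h).

Lemma succ_neq0 x : sS x <> 0.
Proof. exact: (@ax 0 isT (fun=> 0) x). Qed.

Lemma succ_inj x y : sS x = sS y -> x = y.
Proof. exact: (@ax 1 isT (fun=> 0) x y). Qed.

Lemma addx0 x : x + 0 = x.
Proof. exact: (@ax 2 isT (fun=> 0) x). Qed.

Lemma addxS x y : x + sS y = sS (x + y).
Proof. exact: (@ax 3 isT (fun=> 0) x y). Qed.

Lemma mulx0 x : x * 0 = 0.
Proof. exact: (@ax 4 isT (fun=> 0) x). Qed.

Lemma mulxS x y : x * sS y = x * y + x.
Proof. exact: (@ax 5 isT (fun=> 0) x y). Qed.

Lemma leE x y : x <= y <-> exists z, z + x = y.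
Proof.
have : msat (pcons y (pcons x (fun=> 0)))
  (Iff (Le (Var 1) (Var 0)) (Ex (Eq (Add (Var 0) (Var 2)) (Var 1)))).
  exact: (@ax 6 isT (fun=> 0) x y).
by rewrite msat_Iff msat_Ex.
Qed.

(** Induction is available for the predicates that are denoted by a formula. *)
Lemma M_ind (c : ctx M) (F : bterm -> bform) (Q : M -> Prop) :
  pred1 c F Q ->
  Q 0 -> (forall x, Q x -> Q (sS x)) -> forall x, Q x.
Proof.
move=> hF; pose a := F (lev (depth c)) (depth c).+1.
have aQ x : msat (pcons x (env c)) a <-> Q x.
  apply: (fden_here (c := push x c)); apply: hF;
    [exact: deeper_push|exact: tden_lev].
have := @paP M _ (env c) (PA_induction a); rewrite /= !msat_subst.
have E t : msat (fun i => meval (env c) (inst t i)) a <-> Q (meval (env c) t).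
  by rewrite -aQ; apply: msat_ext => -[].
rewrite E /= => h Q0 QS x; rewrite -aQ; apply: h => // y.
rewrite aQ msat_subst (@msat_ext _ _ (pcons (sS y) (env c))); last by case.
by rewrite aQ; exact: QS.
Qed.

End Arithmetic.

Definition ctx0 (S : structure) : ctx S := Ctx 0%N (fun _ => s_zero S).

(** [start_ctx M] opens a context, [param x] makes the element [x] available in
    it, and [m_ind Q] is induction for the predicate [Q]. *)
Ltac start_ctx M := pose proof (@tden_num M (ctx0 M) 0).
Ltac param x :=
  match goal with H : tden ?c _ _ |- _ =>
    destruct (tden_param c x) as [? [? [? ?]]]; lift_den end.
Ltac cur_ctx tac := match goal with H : tden ?c _ _ |- _ => tac c end.
Ltac m_ind Q :=
  cur_ctx ltac:(fun c => refine (@M_ind _ c _ Q _ _ _);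
    [unfold pred1; den_intro; den| |]).

Section Semiring.
Variable M : PAmodel.
Implicit Types x y z : M.

Lemma add0x x : 0 + x = x.
Proof.
start_ctx M; move: x; m_ind (fun x => 0 + x = x) => [|x h]; first exact: addx0.
by rewrite addxS h.
Qed.

Lemma addSx x y : sS x + y = sS (x + y).
Proof.
start_ctx M; param x; move: y.
m_ind (fun y => sS x + y = sS (x + y)) => [|y h]; first by rewrite !addx0.
by rewrite !addxS h.
Qed.

Lemma addC x y : x + y = y + x.
Proof.
start_ctx M; param x; move: y.
m_ind (fun y => x + y = y + x) => [|y h]; first by rewrite addx0 add0x.
by rewrite addxS addSx h.
Qed.

Lemma addA x y z : x + (y + z) = (x + y) + z.
Proof.
start_ctx M; param x; param y; move: z.
m_ind (fun z => x + (y + z) = (x + y) + z) => [|z h]; first by rewrite !addx0.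
by rewrite !addxS h.
Qed.

Lemma mul0x x : 0 * x = 0.
Proof.
start_ctx M; move: x; m_ind (fun x => 0 * x = 0) => [|x h]; first exact: mulx0.
by rewrite mulxS addx0.
Qed.

Lemma mulSx x y : sS x * y = x * y + y.
Proof.
start_ctx M; param x; move: y.
m_ind (fun y => sS x * y = x * y + y) => [|y h]; first by rewrite !mulx0 addx0.
by rewrite !mulxS h !addxS -!addA (addC y).
Qed.

Lemma mulC x y : x * y = y * x.
Proof.
start_ctx M; param x; move: y.
m_ind (fun y => x * y = y * x) => [|y h]; first by rewrite mulx0 mul0x.
by rewrite mulxS mulSx h.
Qed.

Lemma mulDr x y z : x * (y + z) = x * y + x * z.
Proof.
start_ctx M; param x; param y; move: z.
m_ind (fun z => x * (y + z) = x * y + x * z) => [|z h].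
  by rewrite mulx0 !addx0.
by rewrite addxS !mulxS h addA.
Qed.

Lemma mulA x y z : x * (y * z) = (x * y) * z.
Proof.
start_ctx M; param x; param y; move: z.
m_ind (fun z => x * (y * z) = (x * y) * z) => [|z h]; first by rewrite !mulx0.
by rewrite !mulxS mulDr h.
Qed.

Lemma mul1x x : 1 * x = x.
Proof. by rewrite mulSx mul0x add0x. Qed.

Lemma succE x : sS x = x + 1.
Proof. by rewrite addxS addx0. Qed.

Lemma pa_semi_ring :
  semi_ring_theory (s_zero M) 1 (@s_add M) (@s_mul M) eq.
Proof.
split.
- exact: add0x.
- exact: addC.
- exact: addA.
- exact: mul1x.
- exact: mul0x.
- exact: mulC.
- exact: mulA.
- by move=> x y z; rewrite mulC mulDr !(mulC z).
Qed.

End Semiring.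

(** * Arithmetic in a model *)

Ltac unfold_succ := repeat match goal with
  | |- context [sS ?x] =>
    lazymatch x with s_zero _ => fail | _ => rewrite (@succE _ x) end
  end.
Ltac pa_ring := unfold_succ; ring.

Section Order.
Variable M : PAmodel.
Implicit Types x y z d q : M.
Add Ring pa_ring_order : (pa_semi_ring M).

Lemma addIr x y z : x + z = y + z -> x = y.
Proof.
start_ctx M; param x; param y; move: z.
m_ind (fun z => x + z = y + z -> x = y) => [|z h]; first by rewrite !addx0.
by rewrite !addxS => /succ_inj /h.
Qed.

Lemma addIl x y z : z + x = z + y -> x = y.
Proof. by rewrite !(addC z) => /addIr. Qed.

Lemma zero_or_succ x : x = 0 \/ exists y, x = sS y.
Proof.
start_ctx M; move: x.
by m_ind (fun x => x = 0 \/ exists y, x = sS y); [left|right; exists x].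
Qed.

Lemma add_eq0 x y : x + y = 0 -> x = 0 /\ y = 0.
Proof.
have [->|[z ->]] := zero_or_succ y; first by rewrite addx0.
by rewrite addxS => /succ_neq0.
Qed.

Lemma le_add x d : x <= x + d.
Proof. by apply/leE; exists d; rewrite addC. Qed.

Lemma leP' x y : x <= y -> exists d, y = x + d.
Proof. by case/leE=> d <-; exists d; rewrite addC. Qed.

Lemma le_refl x : x <= x.
Proof. by rewrite -{2}(addx0 x); exact: le_add. Qed.

Lemma le_trans y x z : x <= y -> y <= z -> x <= z.
Proof. by case/leP'=> d -> /leP' [e ->]; rewrite -addA; exact: le_add. Qed.

Lemma le_antisym x y : x <= y -> y <= x -> x = y.
Proof.
case/leP'=> d -> /leP' [e]; rewrite -{1}(addx0 x) -addA => /addIl /esym.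
by case/add_eq0=> ->; rewrite addx0.
Qed.

Lemma le0x x : 0 <= x.
Proof. by rewrite -(add0x x); exact: le_add. Qed.

Lemma leS x : x <= sS x.
Proof. by rewrite succE; exact: le_add. Qed.

Lemma le_SS x y : sS x <= sS y <-> x <= y.
Proof.
split=> /leP' [d].
- by rewrite addSx => /succ_inj ->; exact: le_add.
- by move=> ->; rewrite -addSx; exact: le_add.
Qed.

Lemma lt_irrefl x : ~ x < x.
Proof.
case/leP'=> d; rewrite addSx -addxS -{1}(addx0 x) => /addIl /esym.
exact: succ_neq0.
Qed.

Lemma ltx0 x : ~ x < 0.
Proof. by case/leP'=> d; rewrite addSx => /esym /succ_neq0. Qed.

Lemma lt_le x y : x < y -> x <= y.
Proof. exact/le_trans/leS. Qed.

Lemma le_or_lt x y : x <= y \/ y < x.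
Proof.
start_ctx M; param y; move: x.
m_ind (fun x => x <= y \/ y < x) => [|x [/leP' [d]|h]].
- by left; exact: le0x.
- have [->|[e ->] ->] := zero_or_succ d.
  + by rewrite addx0 => ->; right; exact: le_refl.
  + by left; rewrite addxS -addSx; exact: le_add.
- by right; apply: le_trans h (leS _).
Qed.

Lemma lt_trichotomy x y : x < y \/ x = y \/ y < x.
Proof.
have [h|] := le_or_lt x y; last by right; right.
have [h'|] := le_or_lt y x; last by left.
by right; left; exact: le_antisym.
Qed.

Lemma le_lt_trans y x z : x <= y -> y < z -> x < z.
Proof. by move=> h; apply: le_trans; apply/le_SS. Qed.

Lemma lt_le_trans y x z : x < y -> y <= z -> x < z.
Proof. exact: le_trans. Qed.

Lemma le_not_lt x y : x <= y -> ~ y < x.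
Proof. by move=> h h'; apply: (@lt_irrefl y); exact: le_trans h' h. Qed.

Lemma ltSx_le x y : x < sS y <-> x <= y.
Proof. exact: le_SS. Qed.

Lemma le_eq_lt x y : x <= y -> x = y \/ x < y.
Proof.
have [h|[h|h]] := lt_trichotomy x y; [by right|by left|].
by move/le_not_lt.
Qed.

Lemma le_add2 x y z d : x <= y -> z <= d -> x + z <= y + d.
Proof.
case/leP'=> a -> /leP' [b ->].
have -> : x + a + (z + b) = x + z + (a + b) by pa_ring.
exact: le_add.
Qed.

Lemma le_mul2 x y z d : x <= y -> z <= d -> x * z <= y * d.
Proof.
case/leP'=> a -> /leP' [b ->].
have -> : (x + a) * (z + b) = x * z + (x * b + a * z + a * b) by pa_ring.
exact: le_add.
Qed.

Lemma le_mulr x y : y <> 0 -> x <= x * y.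
Proof.
have [->//|[z ->] _] := zero_or_succ y.
by rewrite mulxS addC; exact: le_add.
Qed.

Lemma lt_neq x y : x < y -> x <> y.
Proof. by move=> h e; move: h; rewrite e => /lt_irrefl. Qed.

(** Complete induction and the least number principle for predicates denoted by
    formulas. *)
Lemma strong_ind c F (Q : M -> Prop) : pred1 c F Q ->
  (forall x, (forall y, y < x -> Q y) -> Q x) -> forall x, Q x.
Proof.
move=> hQ h x; apply: (h); move: x.
refine (@M_ind M c _ (fun x => forall y, y < x -> Q y) _ _ _).
- by move=> c' t x hc ht; lift_den; den.
- by move=> y /ltx0.
- move=> x IH y /ltSx_le /le_eq_lt [->|]; [exact: h|exact: IH].
Qed.

Lemma least c F (Q : M -> Prop) x : pred1 c F Q -> Q x ->
  exists2 y, Q y & forall z, z < y -> ~ Q z.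
Proof.
move=> hQ Qx; apply: NNPP => n.
suff no y : ~ Q y by exact: no Qx.
move: y; refine (@strong_ind c _ (fun y => ~ Q y) _ _).
  by move=> c' t y hc ht; lift_den; den.
by move=> y IH Qy; apply: n; exists y.
Qed.

Lemma div_ex x d : exists q r, x = q * sS d + r /\ r <= d.
Proof.
start_ctx M; param d; move: x.
m_ind (fun x => exists q r, x = q * sS d + r /\ r <= d).
  by exists 0, 0; split; [pa_ring|exact: le0x].
move=> x [q [r [-> /le_eq_lt [->|h]]]].
- by exists (sS q), 0; split; [pa_ring|exact: le0x].
- by exists q, (sS r); split=> //; pa_ring.
Qed.

Lemma div_uniq d q r q' r' : r <= d -> r' <= d ->
  q * sS d + r = q' * sS d + r' -> q = q' /\ r = r'.
Proof.
have aux a b s t : s <= d -> a < b -> a * sS d + s <> b * sS d + t.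
  move=> h /leP' [e ->] E; apply: (le_not_lt h).
  have -> : s = sS d + (e * sS d + t); last exact: le_add.
  by apply: (@addIl _ _ (a * sS d)); rewrite E; pa_ring.
move=> h h'; have [l|[->|l]] := lt_trichotomy q q'.
- by move/(aux _ _ _ _ h l).
- by move/addIl.
- by move/esym/(aux _ _ _ _ h' l).
Qed.

Lemma double_inj x y : x + x = y + y -> x = y.
Proof.
have aux (a b : M) : a < b -> a + a <> b + b.
  case/leP'=> d -> E; apply: (@lt_irrefl (a + a)); rewrite {2}E.
  have -> : sS a + d + (sS a + d) = sS (a + a) + (1 + d + d) by pa_ring.
  exact: le_add.
by have [/aux|[//|/aux h /esym]] := lt_trichotomy x y.
Qed.

Lemma lt_double x y : x + x < y + y -> x < y.
Proof.
move=> h; have [l|//] := le_or_lt y x.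
by case: (@le_not_lt (y + y) (x + x) (le_add2 l l) h).
Qed.

Lemma pair_ex x y :
  exists z, z + z = (x + y) * sS (x + y) + (y + y).
Proof.
have [z hz] : exists z, z + z = (x + y) * sS (x + y).
  start_ctx M; move: (x + y).
  m_ind (fun u => exists z, z + z = u * sS u) => [|u [z hz]].
    by exists 0; pa_ring.
  exists (z + sS u).
  have -> : z + sS u + (z + sS u) = z + z + (sS u + sS u) by pa_ring.
  by rewrite hz; pa_ring.
exists (z + y).
by rewrite -hz; pa_ring.
Qed.

End Order.

(** The half of the pairing polynomial, which exists and is unique by induction. *)
Definition pairM (M : PAmodel) (x y : M) : M :=
  epsilon (inhabits (s_zero M))
    (fun z => z + z = (x + y) * sS (x + y) + (y + y)).
Notation "⟪ x , y ⟫" := (pairM x y) (at level 0, x, y at level 99) : pa_scope.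

Section Pairs.
Variable M : PAmodel.
Implicit Types x y z u v : M.
Add Ring pa_ring_pairs : (pa_semi_ring M).

Lemma pairE x y : ⟪x, y⟫ + ⟪x, y⟫ = (x + y) * sS (x + y) + (y + y).
Proof.
exact: (epsilon_spec (inhabits (s_zero M))
  (fun z => z + z = (x + y) * sS (x + y) + (y + y)) (pair_ex x y)).
Qed.

Lemma pair_eq x y z :
  z = ⟪x, y⟫ <-> z + z = (x + y) * sS (x + y) + (y + y).
Proof. by split=> [->|h]; [exact: pairE|apply: double_inj; rewrite h pairE]. Qed.

Lemma pair_lt_diag x y x' y' : x + y < x' + y' -> ⟪x, y⟫ < ⟪x', y'⟫.
Proof.
move=> h; apply: lt_double; rewrite !pairE.
apply: le_trans (le_add _ _).
apply: (@le_trans _ (sS (x + y) * sS (sS (x + y)))); last first.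
  by apply: le_mul2 => //; apply/le_SS.
have -> : sS (x + y) * sS (sS (x + y)) =
  sS ((x + y) * sS (x + y) + (y + y)) + (1 + x + x) by pa_ring.
exact: le_add.
Qed.

Lemma pair_inj x y x' y' : ⟪x, y⟫ = ⟪x', y'⟫ -> x = x' /\ y = y'.
Proof.
move=> E; have [h|[h|h]] := lt_trichotomy (x + y) (x' + y').
- by case: (@lt_irrefl _ ⟪x, y⟫); rewrite {2}E; exact: pair_lt_diag.
- have := pairE x y; rewrite E pairE h => /addIl /double_inj Ey.
  by move: h; rewrite Ey => /addIr.
- by case: (@lt_irrefl _ ⟪x', y'⟫); rewrite -{2}E; exact: pair_lt_diag.
Qed.

Lemma sum_le_pair x y : x + y <= ⟪x, y⟫.
Proof.
have [//|] := le_or_lt (x + y) ⟪x, y⟫.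
have [->|[v E]] := zero_or_succ (x + y); first by move/ltx0.
rewrite E => h; case: (@lt_irrefl _ (⟪x, y⟫ + ⟪x, y⟫)).
apply: (@le_trans _ (sS v + sS v)).
  rewrite -addSx; apply: le_add2 => //; exact: lt_le.
rewrite pairE E.
have -> : sS v * sS (sS v) + (y + y) = (sS v + sS v) + (v * v + v + y + y).
  by pa_ring.
exact: le_add.
Qed.

Lemma pair_ge1 x y : x <= ⟪x, y⟫.
Proof. exact: le_trans (le_add x y) (sum_le_pair x y). Qed.

Lemma pair_ge2 x y : y <= ⟪x, y⟫.
Proof. by apply: le_trans (sum_le_pair x y); rewrite addC; exact: le_add. Qed.

Lemma pair00 : ⟪0, 0⟫ = 0 :> M.
Proof. by symmetry; apply/pair_eq; pa_ring. Qed.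

Lemma pair_le x y x' y' : x <= x' -> y <= y' -> ⟪x, y⟫ <= ⟪x', y'⟫.
Proof.
move=> hx hy; have [//|h] := le_or_lt ⟪x, y⟫ ⟪x', y'⟫.
case: (@lt_irrefl _ (⟪x, y⟫ + ⟪x, y⟫)).
apply: (@le_trans _ (⟪x', y'⟫ + ⟪x', y'⟫ + 1)).
  rewrite !pairE -succE; apply/le_SS; apply: le_add2; last exact: le_add2.
  by apply: le_mul2; [|apply/le_SS]; exact: le_add2.
rewrite -succE -addSx; apply: le_add2 => //; exact: lt_le.
Qed.

Lemma pair_surj z : exists x y, z = ⟪x, y⟫.
Proof.
suff [x [y /pair_eq ->]] : exists x y, z + z = (x + y) * sS (x + y) + (y + y).
  by exists x, y.
start_ctx M; move: z.
m_ind (fun z => exists x y, z + z = (x + y) * sS (x + y) + (y + y)).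
  by exists 0, 0; pa_ring.
move=> z [x [y h]].
have E : sS z + sS z = z + z + (1 + 1) by pa_ring.
have [h0|[u h0]] := zero_or_succ x; rewrite E h h0.
- by exists (sS y), 0; pa_ring.
- by exists u, (sS y); pa_ring.
Qed.

Lemma natM_add m n : natM M (m + n) = natM M m + natM M n.
Proof. by elim: m => [|m IH]; rewrite ?add0x ?add0n //= IH addSx. Qed.

Lemma natM_mul m n : natM M (m * n) = natM M m * natM M n.
Proof.
by elim: m => [|m IH]; rewrite ?mul0x ?mul0n // mulSn natM_add IH /= mulSx addC.
Qed.

Lemma natM_cpair m n : natM M (cpair m n) = ⟪natM M m, natM M n⟫.
Proof.
apply/pair_eq; rewrite -natM_add addnn cpairE !natM_add natM_mul /= -addnn.
by rewrite !natM_add.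
Qed.

Lemma natM_le m n : (m <= n)%N -> natM M m <= natM M n.
Proof. by move/subnKC <-; rewrite natM_add; exact: le_add. Qed.

Lemma natM_inj m n : natM M m = natM M n -> m = n.
Proof.
have aux a b : (a < b)%N -> natM M a <> natM M b.
  by move=> h; apply: lt_neq; exact: (natM_le h).
by have [/aux|/aux h /esym|] := ltngtP m n.
Qed.

End Pairs.

Lemma pden_pair (M : PAmodel) (c : ctx M) p q (x y : M) :
  pden c p x -> pden c q y -> pden c (bpair p q) ⟪x, y⟫.
Proof.
move=> hp hq c' k K l hk.
apply: (hp c') => // c1 t l1 ht.
apply: (hq c1); first exact: deeper_trans l1.
move=> c2 u l2 hu.
apply: (@fden_iffK _ _ _ (exists z, z = ⟪x, y⟫ /\ K)).
  by split=> [[z []]|h] //; exists ⟪x, y⟫.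
apply: fden_ex => z c3 w l3 hw; apply: fden_guard.
- apply: (@fden_iffK _ _ _ (z + z = (x + y) * sS (x + y) + (y + y))).
    by rewrite pair_eq.
  by lift_den; den.
- move=> E; rewrite E in hw; apply: hk hw.
  exact: deeper_trans (deeper_trans l1 l2) l3.
Qed.

Ltac den_poly v ::= lazymatch v with pairM _ _ => apply pden_pair; [pdn|pdn] end.

(** * Sequences coded by the beta function *)

Definition betaM (M : PAmodel) (a b i y : M) : Prop :=
  (exists q, a = q * sS (sS i * b) + y) /\ y <= sS i * b.

Lemma den_beta (M : PAmodel) (c : ctx M) ta tb ti ty (a b i y : M) :
  tden c ta a -> tden c tb b -> tden c ti i -> tden c ty y ->
  fden c (beta ta tb ti ty) (betaM a b i y).
Proof. by move=> ha hb hi hy; rewrite /betaM /beta; den. Qed.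

Ltac den_atom K ::=
  lazymatch K with betaM _ _ _ _ => apply den_beta; [tdn|tdn|tdn|tdn] end.

Section Beta.
Variable M : PAmodel.
Implicit Types a b c i j k n x y z u v : M.
Add Ring pa_ring_beta : (pa_semi_ring M).

Lemma beta_ex a b i : exists y, betaM a b i y.
Proof. by have [q [y [E h]]] := div_ex a (sS i * b); exists y; split=> //; exists q. Qed.

Lemma beta_uniq a b i y z : betaM a b i y -> betaM a b i z -> y = z.
Proof.
move=> [[q E] h] [[q' E'] h'].
by have [] := div_uniq h h' (etrans (esym E) E').
Qed.

Definition unit_mod p q : Prop := exists u v, u * p = 1 + v * q.

Lemma unit_mod1 q : unit_mod 1 q.
Proof. by exists 1, 0; pa_ring. Qed.

Lemma unit_mod_mul p p' q : unit_mod p q -> unit_mod p' q -> unit_mod (p * p') q.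
Proof.
move=> [u [v E]] [u' [v' E']]; exists (u * u'), (v + v' + v * v' * q).
have -> : u * u' * (p * p') = (u * p) * (u' * p') by pa_ring.
by rewrite E E'; pa_ring.
Qed.

(* As (j+1)(1 + (i+1)b) = (i+1)(1 + (j+1)b) + (j-i), multiplying by (j+1)b/(j-i)
   makes the right-hand side congruent to t = (j+1)b, that is to -1. *)
Lemma moduli_coprime b d e i : b = d * e ->
  unit_mod (sS (sS i * b)) (sS (sS (i + d) * b)).
Proof.
move=> ->; set t := sS (i + d) * (d * e).
pose s := sS (i + d) * sS (i + d) * e; pose k := sS (i + d) * sS i * e.
have Es : s * sS (sS i * (d * e)) = k * sS t + t.
  by rewrite /s /k /t; pa_ring.
exists (s * t + sS t), (t * k + t + sS i * (d * e)).
have -> : (s * t + sS t) * sS (sS i * (d * e)) =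
  (s * sS (sS i * (d * e))) * t + sS t * sS (sS i * (d * e)) by pa_ring.
rewrite Es; pa_ring.
Qed.

Lemma moduli_coprime_lt b i j : i < j -> (forall k, k < j -> exists e, b = sS k * e) ->
  unit_mod (sS (sS i * b)) (sS (sS j * b)).
Proof.
case/leP'=> d -> hb.
have [|e E] := hb d.
  have -> : sS i + d = sS d + i by pa_ring.
  exact: le_add.
have -> : sS i + d = i + sS d by pa_ring.
exact: moduli_coprime E.
Qed.

Lemma common_multiple n x :
  exists b, (forall k, k < n -> exists e, b = sS k * e) /\ n <= b /\ x <= b /\ b <> 0.
Proof.
start_ctx M; param x; move: n.
m_ind (fun n => exists b, (forall k, k < n -> exists e, b = sS k * e) /\
  n <= b /\ x <= b /\ b <> 0).
  exists (sS x); split; first by move=> k /ltx0.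
  by split; [exact: le0x|split; [exact: leS|exact: succ_neq0]].
move=> n [b [hb [hn [hx b0]]]]; exists (b * sS n).
have hm : b <= b * sS n by apply: le_mulr; exact: succ_neq0.
split; [|split; [|split]].
- move=> k /ltSx_le /le_eq_lt [->|/hb [e ->]]; first by exists b; pa_ring.
  by exists (e * sS n); pa_ring.
- have [//|[b' ->]] := zero_or_succ b.
  have -> : sS b' * sS n = sS n + b' * sS n by pa_ring.
  exact: le_add.
- exact: le_trans hm.
- by have [//|[b' ->]] := zero_or_succ b; rewrite mulxS addxS; exact: succ_neq0.
Qed.

(** The step of the Chinese remainder theorem: adding a multiple of [p] leaves the
    residues modulo the divisors of [p] unchanged. *)
Lemma chinese a p d y : unit_mod p (sS d) -> y <= d ->
  exists a' s q, a' = a + p * s /\ a' = q * sS d + y.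
Proof.
move=> [u [v E]] hy.
have [q [r [Ea hr]]] := div_ex a (d).
have [e Ed] := leP' hr.
(* add p u (y + (d + 1 - r)), which is y - r modulo d + 1 *)
pose w := y + (1 + e).
exists (a + p * (u * w)), (u * w), (q + v * w + 1); split=> //.
have -> : p * (u * w) = (u * p) * w by pa_ring.
by rewrite E Ea /w Ed; pa_ring.
Qed.

Lemma beta_add a b i y p s e : p = sS (sS i * b) * e ->
  betaM a b i y -> betaM (a + p * s) b i y.
Proof. by move=> -> [[q ->] h]; split=> //; exists (q + e * s); pa_ring. Qed.

(** If b' is a multiple of 1, ..., n that exceeds [b] and [x], then the numbers
    1 + (i+1)b' with i <= n are pairwise coprime, so that the old entries can be copied
    one after the other before the new one is added. *)
Lemma beta_append a b n x : exists a' b',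
  (forall i, i < n -> forall y, betaM a b i y -> betaM a' b' i y) /\
  betaM a' b' n x.
Proof.
have [b' [hb [hn [hx b0]]]] := common_multiple n (b + x).
have bb' : b <= b' by apply: le_trans hx; exact: le_add.
have xb' : x <= b' by apply: le_trans hx; rewrite addC; exact: le_add.
have small i y : betaM a b i y -> y <= sS i * b'.
  by case=> _ h; apply: le_trans h _; apply: le_mul2 => //; exact: le_refl.
have coprime i j : i < j -> j <= n -> unit_mod (sS (sS i * b')) (sS (sS j * b')).
  move=> hij hjn; apply: moduli_coprime_lt => // k hk; apply: hb.
  exact: lt_le_trans hk hjn.
have main : forall k, k <= n -> exists a' p,
    (forall i, i < k -> forall y, betaM a b i y -> betaM a' b' i y) /\
    (forall i, i < k -> exists e, p = sS (sS i * b') * e) /\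
    (forall j, k <= j -> j <= n ->
      exists u v, u * p = 1 + v * sS (sS j * b')).
  start_ctx M; param a; param b; param b'; param n.
  m_ind (fun k => k <= n -> exists a' p,
    (forall i, i < k -> forall y, betaM a b i y -> betaM a' b' i y) /\
    (forall i, i < k -> exists e, p = sS (sS i * b') * e) /\
    (forall j, k <= j -> j <= n ->
      exists u v, u * p = 1 + v * sS (sS j * b'))).
    move=> _; exists 0, 1; split; first by move=> i /ltx0.
    by split=> [i /ltx0|j _ _] //; exact: unit_mod1.
  move=> k IH hk; have [a' [p [h1 [h2 h3]]]] := IH (lt_le hk).
  have [y hy] := beta_ex a b k.
  have [a2 [s [q [E1 E2]]]] :=
    chinese a' (h3 k (le_refl k) (lt_le hk)) (small _ _ hy).
  exists a2, (p * sS (sS k * b')); split; [|split].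
  - move=> i /ltSx_le /le_eq_lt [->|hi] z hz.
    + rewrite (beta_uniq hz hy); split; [by exists q|exact: small].
    + by have [e Ee] := h2 _ hi; rewrite E1; exact: beta_add Ee (h1 _ hi _ hz).
  - move=> i /ltSx_le /le_eq_lt [->|hi]; first by exists p; rewrite mulC.
    by have [e ->] := h2 _ hi; exists (e * sS (sS k * b')); rewrite mulA.
  - move=> j hkj hj; apply: (@unit_mod_mul p (sS (sS k * b'))); last exact: coprime.
    exact: h3 (lt_le hkj) hj.
have [a' [p [h1 [h2 h3]]]] := main n (le_refl n).
have xs : x <= sS n * b'.
  by apply: le_trans xb' _; rewrite mulC; apply: le_mulr; exact: succ_neq0.
have [a2 [s [q [E1 E2]]]] := chinese a' (h3 n (le_refl n) (le_refl n)) xs.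
exists a2, b'; split; last by split; [exists q|].
move=> i hi y hy; have [e Ee] := h2 _ hi.
by rewrite E1; exact: beta_add Ee (h1 _ hi _ hy).
Qed.

(** By induction on [m], appending one entry at a time. *)
Lemma beta_concat a b n a2 b2 m : exists a' b',
  (forall i, i < n -> forall y, betaM a b i y -> betaM a' b' i y) /\
  (forall i, i < m -> forall y, betaM a2 b2 i y -> betaM a' b' (n + i) y).
Proof.
start_ctx M; param a; param b; param n; param a2; param b2; move: m.
m_ind (fun m => exists a' b',
  (forall i, i < n -> forall y, betaM a b i y -> betaM a' b' i y) /\
  (forall i, i < m -> forall y, betaM a2 b2 i y -> betaM a' b' (n + i) y)).
  by exists a, b; split=> // i /ltx0.
move=> m [a' [b' [h1 h2]]]; have [y hy] := beta_ex a2 b2 m.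
have [a3 [b3 [h3 h4]]] := beta_append a' b' (n + m) y.
exists a3, b3; split=> [i hi z /h1|i /ltSx_le /le_eq_lt [->|hi] z hz].
- by move/(_ hi); apply: h3; apply: lt_le_trans hi (le_add _ _).
- by rewrite (beta_uniq hz hy).
- apply: h3; last exact: h2.
  by rewrite -addxS; apply: le_add2 => //; exact: le_refl.
Qed.

End Beta.

(** * Inductively defined predicates *)

Definition lfpM (M : PAmodel) (Phi : (M -> Prop) -> M -> Prop) (x : M) : Prop :=
  exists a b n, betaM a b n x /\
    forall i, i <= n -> exists y, betaM a b i y /\
      Phi (fun z => exists j, j < i /\ betaM a b j z) y.

Definition monotone (M : PAmodel) (Phi : (M -> Prop) -> M -> Prop) : Prop :=
  forall Z Z' : M -> Prop, (forall z, Z z -> Z' z) -> forall x, Phi Z x -> Phi Z' x.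

Definition opden (M : PAmodel) (c : ctx M)
    (PhiF : (bpoly -> bform) -> bterm -> bform)
    (Phi : (M -> Prop) -> M -> Prop) : Prop :=
  forall c' In Z t y, c ⊑ c' -> inden c' In Z -> tden c' t y ->
    fden c' (PhiF In t) (Phi Z y).

Lemma den_lfp (M : PAmodel) (c : ctx M) PhiF Phi p v :
  opden c PhiF Phi -> pden c p v -> fden c (lfp PhiF p) (lfpM Phi v).
Proof.
move=> hPhi hp; apply: (fden_bind hp) => c0 t l0 ht; rewrite /lfpM.
apply: fden_ex => a c1 ta l1 ha; apply: fden_ex => b c2 tb l2 hb.
apply: fden_ex => n c3 tn l3 hn.
have l := deeper_trans (deeper_trans l0 l1) (deeper_trans l2 l3).
have {}ht := tden_mono (deeper_trans l1 (deeper_trans l2 l3)) ht.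
have {}ha := tden_mono (deeper_trans l2 l3) ha; have {}hb := tden_mono l3 hb.
apply: fden_and; first by den.
apply: fden_all => i c4 ti l4 hi; apply: fden_imp.
  by apply: fden_le => //; exact: tden_mono hn.
apply: fden_ex => y c5 ty l5 hy.
have l45 := deeper_trans l4 l5.
have {}hi := tden_mono l5 hi.
have {}ha := tden_mono l45 ha; have {}hb := tden_mono l45 hb.
apply: fden_and; first by den.
apply: hPhi => //; first exact: deeper_trans l45.
move=> c6 q w l6 hq; apply: (fden_bind hq) => c7 tz l7 hz.
have l67 := deeper_trans l6 l7.
have {}hi := tden_mono l67 hi.
have {}ha := tden_mono l67 ha; have {}hb := tden_mono l67 hb.
by den.
Qed.

Section Lfp.
Variable M : PAmodel.
Implicit Types a b n i j x y z u v : M.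
Variables (Phi : (M -> Prop) -> M -> Prop).
Hypothesis mono : monotone Phi.

Definition stages a b n : Prop :=
  forall i, i < n -> exists y, betaM a b i y /\
    Phi (fun z => exists j, j < i /\ betaM a b j z) y.

(** A single construction sequence is needed when an element is introduced from
    several others; sequences for them are concatenated. *)
Definition covered (Z : M -> Prop) : Prop :=
  exists a b n, stages a b n /\
    forall z, Z z -> exists j, j < n /\ betaM a b j z.

Lemma covered_mem Z z : covered Z -> Z z -> lfpM Phi z.
Proof.
move=> [a [b [n [h cov]]]] /cov [j [hj hz]]; exists a, b, j; split=> // i hi.
by apply: h; exact: le_lt_trans hi hj.
Qed.

Lemma covered_union Z Z' : covered Z -> covered Z' ->
  covered (fun z => Z z \/ Z' z).
Proof.
move=> [a [b [n [h cov]]]] [a2 [b2 [n2 [h2 cov2]]]].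
have [a3 [b3 [e1 e2]]] := beta_concat a b n a2 b2 n2.
exists a3, b3, (n + n2); split=> [i hi|z [/cov|/cov2] [j [hj hz]]].
- have [hin|hin] := le_or_lt n i.
  + have [k Ek] := leP' hin; subst i.
    have hk : k < n2.
      have [hle|//] := le_or_lt n2 k.
      by case: (le_not_lt (le_add2 (le_refl n) hle) hi).
    have [y [hy hP]] := h2 _ hk; exists y; split; first exact: e2.
    apply: mono hP => z [j [hj hz]]; exists (n + j); split; last first.
      by apply: e2 hz; apply: lt_le_trans hj _; exact: lt_le.
    by rewrite -addxS; apply: le_add2 => //; exact: le_refl.
  + have [y [hy hP]] := h _ hin; exists y; split; first exact: e1.
    apply: mono hP => z [j [hj hz]]; exists j; split=> //.
    by apply: e1 hz; apply: lt_le_trans hj _; exact: lt_le.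
- exists j; split; last exact: e1 hz.
  by apply: lt_le_trans hj _; exact: le_add.
- exists (n + j); split; last exact: e2 hz.
  by rewrite -addxS; apply: le_add2 => //; exact: le_refl.
Qed.

Lemma covered_empty : covered (fun _ => False).
Proof. by exists 0, 0, 0; split=> // i /ltx0. Qed.

Lemma covered_intro Z x : covered Z -> Phi Z x ->
  covered (fun z => Z z \/ z = x).
Proof.
move=> [a [b [n [h cov]]]] hP.
have [a' [b' [e1 e2]]] := beta_append a b n x.
exists a', b', (sS n); split=> [i /ltSx_le /le_eq_lt [->|hi]|z [/cov [j [hj hz]]|->]].
- exists x; split=> //; apply: mono hP => z /cov [j [hj hz]].
  by exists j; split=> //; exact: e1 hz.
- have [y [hy hPy]] := h _ hi; exists y; split; first exact: e1.
  apply: mono hPy => z [j [hj hz]]; exists j; split=> //.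
  by apply: e1 hz; apply: lt_le_trans hj _; exact: lt_le.
- by exists j; split; [exact: le_trans hj (leS _)|exact: e1 hz].
- by exists n; split=> //; exact: le_refl.
Qed.

Lemma lfp_covered x : lfpM Phi x -> covered (eq x).
Proof.
move=> [a [b [n [hx h]]]]; exists a, b, (sS n); split=> [i /ltSx_le /h //|z <-].
by exists n; split=> //; exact: le_refl.
Qed.

Lemma lfp_intro Z x : covered Z -> Phi Z x -> lfpM Phi x.
Proof. by move=> h hP; apply: covered_mem (covered_intro h hP) _; right. Qed.

Lemma lfp_intro0 x : Phi (fun _ => False) x -> lfpM Phi x.
Proof. exact: lfp_intro covered_empty. Qed.

Lemma lfp_intro1 x y : lfpM Phi y -> Phi (eq y) x -> lfpM Phi x.
Proof. by move/lfp_covered/lfp_intro; apply. Qed.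

Lemma lfp_intro2 x y z : lfpM Phi y -> lfpM Phi z ->
  Phi (fun w => y = w \/ z = w) x -> lfpM Phi x.
Proof.
by move=> /lfp_covered hy /lfp_covered hz; exact: lfp_intro (covered_union hy hz).
Qed.

Lemma lfp_unfold x : lfpM Phi x -> Phi (lfpM Phi) x.
Proof.
move=> [a [b [n [hx h]]]]; have [y [hy hP]] := h n (le_refl n).
rewrite (beta_uniq hx hy); apply: mono hP => z [j [hj hz]].
exists a, b, j; split=> // i hi; apply: h.
exact: le_trans hi (lt_le hj).
Qed.

(** Construction sequences for boundedly many elements can be combined, by induction
    on the bound; this serves the clause for bounded quantifiers of a satisfaction
    predicate. *)
Lemma covered_bounded c PhiF g G v : opden c PhiF Phi ->
  (forall c' t y, c ⊑ c' -> tden c' t y -> pden c' (G t) (g y)) ->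
  (forall y, y <= v -> lfpM Phi (g y)) ->
  covered (fun z => exists2 y, y <= v & z = g y).
Proof.
move=> hPhi hG hv.
suff main : forall u, u <= v -> exists a b n,
    (forall i, i < n -> exists y, betaM a b i y /\
      Phi (fun z => exists j, j < i /\ betaM a b j z) y) /\
    (forall y, y <= u -> exists z, z = g y /\ exists j, j < n /\ betaM a b j z).
  have [a [b [n [h1 h2]]]] := main v (le_refl v).
  by exists a, b, n; split=> // z [y hy ->]; have [w [<-]] := h2 _ hy.
have [c' [t [l ht]]] := tden_param c v.
refine (@M_ind M c' _ (fun u => u <= v -> exists a b n,
    (forall i, i < n -> exists y, betaM a b i y /\
      Phi (fun z => exists j, j < i /\ betaM a b j z) y) /\
    (forall y, y <= u -> exists z, z = g y /\ exists j, j < n /\ betaM a b j z)) _ _ _).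
- move=> c1 tu u l1 hu.
  have {}hG : forall c' t y, c1 ⊑ c' -> tden c' t y -> pden c' (G t) (g y).
    by move=> c2 t2 y2 l2; apply: hG; exact: deeper_trans (deeper_trans l l1) l2.
  have {}hPhi : opden c1 PhiF Phi.
    move=> c2 In Z t2 y2 l2; apply: hPhi.
    exact: deeper_trans (deeper_trans l l1) l2.
  lift_den; apply: fden_imp; first by den.
  apply: fden_ex => a c2 ta l2 ha; apply: fden_ex => b c3 tb l3 hb.
  apply: fden_ex => n c4 tn l4 hn.
  have l14 := deeper_trans l2 (deeper_trans l3 l4).
  have {}hu := tden_mono l14 hu.
  have {}ha := tden_mono (deeper_trans l3 l4) ha; have {}hb := tden_mono l4 hb.
  apply: fden_and.
  + apply: fden_all => i c5 ti l5 hi; have hn5 := tden_mono l5 hn.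
    apply: fden_imp; first by den.
    apply: fden_ex => y c6 ty l6 hy.
    have {}ha := tden_mono (deeper_trans l5 l6) ha.
    have {}hb := tden_mono (deeper_trans l5 l6) hb; have {}hi := tden_mono l6 hi.
    apply: fden_and; first by den.
    refine (hPhi c6 (fun e : bpoly => e (fun z : bterm => bex (fun j : bterm =>
      band (ble (bS j) ti) (beta ta tb j z)))) _ ty y _ _ hy).
      exact: deeper_trans (deeper_trans l14 l5) l6.
    move=> c7 q w l7 hq; apply: (fden_bind hq) => c8 tz l8 hz.
    by lift_den; den.
  + apply: fden_all => y c5 ty l5 hy; have hu5 := tden_mono l5 hu.
    apply: fden_imp; first by den.
    apply: fden_ex => z c6 tz l6 hz.
    have l56 := deeper_trans l5 l6.
    apply: fden_and; last by lift_den; den.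
    refine (fden_is hz (hG c6 ty y _ (tden_mono l6 hy))).
    exact: deeper_trans l14 l56.
- move=> h0; have [a [b [n [h1 h2]]]] := lfp_covered (hv _ h0).
  exists a, b, n; split=> // y hy.
  have -> : y = 0 by apply: le_antisym hy (le0x _).
  by exists (g 0); split=> //; exact: h2.
- move=> u IH hu; have [a [b [n [h1 h2]]]] := IH (lt_le hu).
  have cov : covered (fun z => exists2 y, y <= u & z = g y).
    exists a, b, n; split=> // z [y hy ->].
    by have [w [<-]] := h2 _ hy.
  have [a' [b' [n' [h1' h2']]]] := covered_union cov (lfp_covered (hv _ hu)).
  exists a', b', n'; split=> // y hy; exists (g y); split=> //; apply: h2'.
  by have [->|hyu] := le_eq_lt hy; [right|left; exists y => //; apply/ltSx_le].
Qed.

End Lfp.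

(** * Arithmetized syntax *)

Section Syntax.
Variable M : PAmodel.
Implicit Types (x y k t u v e w : M) (Z : M -> Prop).

Definition tagM (n : nat) x : M := ⟪natM M n, x⟫.
Definition cVarM i := tagM 0 i.
Definition cZeroM := tagM 1 (natM M 0).
Definition cSuccM t := tagM 2 t.
Definition cAddM t u := tagM 3 ⟪t, u⟫.
Definition cMulM t u := tagM 4 ⟪t, u⟫.
Definition cEqM t u := tagM 0 ⟪t, u⟫.
Definition cLeM t u := tagM 1 ⟪t, u⟫.
Definition cBotM := tagM 2 (natM M 0).
Definition cImpM a b := tagM 3 ⟪a, b⟫.
Definition cAllM a := tagM 4 a.
Definition cNegM a := cImpM a cBotM.
Definition cAndM a b := cNegM (cImpM a (cNegM b)).
Definition cExM a := cNegM (cAllM (cNegM a)).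
Definition ctermM (t : term) := natM M (tcode t).
Definition cformM (a : form) := natM M (fcode a).

Definition TscopedPhi Z x : Prop :=
     (exists k i, x = ⟪k, cVarM i⟫ /\ i < k)
  \/ (exists k, x = ⟪k, cZeroM⟫)
  \/ (exists k t, x = ⟪k, cSuccM t⟫ /\ Z ⟪k, t⟫)
  \/ (exists k t u, (x = ⟪k, cAddM t u⟫ \/ x = ⟪k, cMulM t u⟫)
        /\ Z ⟪k, t⟫ /\ Z ⟪k, u⟫).
Definition TscopedM k t := lfpM TscopedPhi ⟪k, t⟫.

Definition FscopedPhi Z x : Prop :=
     (exists k t u, (x = ⟪k, cEqM t u⟫ \/ x = ⟪k, cLeM t u⟫)
        /\ TscopedM k t /\ TscopedM k u)
  \/ (exists k, x = ⟪k, cBotM⟫)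
  \/ (exists k a b, x = ⟪k, cImpM a b⟫ /\ Z ⟪k, a⟫ /\ Z ⟪k, b⟫)
  \/ (exists k a, x = ⟪k, cAllM a⟫ /\ Z ⟪sS k, a⟫).
Definition FscopedM k a := lfpM FscopedPhi ⟪k, a⟫.

Definition IstermM t := exists k, TscopedM k t.
Definition IsformM a := exists k, FscopedM k a.

Definition TsubstPhi (r : nat) Z x : Prop :=
     (exists k t i, x = ⟪k, ⟪t, ⟪cVarM i, cVarM i⟫⟫⟫ /\ i < k)
  \/ (exists k t, x = ⟪k, ⟪t, ⟪cVarM k, t⟫⟫⟫)
  \/ (exists k t j, x = ⟪k, ⟪t, ⟪cVarM (sS (k + j)), cVarM (k + j + natM M r)⟫⟫⟫)
  \/ (exists k t, x = ⟪k, ⟪t, ⟪cZeroM, cZeroM⟫⟫⟫)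
  \/ (exists k t u v, x = ⟪k, ⟪t, ⟪cSuccM u, cSuccM v⟫⟫⟫ /\ Z ⟪k, ⟪t, ⟪u, v⟫⟫⟫)
  \/ (exists k t u u' v v',
        (x = ⟪k, ⟪t, ⟪cAddM u u', cAddM v v'⟫⟫⟫
         \/ x = ⟪k, ⟪t, ⟪cMulM u u', cMulM v v'⟫⟫⟫)
        /\ Z ⟪k, ⟪t, ⟪u, v⟫⟫⟫ /\ Z ⟪k, ⟪t, ⟪u', v'⟫⟫⟫).
Definition TsubstM r k t u v := lfpM (TsubstPhi r) ⟪k, ⟪t, ⟪u, v⟫⟫⟫.
Definition TshiftM u v := TsubstM 2 (natM M 0) (ctermM (Var 1)) u v.

Definition FsubstPhi (r : nat) Z x : Prop :=
     (exists k t u u' v v',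
        (x = ⟪k, ⟪t, ⟪cEqM u u', cEqM v v'⟫⟫⟫
         \/ x = ⟪k, ⟪t, ⟪cLeM u u', cLeM v v'⟫⟫⟫)
        /\ TsubstM r k t u v /\ TsubstM r k t u' v')
  \/ (exists k t, x = ⟪k, ⟪t, ⟪cBotM, cBotM⟫⟫⟫)
  \/ (exists k t a a' b b', x = ⟪k, ⟪t, ⟪cImpM a a', cImpM b b'⟫⟫⟫
        /\ Z ⟪k, ⟪t, ⟪a, b⟫⟫⟫ /\ Z ⟪k, ⟪t, ⟪a', b'⟫⟫⟫)
  \/ (exists k t a b t', x = ⟪k, ⟪t, ⟪cAllM a, cAllM b⟫⟫⟫
        /\ TshiftM t t' /\ Z ⟪sS k, ⟪t', ⟪a, b⟫⟫⟫).
Definition FsubstM r k t a b := lfpM (FsubstPhi r) ⟪k, ⟪t, ⟪a, b⟫⟫⟫.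
Definition FinstM t a b := FsubstM 0 (natM M 0) t a b.
Definition FshiftM a b := FsubstM 2 (natM M 0) (ctermM (Var 1)) a b.

Definition NumPhi Z x : Prop :=
     x = ⟪natM M 0, cZeroM⟫
  \/ (exists u v, x = ⟪sS u, cSuccM v⟫ /\ Z ⟪u, v⟫).
Definition NumM x y := lfpM NumPhi ⟪x, y⟫.

Definition LogaxM x : Prop :=
  IsformM x /\
  (  (exists a b, x = cImpM a (cImpM b a))
   \/ (exists a b c,
        x = cImpM (cImpM a (cImpM b c)) (cImpM (cImpM a b) (cImpM a c)))
   \/ (exists a, x = cImpM (cNegM (cNegM a)) a)
   \/ (exists a t b, IstermM t /\ FinstM t a b /\ x = cImpM (cAllM a) b)
   \/ (exists a b, x = cImpM (cAllM (cImpM a b)) (cImpM (cAllM a) (cAllM b)))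
   \/ (exists a b, FshiftM a b /\ x = cImpM a (cAllM b))
   \/ (exists t, x = cEqM t t)
   \/ (exists a t u b c, IsformM a /\ FinstM t a b /\ FinstM u a c
        /\ x = cImpM (cEqM t u) (cImpM b c))).

Definition DerPhi a b n Z y : Prop :=
     (exists i, i < n /\ betaM a b i y)
  \/ LogaxM y
  \/ (exists z, Z (cImpM z y) /\ Z z)
  \/ (exists z, y = cAllM z /\ Z z).
Definition DerM x a b n := lfpM (DerPhi a b n) x.

Definition SubnumM x p w := exists n, NumM x n /\ FinstM n p w.

Definition cprvM tau := cExM (cExM (cExM (cAndM (cformM derivable_form)
    (cAllM (cImpM (cformM (Le (Succ (Var 0)) (Var 1)))
      (cExM (cAndM (cformM premise_form) tau))))))).

Definition IsRfnM tau y : Prop :=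
  exists a n, FscopedM (natM M 1) a /\ NumM a n /\
    y = cAllM (cImpM (cExM (cAndM (cEqM (ctermM (Var 0)) n)
                (cExM (cAndM (cformM subst_num_form) (cprvM tau))))) a).

Definition AxPAM x : Prop :=
     foldr (fun a P => x = cformM a \/ P) False basic_axioms
  \/ (exists a b c, IsformM a /\ FinstM cZeroM a b
       /\ FsubstM 1 (natM M 0) (ctermM (Succ (Var 0))) a c
       /\ x = cImpM b (cImpM (cAllM (cImpM a c)) (cAllM a))).

Lemma pden_tag (c : ctx M) n p x : pden c p x -> pden c (Defs.tag n p) (tagM n x).
Proof. by move=> h; apply: pden_pair h; apply: pden_ret; exact: tden_num. Qed.

End Syntax.

Lemma fcode_Imp a b : fcode (Imp a b) = cpair 3 (cpair (fcode a) (fcode b)).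
Proof. by []. Qed.
Lemma fcode_All a : fcode (All a) = cpair 4 (fcode a).
Proof. by []. Qed.
Lemma fcode_Eq t u : fcode (Eq t u) = cpair 0 (cpair (tcode t) (tcode u)).
Proof. by []. Qed.
Lemma fcode_Le t u : fcode (Le t u) = cpair 1 (cpair (tcode t) (tcode u)).
Proof. by []. Qed.
Lemma fcode_Bot : fcode Bot = cpair 2 0.
Proof. by []. Qed.
Lemma tcode_Var i : tcode (Var i) = cpair 0 i.
Proof. by []. Qed.
Lemma tcode_Zero : tcode Zero = cpair 1 0.
Proof. by []. Qed.
Lemma tcode_Succ t : tcode (Succ t) = cpair 2 (tcode t).
Proof. by []. Qed.
Lemma tcode_Add t u : tcode (Add t u) = cpair 3 (cpair (tcode t) (tcode u)).
Proof. by []. Qed.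
Lemma tcode_Mul t u : tcode (Mul t u) = cpair 4 (cpair (tcode t) (tcode u)).
Proof. by []. Qed.
Definition codeE := (fcode_Imp, fcode_All, fcode_Eq, fcode_Le, fcode_Bot,
  tcode_Var, tcode_Zero, tcode_Succ, tcode_Add, tcode_Mul).
(* The codes of concrete formulas are far too large to be computed. *)
#[global] Opaque fcode tcode.
#[global] Arguments fcode : simpl never.
#[global] Arguments tcode : simpl never.
Arguments tagM : simpl never.

Ltac den_poly v ::=
  lazymatch v with
  | pairM _ _ => apply pden_pair; [pdn|pdn]
  | tagM _ _ => apply pden_tag; pdn
  | cVarM _ => apply pden_tag; pdn
  | cZeroM _ => apply pden_tag; pdn
  | cSuccM _ => apply pden_tag; pdn
  | cAddM _ _ => apply pden_tag; pdn
  | cMulM _ _ => apply pden_tag; pdn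
  | cEqM _ _ => apply pden_tag; pdn
  | cLeM _ _ => apply pden_tag; pdn
  | cBotM _ => apply pden_tag; pdn
  | cImpM _ _ => apply pden_tag; pdn
  | cAllM _ => apply pden_tag; pdn
  | cNegM _ => apply pden_tag; pdn
  | cAndM _ _ => apply pden_tag; pdn
  | cExM _ => apply pden_tag; pdn
  | ctermM _ _ => apply pden_ret; apply tden_num
  | cformM _ _ => apply pden_ret; apply tden_num
  | cprvM _ => unfold cprvM; pdn
  end.

Ltac opd Phi :=
  intros ? ? ? ? ? ? ? ?; lift_den; unfold Phi; cbv beta; den.
Ltac den_by_lfp Phi := apply den_lfp; [opd Phi|pdn].

Section SyntaxDen1.
Variable M : PAmodel.
Implicit Types (c : ctx M).

Lemma den_tscoped c p q (k t : M) : pden c p k -> pden c q t ->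
  fden c (b_tscoped p q) (TscopedM k t).
Proof. by move=> hk ht; den_by_lfp TscopedPhi. Qed.

Lemma den_tsubst c r p1 p2 p3 p4 (k t u v : M) :
  pden c p1 k -> pden c p2 t -> pden c p3 u -> pden c p4 v ->
  fden c (b_tsubst r p1 p2 p3 p4) (TsubstM r k t u v).
Proof. by move=> h1 h2 h3 h4; den_by_lfp TsubstPhi. Qed.

Lemma den_tshift c p3 p4 (u v : M) : pden c p3 u -> pden c p4 v ->
  fden c (b_tshift p3 p4) (TshiftM u v).
Proof.
by move=> h3 h4; apply: den_tsubst => //; apply: pden_ret; exact: tden_num.
Qed.

Lemma den_num c p q (x y : M) : pden c p x -> pden c q y ->
  fden c (b_num p q) (NumM x y).
Proof. by move=> h1 h2; den_by_lfp NumPhi. Qed.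

End SyntaxDen1.

Ltac den_atom K ::=
  lazymatch K with
  | betaM _ _ _ _ => apply den_beta; [tdn|tdn|tdn|tdn]
  | TscopedM _ _ => apply den_tscoped; [pdn|pdn]
  | TsubstM _ _ _ _ _ => apply den_tsubst; [pdn|pdn|pdn|pdn]
  | TshiftM _ _ => apply den_tshift; [pdn|pdn]
  | NumM _ _ => apply den_num; [pdn|pdn]
  end.

Section SyntaxDen2.
Variable M : PAmodel.
Implicit Types (c : ctx M).

Lemma den_fscoped c p q (k a : M) : pden c p k -> pden c q a ->
  fden c (b_fscoped p q) (FscopedM k a).
Proof. by move=> hk ht; den_by_lfp FscopedPhi. Qed.

Lemma den_isterm c q (t : M) : pden c q t -> fden c (b_isterm q) (IstermM t).
Proof. by move=> ht; rewrite /b_isterm /IstermM; den. Qed.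

Lemma den_fsubst c r p1 p2 p3 p4 (k t u v : M) :
  pden c p1 k -> pden c p2 t -> pden c p3 u -> pden c p4 v ->
  fden c (b_fsubst r p1 p2 p3 p4) (FsubstM r k t u v).
Proof. by move=> h1 h2 h3 h4; den_by_lfp FsubstPhi. Qed.

Lemma den_finst c p2 p3 p4 (t u v : M) :
  pden c p2 t -> pden c p3 u -> pden c p4 v ->
  fden c (b_finst p2 p3 p4) (FinstM t u v).
Proof. by move=> *; apply: den_fsubst => //; apply: pden_ret; exact: tden_num. Qed.

Lemma den_fshift c p3 p4 (u v : M) :
  pden c p3 u -> pden c p4 v ->
  fden c (b_fshift p3 p4) (FshiftM u v).
Proof. by move=> *; apply: den_fsubst => //; apply: pden_ret; exact: tden_num. Qed.

End SyntaxDen2.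

Ltac den_atom K ::=
  lazymatch K with
  | betaM _ _ _ _ => apply den_beta; [tdn|tdn|tdn|tdn]
  | TscopedM _ _ => apply den_tscoped; [pdn|pdn]
  | TsubstM _ _ _ _ _ => apply den_tsubst; [pdn|pdn|pdn|pdn]
  | TshiftM _ _ => apply den_tshift; [pdn|pdn]
  | NumM _ _ => apply den_num; [pdn|pdn]
  | FscopedM _ _ => apply den_fscoped; [pdn|pdn]
  | IstermM _ => apply den_isterm; pdn
  | FsubstM _ _ _ _ _ => apply den_fsubst; [pdn|pdn|pdn|pdn]
  | FinstM _ _ _ => apply den_finst; [pdn|pdn|pdn]
  | FshiftM _ _ => apply den_fshift; [pdn|pdn]
  end.

Section SyntaxDen3.
Variable M : PAmodel.
Implicit Types (c : ctx M).

Lemma den_isform c q (a : M) : pden c q a -> fden c (b_isform q) (IsformM a).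
Proof. by move=> ht; rewrite /b_isform /IsformM; den. Qed.

End SyntaxDen3.

Ltac den_atom K ::=
  lazymatch K with
  | betaM _ _ _ _ => apply den_beta; [tdn|tdn|tdn|tdn]
  | TscopedM _ _ => apply den_tscoped; [pdn|pdn]
  | TsubstM _ _ _ _ _ => apply den_tsubst; [pdn|pdn|pdn|pdn]
  | TshiftM _ _ => apply den_tshift; [pdn|pdn]
  | NumM _ _ => apply den_num; [pdn|pdn]
  | FscopedM _ _ => apply den_fscoped; [pdn|pdn]
  | IstermM _ => apply den_isterm; pdn
  | FsubstM _ _ _ _ _ => apply den_fsubst; [pdn|pdn|pdn|pdn]
  | FinstM _ _ _ => apply den_finst; [pdn|pdn|pdn]
  | FshiftM _ _ => apply den_fshift; [pdn|pdn]
  | IsformM _ => apply den_isform; pdn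
  end.

Section SyntaxDen4.
Variable M : PAmodel.
Implicit Types (c : ctx M).

Lemma den_logax c t (x : M) : tden c t x ->
  fden c (b_logical_axiom t) (LogaxM x).
Proof. by move=> h; rewrite /LogaxM; den. Qed.

Lemma den_subnum c t1 t2 t3 (x p w : M) : tden c t1 x -> tden c t2 p ->
  tden c t3 w -> fden c (b_subst_num t1 t2 t3) (SubnumM x p w).
Proof. by move=> h1 h2 h3; rewrite /SubnumM /b_subst_num; den. Qed.

Lemma den_der c t1 t2 t3 t4 (x a b n : M) : tden c t1 x -> tden c t2 a ->
  tden c t3 b -> tden c t4 n -> fden c (b_derivable t1 t2 t3 t4) (DerM x a b n).
Proof.
move=> h1 h2 h3 h4; apply: den_lfp; last exact: pden_ret.
intros ? ? ? ? ? ? ? ?; lift_den; rewrite /DerPhi; apply fden_or; first by den.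
apply fden_or; first exact: den_logax.
by den.
Qed.

Lemma den_axPA c t (x : M) : tden c t x -> fden c (b_axPA t) (AxPAM x).
Proof.
move=> h; apply fden_or; last by den.
elim: basic_axioms => [|a l IH] /=; first exact: fden_bot.
by apply: fden_or IH; apply: fden_is h _; apply: pden_ret; exact: tden_num.
Qed.

Lemma den_isrfn c p q (tau y : M) : pden c p tau -> pden c q y ->
  fden c (b_is_rfn p q) (IsRfnM tau y).
Proof.
move=> hp hq; rewrite /IsRfnM /b_is_rfn.
apply: fden_ex => a c1 ta l1 ha; apply: fden_ex => n c2 tn l2 hn; lift_den.
apply fden_and; first by den.
apply fden_and; first by den.
apply: (fden_bind hq) => c3 t l3 ht; lift_den.
apply: fden_is ht _; den.
Qed.

End SyntaxDen4.

(** * Codes of formulas with numerals, and provability *)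

Section Codes.
Variable M : PAmodel.
Implicit Types (x y z u v w : M).

Lemma tag_inj m n x y : @tagM M m x = tagM n y -> m = n /\ x = y.
Proof. by case/pair_inj=> /natM_inj. Qed.

Lemma num_mono : monotone (@NumPhi M).
Proof.
move=> Z Z' h x [->|[u [v [-> H]]]]; first by left.
by right; exists u, v; split=> //; exact: h.
Qed.

Lemma num0 : NumM 0 (cZeroM M).
Proof. by apply: (lfp_intro0 num_mono); left. Qed.

Lemma numS x y : NumM x y -> NumM (sS x) (cSuccM y).
Proof.
by move=> h; apply: (lfp_intro1 num_mono h); right; exists x, y.
Qed.

Lemma num_uniq x y z : NumM x y -> NumM x z -> y = z.
Proof.
start_ctx M; move: x y z.
m_ind (fun x => forall y z, NumM x y -> NumM x z -> y = z).
  have aux y : NumM 0 y -> y = cZeroM M.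
    by case/(lfp_unfold num_mono) => [/pair_inj[]|[u [v [/pair_inj[/esym/succ_neq0]]]]].
  by move=> y z /aux -> /aux ->.
have aux x y : NumM (sS x) y -> exists2 v, y = cSuccM v & NumM x v.
  case/(lfp_unfold num_mono) => [/pair_inj[/succ_neq0//]|].
  by move=> [u [v [/pair_inj[/succ_inj -> ->] h]]]; exists v.
by move=> x IH y z /aux [v -> hv] /aux [w -> hw]; rewrite (IH _ _ hv hw).
Qed.

Lemma num_ex x : exists y, NumM x y.
Proof.
start_ctx M; move: x; m_ind (fun x => exists y, NumM x y).
  by exists (cZeroM M); exact: num0.
by move=> x [y h]; exists (cSuccM y); exact: numS.
Qed.

Definition numc x : M := epsilon (inhabits (s_zero M)) (NumM x).

Lemma numcP x : NumM x (numc x).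
Proof. exact: (epsilon_spec (inhabits (s_zero M)) (NumM x) (num_ex x)). Qed.

Lemma numcE x y : NumM x y <-> y = numc x.
Proof. by split=> [/num_uniq /(_ (numcP x))|->]; last exact: numcP. Qed.

Lemma numc0 : numc 0 = cZeroM M.
Proof. by symmetry; apply/numcE; exact: num0. Qed.

Lemma numcS x : numc (sS x) = cSuccM (numc x).
Proof. by symmetry; apply/numcE/numS; exact: numcP. Qed.

(** The arithmetized counterpart of an assignment: numerals, possibly nonstandard,
    take the place of all variables that are not among the [k] innermost bound ones. *)
Fixpoint tcl (k : nat) r (t : term) : M :=
  match t with
  | Var i => if (i < k)%N then cVarM (natM M i) else numc (r (i - k)%N)
  | Zero => cZeroM M
  | Succ t => cSuccM (tcl k r t)
  | Add t u => cAddM (tcl k r t) (tcl k r u)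
  | Mul t u => cMulM (tcl k r t) (tcl k r u)
  end.

Fixpoint fcl (k : nat) r (a : form) : M :=
  match a with
  | Eq t u => cEqM (tcl k r t) (tcl k r u)
  | Le t u => cLeM (tcl k r t) (tcl k r u)
  | Bot => cBotM M
  | Imp a b => cImpM (fcl k r a) (fcl k r b)
  | All a => cAllM (fcl k.+1 r a)
  end.

Lemma tcl_std k r t : tscoped k t -> tcl k r t = ctermM M t.
Proof.
rewrite /ctermM; elim: t => [i||t IH|t IHt u IHu|t IHt u IHu] /=;
  rewrite codeE !natM_cpair //.
- by move=> ->.
- by move/IH=> ->.
- by case/andP=> /IHt -> /IHu ->.
- by case/andP=> /IHt -> /IHu ->.
Qed.

Lemma fcl_std k r a : fscoped k a -> fcl k r a = cformM M a.
Proof.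
rewrite /cformM; elim: a k => [t u|t u||a IHa b IHb|a IHa] k /=;
  rewrite codeE !natM_cpair //.
- by case/andP=> ht hu; rewrite !tcl_std.
- by case/andP=> ht hu; rewrite !tcl_std.
- by case/andP=> /IHa -> /IHb ->.
- by move/IHa=> ->.
Qed.

Lemma tcl_ext K k r r' t : tscoped (k + K) t ->
  (forall i, (i < K)%N -> r i = r' i) -> tcl k r t = tcl k r' t.
Proof.
move=> + E; elim: t => [i h||t IH|t IHt u IHu|t IHt u IHu] //=.
- by case: ltnP => // hk; rewrite E //; move: h => /=; lia.
- by move/IH=> ->.
- by case/andP=> /IHt -> /IHu ->.
- by case/andP=> /IHt -> /IHu ->.
Qed.

Lemma fcl_ext K k r r' a : fscoped (k + K) a ->
  (forall i, (i < K)%N -> r i = r' i) -> fcl k r a = fcl k r' a.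
Proof.
move=> + E; elim: a k => [t u|t u||a IHa b IHb|a IHa] k //=.
- by case/andP=> ht hu; rewrite !(tcl_ext (r := r) (r' := r') _ E).
- by case/andP=> ht hu; rewrite !(tcl_ext (r := r) (r' := r') _ E).
- by case/andP=> /IHa -> /IHb ->.
- by rewrite -addSn => /IHa ->.
Qed.

Lemma tcl_subst k r s k' r' t :
  (forall i, tcl k r (s i) = tcl k' r' (Var i)) ->
  tcl k r (tsubst s t) = tcl k' r' t.
Proof. by move=> E; elim: t => [i||t IH|t IHt u IHu|t IHt u IHu] //=; rewrite ?IH ?IHt ?IHu // E. Qed.

Lemma fcl_rename k r (s : nat -> nat) k' r' a :
  (forall i, tcl k r (Var (s i)) = tcl k' r' (Var i)) ->
  (forall i, (s i < k)%N -> s i = i) ->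
  (forall i, (s i < k)%N = (i < k')%N) ->
  fcl k r (fsubst (fun i => Var (s i)) a) = fcl k' r' a.
Proof.
elim: a k k' s => [t u|t u||a IHa b IHb|a IHa] k k' s E E1 E2 /=.
- by rewrite !(tcl_subst (k' := k') (r' := r') _ E).
- by rewrite !(tcl_subst (k' := k') (r' := r') _ E).
- by [].
- by rewrite (IHa k k') // (IHb k k').
- congr cAllM; pose s' i := if i is j.+1 then (s j).+1 else 0%N.
  rewrite (@fsubst_ext _ (fun i => Var (s' i))); last by case.
  apply: IHa => -[|i] //=.
  + have := E i; rewrite /= !ltnS !subSS (E2 i).
    by case: ltnP => // h _; rewrite E1 // E2.
  + by rewrite ltnS => /E1 ->.
  + by rewrite !ltnS.
Qed.

(** The substitutions [inst], [shift] and [inst_succ], lifted under binders, have this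
    form; the parameters [r], [k] and [t] are those of [b_tsubst]. *)
Definition subst_spec (r k : nat) (t : term) (k1 : nat) (r1 : nat -> M)
    (s : nat -> term) (k2 : nat) (r2 : nat -> M) : Prop :=
  forall i,
    if (i < k1)%N then
      if (i < k)%N then s i = Var i /\ (i < k2)%N
      else if i == k then s i = t
      else s i = Var (i.-1 + r) /\ (i.-1 + r < k2)%N
    else exists2 m, s i = Var m & (k2 <= m)%N /\ r2 (m - k2)%N = r1 (i - k1)%N.

Lemma subst_spec_up r k t k1 r1 s k2 r2 : subst_spec r k t k1 r1 s k2 r2 ->
  subst_spec r k.+1 (tsubst shift t) k1.+1 r1 (up s) k2.+1 r2.
Proof.
move=> h [|i]; first by [].
have := h i; rewrite /= !ltnS eqSS subSS.
case: ltnP => h1; last by move=> [m -> [h2 h3]]; exists m.+1; rewrite ?subSS.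
case: ltnP => h2; first by move=> [-> h3].
case: eqP => h3; first by move=> ->.
by move=> [-> h4] /=; rewrite /shift; case: i h1 h2 h3 h4 {h} => [|i] /=; [lia|].
Qed.

Lemma subst_spec_inst k r t :
  subst_spec 0 0 t k.+1 r (inst t) k r.
Proof.
move=> [|i] //; rewrite ltnS /= addn0; case: ltnP => h //.
by exists i => //; rewrite subSS.
Qed.

Lemma subst_spec_shift k r : subst_spec 2 0 (Var 1) k r shift k.+1 r.
Proof.
move=> i; case: ltnP => h /=; last by exists i.+1; rewrite ?subSS.
by case: i h => [|i] //= h; rewrite /shift addn2.
Qed.

Lemma subst_spec_succ k r :
  subst_spec 1 0 (Succ (Var 0)) k.+1 r inst_succ k.+1 r.
Proof.
move=> [|i] //; rewrite ltnS /= addn1 ltnS; case: ltnP => h //.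
by exists i.+1.
Qed.

Lemma tsubst_mono r : monotone (@TsubstPhi M r).
Proof.
move=> Z Z' h x [H|[H|[H|[H|[[k [t [u [v [E H]]]]]|
  [k [t [u [u' [v [v' [E [H1 H2]]]]]]]]]]]]]; [by left|by right; left|
  by right; right; left|by do 3?right; left| |].
- by do 4?right; left; exists k, t, u, v; split=> //; exact: h.
- by do 5?right; exists k, t, u, u', v, v'; split=> //; split; exact: h.
Qed.

Lemma tsubst_num r k t x : TsubstM r k t (numc x) (numc x).
Proof.
start_ctx M; param k; param t; move: x.
suff: forall x, exists y, NumM x y /\ TsubstM r k t y y.
  by move=> h x; have [y [/numcE ->]] := h x.
m_ind (fun x => exists y, NumM x y /\ TsubstM r k t y y).
  exists (cZeroM M); split; first exact: num0.
  by apply: (lfp_intro0 (@tsubst_mono r)); do 3?right; left; exists k, t.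
move=> x [y [hy h]]; exists (cSuccM y); split; first exact: numS.
apply: (lfp_intro1 (@tsubst_mono r) h).
by do 4?right; left; exists k, t, y, y.
Qed.

Lemma natM_lt m n : (m < n)%N -> natM M m < natM M n.
Proof. by move=> h; exact: (natM_le M h). Qed.

(** By induction on the standard term [u]; numerals are fixed by substitution.  If the
    variable [k] does not occur, the term replacing it is arbitrary. *)
Lemma tsubst_code r k t k1 r1 s k2 r2 k3 r3 (u : term) :
  subst_spec r k t k1 r1 s k2 r2 ->
  ((k < k1)%N -> k3 = k2 /\ r3 = r2) ->
  TsubstM r (natM M k) (tcl k3 r3 t) (tcl k1 r1 u) (tcl k2 r2 (tsubst s u)).
Proof.
move=> h e; elim: u => [i||u IH|u IHu v IHv|u IHu v IHv] /=.
- have := h i; case: ltnP => h1; last first.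
    move=> [m -> [h2 E]] /=; rewrite ltnNge h2 /= E; exact: tsubst_num.
  case: ltnP => h2.
    move=> [-> h3] /=; rewrite h3; apply: (lfp_intro0 (@tsubst_mono r)).
    left; exists (natM M k), (tcl k3 r3 t), (natM M i); split=> //.
    exact: natM_lt.
  case: eqP => h3.
    move=> ->; rewrite h3 in h1 *; have [-> ->] := e h1.
    apply: (lfp_intro0 (@tsubst_mono r)).
    by right; left; exists (natM M k), (tcl k2 r2 t).
  move=> [-> h4] /=; rewrite h4; apply: (lfp_intro0 (@tsubst_mono r)).
  right; right; left; exists (natM M k), (tcl k3 r3 t), (natM M (i.-1 - k)).
  rewrite -natM_add -[sS _]/(natM M (k + (i.-1 - k)).+1) -natM_add.
  have -> : (k + (i.-1 - k) = i.-1)%N by lia.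
  by have -> : (i.-1).+1 = i by lia.
- apply: (lfp_intro0 (@tsubst_mono r)).
  by do 3?right; left; exists (natM M k), (tcl k3 r3 t).
- apply: (lfp_intro1 (@tsubst_mono r) IH); do 4?right; left.
  by exists (natM M k), (tcl k3 r3 t), (tcl k1 r1 u), (tcl k2 r2 (tsubst s u)).
- apply: (lfp_intro2 (@tsubst_mono r) IHu IHv); do 5?right.
  exists (natM M k), (tcl k3 r3 t), (tcl k1 r1 u), (tcl k1 r1 v),
    (tcl k2 r2 (tsubst s u)), (tcl k2 r2 (tsubst s v)).
  by split; [left|split; [left|right]].
- apply: (lfp_intro2 (@tsubst_mono r) IHu IHv); do 5?right.
  exists (natM M k), (tcl k3 r3 t), (tcl k1 r1 u), (tcl k1 r1 v),
    (tcl k2 r2 (tsubst s u)), (tcl k2 r2 (tsubst s v)).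
  by split; [right|split; [left|right]].
Qed.

Lemma tcl_Var1 k r : (1 < k)%N -> tcl k r (Var 1) = ctermM M (Var 1).
Proof. by move=> h; rewrite tcl_std. Qed.

Lemma tshift_code k r (u : term) :
  TshiftM (tcl k r u) (tcl k.+1 r (tsubst shift u)).
Proof.
rewrite /TshiftM -(@tcl_Var1 (maxn k.+1 2) r); last by lia.
apply: (tsubst_code _ (subst_spec_shift k r)) => h; split=> //; lia.
Qed.

Lemma fsubst_mono r : monotone (@FsubstPhi M r).
Proof.
move=> Z Z' h x [H|[H|[[k [t [a [a' [b [b' [E [H1 H2]]]]]]]]|
  [k [t [a [b [t' [E [H1 H2]]]]]]]]]]; [by left|by right; left| |].
- by do 2?right; left; exists k, t, a, a', b, b'; split=> //; split; exact: h.
- by do 3?right; exists k, t, a, b, t'; split=> //; split=> //; exact: h.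
Qed.

Lemma fsubst_code r k t k1 r1 s k2 r2 k3 r3 a :
  subst_spec r k t k1 r1 s k2 r2 ->
  ((k < k1)%N -> k3 = k2 /\ r3 = r2) ->
  FsubstM r (natM M k) (tcl k3 r3 t) (fcl k1 r1 a) (fcl k2 r2 (fsubst s a)).
Proof.
elim: a k t k1 s k2 k3 => [t1 t2|t1 t2||a IHa b IHb|a IHa] k t k1 s k2 k3 h e /=.
- apply: (lfp_intro0 (@fsubst_mono r)); left.
  exists (natM M k), (tcl k3 r3 t), (tcl k1 r1 t1), (tcl k1 r1 t2),
    (tcl k2 r2 (tsubst s t1)), (tcl k2 r2 (tsubst s t2)).
  by split; [left|split; exact: tsubst_code].
- apply: (lfp_intro0 (@fsubst_mono r)); left.
  exists (natM M k), (tcl k3 r3 t), (tcl k1 r1 t1), (tcl k1 r1 t2),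
    (tcl k2 r2 (tsubst s t1)), (tcl k2 r2 (tsubst s t2)).
  by split; [right|split; exact: tsubst_code].
- apply: (lfp_intro0 (@fsubst_mono r)); right; left.
  by exists (natM M k), (tcl k3 r3 t).
- apply: (lfp_intro2 (@fsubst_mono r) (IHa _ _ _ _ _ _ h e) (IHb _ _ _ _ _ _ h e)).
  right; right; left.
  exists (natM M k), (tcl k3 r3 t), (fcl k1 r1 a), (fcl k1 r1 b),
    (fcl k2 r2 (fsubst s a)), (fcl k2 r2 (fsubst s b)).
  by split=> //; split; [left|right].
- have e' : (k.+1 < k1.+1)%N -> k3.+1 = k2.+1 /\ r3 = r2.
    by rewrite ltnS => /e [-> ->].
  apply: (lfp_intro1 (@fsubst_mono r) (IHa _ _ _ _ _ _ (subst_spec_up h) e')).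
  do 3?right; exists (natM M k), (tcl k3 r3 t), (fcl k1.+1 r1 a),
    (fcl k2.+1 r2 (fsubst (up s) a)), (tcl k3.+1 r3 (tsubst shift t)).
  by split=> //; split=> //; exact: tshift_code.
Qed.

Lemma finst_code k r (t : term) a :
  FinstM (tcl k r t) (fcl k.+1 r a) (fcl k r (fsubst (inst t) a)).
Proof. exact: (fsubst_code _ (subst_spec_inst k r t)). Qed.

Lemma fshift_code k r a : FshiftM (fcl k r a) (fcl k.+1 r (fsubst shift a)).
Proof.
rewrite /FshiftM -(@tcl_Var1 (maxn k.+1 2) r); last by lia.
apply: (fsubst_code _ (subst_spec_shift k r)) => h; split=> //; lia.
Qed.

Lemma fsucc_code k r a : FsubstM 1 (natM M 0) (ctermM M (Succ (Var 0)))
  (fcl k.+1 r a) (fcl k.+1 r (fsubst inst_succ a)).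
Proof.
rewrite -(@tcl_std k.+1 r (Succ (Var 0))) //.
exact: (fsubst_code _ (subst_spec_succ k r)).
Qed.

Lemma tscoped_mono : monotone (@TscopedPhi M).
Proof.
move=> Z Z' h x [H|[H|[[k [t [E H]]]|[k [t [u [E [H1 H2]]]]]]]];
  [by left|by right; left| |].
- by do 2?right; left; exists k, t; split=> //; exact: h.
- by do 3?right; exists k, t, u; split=> //; split; exact: h.
Qed.

Lemma tscoped_num k x : TscopedM k (numc x).
Proof.
start_ctx M; param k; move: x.
suff: forall x, exists y, NumM x y /\ TscopedM k y.
  by move=> h x; have [y [/numcE ->]] := h x.
m_ind (fun x => exists y, NumM x y /\ TscopedM k y).
  exists (cZeroM M); split; first exact: num0.
  by apply: (lfp_intro0 tscoped_mono); right; left; exists k.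
move=> x [y [hy h]]; exists (cSuccM y); split; first exact: numS.
apply: (lfp_intro1 tscoped_mono h).
by do 2?right; left; exists k, y.
Qed.

Lemma tscoped_code k r (u : term) : TscopedM (natM M k) (tcl k r u).
Proof.
elim: u => [i||u IH|u IHu v IHv|u IHu v IHv] /=.
- case: ltnP => h; last exact: tscoped_num.
  apply: (lfp_intro0 tscoped_mono); left; exists (natM M k), (natM M i).
  by split=> //; exact: natM_lt.
- by apply: (lfp_intro0 tscoped_mono); right; left; exists (natM M k).
- apply: (lfp_intro1 tscoped_mono IH); do 2?right; left.
  by exists (natM M k), (tcl k r u).
- apply: (lfp_intro2 tscoped_mono IHu IHv); do 3?right.
  exists (natM M k), (tcl k r u), (tcl k r v).
  by split; [left|split; [left|right]].
- apply: (lfp_intro2 tscoped_mono IHu IHv); do 3?right.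
  exists (natM M k), (tcl k r u), (tcl k r v).
  by split; [right|split; [left|right]].
Qed.

Lemma fscoped_mono : monotone (@FscopedPhi M).
Proof.
move=> Z Z' h x [H|[H|[[k [a [b [E [H1 H2]]]]]|[k [a [E H]]]]]];
  [by left|by right; left| |].
- by do 2?right; left; exists k, a, b; split=> //; split; exact: h.
- by do 3?right; exists k, a; split=> //; exact: h.
Qed.

Lemma fscoped_code k r a : FscopedM (natM M k) (fcl k r a).
Proof.
elim: a k => [t u|t u||a IHa b IHb|a IHa] k /=.
- apply: (lfp_intro0 fscoped_mono); left; exists (natM M k), (tcl k r t), (tcl k r u).
  by split; [left|split; exact: tscoped_code].
- apply: (lfp_intro0 fscoped_mono); left; exists (natM M k), (tcl k r t), (tcl k r u).
  by split; [right|split; exact: tscoped_code].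
- by apply: (lfp_intro0 fscoped_mono); right; left; exists (natM M k).
- apply: (lfp_intro2 fscoped_mono (IHa k) (IHb k)); do 2?right; left.
  by exists (natM M k), (fcl k r a), (fcl k r b); split=> //; split; [left|right].
- apply: (lfp_intro1 fscoped_mono (IHa k.+1)); do 3?right.
  by exists (natM M k), (fcl k.+1 r a).
Qed.

Lemma isform_code k r a : IsformM (fcl k r a).
Proof. by exists (natM M k); exact: fscoped_code. Qed.

Lemma isterm_code k r (t : term) : IstermM (tcl k r t).
Proof. by exists (natM M k); exact: tscoped_code. Qed.

Lemma logax_code k r a : logical_axiom a -> LogaxM (fcl k r a).
Proof.
move=> h; split; first exact: isform_code.
case: h => {a} /=.
- by move=> a b; left; exists (fcl k r a), (fcl k r b).
- by move=> a b c; right; left; exists (fcl k r a), (fcl k r b), (fcl k r c).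
- by move=> a; do 2?right; left; exists (fcl k r a).
- move=> a t; do 3?right; left.
  exists (fcl k.+1 r a), (tcl k r t), (fcl k r (fsubst (inst t) a)).
  by split; [exact: isterm_code|split; [exact: finst_code|]].
- by move=> a b; do 4?right; left; exists (fcl k.+1 r a), (fcl k.+1 r b).
- move=> a; do 5?right; left; exists (fcl k r a), (fcl k.+1 r (fsubst shift a)).
  by split=> //; exact: fshift_code.
- by move=> t; do 6?right; left; exists (tcl k r t).
- move=> a t u; do 7?right; exists (fcl k.+1 r a), (tcl k r t), (tcl k r u),
    (fcl k r (fsubst (inst t) a)), (fcl k r (fsubst (inst u) a)).
  by split; [exact: isform_code|split; [exact: finst_code|split; [exact: finst_code|]]].
Qed.

Lemma axPA_code k r a : PA a -> AxPAM (fcl k r a).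
Proof.
case=> {a} [i hi|a].
- left.
  have E : fcl k r (nth Bot basic_axioms i) = cformM M (nth Bot basic_axioms i).
    apply: fcl_std; apply: (@fscoped_leq 0) => //.
    by do 7?[case: i hi => //= i hi].
  rewrite E; elim: basic_axioms i hi {E} => [|b l IH] [|i] //= hi; first by left.
  by right; exact: IH.
- right; exists (fcl k.+1 r a), (fcl k r (fsubst (inst Zero) a)),
    (fcl k.+1 r (fsubst inst_succ a)).
  split; first exact: isform_code; split; first exact: (finst_code k r Zero).
  by split; first exact: fsucc_code.
Qed.

Definition PrvM (tau : M -> Prop) x : Prop :=
  exists a b n, DerM x a b n /\
    forall i, i < n -> exists y, betaM a b i y /\ tau y.

Lemma der_mono a b n : monotone (@DerPhi M a b n).
Proof.
move=> Z Z' h x [H|[H|[[z [H1 H2]]|[z [E H]]]]]; [by left|by right; left| |].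
- by do 2?right; left; exists z; split; exact: h.
- by do 3?right; exists z; split=> //; exact: h.
Qed.

Lemma lfp_weaken (Phi Psi : (M -> Prop) -> M -> Prop) x :
  (forall Z y, Phi Z y -> Psi Z y) -> lfpM Phi x -> lfpM Psi x.
Proof.
move=> h [a [b [n [hx H]]]]; exists a, b, n; split=> // i /H [y [hy hP]].
by exists y; split=> //; exact: h.
Qed.

Section Prv.
Variable tau : M -> Prop.

Lemma prv_log x : LogaxM x -> PrvM tau x.
Proof.
move=> h; exists 0, 0, 0; split; last by move=> i /ltx0.
by apply: (lfp_intro0 (@der_mono 0 0 0)); right; left.
Qed.

Lemma prv_ax x : tau x -> PrvM tau x.
Proof.
move=> h; have [a [b [_ hb]]] := beta_append 0 0 0 x.
exists a, b, 1; split.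
  by apply: (lfp_intro0 (@der_mono a b 1)); left; exists 0; split=> //; exact: le_refl.
move=> i /ltSx_le hi; exists x; split=> //.
by rewrite (le_antisym hi (le0x _)).
Qed.

Lemma prv_gen x : PrvM tau x -> PrvM tau (cAllM x).
Proof.
move=> [a [b [n [h H]]]]; exists a, b, n; split=> //.
by apply: (lfp_intro1 (@der_mono a b n) h); do 3?right; exists x.
Qed.

(* The two lists of premises are concatenated. *)
Lemma prv_mp x y : PrvM tau (cImpM x y) -> PrvM tau x -> PrvM tau y.
Proof.
move=> [a [b [n [h H]]]] [a2 [b2 [n2 [h2 H2]]]].
have [a3 [b3 [e1 e2]]] := beta_concat a b n a2 b2 n2.
exists a3, b3, (n + n2); split.
- apply: (lfp_intro2 (@der_mono a3 b3 (n + n2)) (y := cImpM x y) (z := x)).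
  + apply: lfp_weaken h => Z z [[i [hi hz]]|]; last by right.
    left; exists i; split; last exact: e1.
    by apply: lt_le_trans hi _; exact: le_add.
  + apply: lfp_weaken h2 => Z z [[i [hi hz]]|]; last by right.
    left; exists (n + i); split; last exact: e2.
    by rewrite -addxS; apply: le_add2 => //; exact: le_refl.
  + by do 2?right; left; exists x; split; [left|right].
- move=> i hi; have [hin|hin] := le_or_lt n i.
  + have [j Ej] := leP' hin; subst i.
    have hj : j < n2.
      have [hle|//] := le_or_lt n2 j.
      by case: (le_not_lt (le_add2 (le_refl n) hle) hi).
    have [z [hz tz]] := H2 _ hj; exists z; split=> //; exact: e2.
  + by have [z [hz tz]] := H _ hin; exists z; split=> //; exact: e1.
Qed.

Hypothesis tauPA : forall x, AxPAM x -> tau x.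

(** A derivation is repeated inside the model, with numerals of arbitrary elements in
    place of the free variables. *)
Lemma prv_PA a k r : proves PA a -> PrvM tau (fcl k r a).
Proof.
move=> h; elim: h k r => {a} [a ha|a ha|a b _ IHab _ IHa|a _ IHa] k r.
- exact/prv_ax/tauPA/axPA_code.
- exact/prv_log/logax_code.
- exact: prv_mp (IHab k r) (IHa k r).
- exact/prv_gen/IHa.
Qed.

End Prv.

End Codes.

(* Codes are compared by computing [tcl] and [fcl] first. *)
#[global] Strategy 1000 [pairM tagM numc cVarM cZeroM cSuccM cAddM cMulM cEqM
  cLeM cBotM cImpM cAllM cNegM cAndM cExM PrvM AxPAM natM].
#[global] Strategy expand [fcl tcl].

(** * Provable completeness for Sigma_1 formulas, and Loeb's theorem *)

Lemma PA_complete a :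
  (forall (M : PAmodel) (r : nat -> M), msat r a) -> proves PA a.
Proof.
move=> h; apply: completeness PA_subst_closed _ => S mS r.
exact: (h (PAModel mS)).
Qed.

Fixpoint no0 (t : term) : bool :=
  match t with
  | Var i => i != 0%N
  | Zero => true
  | Succ t => no0 t
  | Add t u | Mul t u => no0 t && no0 u
  end.

(** [sig true a]: the quantifiers of [a] that are not bounded are existential
    (in negation normal form); [sig false a] is the same for the negation. *)
Fixpoint sig (b : bool) (a : form) : bool :=
  match a with
  | Imp a c => sig (~~ b) a && sig b c
  | All a =>
    if b then
      match a with
      | Imp (Le (Var 0) t) c | Imp (Le (Succ (Var 0)) t) c => no0 t && sig true c
      | _ => false
      end
    else sig false a
  | _ => true
  end.

Lemma no0_shift t : no0 t -> tsubst shift (tsubst (inst Zero) t) = t.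
Proof.
elim: t => //= [[|i]||t IHt u IHu|t IHt u IHu] //.
- by move=> t IH /IH ->.
- by case/andP=> /IHt -> /IHu ->.
- by case/andP=> /IHt -> /IHu ->.
Qed.

Lemma no0_shifted t : no0 (tsubst shift t).
Proof. by elim: t => //= t -> u IH; rewrite IH. Qed.

Lemma no0_up s t : no0 t -> no0 (tsubst (up s) t).
Proof.
elim: t => //= [[|i] // _|t IHt u IHu|t IHt u IHu].
- exact: no0_shifted.
- by case/andP=> /IHt -> /IHu ->.
- by case/andP=> /IHt -> /IHu ->.
Qed.

Lemma sig_subst a : forall b s, sig b a -> sig b (fsubst s a).
Proof.
have IHA c : (forall b s, sig b c -> sig b (fsubst s c)) ->
    forall t s, no0 t && sig true c ->
    no0 (tsubst (up s) t) && sig true (fsubst (up s) c).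
  by move=> IH t s /andP[h1 /IH ->]; rewrite no0_up.
elim: a => [t u|t u||a IHa c IHc|a IHa] b s //=.
- by case/andP=> /IHa -> /IHc ->.
- case: b => [|/IHa //].
  case: a IHa => // -[] // t u c IH.
  have IHc b s' : sig b c -> sig b (fsubst s' c).
    by move=> h; have := IH b s'; rewrite /= h; apply.
  by case: t IH => [[|i]||[[|i]||?|? ?|? ?]|? ?|? ?] //= _; exact: IHA.
Qed.

Lemma msat_ext1 (S : structure) (r r' : nat -> S) a :
  (forall i, r i = r' i) -> msat r a -> msat r' a.
Proof. by move=> E; rewrite (msat_ext _ E). Qed.

Section SigmaCompleteness.
Variable M : PAmodel.
Implicit Types (x y z u v w : M) (r : nat -> M).

Lemma iter_up p s i : iter p up s i =
  if (i < p)%N then Var i else tsubst (fun j => Var (p + j)) (s (i - p)%N).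
Proof.
elim: p i => [|p IH] i /=; first by rewrite subn0 tsubst_Var.
case: i => [|i] //=; rewrite IH ltnS subSS; case: ltnP => // _.
by rewrite tsubst_comp; apply: tsubst_ext.
Qed.

Lemma tcl_addk p r t : tcl p r (tsubst (fun j => Var (p + j)) t) = tcl 0 r t.
Proof.
elim: t => [i||t IH|t IHt u IHu|t IHt u IHu] //=; rewrite ?IH ?IHt ?IHu //.
by rewrite ltnNge leq_addr /= addKn subn0.
Qed.

Lemma fcl_subst r s r' a : (forall i, tcl 0 r (s i) = numc (r' i)) ->
  fcl 0 r (fsubst s a) = fcl 0 r' a.
Proof.
move=> E; have {}E p i : tcl p r (iter p up s i) = tcl p r' (Var i).
  by rewrite iter_up /=; case: ltnP => [/= -> //|_]; rewrite tcl_addk.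
suff h p : fcl p r (fsubst (iter p up s) a) = fcl p r' a by exact: (h 0%N).
elim: a p => [t u|t u||a IHa b IHb|a IHa] p /=.
- by rewrite !(tcl_subst (k' := p) (r' := r') _ (E p)).
- by rewrite !(tcl_subst (k' := p) (r' := r') _ (E p)).
- by [].
- by rewrite IHa IHb.
- by rewrite -[up _]/(iter p.+1 up s) IHa.
Qed.

Lemma tcl_num k r n : tcl k r (num n) = numc (natM M n).
Proof. by elim: n => [|n IH] /=; rewrite ?numc0 // numcS -IH. Qed.

Definition bprvPA (t : bterm) : bform :=
  bex (fun a => bex (fun b => bex (fun n =>
    band (b_derivable t a b n) (ball (fun i => bimp (ble (bS i) n)
      (bex (fun y : bterm => band (beta a b i y) (b_axPA y)))))))).

Lemma den_prvPA c t x : tden c t x -> fden c (bprvPA t) (PrvM (@AxPAM M) x).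
Proof.
move=> ht; rewrite /PrvM.
apply: fden_ex => a c1 ta l1 ha; apply: fden_ex => b c2 tb l2 hb.
apply: fden_ex => n c3 tn l3 hn; lift_den; apply: fden_and.
  exact: den_der.
apply: fden_all => i c4 ti l4 hi; lift_den; apply fden_imp; first by den.
apply: fden_ex => y c5 ty l5 hy; lift_den; apply fden_and; first by den.
exact: den_axPA.
Qed.

Definition Prvd r a : Prop := PrvM (@AxPAM M) (fcl 0 r a).

Lemma prvd_valid r a :
  (forall (N : PAmodel) (e : nat -> N), msat e a) -> Prvd r a.
Proof. by move=> h; apply: prv_PA => //; exact: PA_complete. Qed.

Lemma prvd_cons1 r a b :
  (forall (N : PAmodel) (e : nat -> N), msat e a -> msat e b) ->
  Prvd r a -> Prvd r b.
Proof. by move=> h; apply: prv_mp; exact: (@prvd_valid r (Imp a b)). Qed.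

Lemma prvd_cons2 r a b c :
  (forall (N : PAmodel) (e : nat -> N), msat e a -> msat e b -> msat e c) ->
  Prvd r a -> Prvd r b -> Prvd r c.
Proof. by move=> h ha; exact: prv_mp (@prvd_cons1 r a (Imp b c) h ha). Qed.

Lemma prvd_cons3 r a b c d :
  (forall (N : PAmodel) (e : nat -> N),
     msat e a -> msat e b -> msat e c -> msat e d) ->
  Prvd r a -> Prvd r b -> Prvd r c -> Prvd r d.
Proof.
by move=> h ha hb; exact: prv_mp (@prvd_cons2 r a b (Imp c d) h ha hb).
Qed.

Lemma prvd_subst r s r' a : (forall i, tcl 0 r (s i) = numc (r' i)) ->
  Prvd r (fsubst s a) <-> Prvd r' a.
Proof. by move=> /fcl_subst E; rewrite /Prvd E. Qed.

Lemma prvd_shift r x a : Prvd (pcons x r) (fsubst shift a) <-> Prvd r a.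
Proof. exact: prvd_subst. Qed.

Let e3 x y z : nat -> M := pcons x (pcons y (pcons z (fun=> 0))).

Lemma prvd_add x y : Prvd (e3 x y (x + y)) (Eq (Add (Var 0) (Var 1)) (Var 2)).
Proof.
rewrite /Prvd /=; start_ctx M; param x; move: y.
suff: forall y, exists a b c, NumM x a /\ NumM y b /\ NumM (x + y) c /\
    exists w, w = cEqM (cAddM a b) c /\ PrvM (@AxPAM M) w.
  by move=> h y; have [a [b [c [/numcE -> [/numcE -> [/numcE -> [w [->]]]]]]]] := h y.
cur_ctx ltac:(fun c => refine (@M_ind _ c _ (fun y => exists a b c, NumM x a /\ NumM y b /\ NumM (x + y) c /\
    exists w, w = cEqM (cAddM a b) c /\ PrvM (@AxPAM M) w) _ _ _)).
- unfold pred1; den_intro.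
  apply fden_ex; den_intro; apply fden_ex; den_intro; apply fden_ex; den_intro.
  apply fden_and; first by den. apply fden_and; first by den.
  apply fden_and; first by den. apply fden_ex; den_intro; apply fden_and; first by den.
  by apply: den_prvPA; eassumption.
- exists (numc x), (numc 0), (numc (x + 0)); rewrite !numcE.
  do !split=> //; exists (cEqM (cAddM (numc x) (numc 0)) (numc (x + 0))); split=> //.
  rewrite addx0 numc0.
  have := @prvd_valid (pcons x (fun=> 0)) (Eq (Add (Var 0) Zero) (Var 0))
    (fun N e => addx0 _).
  by rewrite /Prvd.
- move=> y [a [b [c [/numcE -> [/numcE -> [/numcE -> [w [-> h]]]]]]]].
  exists (numc x), (numc (sS y)), (numc (x + sS y)); rewrite !numcE.
  do !split=> //; eexists; split=> //.
  rewrite addxS !numcS.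
  have := @prvd_cons1 (e3 x y (x + y)) (Eq (Add (Var 0) (Var 1)) (Var 2))
    (Eq (Add (Var 0) (Succ (Var 1))) (Succ (Var 2))).
  rewrite /Prvd; apply=> // N e /= <-; exact: addxS.
Qed.

Lemma prvd_mul x y : Prvd (e3 x y (x * y)) (Eq (Mul (Var 0) (Var 1)) (Var 2)).
Proof.
rewrite /Prvd /=; start_ctx M; param x; move: y.
suff: forall y, exists a b c, NumM x a /\ NumM y b /\ NumM (x * y) c /\
    exists w, w = cEqM (cMulM a b) c /\ PrvM (@AxPAM M) w.
  by move=> h y; have [a [b [c [/numcE -> [/numcE -> [/numcE -> [w [->]]]]]]]] := h y.
cur_ctx ltac:(fun c => refine (@M_ind _ c _ (fun y => exists a b c, NumM x a /\ NumM y b /\ NumM (x * y) c /\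
    exists w, w = cEqM (cMulM a b) c /\ PrvM (@AxPAM M) w) _ _ _)).
- unfold pred1; den_intro.
  apply fden_ex; den_intro; apply fden_ex; den_intro; apply fden_ex; den_intro.
  apply fden_and; first by den. apply fden_and; first by den.
  apply fden_and; first by den. apply fden_ex; den_intro; apply fden_and; first by den.
  by apply: den_prvPA; eassumption.
- exists (numc x), (numc 0), (numc (x * 0)); rewrite !numcE.
  do !split=> //; eexists; split=> //.
  rewrite mulx0 numc0.
  have := @prvd_valid (pcons x (fun=> 0)) (Eq (Mul (Var 0) Zero) Zero)
    (fun N e => mulx0 _).
  by rewrite /Prvd.
- move=> y [a [b [c [/numcE -> [/numcE -> [/numcE -> [w [-> h]]]]]]]].
  exists (numc x), (numc (sS y)), (numc (x * sS y)); rewrite !numcE.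
  do !split=> //; eexists; split=> //.
  rewrite mulxS numcS.
  have h2 := prvd_add (x * y) x.
  pose e : nat -> M := pcons x (pcons y (pcons (x * y) (pcons (x * y + x) (fun=> 0)))).
  have := @prvd_cons2 e (Eq (Mul (Var 0) (Var 1)) (Var 2))
    (Eq (Add (Var 2) (Var 0)) (Var 3))
    (Eq (Mul (Var 0) (Succ (Var 1))) (Var 3)) _ h h2.
  rewrite /Prvd; apply=> N f /= <- <-; exact: mulxS.
Qed.

Lemma tcl_ren (m : nat -> nat) r r' t : (forall i, r (m i) = r' i) ->
  tcl 0 r (tsubst (fun i => Var (m i)) t) = tcl 0 r' t.
Proof. by move=> E; apply: tcl_subst => i /=; rewrite !subn0 E. Qed.

Lemma tcl_shift k r t : tcl 0 (pcons k r) (tsubst shift t) = tcl 0 r t.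
Proof. exact: tcl_ren. Qed.

Lemma tcl_shift3 x y z r t :
  tcl 0 (pcons x (pcons y (pcons z r))) (tsubst (fun i => Var i.+3) t) = tcl 0 r t.
Proof. exact: (@tcl_ren (fun i => i.+3)). Qed.

Lemma prvd_term t r :
  Prvd (pcons (meval r t) r) (Eq (tsubst shift t) (Var 0)).
Proof.
rewrite /Prvd /= tcl_shift.
elim: t => [i||t IH|t IHt u IHu|t IHt u IHu] /=.
- have := @prvd_valid r (Eq (Var i) (Var i)) (fun _ _ => erefl).
  by rewrite /Prvd /= subn0.
- by rewrite numc0; exact: (@prvd_valid r (Eq Zero Zero)).
- have := @prvd_cons1 (pcons (meval r t) r) (Eq (tsubst shift t) (Var 0))
    (Eq (Succ (tsubst shift t)) (Succ (Var 0))).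
  by rewrite /Prvd /= tcl_shift numcS; apply=> // N e ->.
- set x := meval r t in IHt *; set y := meval r u in IHu *.
  pose s3 (t : term) := tsubst (fun i => Var i.+3) t.
  have := @prvd_cons3 (pcons x (pcons y (pcons (x + y) r)))
    (Eq (s3 t) (Var 0)) (Eq (s3 u) (Var 1))
    (Eq (Add (Var 0) (Var 1)) (Var 2)) (Eq (Add (s3 t) (s3 u)) (Var 2)).
  rewrite /Prvd /= !tcl_shift3; apply=> //; last exact: prvd_add.
  by move=> N f -> ->.
- set x := meval r t in IHt *; set y := meval r u in IHu *.
  pose s3 (t : term) := tsubst (fun i => Var i.+3) t.
  have := @prvd_cons3 (pcons x (pcons y (pcons (x * y) r)))
    (Eq (s3 t) (Var 0)) (Eq (s3 u) (Var 1))
    (Eq (Mul (Var 0) (Var 1)) (Var 2)) (Eq (Mul (s3 t) (s3 u)) (Var 2)).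
  rewrite /Prvd /= !tcl_shift3; apply=> //; last exact: prvd_mul.
  by move=> N f -> ->.
Qed.

Let e2 x y : nat -> M := pcons x (pcons y (fun=> 0)).

Lemma prvd_le x y : x <= y -> Prvd (e2 x y) (Le (Var 0) (Var 1)).
Proof.
case/leP'=> d ->; have := prvd_add x d.
have := @prvd_cons1 (pcons x (pcons d (pcons (x + d) (fun=> 0))))
  (Eq (Add (Var 0) (Var 1)) (Var 2)) (Le (Var 0) (Var 2)).
by rewrite /Prvd /=; apply=> N e /= <-; exact: le_add.
Qed.

Lemma prvd_nle x y : ~ x <= y -> Prvd (e2 x y) (Neg (Le (Var 0) (Var 1))).
Proof.
have [//|h _] := le_or_lt x y; have := prvd_le h.
have := @prvd_cons1 (e2 x y) (Le (Succ (Var 1)) (Var 0)) (Neg (Le (Var 0) (Var 1))).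
rewrite /Prvd /= numcS; apply=> N e /= h1 h2; exact: le_not_lt h2 h1.
Qed.

Lemma prvd_neq x y : x <> y -> Prvd (e2 x y) (Neg (Eq (Var 0) (Var 1))).
Proof.
have [h|[//|h]] := lt_trichotomy x y => _; have := prvd_le h.
- have := @prvd_cons1 (e2 x y) (Le (Succ (Var 0)) (Var 1)) (Neg (Eq (Var 0) (Var 1))).
  by rewrite /Prvd /= numcS; apply=> N e /= h1 h2; exact: lt_neq h1 h2.
- have := @prvd_cons1 (e2 x y) (Le (Succ (Var 1)) (Var 0)) (Neg (Eq (Var 0) (Var 1))).
  by rewrite /Prvd /= numcS; apply=> N e /= h1 h2; exact: lt_neq h1 (esym h2).
Qed.

(** It suffices to consider numerals, as terms are provably equal to the numerals of
    their values. *)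
Lemma prvd_atom (R : term -> term -> form) (t u : term) r :
  (forall s (v w : term), fsubst s (R v w) = R (tsubst s v) (tsubst s w)) ->
  fscoped 2 (R (Var 0) (Var 1)) ->
  (forall (N : PAmodel) (f : nat -> N) (v w v' w' : term), meval f v = meval f v' ->
     meval f w = meval f w' -> msat f (R v w) -> msat f (R v' w')) ->
  Prvd (e2 (meval r t) (meval r u)) (R (Var 0) (Var 1)) -> Prvd r (R t u).
Proof.
move=> nR sR cR h; set x := meval r t in h; set y := meval r u in h.
pose s2 := fun i => Var i.+2; pose e := pcons x (pcons y r).
rewrite -(@prvd_subst e s2 r) // nR.
have E t' : tcl 0 e (tsubst s2 t') = tcl 0 r t' by exact: (@tcl_ren (fun i => i.+2)).
have ht := prvd_term t r; have hu := prvd_term u r.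
apply: (@prvd_cons3 e (Eq (tsubst s2 t) (Var 0)) (Eq (tsubst s2 u) (Var 1))
  (R (Var 0) (Var 1))).
- by move=> N f /= h1 h2; exact: cR.
- by move: ht; rewrite /Prvd /= tcl_shift E.
- by move: hu; rewrite /Prvd /= tcl_shift E.
- by move: h; rewrite /Prvd (@fcl_ext _ 2 0 (e2 x y) e) // => -[|[|i]].
Qed.

(** Provability of [a] with the numeral of an element is a definable property of the
    element, to which induction applies. *)
Lemma fcl_den (a : form) k r c : exists c' G, c ⊑ c' /\
  forall c2 t x, c' ⊑ c2 -> tden c2 t (numc x) ->
    pden c2 (G t) (fcl k (pcons x r) a).
Proof.
have T (t : term) k' c1 : exists c' G, c1 ⊑ c' /\
  forall c2 t' x, c' ⊑ c2 -> tden c2 t' (numc x) ->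
    pden c2 (G t') (tcl k' (pcons x r) t).
  elim: t c1 => [i||t IH|t IHt u IHu|t IHt u IHu] c1 /=.
  - case: ltnP => hi.
      exists c1, (fun _ => cVar (bnum i)); split; first exact: deeper_refl.
      by move=> c2 t' x l ht; den.
    case: (i - k')%N => [|j] /=.
      exists c1, (fun t => bret t); split; first exact: deeper_refl.
      by move=> c2 t' x l ht; den.
    have [c' [t [l ht]]] := tden_param c1 (numc (r j)).
    exists c', (fun _ => bret t); split=> // c2 t' x l2 _; lift_den.
    exact: pden_ret.
  - exists c1, (fun _ => cZero); split; first exact: deeper_refl.
    by move=> c2 t' x l ht; den.
  - have [c' [G [l hG]]] := IH c1; exists c', (fun t => cSucc (G t)); split=> //.
    by move=> c2 t' x l2 ht; have := hG _ _ _ l2 ht => h; den.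
  - have [c' [G [l hG]]] := IHt c1; have [c'' [G' [l' hG']]] := IHu c'.
    exists c'', (fun t => cAdd (G t) (G' t)); split; first exact: deeper_trans l'.
    move=> c2 t' x l2 ht; have h' := hG' _ _ _ l2 ht.
    by have h := hG _ _ _ (deeper_trans l' l2) ht; den.
  - have [c' [G [l hG]]] := IHt c1; have [c'' [G' [l' hG']]] := IHu c'.
    exists c'', (fun t => cMul (G t) (G' t)); split; first exact: deeper_trans l'.
    move=> c2 t' x l2 ht; have h' := hG' _ _ _ l2 ht.
    by have h := hG _ _ _ (deeper_trans l' l2) ht; den.
elim: a k c => [t u|t u||a IHa b IHb|a IHa] k c /=.
- have [c' [G [l hG]]] := T t k c; have [c'' [G' [l' hG']]] := T u k c'.
  exists c'', (fun t => cEq (G t) (G' t)); split; first exact: deeper_trans l'.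
  move=> c2 t' x l2 ht; have h' := hG' _ _ _ l2 ht.
  by have h := hG _ _ _ (deeper_trans l' l2) ht; den.
- have [c' [G [l hG]]] := T t k c; have [c'' [G' [l' hG']]] := T u k c'.
  exists c'', (fun t => cLe (G t) (G' t)); split; first exact: deeper_trans l'.
  move=> c2 t' x l2 ht; have h' := hG' _ _ _ l2 ht.
  by have h := hG _ _ _ (deeper_trans l' l2) ht; den.
- exists c, (fun _ => cBot); split; first exact: deeper_refl.
  by move=> c2 t' x l ht; den.
- have [c' [G [l hG]]] := IHa k c; have [c'' [G' [l' hG']]] := IHb k c'.
  exists c'', (fun t => cImp (G t) (G' t)); split; first exact: deeper_trans l'.
  move=> c2 t' x l2 ht; have h' := hG' _ _ _ l2 ht.
  by have h := hG _ _ _ (deeper_trans l' l2) ht; den.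
- have [c' [G [l hG]]] := IHa k.+1 c; exists c', (fun t => cAll (G t)); split=> //.
  by move=> c2 t' x l2 ht; have := hG _ _ _ l2 ht => h; den.
Qed.

(** By induction inside the model on the possibly nonstandard bound [v]. *)
Lemma prvd_ball c r v : (forall x, x < v -> Prvd (pcons x r) c) ->
  Prvd (pcons v r) (All (Imp (Le (Succ (Var 0)) (Var 1))
    (fsubst (fun i => if i is j.+1 then Var j.+2 else Var 0) c))).
Proof.
set B := All _ => h.
suff main : forall w, w <= v -> Prvd (pcons w r) B by exact: main (le_refl v).
have BE (N : PAmodel) (f : nat -> N) :
    msat f B <-> forall x : N, x < f 0%N -> msat (pcons x (fun i => f i.+1)) c.
  have E (x : N) : msat (pcons x f) (fsubst
      (fun i => if i is j.+1 then Var j.+2 else Var 0) c) <->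
      msat (pcons x (fun i => f i.+1)) c.
    by rewrite msat_subst; apply: msat_ext; case.
  by split=> h1 x hx; apply/E; exact: h1.
have base : Prvd (pcons 0 r) B.
  rewrite -(@prvd_subst r (inst Zero)).
  - by apply: prvd_valid => N e x /= /ltx0.
  - by move=> [|i] /=; rewrite ?numc0 // subn0.
have step w : w < v -> Prvd (pcons w r) B -> Prvd (pcons (sS w) r) B.
  move=> hw hB.
  rewrite -(@prvd_subst (pcons w r) inst_succ); last by case=> [|i] /=; rewrite ?numcS.
  apply: prvd_cons2 hB (h _ hw) => N e.
  rewrite msat_subst !BE => h1 h2 x /= /ltSx_le /le_eq_lt [->|hx].
  - by rewrite (@msat_ext _ _ e) // => -[].
  - exact: h1.
have [c0 [G [_ hG]]] := fcl_den B 0 r (ctx0 M).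
have [c1 [tv [l1 hv]]] := tden_param c0 v.
refine (@M_ind M c1 (fun t => bimp (ble t tv) (bex (fun n => band (b_num t n)
  (bex (fun u : bterm => band (bis u (G n)) (bprvPA u))))))
  (fun w => w <= v -> Prvd (pcons w r) B) _ _ _).
- move=> c2 t x l2 ht; have {}hv := tden_mono l2 hv.
  apply: (@fden_iffK _ _ _ (x <= v -> exists n, NumM x n /\
    exists u, u = fcl 0 (pcons x r) B /\ PrvM (@AxPAM M) u)).
    split=> h1 /h1; first by move=> [n [_ [u [-> //]]]].
    by move=> h2; exists (numc x); split; [exact: numcP|eexists; split].
  apply: fden_imp; first by den.
  apply: fden_ex => n c3 tn l3 hn; apply: fden_guard.
    by have {}ht := tden_mono l3 ht; den.
  move=> /numcE En; rewrite En in hn.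
  apply: fden_ex => u c4 tu l4 hu; apply: fden_and; last exact: den_prvPA.
  apply: fden_is hu _; apply: hG; last exact: tden_mono hn.
  exact: deeper_trans l1 (deeper_trans l2 (deeper_trans l3 l4)).
- by move=> _; exact: base.
- by move=> w IH hw; apply: step => //; apply: IH; exact: lt_le.
Qed.

Lemma meval_no0 (S : structure) (e : nat -> S) (d : S) t : no0 t ->
  meval (pcons d e) t = meval e (tsubst (inst Zero) t).
Proof. by move/no0_shift=> {1}<-; rewrite meval_subst. Qed.

Lemma prvd_blt c t v r : no0 t -> v = meval r (tsubst (inst Zero) t) ->
  (forall x, x < v -> Prvd (pcons x r) c) ->
  Prvd r (All (Imp (Le (Succ (Var 0)) t) c)).
Proof.
move=> ht Ev /prvd_ball h; have := prvd_term (tsubst (inst Zero) t) r.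
rewrite -Ev => h2; rewrite -(@prvd_shift _ v).
apply: prvd_cons2 h h2 => N e /= h1 h2 x.
have E : meval (pcons x e) (tsubst (up shift) t) = e 0%N.
  rewrite -h2 [RHS]meval_subst -(meval_no0 _ x) // meval_subst.
  by apply: meval_ext; case.
rewrite E => /h1; rewrite !msat_subst; apply: msat_ext1.
by case.
Qed.

Lemma prvd_ble c t v r : no0 t -> v = meval r (tsubst (inst Zero) t) ->
  (forall x, x <= v -> Prvd (pcons x r) c) ->
  Prvd r (All (Imp (Le (Var 0) t) c)).
Proof.
move=> ht Ev h.
have: Prvd r (All (Imp (Le (Succ (Var 0)) (Succ t)) c)).
  by apply: (@prvd_blt _ _ (sS v)) => //= [|x /ltSx_le]; [rewrite Ev|exact: h].
by apply: prvd_cons1 => N e /= h1 x h2; apply: h1; apply/le_SS.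
Qed.

Lemma prvd_Le (t u : term) r : msat r (Le t u) -> Prvd r (Le t u).
Proof.
by move=> h; apply: (@prvd_atom Le) => //= [N f v w v' w' -> -> //|]; exact: prvd_le.
Qed.

(** By induction on the standard formula, while the numerals in it may be nonstandard:
    bounded quantifiers are treated by [prvd_ball]. *)
Theorem sigma_complete a r :
  (sig true a -> msat r a -> Prvd r a) /\
  (sig false a -> ~ msat r a -> Prvd r (Neg a)).
Proof.
elim: a r => [t u|t u||a IHa b IHb|a IHa] r.
- split=> _ /= h.
  + apply: (@prvd_atom Eq) => //= [N f v w v' w' -> -> //|].
    by rewrite h; exact: (@prvd_valid (e2 _ _) (Eq (Var 1) (Var 1))).
  + by apply: (@prvd_atom (fun t u : term => Neg (Eq t u))) => //=
      [N f v w v' w' -> -> //|]; exact: prvd_neq.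
- split=> _ /= h.
  + by apply: (@prvd_atom Le) => //= [N f v w v' w' -> -> //|]; exact: prvd_le.
  + by apply: (@prvd_atom (fun t u : term => Neg (Le t u))) => //=
      [N f v w v' w' -> -> //|]; exact: prvd_nle.
- by split=> [_ []|_ _]; apply: prvd_valid => N e; apply.
- split=> /= /andP[sa sb] h.
  + have [ha|ha] := classic (msat r a).
    * by apply: prvd_cons1 ((IHb r).1 sb (h ha)) => N e hb _.
    * by apply: prvd_cons1 ((IHa r).2 sa ha) => N e hn /hn.
  + have [ha|ha] := classic (msat r a); last by case: h.
    have hb : ~ msat r b by move=> hb; apply: h.
    by apply: prvd_cons2 ((IHa r).1 sa ha) ((IHb r).2 sb hb) => N e h1 h2 /(_ h1).
- split=> /= sa h; last first.
    have [x hx] := not_all_ex_not _ _ h.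
    rewrite -(@prvd_shift _ x); apply: prvd_cons1 ((IHa (pcons x r)).2 sa hx) => N e.
    move=> /= h1 h2; apply: h1; have := h2 (e 0%N); rewrite msat_subst.
    by apply: msat_ext1 => -[].
  case: a IHa sa h => // -[] // t u c IH.
  have IHc g x : msat (pcons x r) (Le g u) ->
      (forall r, (sig true (Imp (Le g u) c) -> msat r (Imp (Le g u) c) ->
         Prvd r (Imp (Le g u) c))) -> sig true c -> msat (pcons x r) c ->
      Prvd (pcons x r) c.
    move=> hg IHg sc hc; apply: prvd_cons2 (prvd_Le hg) (IHg _ _ _) => //.
    by move=> N e h1; apply.
  case: t IH => [[|i]||[[|i]||?|? ?|? ?]|? ?|? ?] //= IH /andP[nu sc] h.
  - apply: (prvd_ble nu erefl) => x hx.
    have hx' : msat (pcons x r) (Le (Var 0) u) by rewrite /= meval_no0.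
    apply: (IHc _ _ hx') => //; [by move=> r'; exact: (IH r').1|exact: h].
  - apply: (prvd_blt nu erefl) => x hx.
    have hx' : msat (pcons x r) (Le (Succ (Var 0)) u) by rewrite /= meval_no0.
    apply: (IHc _ _ hx') => //; [by move=> r'; exact: (IH r').1|exact: h].
Qed.

End SigmaCompleteness.

Lemma sig_Ex a : sig true (Ex a) = sig true a.
Proof. by rewrite /= !andbT. Qed.

Lemma sig_And a b : sig true (And a b) = sig true a && sig true b.
Proof. by rewrite /= !andbT. Qed.

Lemma sig_Or b0 a b : sig b0 (Or a b) = sig b0 a && sig b0 b.
Proof. by case: b0 => /=; rewrite !andbT. Qed.

Lemma sig_derivable : sig true derivable_form.
Proof. by vm_compute. Qed.

Lemma sig_premise : sig true premise_form.
Proof. by vm_compute. Qed.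

Section MsatPrv.
Variable M : PAmodel.

Lemma msat_derivable (r : nat -> M) a b n :
  msat (pcons n (pcons b (pcons a r))) derivable_form <-> DerM (r 0%N) a b n.
Proof.
pose r' := pcons n (pcons b (pcons a r)).
apply: (@fden_here _ (Ctx 4 r')); apply: den_der;
  exact: (@tden_lev_lt _ 4 r').
Qed.

Lemma msat_premise (r : nat -> M) y i n b a :
  msat (pcons y (pcons i (pcons n (pcons b (pcons a r))))) premise_form <->
  betaM a b i y.
Proof.
pose r' := pcons y (pcons i (pcons n (pcons b (pcons a r)))).
apply: (@fden_here _ (Ctx 6 r')); apply: den_beta;
  exact: (@tden_lev_lt _ 6 r').
Qed.

Lemma msat_prv (r : nat -> M) tau (T : M -> Prop) :
  (forall y i n b a,
     msat (pcons y (pcons i (pcons n (pcons b (pcons a r))))) tau <-> T y) ->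
  msat r (prv tau) <-> PrvM T (r 0%N).
Proof.
move=> hT; rewrite /prv /PrvM msat_Ex.
have E1 a : msat (pcons a r) (Ex (Ex (And derivable_form
    (All (Imp (Le (Succ (Var 0)) (Var 1)) (Ex (And premise_form tau))))))) <->
  exists b n, DerM (r 0%N) a b n /\
    forall i, i < n -> exists y, betaM a b i y /\ T y.
  rewrite msat_Ex.
  have E2 b : msat (pcons b (pcons a r)) (Ex (And derivable_form
    (All (Imp (Le (Succ (Var 0)) (Var 1)) (Ex (And premise_form tau)))))) <->
    exists n, DerM (r 0%N) a b n /\
      forall i, i < n -> exists y, betaM a b i y /\ T y.
    rewrite msat_Ex.
    have E3 n : msat (pcons n (pcons b (pcons a r))) (And derivable_form
      (All (Imp (Le (Succ (Var 0)) (Var 1)) (Ex (And premise_form tau))))) <->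
      DerM (r 0%N) a b n /\ forall i, i < n -> exists y, betaM a b i y /\ T y.
      rewrite msat_And msat_derivable.
      have E4 i : msat (pcons i (pcons n (pcons b (pcons a r))))
          (Ex (And premise_form tau)) <-> exists y, betaM a b i y /\ T y.
        rewrite msat_Ex.
        have E5 y := @msat_And M (pcons y (pcons i (pcons n (pcons b (pcons a r)))))
          premise_form tau.
        by split=> -[y hy]; exists y; move: hy; rewrite E5 msat_premise hT.
      by split=> -[h1 h2]; split=> // i hi; apply/E4; exact: h2.
    by split=> -[n hn]; exists n; apply/E3.
  by split=> -[b hb]; exists b; apply/E2.
by split=> -[a ha]; exists a; apply/E1.
Qed.

Lemma msat_axPA (r : nat -> M) : msat r axPA <-> AxPAM (r 0%N).
Proof.
apply: (@fden_build1 _ b_axPA r); apply: den_axPA.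
exact: (@tden_lev_lt _ 1 r).
Qed.

Lemma msat_prvPA (r : nat -> M) : msat r (prv axPA) <-> PrvM (@AxPAM M) (r 0%N).
Proof. by apply: msat_prv => y i n b a; rewrite msat_axPA. Qed.

End MsatPrv.

Lemma sig_axPA : sig true axPA.
Proof.
have -> : axPA = Or ((foldr (fun a f => bor (bis (lev 0) (cform a)) f)
    bbot basic_axioms) 1%N)
  ((bex (fun a => bex (fun b => bex (fun c => band (b_isform a)
      (band (b_finst cZero a b)
       (band (b_fsubst 1 (bnum 0) (cterm (Succ (Var 0))) a c)
        (bis (lev 0) (cImp b (cImp (cAll (cImp a c)) (cAll a)))))))))) 1%N) by [].
rewrite sig_Or; apply/andP; split; last by vm_compute.
by elim: basic_axioms => //= a l IH; rewrite IH.
Qed.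

Lemma sig_prvPA : sig true (prv axPA).
Proof.
rewrite /prv !sig_Ex sig_And sig_derivable.
have -> : forall a, sig true (All (Imp (Le (Succ (Var 0)) (Var 1)) a)) = sig true a.
  by [].
by rewrite sig_Ex sig_And sig_premise sig_axPA.
Qed.

Definition only0 (i : nat) : term := if i is 0%N then Var 0 else Zero.

Lemma tscoped_subst k k' s t : (forall i, (i < k)%N -> tscoped k' (s i)) ->
  tscoped k t -> tscoped k' (tsubst s t).
Proof.
move=> E; elim: t => //= [t IHt u IHu|t IHt u IHu].
- by case/andP=> /IHt -> /IHu ->.
- by case/andP=> /IHt -> /IHu ->.
Qed.

Lemma tscoped_shift k t : tscoped k t -> tscoped k.+1 (tsubst shift t).
Proof. by apply: tscoped_subst => i. Qed.

Lemma fscoped_subst k k' s a : (forall i, (i < k)%N -> tscoped k' (s i)) ->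
  fscoped k a -> fscoped k' (fsubst s a).
Proof.
elim: a k k' s => [t u|t u||a IHa b IHb|a IHa] k k' s E //=.
- by case/andP=> h1 h2; rewrite !(tscoped_subst E).
- by case/andP=> h1 h2; rewrite !(tscoped_subst E).
- by case/andP=> h1 h2; rewrite (IHa _ _ _ E) // (IHb _ _ _ E).
- by apply: IHa => -[|i] //= /E /tscoped_shift.
Qed.

Lemma fscoped_only0 a : fscoped 1 (fsubst only0 a).
Proof.
have [k hk] := fscoped_ex a; apply: fscoped_subst hk => i _.
by case: i.
Qed.

(** The provability of the diagonalization of a formula.  In place of substituting the
    numeral one says that every number equal to it satisfies the formula, so that only
    numerals have to be arithmetized. *)
Definition diag_form : form := fsubst only0 (build1 (fun x =>
  bex (fun n => bex (fun w => band (b_num x n)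
    (band (bis w (cAll (cImp (cEq (cterm (Var 0)) n) x)))
      (bsub (prv axPA) w)))))).

Lemma sig_diag : sig true diag_form.
Proof.
apply: sig_subst; rewrite /build1 /bex !sig_Ex /band !sig_And.
apply/andP; split; first by vm_compute.
apply/andP; split; first by vm_compute.
exact/sig_subst/sig_prvPA.
Qed.

Lemma msat_diag (M : PAmodel) (r : nat -> M) : msat r diag_form <->
  PrvM (@AxPAM M)
    (cAllM (cImpM (cEqM (ctermM M (Var 0)) (numc (r 0%N))) (r 0%N))).
Proof.
rewrite /diag_form msat_subst; set r' := fun i => _.
rewrite (@fden_build1 _ _ r' (exists n w, NumM (r' 0%N) n /\
  (w = cAllM (cImpM (cEqM (ctermM M (Var 0)) n) (r' 0%N)) /\
   msat (fun _ => w) (prv axPA)))).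
- split=> [[n [w [/numcE -> [-> ]]]]|]; first by rewrite msat_prvPA.
  move=> h; exists (numc (r 0%N)); eexists; split; first exact: numcP.
  by split; [|rewrite msat_prvPA].
- have h0 := @tden_lev_lt _ 1 r' 0 isT.
  apply: fden_ex => n c1 tn l1 hn; apply: fden_ex => w c2 tw l2 hw; lift_den.
  apply fden_and; first by den. apply fden_and; first by den.
  exact: fden_sub.
Qed.

Lemma fscoped_diag : fscoped 1 diag_form.
Proof. exact: fscoped_only0. Qed.

#[global] Opaque diag_form.

Lemma fscoped_Imp k a b : fscoped k (Imp a b) = fscoped k a && fscoped k b.
Proof. by []. Qed.

Lemma meval_num (S : structure) (r : nat -> S) n : meval r (num n) = natM S n.
Proof. by elim: n => //= n; rewrite /num /= => ->. Qed.

Definition fixpoint_of (delta : form) : form :=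
  All (Imp (Eq (Var 0) (num (fcode delta))) delta).

Lemma fcl_fixpoint (M : PAmodel) (r : nat -> M) delta : fscoped 1 delta ->
  fcl 0 r (fixpoint_of delta) = cAllM (cImpM (cEqM (ctermM M (Var 0))
    (numc (natM M (fcode delta)))) (natM M (fcode delta))).
Proof.
move=> sd.
have -> : fcl 0 r (fixpoint_of delta) = cAllM (cImpM (cEqM (tcl 1 r (Var 0))
  (tcl 1 r (num (fcode delta)))) (fcl 1 r delta)) by [].
by rewrite tcl_num (fcl_std _ sd) tcl_std.
Qed.

Lemma msat_fixpoint (M : PAmodel) (r : nat -> M) delta :
  msat r (fixpoint_of delta) <->
  msat (pcons (natM M (fcode delta)) r) delta.
Proof.
split=> [h|h x /=]; first by apply: (h (natM M (fcode delta))); rewrite /= meval_num.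
by rewrite meval_num => ->.
Qed.

Lemma loeb_fixpoint chi delta : fscoped 0 chi -> fscoped 1 delta ->
  (forall (M : PAmodel) (r : nat -> M),
     msat r delta <-> (msat r diag_form -> msat r chi)) ->
  (forall (M : PAmodel) (r : nat -> M),
     PrvM (@AxPAM M) (cformM M chi) -> msat r chi) ->
  forall (M : PAmodel) (r : nat -> M), msat r chi.
Proof.
move=> sc sd hdelta h.
have chi_env (M : PAmodel) (r r' : nat -> M) : msat r chi -> msat r' chi.
  by rewrite (@msat_scoped _ 0 r r').
have lambdaP (M : PAmodel) (r : nat -> M) : msat r (fixpoint_of delta).
  apply/msat_fixpoint/hdelta => hG; pose e := pcons (natM M (fcode delta)) r.
  have h1 : Prvd e (fsubst shift (fixpoint_of delta)).
    by rewrite prvd_shift /Prvd fcl_fixpoint //; move/msat_diag: hG.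
  have h2 : Prvd e (Eq (Var 0) (num (fcode delta))).
    have := @prvd_valid _ e (Eq (Var 0) (Var 0)) (fun _ _ => erefl).
    by rewrite /Prvd /= tcl_num.
  have h3 := (sigma_complete diag_form e).1 sig_diag hG.
  apply: (h M); rewrite -(@fcl_std M 0 e) //.
  apply: prvd_cons3 h1 h2 h3 => N f; rewrite msat_subst msat_fixpoint hdelta /=.
  rewrite meval_num => h1 h2 h3; rewrite -h2 in h1; apply: chi_env (h1 _).
  by apply/(iffLR (msat_scoped fscoped_diag _)): h3 => -[|i].
move=> M r; have := lambdaP M r; rewrite msat_fixpoint hdelta => hd.
apply: (chi_env _ _ _ (hd _)); apply/msat_diag; rewrite -(fcl_fixpoint r sd).
by apply: prv_PA => //; exact: PA_complete.
Qed.

(** The fixed point says that its own provability implies [chi].  By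
    Sigma_1-completeness its provability implies that of [chi], hence [chi]; so the fixed
    point holds in all models and is provable, which yields [chi]. *)
Theorem loeb chi : fscoped 0 chi ->
  (forall (M : PAmodel) (r : nat -> M),
     PrvM (@AxPAM M) (cformM M chi) -> msat r chi) ->
  forall (M : PAmodel) (r : nat -> M), msat r chi.
Proof.
move=> sc h; have sd : fscoped 1 (Imp diag_form chi).
  rewrite fscoped_Imp fscoped_diag; exact: fscoped_leq sc.
refine (@loeb_fixpoint chi (Imp diag_form chi) sc sd _ h).
by move=> M r; split.
Qed.

(** * The satisfaction predicate for Sigma_1 formulas *)

Section SatDefs.
Variable M : PAmodel.
Implicit Types (x y t u v w e a b : M) (Z : M -> Prop).

Definition EvalPhi Z x : Prop :=
     (exists v e, x = ⟪cVarM (natM M 0), ⟪⟪v, e⟫, v⟫⟫)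
  \/ (exists i w e v, x = ⟪cVarM (sS i), ⟪⟪w, e⟫, v⟫⟫ /\ Z ⟪cVarM i, ⟪e, v⟫⟫)
  \/ (exists e, x = ⟪cZeroM M, ⟪e, natM M 0⟫⟫)
  \/ (exists t e v, x = ⟪cSuccM t, ⟪e, sS v⟫⟫ /\ Z ⟪t, ⟪e, v⟫⟫)
  \/ (exists t u e v w,
        (x = ⟪cAddM t u, ⟪e, v + w⟫⟫ \/ x = ⟪cMulM t u, ⟪e, v * w⟫⟫)
        /\ Z ⟪t, ⟪e, v⟫⟫ /\ Z ⟪u, ⟪e, w⟫⟫).
Definition EvalM t e v := lfpM EvalPhi ⟪t, ⟪e, v⟫⟫.

Definition SatPhi Z x : Prop :=
       (exists t u e v w, EvalM t e v /\ EvalM u e w /\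
          (  (x = ⟪natM M 1, ⟪cEqM t u, e⟫⟫ /\ v = w)
           \/ (x = ⟪natM M 0, ⟪cEqM t u, e⟫⟫ /\ ~ v = w)
           \/ (x = ⟪natM M 1, ⟪cLeM t u, e⟫⟫ /\ v <= w)
           \/ (x = ⟪natM M 0, ⟪cLeM t u, e⟫⟫ /\ ~ v <= w)))
  \/ (exists e, x = ⟪natM M 0, ⟪cBotM M, e⟫⟫)
  \/ (exists a b e, x = ⟪natM M 1, ⟪cImpM a b, e⟫⟫ /\
        (Z ⟪natM M 0, ⟪a, e⟫⟫ \/ Z ⟪natM M 1, ⟪b, e⟫⟫))
  \/ (exists a b e, x = ⟪natM M 0, ⟪cImpM a b, e⟫⟫ /\
        Z ⟪natM M 1, ⟪a, e⟫⟫ /\ Z ⟪natM M 0, ⟪b, e⟫⟫)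
  \/ (exists a e, x = ⟪natM M 0, ⟪cAllM a, e⟫⟫ /\
        exists y, Z ⟪natM M 0, ⟪a, ⟪y, e⟫⟫⟫)
  \/ (exists a t t' e v,
        x = ⟪natM M 1, ⟪cAllM (cImpM (cLeM (ctermM M (Var 0)) t') a), e⟫⟫
        /\ TshiftM t t' /\ EvalM t e v /\
        forall y, y <= v -> Z ⟪natM M 1, ⟪a, ⟪y, e⟫⟫⟫).
Definition SatM (s : nat) a e := lfpM SatPhi ⟪natM M s, ⟪a, e⟫⟫.

Lemma den_eval (c : ctx M) p q o t e v : pden c p t -> pden c q e -> pden c o v ->
  fden c (b_eval p q o) (EvalM t e v).
Proof. by move=> h1 h2 h3; den_by_lfp EvalPhi. Qed.
End SatDefs.

Ltac den_atom K ::=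
  lazymatch K with
  | betaM _ _ _ _ => apply den_beta; [tdn|tdn|tdn|tdn]
  | TscopedM _ _ => apply den_tscoped; [pdn|pdn]
  | TsubstM _ _ _ _ _ => apply den_tsubst; [pdn|pdn|pdn|pdn]
  | TshiftM _ _ => apply den_tshift; [pdn|pdn]
  | NumM _ _ => apply den_num; [pdn|pdn]
  | FscopedM _ _ => apply den_fscoped; [pdn|pdn]
  | IstermM _ => apply den_isterm; pdn
  | FsubstM _ _ _ _ _ => apply den_fsubst; [pdn|pdn|pdn|pdn]
  | FinstM _ _ _ => apply den_finst; [pdn|pdn|pdn]
  | FshiftM _ _ => apply den_fshift; [pdn|pdn]
  | IsformM _ => apply den_isform; pdn
  | EvalM _ _ _ => apply den_eval; [pdn|pdn|pdn]
  end.

(** Equations between codes are decomposed; different constructors clash. *)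
Ltac inv_codes :=
  repeat match goal with
  | H : pairM _ _ = pairM _ _ |- _ => apply pair_inj in H; destruct H
  | H : sS _ = sS _ |- _ => apply succ_inj in H
  | H : natM _ 0%N = sS _ |- _ => case (succ_neq0 (esym H))
  | H : natM ?S (?n.+1) = sS ?x |- _ => change (sS (natM S n) = sS x) in H
  | H : natM _ _ = natM _ _ |- _ => apply natM_inj in H; try discriminate H
  | H : _ = ?x |- _ => is_var x; subst x
  | H : ?x = _ |- _ => is_var x; subst x
  | H : _ = _ |- _ => apply tag_inj in H; destruct H as [H ?]; try discriminate H
  end.

Section Sat.
Variable M : PAmodel.
Implicit Types (x y v w e : M).

Lemma op_sat (c : ctx M) : exists PhiF, opden c PhiF (@SatPhi M).
Proof. eexists; opd SatPhi. Qed.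

Lemma den_sat (c : ctx M) s p q a e : pden c p a -> pden c q e ->
  fden c (b_sat s p q) (SatM s a e).
Proof. by move=> h1 h2; den_by_lfp SatPhi. Qed.

Definition fstM x : M := epsilon (inhabits 0) (fun y => exists z, x = ⟪y, z⟫).
Definition sndM x : M := epsilon (inhabits 0) (fun z => exists y, x = ⟪y, z⟫).

Lemma fst_pair x y : fstM ⟪x, y⟫ = x.
Proof.
have [z E] := epsilon_spec (inhabits (s_zero M))
  (fun u => exists z, ⟪x, y⟫ = ⟪u, z⟫) (ex_intro _ x (ex_intro _ y erefl)).
by have [] := pair_inj E.
Qed.

Lemma snd_pair x y : sndM ⟪x, y⟫ = y.
Proof.
have [z E] := epsilon_spec (inhabits (s_zero M))
  (fun u => exists z, ⟪x, y⟫ = ⟪z, u⟫) (ex_intro _ y (ex_intro _ x erefl)).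
by have [] := pair_inj E.
Qed.

Lemma pair_eta x : ⟪fstM x, sndM x⟫ = x.
Proof. by have [y [z ->]] := pair_surj x; rewrite fst_pair snd_pair. Qed.

(** Assignments are coded by iterated pairs <e_0, <e_1, ... >>. *)
Definition venv e (i : nat) : M := fstM (iter i sndM e).

Lemma venv_pair x e i : venv ⟪x, e⟫ i = pcons x (venv e) i.
Proof. by case: i => [|i]; rewrite /venv ?iterSr /= ?fst_pair // snd_pair. Qed.

Lemma eval_mono : monotone (@EvalPhi M).
Proof.
move=> Z Z' h x [H|[[i [w [e [v [E H]]]]]|[H|[[t [e [v [E H]]]]|
  [t [u [e [v [w [E [H1 H2]]]]]]]]]]].
- by left.
- by right; left; exists i, w, e, v; split=> //; exact: h.
- by right; right; left.
- by do 3?right; left; exists t, e, v; split=> //; exact: h.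
- by do 4?right; exists t, u, e, v, w; split=> //; split; exact: h.
Qed.

Lemma codeM_Var i : ctermM M (Var i) = cVarM (natM M i).
Proof. by rewrite /ctermM codeE natM_cpair. Qed.
Lemma codeM_Zero : ctermM M Zero = cZeroM M.
Proof. by rewrite /ctermM codeE natM_cpair. Qed.
Lemma codeM_Succ t : ctermM M (Succ t) = cSuccM (ctermM M t).
Proof. by rewrite /ctermM codeE natM_cpair. Qed.
Lemma codeM_Add t u : ctermM M (Add t u) = cAddM (ctermM M t) (ctermM M u).
Proof. by rewrite /ctermM codeE !natM_cpair. Qed.
Lemma codeM_Mul t u : ctermM M (Mul t u) = cMulM (ctermM M t) (ctermM M u).
Proof. by rewrite /ctermM codeE !natM_cpair. Qed.
Lemma codeM_Eq t u : cformM M (Eq t u) = cEqM (ctermM M t) (ctermM M u).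
Proof. by rewrite /cformM codeE !natM_cpair. Qed.
Lemma codeM_Le t u : cformM M (Le t u) = cLeM (ctermM M t) (ctermM M u).
Proof. by rewrite /cformM codeE !natM_cpair. Qed.
Lemma codeM_Bot : cformM M Bot = cBotM M.
Proof. by rewrite /cformM codeE !natM_cpair. Qed.
Lemma codeM_Imp a b : cformM M (Imp a b) = cImpM (cformM M a) (cformM M b).
Proof. by rewrite /cformM codeE !natM_cpair. Qed.
Lemma codeM_All a : cformM M (All a) = cAllM (cformM M a).
Proof. by rewrite /cformM codeE !natM_cpair. Qed.
Definition codeME := (codeM_Var, codeM_Zero, codeM_Succ, codeM_Add, codeM_Mul,
  codeM_Eq, codeM_Le, codeM_Bot, codeM_Imp, codeM_All).

Lemma eval_complete t e : EvalM (ctermM M t) e (meval (venv e) t).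
Proof.
elim: t => [i||t IH|t IHt u IHu|t IHt u IHu] /=; rewrite codeME.
- elim: i e => [|i IH] e; rewrite -{1}(pair_eta e).
    by apply: (lfp_intro0 eval_mono); left; exists (fstM e), (sndM e).
  apply: (lfp_intro1 eval_mono (IH (sndM e))); right; left.
  by exists (natM M i), (fstM e), (sndM e), (venv (sndM e) i); rewrite /venv -iterSr.
- by apply: (lfp_intro0 eval_mono); do 2?right; left; exists e.
- apply: (lfp_intro1 eval_mono IH); do 3?right; left.
  by exists (ctermM M t), e, (meval (venv e) t).
- apply: (lfp_intro2 eval_mono IHt IHu); do 4?right.
  exists (ctermM M t), (ctermM M u), e, (meval (venv e) t), (meval (venv e) u).
  by split; [left|split; [left|right]].
- apply: (lfp_intro2 eval_mono IHt IHu); do 4?right.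
  exists (ctermM M t), (ctermM M u), e, (meval (venv e) t), (meval (venv e) u).
  by split; [right|split; [left|right]].
Qed.

Ltac clash := solve [exfalso; inv_codes].

Lemma eval_sound t e v : EvalM (ctermM M t) e v -> v = meval (venv e) t.
Proof.
elim: t e v => [i||t IH|t IHt u IHu|t IHt u IHu] e v; rewrite codeME.
- elim: i e v => [|i IH] e v => /(lfp_unfold eval_mono)
    [[v' [e' E]]|[[i' [w [e' [v' [E H]]]]]|[[e' E]|[[t [e' [v' [E H]]]]|
      [t [u [e' [v' [w [[E|E] [H1 H2]]]]]]]]]]]; try clash; inv_codes.
  + by rewrite /= venv_pair.
  + by rewrite /= venv_pair; exact: IH.
- move=> /(lfp_unfold eval_mono)
    [[v' [e' E]]|[[i' [w [e' [v' [E H]]]]]|[[e' E]|[[t [e' [v' [E H]]]]|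
      [t [u [e' [v' [w [[E|E] [H1 H2]]]]]]]]]]]; try clash; by inv_codes.
- move=> /(lfp_unfold eval_mono)
    [[v' [e' E]]|[[i' [w [e' [v' [E H]]]]]|[[e' E]|[[t' [e' [v' [E H]]]]|
      [t' [u [e' [v' [w [[E|E] [H1 H2]]]]]]]]]]]; try clash; inv_codes.
  by rewrite (IH _ _ H).
- move=> /(lfp_unfold eval_mono)
    [[v' [e' E]]|[[i' [w [e' [v' [E H]]]]]|[[e' E]|[[t' [e' [v' [E H]]]]|
      [t' [u' [e' [v' [w [[E|E] [H1 H2]]]]]]]]]]]; try clash; inv_codes.
  by rewrite (IHt _ _ H1) (IHu _ _ H2).
- move=> /(lfp_unfold eval_mono)
    [[v' [e' E]]|[[i' [w [e' [v' [E H]]]]]|[[e' E]|[[t' [e' [v' [E H]]]]|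
      [t' [u' [e' [v' [w [[E|E] [H1 H2]]]]]]]]]]]; try clash; inv_codes.
  by rewrite (IHt _ _ H1) (IHu _ _ H2).
Qed.

Lemma tshift_inv t u : TshiftM t (ctermM M (tsubst shift u)) -> t = ctermM M u.
Proof.
rewrite /TshiftM codeME.
elim: u t => [i||u IH|u IHu u2 IHu2|u IHu u2 IHu2] t; rewrite [tsubst _ _]/= !codeME
  => /(lfp_unfold (@tsubst_mono M 2)) [[k [t1 [i' [E H]]]]|[[k [t1 E]]|[[k [t1 [j E]]]|
  [[k [t1 E]]|[[k [t1 [v [w [E H]]]]]|
  [k [t1 [v [v' [w [w' [[E|E] [H1 H2]]]]]]]]]]]]]; try clash; inv_codes => //.
- by case: (ltx0 H).
- by match goal with H : i.+1 = 1%N |- _ => case: i H end.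
- congr cVarM; apply: succ_inj.
  rewrite -[RHS]/(natM M i.+1) H.
  by rewrite add0x /= !addxS addx0.
- by rewrite (IH _ H).
- by rewrite (IHu _ H1) (IHu2 _ H2).
- by rewrite (IHu _ H1) (IHu2 _ H2).
Qed.

Lemma sat_mono : monotone (@SatPhi M).
Proof.
move=> Z Z' h x [H|[H|[[a [b [e [E [H|H]]]]]|[[a [b [e [E [H1 H2]]]]]|
  [[a [e [E [y H]]]]|[a [t [t' [e [v [E [H1 [H2 H3]]]]]]]]]]]]]; [by left|by right; left| | | | |].
- by do 2?right; left; exists a, b, e; split=> //; left; exact: h.
- by do 2?right; left; exists a, b, e; split=> //; right; exact: h.
- by do 3?right; left; exists a, b, e; split=> //; split; exact: h.
- by do 4?right; left; exists a, e; split=> //; exists y; exact: h.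
- do 5?right; exists a, t, t', e, v; do !split=> //.
  by move=> y hy; apply: h; exact: H3.
Qed.

Lemma sat_atom x t u e v w : v = meval (venv e) t -> w = meval (venv e) u ->
  (  (x = ⟪natM M 1, ⟪cEqM (ctermM M t) (ctermM M u), e⟫⟫ /\ v = w)
  \/ (x = ⟪natM M 0, ⟪cEqM (ctermM M t) (ctermM M u), e⟫⟫ /\ ~ v = w)
  \/ (x = ⟪natM M 1, ⟪cLeM (ctermM M t) (ctermM M u), e⟫⟫ /\ v <= w)
  \/ (x = ⟪natM M 0, ⟪cLeM (ctermM M t) (ctermM M u), e⟫⟫ /\ ~ v <= w)) ->
  lfpM (@SatPhi M) x.
Proof.
move=> -> -> h; apply: (lfp_intro0 sat_mono); left.
exists (ctermM M t), (ctermM M u), e, (meval (venv e) t), (meval (venv e) u).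
by split; [exact: eval_complete|split; [exact: eval_complete|]].
Qed.

Ltac sat_cases H := destruct (lfp_unfold sat_mono H) as
  [[? [? [? [? [? [? [? [[? ?]|[[? ?]|[[? ?]|[? ?]]]]]]]]]]]|[[? ?]|
   [[? [? [? [? [?|?]]]]]|[[? [? [? [? [? ?]]]]]|[[? [? [? [? ?]]]]|
   [? [? [? [? [? [? [? [? ?]]]]]]]]]]]]].
Ltac evals := repeat match goal with
  | h : EvalM (ctermM _ _) _ _ |- _ => apply eval_sound in h; subst end.

Lemma satT_Eq t u e :
  SatM 1 (cEqM (ctermM M t) (ctermM M u)) e <-> meval (venv e) t = meval (venv e) u.
Proof.
split=> h; last by apply: sat_atom => //; left; split.
by sat_cases h; try clash; inv_codes; evals.
Qed.

Lemma satF_Eq t u e :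
  SatM 0 (cEqM (ctermM M t) (ctermM M u)) e <-> meval (venv e) t <> meval (venv e) u.
Proof.
split=> h; last by apply: sat_atom => //; right; left; split.
by sat_cases h; try clash; inv_codes; evals.
Qed.

Lemma satT_Le t u e :
  SatM 1 (cLeM (ctermM M t) (ctermM M u)) e <-> meval (venv e) t <= meval (venv e) u.
Proof.
split=> h; last by apply: sat_atom => //; do 2?right; left; split.
by sat_cases h; try clash; inv_codes; evals.
Qed.

Lemma satF_Le t u e :
  SatM 0 (cLeM (ctermM M t) (ctermM M u)) e <-> ~ meval (venv e) t <= meval (venv e) u.
Proof.
split=> h; last by apply: sat_atom => //; do 3?right; split.
by sat_cases h; try clash; inv_codes; evals.
Qed.

Lemma satT_Bot e : ~ SatM 1 (cBotM M) e.
Proof. by move=> h; sat_cases h; clash. Qed.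

Lemma satF_Bot e : SatM 0 (cBotM M) e.
Proof. by apply: (lfp_intro0 sat_mono); right; left; exists e. Qed.

Lemma satT_Imp a b e : SatM 1 (cImpM a b) e <-> SatM 0 a e \/ SatM 1 b e.
Proof.
split=> [h|[h|h]].
- by sat_cases h; try clash; inv_codes; [left|right].
- by apply: (lfp_intro1 sat_mono h); do 2?right; left; exists a, b, e; split=> //; left.
- by apply: (lfp_intro1 sat_mono h); do 2?right; left; exists a, b, e; split=> //; right.
Qed.

Lemma satF_Imp a b e : SatM 0 (cImpM a b) e <-> SatM 1 a e /\ SatM 0 b e.
Proof.
split=> [h|[h h']].
- by sat_cases h; try clash; inv_codes.
- apply: (lfp_intro2 sat_mono h h'); do 3?right; left; exists a, b, e; split=> //.
  by split; [left|right].
Qed.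

Lemma satF_All a e : SatM 0 (cAllM a) e <-> exists y, SatM 0 a ⟪y, e⟫.
Proof.
split=> [h|[y h]].
- by sat_cases h; try clash; inv_codes; eexists; eassumption.
- by apply: (lfp_intro1 sat_mono h); do 4?right; left; exists a, e; split=> //; exists y.
Qed.

Lemma tshift_std t : TshiftM (ctermM M t) (ctermM M (tsubst shift t)).
Proof.
have [k hk] := tscoped_ex t; have := @tshift_code M k (fun=> 0) t.
rewrite !tcl_std //; move: hk; clear; elim: t => //= [t IHt u IHu|t IHt u IHu].
- by case/andP=> /IHt -> /IHu ->.
- by case/andP=> /IHt -> /IHu ->.
Qed.

(* Verifications of all instances are combined into one by [covered_bounded]. *)
Lemma satT_ball a t e :
  SatM 1 (cAllM (cImpM (cLeM (ctermM M (Var 0)) (ctermM M (tsubst shift t))) a)) e <->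
  forall y, y <= meval (venv e) t -> SatM 1 a ⟪y, e⟫.
Proof.
split=> [h y hy|h].
- sat_cases h; try clash; inv_codes.
  repeat match goal with h : TshiftM _ _ |- _ => apply tshift_inv in h; subst end.
  by evals; match goal with h : forall y, _ |- _ => exact: h end.
- have [c [te [_ he]]] := tden_param (ctx0 M) e.
  have [c1 [ta [l1 ha]]] := tden_param c a; lift_den.
  have [PhiF hPhi] := op_sat c1.
  have := @covered_bounded M _ sat_mono c1 PhiF (fun y => ⟪natM M 1, ⟪a, ⟪y, e⟫⟫⟫)
    (fun t => bpair (bnum 1) (bpair ta (bpair t te))) (meval (venv e) t) hPhi.
  case=> [c2 ty y l2 hy|y hy|A [B [n [h1 h2]]]].
  + by lift_den; den.
  + exact: h.
  + apply: (@lfp_intro _ _ sat_mono (fun z => exists2 y,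
      y <= meval (venv e) t & z = ⟪natM M 1, ⟪a, ⟪y, e⟫⟫⟫)).
      by exists A, B, n.
    do 5?right; exists a, (ctermM M t), (ctermM M (tsubst shift t)), e, (meval (venv e) t).
    split=> //; split; first exact: tshift_std.
    by split; [exact: eval_complete|move=> y hy; exists y].
Qed.

(** For standard bounded formulas, by induction on the formula. *)
Theorem sat_delta0 a : delta0 a -> forall e,
  (SatM 1 (cformM M a) e <-> msat (venv e) a) /\
  (SatM 0 (cformM M a) e <-> ~ msat (venv e) a).
Proof.
elim=> {a} [t u|t u||a b _ IHa _ IHb|t a _ IHa] e.
- by rewrite codeM_Eq satT_Eq satF_Eq.
- by rewrite codeM_Le satT_Le satF_Le.
- by rewrite codeM_Bot; split; split=> [h|h] //; [case: (satT_Bot h)|exact: satF_Bot].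
- rewrite codeM_Imp satT_Imp satF_Imp !(IHa e).1 !(IHa e).2 !(IHb e).1 !(IHb e).2.
  rewrite [msat _ (Imp a b)]/=.
  case: (classic (msat (venv e) a)); case: (classic (msat (venv e) b)); tauto.
- have E x b : msat (venv ⟪x, e⟫) b <-> msat (pcons x (venv e)) b.
    by apply: msat_ext => i; exact: venv_pair.
  have Et x : meval (pcons x (venv e)) (tsubst shift t) = meval (venv e) t.
    by rewrite meval_subst.
  have Eg x : SatM 1 (cformM M (Le (Var 0) (tsubst shift t))) ⟪x, e⟫ <->
      x <= meval (venv e) t.
    rewrite codeM_Le satT_Le -(Et x) /= venv_pair.
    by rewrite (@meval_ext _ (venv ⟪x, e⟫) (pcons x (venv e))) // => i; exact: venv_pair.
  rewrite codeM_All codeM_Imp; split.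
  + rewrite codeM_Le satT_ball; split=> h x; have := h x.
    * by rewrite (IHa _).1 E /= Et.
    * by rewrite (IHa _).1 E /= Et.
  + rewrite satF_All; split.
    * move=> [y]; rewrite satF_Imp (IHa _).2 E Eg => -[h1 h2] h3.
      by apply: h2; apply: (h3 y); rewrite /= Et.
    * move=> h; have [y hy] := not_all_ex_not _ _ h; exists y.
      have [/= h1 h2] := imply_to_and _ _ hy.
      by rewrite satF_Imp (IHa _).2 E Eg -(Et y).
Qed.

End Sat.

(** * The orders coded by numbers *)

Definition LeqM (M : PAmodel) (l x y : M) : Prop :=
  exists p s, l = ⟪p, s⟫ /\ SatM 1 s ⟪⟪x, y⟫, natM M 0⟫.

Lemma den_le (M : PAmodel) (c : ctx M) tl tx ty (l x y : M) :
  tden c tl l -> tden c tx x -> tden c ty y ->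
  fden c (b_le tl tx ty) (LeqM l x y).
Proof.
move=> h1 h2 h3; apply: fden_ex => p c1 tp l1 hp.
apply: fden_ex => s c2 ts l2 hs; lift_den; apply fden_and; first by den.
by apply: den_sat; den.
Qed.

Section Index.
Variables (M : PAmodel) (theta : form).
Hypothesis theta0 : delta0 theta.
Let l : nat := cpair (fcode theta) (fcode theta).

Definition rel_of (z : M) : Prop := msat (pcons z (fun=> 0)) theta.

Lemma venv0 i : @venv M 0 i = 0.
Proof.
have hs : @sndM M 0 = 0 by rewrite -{1}(pair00 M) snd_pair.
have hf : @fstM M 0 = 0 by rewrite -{1}(pair00 M) fst_pair.
have -> : venv 0 i = fstM (iter i (@sndM M) 0) by [].
by have -> : iter i (@sndM M) 0 = 0 by elim: i => //= i ->.
Qed.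

Lemma sat_index z : (SatM 1 (cformM M theta) ⟪z, natM M 0⟫ <-> rel_of z) /\
  (SatM 0 (cformM M theta) ⟪z, natM M 0⟫ <-> ~ rel_of z).
Proof.
have E : msat (venv ⟪z, 0⟫) theta <-> rel_of z.
  by apply: msat_ext => i; rewrite venv_pair; case: i => //= i; exact: venv0.
have [h1 h2] := @sat_delta0 M _ theta0 ⟪z, 0⟫.
by split; [exact: iff_trans h1 E|apply: iff_trans h2 _; rewrite E].
Qed.

Lemma leq_index x y : LeqM (natM M l) x y <-> rel_of ⟪x, y⟫.
Proof.
rewrite /LeqM /l natM_cpair; split=> [[p [s [/pair_inj [_ <-]]]]|h].
  by rewrite (sat_index _).1.
by eexists; eexists; split; [reflexivity|rewrite (sat_index _).1].
Qed.

(** Bounded formulas are decided by the satisfaction predicate, so that one code serves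
    as the index of a Pi_1 set and of a Sigma_1 set. *)
Lemma LO_index (r : nat -> M) :
  (forall x y, rel_of ⟪x, y⟫ -> rel_of ⟪x, x⟫ /\ rel_of ⟪y, y⟫) ->
  (forall x y, rel_of ⟪x, y⟫ -> rel_of ⟪y, x⟫ -> x = y) ->
  (forall x y z, rel_of ⟪x, y⟫ -> rel_of ⟪y, z⟫ -> rel_of ⟪x, z⟫) ->
  (forall x y, rel_of ⟪x, x⟫ -> rel_of ⟪y, y⟫ -> rel_of ⟪x, y⟫ \/ rel_of ⟪y, x⟫) ->
  msat r (LO l).
Proof.
move=> h1 h2 h3 h4; rewrite /LO msat_subst; set r' := fun i => _.
have hl : tden (Ctx 1 r') (lev 0) (natM M l).
  have := @tden_lev_lt M 1 r' 0 isT.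
  by rewrite /r' /= meval_num.
rewrite (@fden_build1 _ b_LO r' (
    (exists p s, natM M l = ⟪p, s⟫ /\ forall z,
       ~ SatM 0 p ⟪z, natM M 0⟫ <-> SatM 1 s ⟪z, natM M 0⟫)
  /\ (forall x y, LeqM (natM M l) x y -> LeqM (natM M l) x x /\ LeqM (natM M l) y y)
  /\ (forall x y, LeqM (natM M l) x y /\ LeqM (natM M l) y x -> x = y)
  /\ (forall x y z, LeqM (natM M l) x y /\ LeqM (natM M l) y z -> LeqM (natM M l) x z)
  /\ (forall x y, LeqM (natM M l) x x /\ LeqM (natM M l) y y ->
       LeqM (natM M l) x y \/ LeqM (natM M l) y x))).
- split; [|split; [|split; [|split]]].
  + exists (cformM M theta), (cformM M theta); split; first exact: natM_cpair.
    by move=> z; rewrite (sat_index z).1 (sat_index z).2; split=> [/NNPP|h /(_ h)].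
  + by move=> x y; rewrite !leq_index; exact: h1.
  + by move=> x y; rewrite !leq_index => -[]; exact: h2.
  + by move=> x y z; rewrite !leq_index => -[]; exact: h3.
  + by move=> x y; rewrite !leq_index => -[]; exact: h4.
- apply fden_and.
    apply: fden_ex => p c1 tp l1 hp; apply: fden_ex => s c2 ts l2 hs; lift_den.
    apply fden_and; first by den.
    apply: fden_all => z c3 tz l3 hz; lift_den; apply fden_iff; last by apply: den_sat; den.
    by apply: fden_neg; apply: den_sat; den.
  apply fden_and.
    apply: fden_all => x c1 tx l1 hx; apply: fden_all => y c2 ty l2 hy; lift_den.
    by apply fden_imp; [|apply fden_and]; exact: den_le.
  apply fden_and.
    apply: fden_all => x c1 tx l1 hx; apply: fden_all => y c2 ty l2 hy; lift_den.
    by apply fden_imp; [apply fden_and; exact: den_le|den].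
  apply fden_and.
    apply: fden_all => x c1 tx l1 hx; apply: fden_all => y c2 ty l2 hy.
    apply: fden_all => z c3 tz l3 hz; lift_den.
    by apply fden_imp; [apply fden_and|]; exact: den_le.
  apply: fden_all => x c1 tx l1 hx; apply: fden_all => y c2 ty l2 hy; lift_den.
  by apply fden_imp; [apply fden_and|apply fden_or]; exact: den_le.
Qed.

End Index.

(** * Iterated reflection along an order with a descending class *)

Lemma tscoped_numeral k n : tscoped k (num n).
Proof. by elim: n. Qed.

Lemma num_shift n : tsubst shift (num n) = num n.
Proof. by elim: n => //= n; rewrite /num /= => ->. Qed.

#[global] Arguments num : simpl never.

(** Scoping of higher-order formulas, proved by following their construction. *)
Definition tsc (d : nat) (t : bterm) := forall d', (d <= d')%N -> tscoped d' (t d').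
Definition fsc (d : nat) (f : bform) := forall d', (d <= d')%N -> fscoped d' (f d').
Definition psc (d : nat) (p : bpoly) := forall d' k, (d <= d')%N ->
  (forall d'' t, (d' <= d'')%N -> tsc d'' t -> fsc d'' (k t)) -> fsc d' (p k).
Definition isc (d : nat) (In : bpoly -> bform) :=
  forall d' p, (d <= d')%N -> psc d' p -> fsc d' (In p).

Lemma tsc_mono d d' t : (d <= d')%N -> tsc d t -> tsc d' t.
Proof. by move=> h ht e l; apply: ht; exact: leq_trans l. Qed.
Lemma psc_mono d d' t : (d <= d')%N -> psc d t -> psc d' t.
Proof. by move=> h ht e k l; apply: ht; exact: leq_trans l. Qed.
Lemma isc_mono d d' t : (d <= d')%N -> isc d t -> isc d' t.
Proof. by move=> h ht e k l; apply: ht; exact: leq_trans l. Qed.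

Lemma tsc_lev d l : (l < d)%N -> tsc d (lev l).
Proof. by move=> h d' h' /=; lia. Qed.
Lemma tsc_num d n : tsc d (bnum n).
Proof. by move=> d' _; exact: tscoped_numeral. Qed.
Lemma tsc_S d t : tsc d t -> tsc d (bS t).
Proof. by move=> h d' /h. Qed.
Lemma tsc_add d t u : tsc d t -> tsc d u -> tsc d (badd t u).
Proof. by move=> h1 h2 d' l /=; rewrite h1 // h2. Qed.
Lemma tsc_mul d t u : tsc d t -> tsc d u -> tsc d (bmul t u).
Proof. by move=> h1 h2 d' l /=; rewrite h1 // h2. Qed.
Lemma fsc_eq d t u : tsc d t -> tsc d u -> fsc d (beq t u).
Proof. by move=> h1 h2 d' l /=; rewrite h1 // h2. Qed.
Lemma fsc_le d t u : tsc d t -> tsc d u -> fsc d (ble t u).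
Proof. by move=> h1 h2 d' l /=; rewrite h1 // h2. Qed.
Lemma fsc_bot d : fsc d bbot.
Proof. by []. Qed.
Lemma fsc_neg d f : fsc d f -> fsc d (bneg f).
Proof. by move=> h d' l /=; rewrite h. Qed.
Lemma fsc_imp d f g : fsc d f -> fsc d g -> fsc d (bimp f g).
Proof. by move=> h1 h2 d' l /=; rewrite h1 // h2. Qed.
Lemma fsc_and d f g : fsc d f -> fsc d g -> fsc d (band f g).
Proof. by move=> h1 h2 d' l /=; rewrite h1 // h2. Qed.
Lemma fsc_or d f g : fsc d f -> fsc d g -> fsc d (bor f g).
Proof. by move=> h1 h2 d' l /=; rewrite h1 // h2. Qed.
Lemma fsc_all d f : (forall d' t, (d <= d')%N -> tsc d' t -> fsc d' (f t)) ->
  fsc d (ball f).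
Proof. by move=> h d' l /=; apply: (h d'.+1) => //; [lia|exact: tsc_lev]. Qed.
Lemma fsc_ex d f : (forall d' t, (d <= d')%N -> tsc d' t -> fsc d' (f t)) ->
  fsc d (bex f).
Proof.
by move=> h d' l /=; rewrite !andbT; apply: (h d'.+1) => //; [lia|exact: tsc_lev].
Qed.
Lemma fsc_sub d a t : tsc d t -> fsc d (bsub a t).
Proof.
by have [k hk] := fscoped_ex a => h d' l; apply: fscoped_subst hk => i _; exact: h.
Qed.
Lemma psc_ret d t : tsc d t -> psc d (bret t).
Proof. by move=> h d' k l hk; apply: hk => //; exact: tsc_mono h. Qed.
Lemma psc_pair d p q : psc d p -> psc d q -> psc d (bpair p q).
Proof.
move=> hp hq d' k l hk; apply: (hp d') => // d1 t l1 ht.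
apply: (hq d1) => [|d2 u l2 hu]; first exact: leq_trans l1.
have {}ht := tsc_mono l2 ht.
apply: fsc_ex => d3 z l3 hz; have {}ht := tsc_mono l3 ht; have {}hu := tsc_mono l3 hu.
apply: fsc_and; last by apply: hk hz; exact: leq_trans l1 (leq_trans l2 l3).
apply: fsc_eq; first exact: tsc_add.
apply: tsc_add; last exact: tsc_add.
by apply: tsc_mul; [|apply: tsc_S]; exact: tsc_add.
Qed.
Lemma fsc_bind d p k : psc d p ->
  (forall d' t, (d <= d')%N -> tsc d' t -> fsc d' (k t)) -> fsc d (p k).
Proof. by move=> hp; apply: hp. Qed.
Lemma fsc_is d t p : tsc d t -> psc d p -> fsc d (bis t p).
Proof.
move=> ht hp; apply: (fsc_bind hp) => d' u l hu.
by apply: fsc_eq hu; exact: tsc_mono ht.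
Qed.
Lemma isc_use d In p : isc d In -> psc d p -> fsc d (In p).
Proof. by apply. Qed.

Ltac lift_sc :=
  repeat match goal with
  | L : is_true (?d <= ?d')%N, H : tsc ?d _ |- _ => apply (tsc_mono L) in H
  | L : is_true (?d <= ?d')%N, H : psc ?d _ |- _ => apply (psc_mono L) in H
  | L : is_true (?d <= ?d')%N, H : isc ?d _ |- _ => apply (isc_mono L) in H
  end;
  repeat match goal with L : is_true (_ <= _)%N |- _ => clear L end.
Ltac sc_intro := intros; lift_sc; cbv beta.
Ltac head_of f := lazymatch f with ?g _ => head_of g | _ => f end.

Lemma fsc_beta d a b i y : tsc d a -> tsc d b -> tsc d i -> tsc d y ->
  fsc d (beta a b i y).
Proof.
move=> h1 h2 h3 h4; apply: fsc_and; last first.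
  by apply: fsc_le => //; apply: tsc_mul => //; exact: tsc_S.
apply: fsc_ex; sc_intro; apply: fsc_eq => //; apply: tsc_add => //.
by apply: tsc_mul => //; apply: tsc_S; apply: tsc_mul => //; exact: tsc_S.
Qed.

Definition opsc (d : nat) (Phi : (bpoly -> bform) -> bterm -> bform) :=
  forall d' In t, (d <= d')%N -> isc d' In -> tsc d' t -> fsc d' (Phi In t).
Lemma opsc_mono d d' Phi : (d <= d')%N -> opsc d Phi -> opsc d' Phi.
Proof. by move=> h ht e k t l; apply: ht; exact: leq_trans l. Qed.

Lemma fsc_lfp d Phi p : psc d p -> opsc d Phi -> fsc d (lfp Phi p).
Proof.
move=> hp hPhi; apply: (fsc_bind hp) => d0 x l0 hx.
have {}hPhi := opsc_mono l0 hPhi; clear hp; lift_sc.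
apply: fsc_ex => d1 a l1 ha; have {}hPhi := opsc_mono l1 hPhi; lift_sc.
apply: fsc_ex => d2 b l2 hb; have {}hPhi := opsc_mono l2 hPhi; lift_sc.
apply: fsc_ex => d3 n l3 hn; have {}hPhi := opsc_mono l3 hPhi; lift_sc.
apply: fsc_and; first exact: fsc_beta.
apply: fsc_all => d4 i l4 hi; have {}hPhi := opsc_mono l4 hPhi; lift_sc.
apply: fsc_imp; first exact: fsc_le.
apply: fsc_ex => d5 y l5 hy; have {}hPhi := opsc_mono l5 hPhi; lift_sc.
apply: fsc_and; first exact: fsc_beta.
apply: hPhi => // d6 q l6 hq; apply: (fsc_bind hq); sc_intro.
apply: fsc_ex; sc_intro; apply: fsc_and; first by apply: fsc_le => //; exact: tsc_S.
exact: fsc_beta.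
Qed.

Ltac sc :=
  lazymatch goal with
  | H : tsc ?d ?t |- tsc ?d ?t => exact H
  | |- tsc _ (bnum _) => apply tsc_num
  | |- tsc _ (lev _) => apply tsc_lev; reflexivity
  | |- tsc _ (bS _) => apply tsc_S; sc
  | |- tsc _ (badd _ _) => apply tsc_add; [sc|sc]
  | |- tsc _ (bmul _ _) => apply tsc_mul; [sc|sc]
  | H : psc ?d ?p |- psc ?d ?p => exact H
  | |- psc _ (bpair _ _) => apply psc_pair; [sc|sc]
  | |- psc _ (bret _) => apply psc_ret; sc
  | |- psc _ ?p => let h := head_of p in unfold h; sc
  | |- fsc ?d ?f =>
     lazymatch f with
     | bex _ => apply fsc_ex; sc_intro; sc
     | ball _ => apply fsc_all; sc_intro; sc
     | band _ _ => apply fsc_and; [sc|sc]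
     | bor _ _ => apply fsc_or; [sc|sc]
     | bimp _ _ => apply fsc_imp; [sc|sc]
     | bneg _ => apply fsc_neg; sc
     | beq _ _ => apply fsc_eq; [sc|sc]
     | ble _ _ => apply fsc_le; [sc|sc]
     | bbot => exact (@fsc_bot d)
     | bis _ _ => apply fsc_is; [sc|sc]
     | beta _ _ _ _ => apply fsc_beta; [sc|sc|sc|sc]
     | bsub _ _ => apply fsc_sub; sc
     | bret ?t ?k => change (fsc d (k t)); cbv beta; sc
     | lfp _ _ => apply fsc_lfp; [sc|unfold opsc; sc_intro; sc]
     | _ => first
       [ match goal with H : isc d ?In |- fsc d (?In _) => apply (isc_use H); sc end
       | match goal with H : psc d ?p |- fsc d (?p _) => apply (fsc_bind H); sc_intro; sc end
       | let h := head_of f in unfold h; cbv beta zeta; sc ]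
     end
  end.

Lemma fsc_step l d p x y : tsc d p -> tsc d x -> tsc d y ->
  fsc d (b_iter_step axPA l p x y).
Proof. by move=> hp hx hy; sc. Qed.

Lemma fscoped_iter_diag l : fscoped 3 (iter_diag axPA l).
Proof.
have h0 : tsc 3 (lev 0) by exact: tsc_lev.
have h1 : tsc 3 (lev 1) by exact: tsc_lev.
have h2 : tsc 3 (lev 2) by exact: tsc_lev.
rewrite /iter_diag /build3; move: (leqnn 3); apply: (_ : fsc 3 _).
apply: fsc_ex; sc_intro; apply: fsc_ex; sc_intro.
apply: fsc_and; first by sc.
by apply: fsc_and; [sc|exact: fsc_step].
Qed.

#[global] Opaque iter_diag axPA diag_form.

Section Iteration.
Variables (M : PAmodel) (l : nat).
Implicit Types (x y z v w p q n : M) (r : nat -> M).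

Definition iter_code : nat := fcode (iter_diag axPA l).

Definition IterAxM x y : Prop :=
  msat (pcons y (pcons x (pcons (natM M iter_code) (fun=> 0)))) (iter_diag axPA l).

Lemma msat_iter_ax r : msat r (iter_ax axPA l) <-> IterAxM (r 1%N) (r 0%N).
Proof.
rewrite /iter_ax msat_subst /IterAxM /iter_code; move: (fcode _) => d.
apply: (msat_scoped (fscoped_iter_diag l)) => -[|[|[|i]]] // _.
by rewrite [up _ _]/= !num_shift meval_num.
Qed.

Definition StepM p x y : Prop :=
  LeqM (natM M l) x x /\
  (AxPAM y \/
   exists z, LeqM (natM M l) z x /\ ~ z = x /\
     exists n q, NumM z n /\ FsubstM 0 (natM M 1) n p q /\ IsRfnM q y).

Lemma iter_unfold x y : IterAxM x y <->
  exists n p, NumM (natM M iter_code) n /\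
    FsubstM 0 (natM M 2) n (natM M iter_code) p /\ StepM p x y.
Proof.
Transparent iter_diag.
rewrite /IterAxM; set r := pcons y _.
have h0 := @tden_lev_lt M 3 r 0 isT; have h1 := @tden_lev_lt M 3 r 1 isT.
have h2 := @tden_lev_lt M 3 r 2 isT.
apply: (@fden_here _ (Ctx 3 r)).
apply: fden_ex => n c1 tn l1 hn; apply: fden_ex => p c2 tp l2 hp; lift_den.
apply fden_and; first by den. apply fden_and; first by den.
apply fden_and; first by apply: den_le; den.
apply fden_or.
  apply: (@fden_iffK _ _ _ (msat (fun _ => y) axPA)); first by rewrite msat_axPA.
  exact: fden_sub.
apply: fden_ex => z c3 tz l3 hz; lift_den.
apply fden_and; first by apply: den_le; den.
apply fden_and; first by den.
apply: fden_ex => m c4 tm l4 hm; apply: fden_ex => q c5 tq l5 hq; lift_den.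
apply fden_and; first by den. apply fden_and; first by den.
by apply: den_isrfn; den.
Qed.
Opaque iter_diag.

Lemma subst_spec_iter r : subst_spec 0 2 (num iter_code) 3 r
  (up (up (inst (num iter_code)))) 2 r.
Proof.
move: iter_code => d.
by have := subst_spec_up (subst_spec_up (@subst_spec_inst M 0 r (num d)));
   rewrite !num_shift.
Qed.

(** The diagonalization inside the model: the code computed by the formula is that of
    [iter_ax] itself. *)
Lemma iter_self r : FsubstM 0 (natM M 2) (numc (natM M iter_code))
  (natM M iter_code) (fcl 2 r (iter_ax axPA l)).
Proof.
have := fsubst_code (iter_diag axPA l) (subst_spec_iter r) (fun _ => conj erefl erefl).
by rewrite tcl_num (fcl_std _ (fscoped_iter_diag l)).
Qed.

Lemma iter_step x y r : StepM (fcl 2 r (iter_ax axPA l)) x y -> IterAxM x y.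
Proof.
move=> h; apply/iter_unfold; exists (numc (natM M iter_code)); eexists.
by split; [exact: numcP|split; [exact: (iter_self r)|]].
Qed.

Lemma iter_PA x y : LeqM (natM M l) x x -> AxPAM y -> IterAxM x y.
Proof. by move=> hx hy; apply: (@iter_step _ _ (fun=> 0)); split=> //; left. Qed.

End Iteration.

(** Under the binders of [prv] the index of the theory has another number. *)
Definition renum (k i : nat) : nat := if i is j.+1 then (j + k)%N else 0%N.

(** With the numeral of an element [v] for variable 0 its code is, in the arithmetized
    sense, an instance of reflection for the theory attached to [v]. *)
Definition rfn_var (l : nat) (a : form) : form :=
  All (Imp (Ex (And (Eq (Var 0) (num (fcode a)))
    (Ex (And subst_num_form
       (prv (fsubst (fun i => Var (renum 8 i)) (iter_ax axPA l))))))) a).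

Section ReflectionInstance.
Variables (M : PAmodel) (l : nat) (a : form).
Hypothesis a1 : fscoped 1 a.
Implicit Types (x y z v w p q n : M) (r : nat -> M).

Lemma msat_subnum x p w r :
  msat (pcons w (pcons p (pcons x r))) subst_num_form <-> SubnumM x p w.
Proof.
pose r' := pcons w (pcons p (pcons x r)).
apply: (@fden_here _ (Ctx 3 r')); apply: den_subnum; exact: (@tden_lev_lt _ 3 r').
Qed.

Definition RfnM v : Prop := forall x w, SubnumM x (natM M (fcode a)) w ->
  PrvM (@IterAxM M l v) w -> msat (pcons x (fun=> 0)) a.

Lemma msat_rfn_gen tau v r :
  (forall y i n b e w p x, msat (pcons y (pcons i (pcons n (pcons b (pcons e
     (pcons w (pcons p (pcons x r)))))))) tau <-> IterAxM l v y) ->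
  msat r (rfn tau a) <-> RfnM v.
Proof.
move=> htau; rewrite /rfn.
have E1 x : msat (pcons x r) a <-> msat (pcons x (fun=> 0)) a.
  by apply: (msat_scoped a1) => -[].
have E2 x : msat (pcons x r) (Ex (And (Eq (Var 0) (num (fcode a)))
    (Ex (And subst_num_form (prv tau))))) <->
  exists w, SubnumM x (natM M (fcode a)) w /\ PrvM (@IterAxM M l v) w.
  rewrite msat_Ex.
  have E3 p w : msat (pcons w (pcons p (pcons x r))) (And subst_num_form (prv tau)) <->
      SubnumM x p w /\ PrvM (@IterAxM M l v) w.
    by rewrite msat_And msat_subnum (@msat_prv _ _ _ (@IterAxM M l v)).
  split=> [[p]|[w hw]].
    rewrite msat_And msat_Ex => -[Ep [w /E3 h]]; exists w.
    by move: Ep h; rewrite [msat _ _]/= meval_num => ->.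
  exists (natM M (fcode a)); rewrite msat_And msat_Ex; split; first by rewrite /= meval_num.
  by exists w; apply/E3.
split=> [h x w h1 h2|h x /E2 [w [h1 h2]]]; last by apply/E1; exact: h h1 h2.
by apply/E1/h/E2; exists w.
Qed.

Lemma msat_rfn_var v r : msat (pcons v r) (rfn_var l a) <-> RfnM v.
Proof.
apply: msat_rfn_gen => y i n b e w p x.
by rewrite msat_subst msat_iter_ax.
Qed.

Lemma msat_rfn_at k r : msat r (rfn (iter_ax_at axPA l k) a) <-> RfnM (natM M k).
Proof.
apply: msat_rfn_gen => y i n b e w p x.
rewrite /iter_ax_at msat_subst msat_iter_ax /=.
by rewrite num_shift meval_num.
Qed.

Lemma fcl_rfn_shape r (n : term) S D L P T b :
  fcl 0 r (All (Imp (Ex (And (Eq (Var 0) n) (Ex (And S (Ex (Ex (Ex (And D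
    (All (Imp L (Ex (And P T)))))))))))) b)) =
  cAllM (cImpM (cExM (cAndM (cEqM (tcl 2 r (Var 0)) (tcl 2 r n))
    (cExM (cAndM (fcl 3 r S) (cExM (cExM (cExM (cAndM (fcl 6 r D)
      (cAllM (cImpM (fcl 7 r L) (cExM (cAndM (fcl 8 r P) (fcl 8 r T)))))))))))))
    (fcl 1 r b)).
Proof. by rewrite /cExM /cAndM /cNegM. Qed.

Lemma rfn_is_rfn v r : IsRfnM (fcl 1 (pcons v r) (iter_ax axPA l))
  (fcl 0 (pcons v r) (rfn_var l a)).
Proof.
exists (cformM M a), (numc (cformM M a)); split.
  by rewrite -(@fcl_std M 1 r) //; exact: fscoped_code.
split; first exact: numcP.
have Eax : fcl 8 (pcons v r) (fsubst (fun i => Var (renum 8 i)) (iter_ax axPA l)) =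
    fcl 1 (pcons v r) (iter_ax axPA l).
  apply: fcl_rename => [[|i]|[|i]|[|i]] //=; rewrite ?addnK //; try by lia.
  by rewrite ltnNge leq_addl /= subn1.
rewrite /rfn_var /prv fcl_rfn_shape.
have h1 : fscoped 3 subst_num_form by vm_compute.
have h2 : fscoped 6 derivable_form by vm_compute.
have h3 : fscoped 8 premise_form by vm_compute.
have h4 : fscoped 7 (Le (Succ (Var 0)) (Var 1)) by [].
rewrite (fcl_std _ h1) (fcl_std _ h2) (fcl_std _ h3) (fcl_std _ h4) Eax.
by rewrite (fcl_std _ a1) tcl_num (@tcl_std _ 2 _ (Var 0)).
Qed.

Lemma iter_rfn v x r : LeqM (natM M l) v x -> v <> x -> LeqM (natM M l) x x ->
  IterAxM l x (fcl 0 (pcons v r) (rfn_var l a)).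
Proof.
move=> h1 h2 h3; apply: (@iter_step _ _ _ _ r); split=> //; right; exists v.
split=> //; split=> //; exists (numc v), (fcl 1 (pcons v r) (iter_ax axPA l)).
split; first exact: numcP; split; last exact: rfn_is_rfn.
have spec : subst_spec 0 1 (Var 1) 2 r Var 1 (pcons v r).
  move=> i; case: ltnP => hi.
    by case: i hi => [|[|i]].
  by exists i => //; case: i hi => [|[|i]] //= _; rewrite !subSS subn0.
have := fsubst_code (k3 := 1) (r3 := pcons v r) (iter_ax axPA l) spec
  (fun _ => conj erefl erefl).
by rewrite fsubst_id.
Qed.

End ReflectionInstance.

(** The assertion about the theories of the iteration that is derived from its own
    provability. *)
Definition refutes_below (l : nat) (d : form) : form :=
  fsubst (fun _ => Zero) (All (All (Imp
    (band (b_le (bnum l) (lev 1) (lev 0)) (bneg (beq (lev 1) (lev 0))) 2)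
    (Ex (And (b_subst_num (lev 1) (bnum (fcode (Neg d))) (lev 2) 3)
      (prv (fsubst (fun i => Var (renum 7 i)) (iter_ax axPA l)))))))).

Lemma fscoped_refutes l d : fscoped 0 (refutes_below l d).
Proof.
rewrite /refutes_below; set a := All _; have [k hk] := fscoped_ex a.
exact: fscoped_subst hk.
Qed.

Lemma msat_refutes (M : PAmodel) (r : nat -> M) l d :
  msat r (refutes_below l d) <->
  forall x v : M, LeqM (natM M l) v x -> v <> x ->
    exists w, SubnumM v (natM M (fcode (Neg d))) w /\ PrvM (IterAxM l x) w.
Proof.
rewrite /refutes_below msat_subst; set e := fun i => _.
have E1 x v : msat (pcons v (pcons x e))
    (band (b_le (bnum l) (lev 1) (lev 0)) (bneg (beq (lev 1) (lev 0))) 2) <->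
    LeqM (natM M l) v x /\ v <> x.
  apply: (@fden_here _ (Ctx 2 (pcons v (pcons x e)))).
  have h0 := @tden_lev_lt M 2 (pcons v (pcons x e)) 0 isT.
  have h1 := @tden_lev_lt M 2 (pcons v (pcons x e)) 1 isT.
  apply fden_and; first by apply: den_le; den.
  by apply fden_neg; apply fden_eq.
have E2 x v w : msat (pcons w (pcons v (pcons x e)))
    (b_subst_num (lev 1) (bnum (fcode (Neg d))) (lev 2) 3) <->
    SubnumM v (natM M (fcode (Neg d))) w.
  apply: (@fden_here _ (Ctx 3 (pcons w (pcons v (pcons x e))))).
  apply: den_subnum; [|exact: tden_num|].
  - exact: (@tden_lev_lt M 3 (pcons w (pcons v (pcons x e))) 1 isT).
  - exact: (@tden_lev_lt M 3 (pcons w (pcons v (pcons x e))) 2 isT).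
have E3 x v w : msat (pcons w (pcons v (pcons x e)))
    (prv (fsubst (fun i => Var (renum 7 i)) (iter_ax axPA l))) <->
    PrvM (IterAxM l x) w.
  by apply: msat_prv => y i n b a; rewrite msat_subst msat_iter_ax.
have E4 x v w := @msat_And M (pcons w (pcons v (pcons x e)))
  (b_subst_num (lev 1) (bnum (fcode (Neg d))) (lev 2) 3)
  (prv (fsubst (fun i => Var (renum 7 i)) (iter_ax axPA l))).
have E5 x v := @msat_Ex M (pcons v (pcons x e))
  (And (b_subst_num (lev 1) (bnum (fcode (Neg d))) (lev 2) 3)
    (prv (fsubst (fun i => Var (renum 7 i)) (iter_ax axPA l)))).
split=> h x v.
- move=> h1 h2; have /E5 [w /E4 [/E2 hw /E3 hp]] := h x v (iffRL (E1 x v) (conj h1 h2)).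
  by exists w.
- move=> /E1 [h1 h2]; have [w [hw hp]] := h x v h1 h2.
  by apply/E5; exists w; apply/E4; split; [apply/E2|apply/E3].
Qed.

Lemma prv_weaken (M : PAmodel) (S T : M -> Prop) x :
  (forall y, S y -> T y) -> PrvM S x -> PrvM T x.
Proof.
move=> h [a [b [n [hd H]]]]; exists a, b, n; split=> // i /H [y [hy Sy]].
by exists y; split=> //; exact: h.
Qed.

Section Descending.
Variables (l : nat) (d : form).
Hypothesis d1 : fscoped 1 d.
Let holds (M : PAmodel) (x : M) : Prop := msat (pcons x (fun=> 0)) d.
Hypothesis descend : forall (M : PAmodel) (x : M), holds x ->
  exists y : M, [/\ LeqM (natM M l) y x, y <> x & holds y].
Hypothesis refl : forall (M : PAmodel) (x y : M),
  LeqM (natM M l) y x -> LeqM (natM M l) x x.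

Let nd1 : fscoped 1 (Neg d).
Proof. by rewrite /= andbT. Qed.

Let neg_env (M : PAmodel) (r : nat -> M) : msat r (Neg d) <-> ~ holds (r 0%N).
Proof.
by rewrite [msat _ _]/= (@msat_scoped _ 1 r (pcons (r 0%N) (fun=> 0)) _ d1) // => -[].
Qed.

(** By Loeb's theorem: if the assertion is provable and v is below x, then the theory of x
    proves it together with reflection for the theory of v.  So it proves that [d] does
    not hold at v: otherwise [d] holds at some w below v, which the theory of v refutes,
    against reflection. *)
Lemma refutes_valid (M : PAmodel) (r : nat -> M) : msat r (refutes_below l d).
Proof.
move: M r; apply: loeb (fscoped_refutes l d) _ => M r hprov.
apply/msat_refutes => x v hvx nvx.
have hx := refl hvx.
exists (fcl 0 (pcons v r) (Neg d)); split.
- exists (numc v); split; first exact: numcP.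
  have := @finst_code M 0 (pcons v r) (Var 0) (Neg d).
  rewrite (fcl_std _ nd1); have -> : fsubst (inst (Var 0)) (Neg d) = Neg d.
    rewrite (@fsubst_scoped 1 _ Var) ?fsubst_id //.
    by case.
  by [].
- have tauPA y : AxPAM y -> IterAxM l x y by exact: iter_PA.
  have valid : proves PA (Imp (refutes_below l d) (Imp (rfn_var l (Neg d)) (Neg d))).
    apply: PA_complete => N e /msat_refutes h1 h2; apply/neg_env => hd.
    have [y [hy1 hy2 hy3]] := descend hd.
    have [w [hw1 hw2]] := h1 _ _ hy1 hy2.
    have h3 : RfnM l (Neg d) (e 0%N).
      apply/(@msat_rfn_var N l (Neg d) nd1 (e 0%N) (fun i => e i.+1)).
      refine (@msat_ext1 N e _ (rfn_var l (Neg d)) _ h2); by case.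
    by have /neg_env := h3 _ _ hw1 hw2; apply.
  have h1 := prv_PA tauPA 0 (pcons v r) valid.
  have h2 : PrvM (IterAxM l x) (fcl 0 (pcons v r) (refutes_below l d)).
    rewrite (fcl_std _ (fscoped_refutes l d)); exact: prv_weaken hprov.
  have h3 : PrvM (IterAxM l x) (fcl 0 (pcons v r) (rfn_var l (Neg d))).
    by apply: prv_ax; exact: iter_rfn.
  exact: prv_mp (prv_mp h1 h2) h3.
Qed.

(** If [d] holds at [top], then it holds below, where the theory of [top] refutes it. *)
Theorem reflection_refutes (M : PAmodel) (r : nat -> M) (top : nat) :
  msat r (rfn (iter_ax_at axPA l top) (Neg d)) -> ~ holds (natM M top).
Proof.
move=> /(msat_rfn_at _ nd1) h hd; have [y [hy1 hy2 hy3]] := descend hd.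
have [w [hw1 hw2]] := iffLR (msat_refutes r l d) (@refutes_valid M r) _ _ hy1 hy2.
by have /neg_env := h _ _ hw1 hw2; apply.
Qed.

End Descending.

(** * Definable predicates *)

Definition epred := forall M : PAmodel, (nat -> M) -> Prop.
Definition eterm := forall M : PAmodel, (nat -> M) -> M.

(** [DF b] holds of the predicates that are defined by the same formula in all models,
    by a bounded one if [b] is true; the environment supplies the arguments.  The values
    of the functions in [DT] are bounded by terms and have bounded graphs, so that they
    can be used like terms, although pairing and its inverses are not terms. *)
Definition DF (b : bool) (Q : epred) : Prop :=
  exists a, (b -> delta0 a) /\ forall (M : PAmodel) (r : nat -> M), msat r a <-> Q M r.

Definition DT (v : eterm) : Prop :=
  (exists t, forall (M : PAmodel) (r : nat -> M), v M r <= meval r t) /\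
  DF true (fun M r => r 0%N = v M (fun i => r i.+1)).

Lemma delta0_subst s a : delta0 a -> delta0 (fsubst s a).
Proof.
move=> h; elim: h s => {a} [t u|t u||a b _ IHa _ IHb|t a _ IHa] s /=;
  [exact: delta0_eq|exact: delta0_le|exact: delta0_bot|exact: delta0_imp|].
rewrite tsubst_comp (@tsubst_ext (fun i => tsubst (up s) (shift i))
  (fun i => tsubst shift (s i))) // -tsubst_comp; exact: delta0_all.
Qed.

Lemma df_iff b (P Q : epred) : (forall M r, P M r <-> Q M r) -> DF b P -> DF b Q.
Proof. by move=> E [a [h ha]]; exists a; split=> // M r; rewrite ha E. Qed.

Lemma df_bot b : DF b (fun _ _ => False).
Proof. by exists Bot; split=> // _; exact: delta0_bot. Qed.

Lemma df_imp b P Q : DF b P -> DF b Q -> DF b (fun M r => P M r -> Q M r).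
Proof.
move=> [a [h ha]] [c [g hc]]; exists (Imp a c); split.
  by move=> hb; apply: delta0_imp; [exact: h|exact: g].
by move=> M r; rewrite /= ha hc.
Qed.

Lemma df_neg b P : DF b P -> DF b (fun M r => ~ P M r).
Proof. by move=> h; apply: df_imp h (df_bot b). Qed.

Lemma df_and b P Q : DF b P -> DF b Q -> DF b (fun M r => P M r /\ Q M r).
Proof.
move=> h g; apply: df_iff (df_neg (df_imp h (df_neg g))) => M r; tauto.
Qed.

Lemma df_or b P Q : DF b P -> DF b Q -> DF b (fun M r => P M r \/ Q M r).
Proof.
move=> h g; apply: df_iff (df_imp (df_neg h) g) => M r.
by split; [move=> H; have [|] := classic (P M r); tauto|tauto].
Qed.

Lemma df_equiv b P Q : DF b P -> DF b Q -> DF b (fun M r => P M r <-> Q M r).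
Proof. by move=> h g; apply: df_and; apply: df_imp. Qed.

Lemma df_ren b (s : nat -> nat) Q : DF b Q -> DF b (fun M r => Q M (fun i => r (s i))).
Proof.
move=> [a [h ha]]; exists (fsubst (fun i => Var (s i)) a); split.
  by move=> hb; apply/delta0_subst/h.
by move=> M r; rewrite msat_subst ha.
Qed.

Lemma df_weak Q : DF true Q -> forall b, DF b Q.
Proof. by move=> [a [h ha]] b; exists a; split=> // _; exact: h. Qed.

Lemma df_all Q : DF false (fun M r => Q M (fun i => r i.+1) (r 0%N)) ->
  DF false (fun M r => forall x, Q M r x).
Proof.
move=> [a [_ ha]]; exists (All a); split=> // M r /=.
by split=> h x; [exact/(ha M (pcons x r))/h|apply/(ha M (pcons x r)); exact: h].
Qed.

Lemma df_ex Q : DF false (fun M r => Q M (fun i => r i.+1) (r 0%N)) ->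
  DF false (fun M r => exists x, Q M r x).
Proof.
move=> h; apply: df_iff (df_neg (df_all (Q := fun M r x => ~ Q M r x) (df_neg h))) => M r.
split=> [H|[x hx]]; last by move/(_ x); tauto.
by apply: NNPP => H'; apply: H => x hx; apply: H'; exists x.
Qed.

Lemma df_teq b t u : DF b (fun M r => meval r t = meval r u).
Proof. by exists (Eq t u); split=> // _; exact: delta0_eq. Qed.

Lemma df_tle b t u : DF b (fun M r => meval r t <= meval r u).
Proof. by exists (Le t u); split=> // _; exact: delta0_le. Qed.

Lemma df_tball b t Q : DF b (fun M r => Q M (fun i => r i.+1) (r 0%N)) ->
  DF b (fun M r => forall x, x <= meval r t -> Q M r x).
Proof.
move=> [a [h ha]]; exists (All (Imp (Le (Var 0) (tsubst shift t)) a)); split.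
  by move=> hb; apply/delta0_all/h.
move=> M r /=; have E x : meval (pcons x r) (tsubst shift t) = meval r t.
  by rewrite meval_subst.
by split=> H x; have := H x; rewrite E => {}H /H /(ha M (pcons x r)).
Qed.

Lemma dt_var k : DT (fun M r => r k).
Proof.
split; first by exists (Var k) => M r; exact: le_refl.
exact: (df_teq true (Var 0) (Var k.+1)).
Qed.

(** A definable value may be bound by a quantifier before it is used. *)
Lemma df_let b v (Q : forall M : PAmodel, (nat -> M) -> M -> Prop) : DT v ->
  DF b (fun M r => Q M (fun i => r i.+1) (r 0%N)) ->
  DF b (fun M r => Q M r (v M r)).
Proof.
move=> [[t ht] g] hQ.
apply: df_iff (@df_tball b t (fun M r x => x = v M r -> Q M r x) _) => [M r|].
  by split=> [h|h x _ ->] //; apply: h => //.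
by apply: df_imp hQ; exact: df_weak.
Qed.

Lemma df_app1 b (P : forall M : PAmodel, M -> Prop) v :
  DF b (fun M r => P M (r 0%N)) -> DT v -> DF b (fun M r => P M (v M r)).
Proof. by move=> hP hv; exact: (df_let (Q := fun M r x => P M x) hv). Qed.

Lemma dt_shift v : DT v -> DT (fun M r => v M (fun i => r i.+1)).
Proof.
move=> [[t ht] g]; split.
  by exists (tsubst shift t) => M r; rewrite meval_subst.
exact: (df_ren (fun i => if i is j.+1 then j.+2 else 0%N) g).
Qed.

Lemma df_app2 b (P : forall M : PAmodel, M -> M -> Prop) v w :
  DF b (fun M r => P M (r 0%N) (r 1%N)) -> DT v -> DT w ->
  DF b (fun M r => P M (v M r) (w M r)).
Proof.
move=> hP hv hw; apply: (df_let (Q := fun M r x => P M x (w M r)) hv).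
apply: (df_let (Q := fun M r x => P M (r 0%N) x) (dt_shift hw)).
exact: (df_ren (fun i => if i == 0%N then 1%N else 0%N) hP).
Qed.

Lemma df_app3 b (P : forall M : PAmodel, M -> M -> M -> Prop) v w u :
  DF b (fun M r => P M (r 0%N) (r 1%N) (r 2%N)) -> DT v -> DT w -> DT u ->
  DF b (fun M r => P M (v M r) (w M r) (u M r)).
Proof.
move=> hP hv hw hu.
apply: (df_let (Q := fun M r x => P M x (w M r) (u M r)) hv).
apply: (df_let (Q := fun M r x => P M (r 0%N) x (u M (fun i => r i.+1))) (dt_shift hw)).
apply: (df_let (Q := fun M r x => P M (r 1%N) (r 0%N) x) (dt_shift (dt_shift hu))).
exact: (df_ren (fun i => if i == 0%N then 2%N else if i == 1%N then 1%N else 0%N) hP).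
Qed.

Lemma df_eq b v w : DT v -> DT w -> DF b (fun M r => v M r = w M r).
Proof. exact: (@df_app2 b (fun M x y => x = y) v w (df_teq b (Var 0) (Var 1))). Qed.

Lemma df_le b v w : DT v -> DT w -> DF b (fun M r => v M r <= w M r).
Proof. exact: (@df_app2 b (fun M x y => x <= y) v w (df_tle b (Var 0) (Var 1))). Qed.

Lemma df_ball b v Q : DT v -> DF b (fun M r => Q M (fun i => r i.+1) (r 0%N)) ->
  DF b (fun M r => forall x, x <= v M r -> Q M r x).
Proof.
move=> hv hQ; apply: (df_let (Q := fun M r y => forall x, x <= y -> Q M r x) hv).
apply: (@df_tball b (Var 0) (fun M r x => Q M (fun i => r i.+1) x)).
exact: (df_ren (fun i => if i is j.+1 then j.+2 else 0%N) hQ).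
Qed.

Lemma df_bex b v Q : DT v -> DF b (fun M r => Q M (fun i => r i.+1) (r 0%N)) ->
  DF b (fun M r => exists x, x <= v M r /\ Q M r x).
Proof.
move=> hv hQ.
apply: df_iff (df_neg (df_ball (Q := fun M r x => ~ Q M r x) hv (df_neg hQ))) => M r.
split=> [H|[x [h hx]]]; last by move/(_ x h).
by apply: NNPP => H'; apply: H => x h hx; apply: H'; exists x.
Qed.

Lemma df_ball_lt b v Q : DT v -> DF b (fun M r => Q M (fun i => r i.+1) (r 0%N)) ->
  DF b (fun M r => forall x, x < v M r -> Q M r x).
Proof.
move=> hv hQ.
apply: df_iff (df_ball (Q := fun M r x => x < v M r -> Q M r x) hv _) => [M r|].
  by split=> [h x l|h x _]; [apply: h => //; exact: lt_le|exact: h].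
apply: df_imp hQ; apply: (@df_app2 b (fun M x y => x < y) _ _ _ (dt_var 0) (dt_shift hv)).
exact: (df_tle b (Succ (Var 0)) (Var 1)).
Qed.

Lemma dt_S v : DT v -> DT (fun M r => sS (v M r)).
Proof.
move=> hv; split.
  by have [[t ht] _] := hv; exists (Succ t) => M r /=; apply/le_SS.
apply: (@df_app2 true (fun M x y => x = sS y) _ _ _ (dt_var 0) (dt_shift hv)).
exact: (df_teq true (Var 0) (Succ (Var 1))).
Qed.

Lemma dt_num n : DT (fun M r => natM M n).
Proof.
split; first by exists (num n) => M r; rewrite meval_num; exact: le_refl.
apply: df_iff (df_teq true (Var 0) (num n)) => M r; by rewrite meval_num.
Qed.

Lemma dt_0 : DT (fun M r => 0).
Proof. exact: (dt_num 0). Qed.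

Lemma dt_add v w : DT v -> DT w -> DT (fun M r => v M r + w M r).
Proof.
move=> hv hw; split.
  have [[[t ht] _] [[u hu] _]] := (hv, hw); exists (Add t u) => M r /=; exact: le_add2.
apply: (@df_app3 true (fun M x y z => x = y + z) _ _ _ _ (dt_var 0)
  (dt_shift hv) (dt_shift hw)).
exact: (df_teq true (Var 0) (Add (Var 1) (Var 2))).
Qed.

Lemma dt_mul v w : DT v -> DT w -> DT (fun M r => v M r * w M r).
Proof.
move=> hv hw; split.
  have [[[t ht] _] [[u hu] _]] := (hv, hw); exists (Mul t u) => M r /=; exact: le_mul2.
apply: (@df_app3 true (fun M x y z => x = y * z) _ _ _ _ (dt_var 0)
  (dt_shift hv) (dt_shift hw)).
exact: (df_teq true (Var 0) (Mul (Var 1) (Var 2))).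
Qed.

Lemma dt_pair v w : DT v -> DT w -> DT (fun M r => ⟪v M r, w M r⟫).
Proof.
move=> hv hw; split.
  have [[[t ht] _] [[u hu] _]] := (hv, hw).
  exists (Add (Mul (Add t u) (Succ (Add t u))) (Add u u)) => M r.
  apply: (le_trans (pair_le (ht M r) (hu M r))) => /=.
  by rewrite -pairE; exact: le_add.
apply: (@df_app3 true (fun M x y z => x = ⟪y, z⟫) _ _ _ _ (dt_var 0)
  (dt_shift hv) (dt_shift hw)).
set s := Add (Var 1) (Var 2).
apply: df_iff (df_teq true (Add (Var 0) (Var 0))
  (Add (Mul s (Succ s)) (Add (Var 2) (Var 2)))) => M r.
by rewrite pair_eq.
Qed.

(* Solves definability goals following the shape of the predicate; [df_hook] and
   [dt_hook] are extended as predicates are introduced. *)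
Ltac df_hook := fail.
Ltac dt_hook := fail.
Ltac dt := lazymatch goal with
  | |- DT (fun M r => r _) => apply dt_var
  | |- DT (fun M r => 0) => apply dt_0
  | |- DT (fun M r => natM _ _) => apply dt_num
  | |- DT (fun M r => sS _) => apply dt_S; dt
  | |- DT (fun M r => s_add _ _) => apply dt_add; [dt|dt]
  | |- DT (fun M r => s_mul _ _) => apply dt_mul; [dt|dt]
  | |- DT (fun M r => pairM _ _) => apply dt_pair; [dt|dt]
  | _ => first [eassumption | dt_hook]
  end.
Ltac df := lazymatch goal with
  | |- DF _ (fun M r => False) => apply df_bot
  | |- DF _ (fun M r => ~ _) => apply df_neg; df
  | |- DF _ (fun M r => _ /\ _) => apply df_and; [df|df]
  | |- DF _ (fun M r => _ \/ _) => apply df_or; [df|df]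
  | |- DF _ (fun M r => _ <-> _) => apply df_equiv; [df|df]
  | |- DF _ (fun M r => _ = _) => apply df_eq; [dt|dt]
  | |- DF _ (fun M r => s_le _ _) => apply df_le; [dt|dt]
  | |- DF _ (fun M r => exists x, s_le x _ /\ _) =>
      refine (@df_bex _ _ (fun M r x => _) _ _); [dt|cbv beta; df]
  | |- DF _ (fun M r => forall x, s_le (sS x) _ -> _) =>
      refine (@df_ball_lt _ _ (fun M r x => _) _ _); [dt|cbv beta; df]
  | |- DF _ (fun M r => forall x, s_le x _ -> _) =>
      refine (@df_ball _ _ (fun M r x => _) _ _); [dt|cbv beta; df]
  | |- DF false (fun M r => exists x, _) =>
      refine (@df_ex (fun M r x => _) _); cbv beta; df
  | |- DF false (fun M r => forall x : car _, _) =>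
      refine (@df_all (fun M r x => _) _); cbv beta; df
  | |- DF _ (fun M r => _ -> _) => apply df_imp; [df|df]
  | _ => first [eassumption | df_hook]
  end.

Lemma df_beta b va vb vi vy : DT va -> DT vb -> DT vi -> DT vy ->
  DF b (fun M r => betaM (va M r) (vb M r) (vi M r) (vy M r)).
Proof.
move=> ha hb hi hy; rewrite /betaM; apply df_and; last by df.
apply: (@df_iff _ (fun M r => exists q, q <= va M r /\
   va M r = q * sS (sS (vi M r) * vb M r) + vy M r)) => [M r|].
  split=> [[q [_ E]]|[q E]]; exists q => //; split=> //.
  rewrite E; apply: le_trans (le_add _ _); apply: le_mulr; exact: succ_neq0.
have := (dt_shift ha, dt_shift hb, dt_shift hi, dt_shift hy).
move=> [[[ha' hb'] hi'] hy'].
by df.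
Qed.

Lemma df_ind (Q : epred) (M : PAmodel) (r : nat -> M) : DF false Q ->
  Q M (pcons 0 r) -> (forall x, Q M (pcons x r) -> Q M (pcons (sS x) r)) ->
  forall x, Q M (pcons x r).
Proof.
move=> [a [_ ha]] h0 hS x.
have := @paP M _ r (PA_induction a); rewrite /= !msat_subst => H.
apply/ha; move: x; apply: H.
- move/ha: h0; apply: msat_ext1; by case.
- move=> x hx; rewrite msat_subst.
  have /ha := hS x (iffLR (ha _ _) hx); apply: msat_ext1; by case.
Qed.

Lemma df_least (Q : epred) (M : PAmodel) (r : nat -> M) x : DF false Q ->
  Q M (pcons x r) ->
  exists2 y, Q M (pcons y r) & forall z, z < y -> ~ Q M (pcons z r).
Proof.
move=> hQ hx; apply: NNPP => N.
pose P : epred := fun M r => forall y, y <= r 0%N -> ~ Q M (pcons y (fun i => r i.+1)).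
have hP : DF false P.
  apply: (@df_ball _ _ (fun M r y => ~ Q M (pcons y (fun i => r i.+1))) (dt_var 0)).
  apply: df_neg; apply: df_iff (df_ren (fun i => if i is j.+1 then j.+2 else 0%N) hQ).
  move=> M' r'; have -> // : (fun i => r' (if i is j.+1 then j.+2 else 0%N)) =
    pcons (r' 0%N) (fun i => r' i.+2).
  by apply: functional_extensionality; case.
have : P M (pcons x r).
  apply: (df_ind hP) => [y /(le_antisym (le0x y)) <- h0|y IH z hz hQz].
    by apply: N; exists 0 => // z /ltx0.
  have [l|l] := le_or_lt z y; first exact: IH hQz.
  apply: N; exists z => // w hw; apply: IH.
  by apply/ltSx_le; apply: lt_le_trans hw _.
by move/(_ x (le_refl x)); apply.
Qed.

(** * Codes of sequences *)

Section Sequences.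
Variable M : PAmodel.
Implicit Types (a b c i j v w n x y z : M).

Definition lenM c : M := sndM c.
Definition EntM c i v : Prop := i < lenM c /\ betaM (fstM (fstM c)) (sndM (fstM c)) i v.
Definition SameM c c' : Prop := lenM c = lenM c' /\
  forall i, i < lenM c -> forall v, v <= c -> EntM c i v -> EntM c' i v.
(** Only the least code of a sequence is admitted, so that equality of codes is equality
    of sequences. *)
Definition CanM c : Prop := forall c', c' < c -> ~ SameM c' c.

Lemma fst_le c : fstM c <= c.
Proof. by have [x [y ->]] := pair_surj c; rewrite fst_pair; exact: pair_ge1. Qed.

Lemma snd_le c : sndM c <= c.
Proof. by have [x [y ->]] := pair_surj c; rewrite snd_pair; exact: pair_ge2. Qed.

Lemma len_le c : lenM c <= c.
Proof. exact: snd_le. Qed.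

Lemma ent_le c i v : EntM c i v -> v <= c.
Proof.
move=> [_ [[q E] _]]; apply: (le_trans _ (fst_le c)); apply: (le_trans _ (fst_le _)).
by rewrite E addC; exact: le_add.
Qed.

Lemma ent_ex c i : i < lenM c -> exists v, EntM c i v.
Proof. by move=> h; have [v hv] := beta_ex (fstM (fstM c)) (sndM (fstM c)) i; exists v. Qed.

Lemma ent_uniq c i v w : EntM c i v -> EntM c i w -> v = w.
Proof. by move=> [_ h] [_ g]; exact: beta_uniq h g. Qed.

Lemma sameE c c' : SameM c c' <->
  lenM c = lenM c' /\ forall i v, EntM c i v <-> EntM c' i v.
Proof.
split=> [[E h]|[E h]]; split=> // i.
- move=> v; split=> H; first by apply: h => //; [case: H|exact: ent_le H].
  have [w hw] : exists w, EntM c i w by apply: ent_ex; rewrite E; case: H.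
  have := h i hw.1 w (ent_le hw) hw => /(ent_uniq H) E'; by rewrite E'.
- by move=> _ v _ /h.
Qed.

Lemma can_same c c' : CanM c -> CanM c' -> SameM c c' -> c = c'.
Proof.
move=> h h' H; have H' : SameM c' c by apply/sameE; case/sameE: H => -> H; split=> // i v; rewrite H.
by have [l|[//|l]] := lt_trichotomy c c'; [case: (h' _ l)|case: (h _ l)].
Qed.

Lemma can_ext c c' : CanM c -> CanM c' -> lenM c = lenM c' ->
  (forall i v, EntM c i v -> EntM c' i v) -> c = c'.
Proof. by move=> h h' E H; apply: can_same => //; split=> // i _ v _; exact: H. Qed.

Lemma can0 : CanM 0.
Proof. by move=> c /ltx0. Qed.

Lemma len0 : lenM 0 = 0.
Proof. by rewrite /lenM -{1}(pair00 M) snd_pair. Qed.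

Lemma ent0 i v : ~ EntM 0 i v.
Proof. by rewrite /EntM len0 => -[/ltx0]. Qed.

Lemma len_eq0 c : CanM c -> lenM c = 0 -> c = 0.
Proof.
move=> h E; apply: can_ext => //; rewrite ?len0 //; first exact: can0.
by move=> i v [+ _]; rewrite E => /ltx0.
Qed.

End Sequences.

Lemma dt_fst v : DT v -> DT (fun M r => fstM (v M r)).
Proof.
move=> hv; split.
  by have [[t ht] _] := hv; exists t => M r; apply: le_trans (fst_le _) (ht M r).
apply: (@df_app2 true (fun M x y => x = fstM y) _ _ _ (dt_var 0) (dt_shift hv)).
apply: (@df_iff _ (fun M r => exists y, y <= r 1%N /\ r 1%N = ⟪r 0%N, y⟫)); last by df.
move=> M r; split=> [[y [_ ->]]|->]; first by rewrite fst_pair.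
exists (sndM (r 1%N)); split; first exact: snd_le.
by have [x [y ->]] := pair_surj (r 1%N); rewrite fst_pair snd_pair.
Qed.

Lemma dt_snd v : DT v -> DT (fun M r => sndM (v M r)).
Proof.
move=> hv; split.
  by have [[t ht] _] := hv; exists t => M r; apply: le_trans (snd_le _) (ht M r).
apply: (@df_app2 true (fun M x y => x = sndM y) _ _ _ (dt_var 0) (dt_shift hv)).
apply: (@df_iff _ (fun M r => exists y, y <= r 1%N /\ r 1%N = ⟪y, r 0%N⟫)); last by df.
move=> M r; split=> [[y [_ ->]]|->]; first by rewrite snd_pair.
exists (fstM (r 1%N)); split; first exact: fst_le.
by have [x [y ->]] := pair_surj (r 1%N); rewrite fst_pair snd_pair.
Qed.

Ltac dt_hook ::= lazymatch goal with
  | |- DT (fun M r => fstM _) => apply dt_fst; dt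
  | |- DT (fun M r => sndM _) => apply dt_snd; dt
  | |- DT (fun M r => lenM _) => apply dt_snd; dt
  end.

Lemma df_ent b vc vi vv : DT vc -> DT vi -> DT vv ->
  DF b (fun M r => EntM (vc M r) (vi M r) (vv M r)).
Proof. by move=> hc hi hv; apply df_and; [df|apply: df_beta; dt]. Qed.

Ltac df_hook1 := fail.
Ltac df_hook ::= lazymatch goal with
  | |- DF _ (fun M r => EntM _ _ _) => apply df_ent; [dt|dt|dt]
  | |- DF _ (fun M r => betaM _ _ _ _) => apply df_beta; [dt|dt|dt|dt]
  | _ => df_hook1
  end.

Lemma df_same b v w : DT v -> DT w -> DF b (fun M r => SameM (v M r) (w M r)).
Proof.
apply: (@df_app2 b (fun M x y => SameM x y)); rewrite /SameM; df.
Qed.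

Lemma df_can b v : DT v -> DF b (fun M r => CanM (v M r)).
Proof.
apply: (@df_app1 b (fun M x => CanM x)).
apply: (@df_ball_lt b _ (fun M r c' => ~ SameM c' (r 0%N)) (dt_var 0)).
by apply: df_neg; apply: df_same; dt.
Qed.

Ltac df_hook1 ::= lazymatch goal with
  | |- DF _ (fun M r => SameM _ _) => apply df_same; [dt|dt]
  | |- DF _ (fun M r => CanM _) => apply df_can; dt
  end.

Section Building.
Variable M : PAmodel.
Implicit Types (a b c i j v w n x y z : M).

Lemma can_of c : exists2 c', CanM c' & SameM c' c.
Proof.
have hD : DF false (fun M r => SameM (r 0%N) (r 1%N)) by df.
have hc : SameM c c by apply/sameE.
have [c' h1 h2] := df_least (r := pcons c (fun=> 0)) hD hc; exists c' => //.
move=> d hd /sameE [E H]; case: (h2 _ hd); apply/sameE.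
by case/sameE: h1 => E' H'; split=> [|i v]; rewrite ?E // H.
Qed.

Lemma can_code a b n : exists c, [/\ CanM c, lenM c = n &
  forall i v, EntM c i v <-> i < n /\ betaM a b i v].
Proof.
have [c h /sameE [E H]] := can_of ⟪⟪a, b⟫, n⟫.
rewrite /lenM snd_pair in E; exists c; split=> // i v.
by rewrite H /EntM /lenM snd_pair fst_pair fst_pair snd_pair.
Qed.

Lemma can_append c x : exists c', [/\ CanM c', lenM c' = sS (lenM c),
  (forall i v, EntM c i v -> EntM c' i v) & EntM c' (lenM c) x].
Proof.
have [a [b [h1 h2]]] := beta_append (fstM (fstM c)) (sndM (fstM c)) (lenM c) x.
have [c' [h3 h4 h5]] := can_code a b (sS (lenM c)); exists c'; split=> //.
- move=> i v [hi hv]; apply/h5; split; last exact: h1.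
  by apply/ltSx_le; exact: lt_le.
- by apply/h5; split=> //; exact: le_refl.
Qed.

(** Comprehension: a definable choice of entries can be collected. *)
Lemma seq_collect (Q : epred) (r : nat -> M) n : DF false Q ->
  (forall i, i < n -> exists v, Q M (pcons v (pcons i r))) ->
  exists c, [/\ CanM c, lenM c = n &
    forall i v, EntM c i v -> Q M (pcons v (pcons i r))].
Proof.
move=> hQ hn.
pose P : epred := fun M r => r 0%N <= r 1%N -> exists (a : M), exists (b : M),
  forall (i : M), i < r 0%N -> exists (v : M), betaM a b i v /\ Q M (pcons v (pcons i (fun k : nat => r k.+2))).
have hP : DF false P.
  apply: df_imp; first by df.
  refine (@df_ex (fun M r (a : M) => _) _); refine (@df_ex (fun M r (b : M) => _) _).
  refine (@df_ball_lt _ _ (fun M r (i : M) => _) _ _); first by dt.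
  refine (@df_ex (fun M r (v : M) => _) _); apply: df_and; first by df.
  apply: df_iff (df_ren (fun i : nat => if i is i'.+2 then i'.+4.+2 else i) hQ) => M' r'.
  have -> // : (fun i : nat => r' (if i is i'.+2 then i'.+4.+2 else i)) =
    pcons (r' 0%N) (pcons (r' 1%N) (fun i : nat => r' i.+2.+4)).
  by apply: functional_extensionality; case=> // -[].
have H : forall k, P M (pcons k (pcons n r)).
  apply: (df_ind hP) => [_|k IH hk]; first by exists 0, 0 => i /ltx0.
  have [a [b h]] := IH (lt_le hk); have [v hv] := hn k hk.
  have [a' [b' [h1 h2]]] := beta_append a b k v; exists a', b' => i.
  move=> /ltSx_le /le_eq_lt [->|hi]; first by exists v.
  by have [w [hw Qw]] := h i hi; exists w; split=> //; exact: h1.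
have [a [b h]] := H n (le_refl n); have [c [h1 h2 h3]] := can_code a b n.
exists c; split=> // i v /h3 [hi hb]; have [w [hw Qw]] := h i hi.
by rewrite (beta_uniq hb hw).
Qed.

End Building.

(** * Prenex classes and unique witnesses *)

Definition upred := forall M : PAmodel, M -> Prop.

Lemma meval_mono (M : PAmodel) (r r' : nat -> M) t :
  (forall i, r i <= r' i) -> meval r t <= meval r' t.
Proof.
move=> h; elim: t => [i||t IH|t IHt u IHu|t IHt u IHu] //=.
- exact: le_refl.
- exact/le_SS.
- exact: le_add2.
- exact: le_mul2.
Qed.

Lemma dt_app1 (f : forall M : PAmodel, M -> M) v :
  DT (fun M r => f M (r 0%N)) -> DT v -> DT (fun M r => f M (v M r)).
Proof.
move=> [[t ht] g] hv; split.
  have [[u hu] _] := hv; exists (tsubst (fun i => if i is j.+1 then Var j else u) t).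
  move=> M r; rewrite meval_subst.
  apply: le_trans (ht M (pcons (v M r) r)) _; apply: meval_mono => -[|i] //=.
  exact: le_refl.
exact: (@df_app2 true (fun M x y => x = f M y) _ _ g (dt_var 0) (dt_shift hv)).
Qed.

Lemma df_true b : DF b (fun _ _ => True).
Proof. apply: df_iff (df_neg (df_bot b)) => M r; tauto. Qed.

(** [m] alternations of quantifiers in front of a bounded formula, each universal
    quantifier followed by an existential one; with [u] the witnesses for the latter are
    unique. *)
Fixpoint alt (u : bool) (m : nat) (P : upred) : Prop :=
  if m is m'.+1 then
    exists R : upred, [/\ alt u m' R,
      forall (M : PAmodel) (x : M), P M x <-> forall p, exists q, R M ⟪⟪x, p⟫, q⟫ &
      u -> forall (M : PAmodel) (z q q' : M), R M ⟪z, q⟫ -> R M ⟪z, q'⟫ -> q = q']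
  else DF true (fun M r => P M (r 0%N)).

Lemma alt_iff u m P Q : (forall M x, P M x <-> Q M x) -> alt u m P -> alt u m Q.
Proof.
case: m => [|m] E; first by apply: df_iff => M r; exact: E.
by move=> [R [h1 h2 h3]]; exists R; split=> // M x; rewrite -E h2.
Qed.

(** The bounded quantifier joins the outermost universal one.  Where the premise fails
    the witness is required to be 0, to keep it unique. *)
Lemma alt_ball u m (P G : upred) (H : forall M : PAmodel, M -> M -> Prop)
    (t : forall M : PAmodel, M -> M) :
  alt u m P -> DF true (fun M r => G M (r 0%N)) ->
  DF true (fun M r => H M (r 0%N) (r 1%N)) -> DT (fun M r => t M (r 0%N)) ->
  alt u m (fun M x => G M x /\ forall y, y <= t M x -> H M x y -> P M y).
Proof.
elim: m P G H t => [|m IH] P G H t hP hG hH ht.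
  apply df_and => //; refine (@df_ball _ _ (fun M r y => _) ht _).
  apply: df_imp; last exact: (df_app1 hP (dt_var 0)).
  exact: (df_app2 hH (dt_var 1) (dt_var 0)).
have [R [hR ER UR]] := hP.
pose x (M : PAmodel) (w : pa_str M) := fstM (fstM w);
  pose y (M : PAmodel) (w : pa_str M) := fstM (sndM (fstM w)).
pose p (M : PAmodel) (w : pa_str M) := sndM (sndM (fstM w));
  pose q (M : PAmodel) (w : pa_str M) := sndM w.
have hx : DT (fun M r => x M (r 0%N)) by rewrite /x; dt.
have hy : DT (fun M r => y M (r 0%N)) by rewrite /y; dt.
have hA : DF true (fun M r => y M (r 0%N) <= t M (x M (r 0%N)) /\
    H M (x M (r 0%N)) (y M (r 0%N))).
  apply: df_and; first by apply: df_le => //; exact: (dt_app1 ht hx).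
  exact: (df_app2 hH hx hy).
pose A (M : PAmodel) (w : pa_str M) := y M w <= t M (x M w) /\ H M (x M w) (y M w).
have {}IH := IH R
  (fun M w => G M (x M w) /\ (A M w \/ q M w = 0))
  (fun M w z => A M w /\ z = ⟪⟪y M w, p M w⟫, q M w⟫)
  (fun M w => ⟪⟪y M w, p M w⟫, q M w⟫) hR.
exists (fun M w => (G M (x M w) /\ (A M w \/ q M w = 0)) /\
   forall z, z <= ⟪⟪y M w, p M w⟫, q M w⟫ -> A M w /\ z = ⟪⟪y M w, p M w⟫, q M w⟫ ->
     R M z).
have E (M : PAmodel) (x' p' q' : M) : let w := ⟪⟪x', p'⟫, q'⟫ in
    [/\ x M w = x', y M w = fstM p', p M w = sndM p' & q M w = q'].
  by rewrite /= /x /y /p /q !(fst_pair, snd_pair).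
split.
- apply: IH.
  + apply: df_and; first exact: (df_app1 hG hx).
    by apply: df_or => //; rewrite /q; df.
  + apply: df_and; last by rewrite /y /p /q; df.
    exact: (df_app1 (P := A) hA (dt_var 0)).
  + by rewrite /y /p /q; dt.
- move=> M x0; split.
  + move=> [g h] p'; have [hA'|nA] := classic (fstM p' <= t M x0 /\ H M x0 (fstM p')).
      have [q' Rq] := iffLR (ER M _) (h _ hA'.1 hA'.2) (sndM p').
      exists q'; have [-> -> -> ->] := E M x0 p' q'; rewrite /A.
      have [-> -> _ _] := E M x0 p' q'.
      by split; [split=> //; left|move=> z _ [_ ->]].
    exists 0; have [-> -> -> ->] := E M x0 p' 0; rewrite /A.
    have [-> -> _ _] := E M x0 p' 0.
    by split; [split=> //; right|move=> z _ [/nA]].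
  + move=> h; split.
      have [q' [[+ _] _]] := h 0; by have [-> _ _ _] := E M x0 0 q'.
    move=> z hz Hz; apply/ER => p'.
    have [q' [_ +]] := h ⟪z, p'⟫; rewrite /A.
    have [-> -> -> ->] := E M x0 ⟪z, p'⟫ q'; rewrite fst_pair snd_pair.
    by move=> h'; exists q'; apply: h' => //; exact: le_refl.
- move=> hu M z q1 q2.
  have [x' [p' ->]] := pair_surj z.
  rewrite /A; have [-> -> -> ->] := E M x' p' q1; have [-> -> -> ->] := E M x' p' q2.
  move=> [[_ h1] h1'] [[_ h2] h2'].
  have [hA'|nA] := classic (fstM p' <= t M x' /\ H M x' (fstM p')).
    apply: (UR hu M ⟪fstM p', sndM p'⟫); [apply: h1'|apply: h2'] => //; exact: le_refl.
  by case: h1 => [/nA//|->]; case: h2 => [/nA//|->].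
Qed.

Lemma alt_comp u m (P : upred) (f : forall M : PAmodel, M -> M) :
  alt u m P -> DT (fun M r => f M (r 0%N)) -> alt u m (fun M x => P M (f M x)).
Proof.
move=> hP hf.
apply: alt_iff (@alt_ball u m P (fun _ _ => True) (fun M x y => y = f M x) f hP _ _ hf).
- move=> M x; split=> [[_ h]|h]; first by apply: h => //; exact: le_refl.
  by split=> // y _ ->.
- exact: df_true.
- apply: df_eq; first by dt.
  exact: (dt_app1 hf (dt_var 0)).
Qed.

(* Both witnesses are paired. *)
Lemma alt_and u m P Q : alt u m P -> alt u m Q -> alt u m (fun M x => P M x /\ Q M x).
Proof.
elim: m P Q => [|m IH] P Q; first exact: df_and.
move=> [R [hR ER UR]] [S [hS ES US]].
exists (fun M w => R M ⟪fstM w, fstM (sndM w)⟫ /\ S M ⟪fstM w, sndM (sndM w)⟫); split.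
- by apply: IH; apply: alt_comp => //; dt.
- move=> M x; rewrite ER ES; split.
    move=> [h1 h2] p; have [[q1 H1] [q2 H2]] := (h1 p, h2 p).
    by exists ⟪q1, q2⟫; rewrite !(fst_pair, snd_pair).
  move=> h; split=> p; have [q] := h p; rewrite !(fst_pair, snd_pair) => -[];
    by [exists (fstM q)|exists (sndM q)].
- move=> hu M z q q'; rewrite !(fst_pair, snd_pair) => -[h1 h2] [h3 h4].
  by rewrite -(pair_eta q) -(pair_eta q') (UR hu _ _ _ _ h1 h3) (US hu _ _ _ _ h2 h4).
Qed.

Lemma alt_df u m P : alt u m P -> DF false (fun M r => P M (r 0%N)).
Proof.
elim: m P => [|m IH] P; first by move=> h; exact: df_weak.
move=> [R [hR ER _]]; apply: (@df_iff _ (fun M r => forall p, exists q,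
  R M ⟪⟪r 0%N, p⟫, q⟫)) => [M r|]; first by rewrite ER.
refine (@df_all (fun M r p => _) _); refine (@df_ex (fun M r q => _) _).
by apply: (@df_app1 _ R _ (IH _ hR)); dt.
Qed.

(** The negation of a Pi_2m formula is an existential quantification of a Pi_(2m-1) formula,
    which is brought into the form of the class by dummy quantifiers. *)
Lemma alt_neg m A : alt false m A -> exists2 A', alt false m A' &
  forall (M : PAmodel) (y : M), ~ A M y <-> exists s, A' M ⟪y, s⟫.
Proof.
elim: m A => [|m IH] A hA.
  exists (fun M w => ~ A M (fstM w)).
    by apply: df_neg; apply: (df_app1 hA); dt.
  move=> M y; split=> [h|[s]]; last by rewrite fst_pair.
  by exists 0; rewrite fst_pair.
have [R [hR ER _]] := hA; have [R' hR' ER'] := IH R hR.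
exists (fun M w => forall q, exists t, R' M ⟪⟪w, q⟫, t⟫); first by exists R'.
move=> M y; rewrite ER; split=> [h|[p h] g].
  apply: NNPP => N; apply: h => p; apply: NNPP => N'; apply: N; exists p => q.
  by apply/ER' => hq; apply: N'; exists q.
have [q] := g p; by apply/ER'.
Qed.

(** The witness consists of the least [s] and of the sequence of least counterexamples to
    the smaller numbers.  Being a least counterexample does not leave the class: that the
    preceding numbers are none is expressed with the quantifiers of the class. *)
Lemma alt_uniformize m A : alt false m A -> exists2 B, alt false m B &
  (forall (M : PAmodel) (x : M), (exists s, A M ⟪x, s⟫) <-> exists s, B M ⟪x, s⟫) /\
  (forall (M : PAmodel) (x s s' : M), B M ⟪x, s⟫ -> B M ⟪x, s'⟫ -> s = s').
Proof.
case: m => [|m] hA.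
  exists (fun M w => A M w /\ forall s, s < sndM w -> ~ A M ⟪fstM w, s⟫).
    apply: df_and => //; refine (@df_ball_lt _ _ (fun M r s => _) _ _); first by dt.
    by apply: df_neg; apply: (df_app1 hA); dt.
  split=> [M x|M x s s'].
    split=> [[s hs]|[s [hs _]]]; last by exists s.
    have hD : DF false (fun M r => A M ⟪r 1%N, r 0%N⟫).
      by apply: df_weak; apply: (df_app1 hA); dt.
    have [t h1 h2] := @df_least _ M (pcons x (fun=> 0)) s hD hs.
    by exists t; rewrite fst_pair snd_pair.
  rewrite !fst_pair !snd_pair => -[h1 h2] [h3 h4].
  by have [l|[//|l]] := lt_trichotomy s s'; [case: (h4 _ l)|case: (h2 _ l)].
have [R [hR ER _]] := hA; have [R' hR' ER'] := alt_neg hR.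
pose LC : upred := fun M w => (forall q, exists t, R' M ⟪⟪w, q⟫, t⟫) /\
  forall p, p < sndM w -> exists q, R M ⟪⟪fstM w, p⟫, q⟫.
have hLC : alt false m.+1 LC.
  apply: alt_and; first by exists R'.
  exists (fun M v => True /\ forall y, y <= ⟪⟪fstM (fstM (fstM v)), sndM (fstM v)⟫, sndM v⟫ ->
    (sndM (fstM v) < sndM (fstM (fstM v)) /\
     y = ⟪⟪fstM (fstM (fstM v)), sndM (fstM v)⟫, sndM v⟫) -> R M y); split=> //.
    apply: (@alt_ball _ _ R (fun _ _ => True)
      (fun M v y => sndM (fstM v) < sndM (fstM (fstM v)) /\
         y = ⟪⟪fstM (fstM (fstM v)), sndM (fstM v)⟫, sndM v⟫)) => //;
      by [exact: df_true|df|dt].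
  move=> M w; split=> h p.
    have [l|l] := classic (p < sndM w).
      have [q hq] := h p l; exists q; split=> // y _; rewrite !(fst_pair, snd_pair).
      by move=> [_ ->].
    by exists 0; split=> // y _; rewrite !(fst_pair, snd_pair) => -[/l].
  move=> l; have [q [_ hq]] := h p; exists q; apply: hq; rewrite !(fst_pair, snd_pair) //.
  exact: le_refl.
have LC1 (M : PAmodel) (z u : M) : LC M ⟪z, u⟫ -> ~ A M z.
  move=> [h _] /ER /(_ u) [q hq]; have /ER' := h q; exact.
have LC2 (M : PAmodel) (z : M) : ~ A M z -> exists u, LC M ⟪z, u⟫.
  move=> nA; have [p hp] : exists p, forall q, ~ R M ⟪⟪z, p⟫, q⟫.
    apply: NNPP => N; apply: nA; apply/ER => p; apply: NNPP => N'; apply: N; exists p.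
    by move=> q hq; apply: N'; exists q.
  have hD : DF false (fun M r => forall q, ~ R M ⟪⟪r 1%N, r 0%N⟫, q⟫).
    refine (@df_all (fun M r q => _) _); apply: df_neg.
    by apply: (df_app1 (alt_df hR)); dt.
  have [u h1 h2] := @df_least _ M (pcons z (fun=> 0)) p hD hp.
  exists u; split=> [q|p' hp']; first by apply/ER'; exact: h1.
  rewrite snd_pair in hp'; rewrite fst_pair; apply: NNPP => N; apply: (h2 _ hp') => q hq.
  by apply: N; exists q.
have LC3 (M : PAmodel) (z u u' : M) : LC M ⟪z, u⟫ -> LC M ⟪z, u'⟫ -> u = u'.
  have aux (a b : M) : a < b -> LC M ⟪z, a⟫ -> ~ LC M ⟪z, b⟫.
    move=> l [h _] [_]; rewrite fst_pair snd_pair => /(_ a l) [q hq].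
    have /ER' := h q; exact.
  by move=> h h'; have [l|[//|l]] := lt_trichotomy u u'; [case: (aux _ _ l h)|case: (aux _ _ l h')].
pose H (M : PAmodel) (v y : pa_str M) := exists i, i <= v /\ exists e, e <= v /\
  (EntM (sndM (sndM v)) i e /\ y = ⟪⟪fstM v, i⟫, e⟫).
exists (fun M v => A M ⟪fstM v, fstM (sndM v)⟫ /\
  ((CanM (sndM (sndM v)) /\ lenM (sndM (sndM v)) = fstM (sndM v)) /\
   forall y, y <= ⟪⟪v, v⟫, v⟫ -> H M v y -> LC M y)).
  apply: alt_and; first by apply: alt_comp => //; dt.
  apply: (@alt_ball _ _ LC (fun M v => CanM (sndM (sndM v)) /\
    lenM (sndM (sndM v)) = fstM (sndM v)) H) => //; rewrite /H; by [df|dt].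
have EH (M : PAmodel) (x s c : M) : (forall y, y <= ⟪⟪⟪x, ⟪s, c⟫⟫, ⟪x, ⟪s, c⟫⟫⟫, ⟪x, ⟪s, c⟫⟫⟫ ->
    H M ⟪x, ⟪s, c⟫⟫ y -> LC M y) <-> forall i e, EntM c i e -> LC M ⟪⟪x, i⟫, e⟫.
  have bc : c <= ⟪x, ⟪s, c⟫⟫ := le_trans (pair_ge2 s c) (pair_ge2 x _).
  rewrite /H !(fst_pair, snd_pair); split=> [h i e hie|h y _ [i [_ [e [_ [hie ->]]]]]]; last exact: h.
  have hi : i <= ⟪x, ⟪s, c⟫⟫.
    apply: le_trans bc; apply: le_trans (len_le c); apply: lt_le; by case: hie.
  have he : e <= ⟪x, ⟪s, c⟫⟫ by apply: le_trans bc; exact: ent_le hie.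
  apply: h; last by exists i; split=> //; exists e.
  apply: pair_le => //; apply: pair_le => //; exact: pair_ge1.
split=> [M x|M x s s'].
  split=> [[s hs]|[s]]; last by rewrite !(fst_pair, snd_pair) => -[h _]; exists (fstM s).
  have hD : DF false (fun M r => A M ⟪r 1%N, r 0%N⟫).
    by apply: (df_app1 (alt_df hA)); dt.
  have [t h1 h2] := @df_least _ M (pcons x (fun=> 0)) s hD hs.
  have hQ : DF false (fun M r => LC M ⟪⟪r 2%N, r 1%N⟫, r 0%N⟫).
    by apply: (df_app1 (alt_df hLC)); dt.
  have [c [c1 c2 c3]] := @seq_collect M _ (pcons x (fun=> 0)) t hQ (fun i hi => LC2 _ _ (h2 i hi)).
  exists ⟪t, c⟫; rewrite EH !(fst_pair, snd_pair).
  by split=> //; split=> // i e /c3.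
have [t [c ->]] := pair_surj s; have [t' [c' ->]] := pair_surj s'.
rewrite !EH !(fst_pair, snd_pair) => -[h1 [[h2 h3] h4]] [h1' [[h2' h3'] h4']].
have E : t = t'.
  have aux (a b d : M) : A M ⟪x, a⟫ -> lenM d = b -> 
      (forall i e, EntM d i e -> LC M ⟪⟪x, i⟫, e⟫) -> ~ a < b.
    move=> ha hd h l; rewrite -hd in l; have [e he] := ent_ex l.
    exact: LC1 (h _ _ he) ha.
  by have [l|[//|l]] := lt_trichotomy t t'; [case: (aux _ _ _ h1 h3' h4' l)|case: (aux _ _ _ h1' h3 h4 l)].
have -> : c = c'.
  apply: can_ext => //; first by rewrite h3 h3'.
  move=> i v hv; have [w hw] : exists w, EntM c' i w.
    by apply: ent_ex; rewrite h3' -E -h3; case: hv.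
  by rewrite (LC3 _ _ _ _ (h4 _ _ hv) (h4' _ _ hw)).
by rewrite E.
Qed.

Lemma alt_unique m P : alt false m P -> alt true m P.
Proof.
elim: m P => [|m IH] P //= [R [hR ER _]].
have [B hB [EB UB]] := alt_uniformize hR.
exists B; split=> //; [exact: IH|].
by move=> M x; rewrite ER; split=> h p; apply/EB; exact: h.
Qed.

Lemma df_msat a (v : nat -> eterm) : delta0 a -> (forall i, DT (v i)) ->
  DF true (fun M r => msat (fun i => v i M r) a).
Proof.
have ht t (w : nat -> eterm) : (forall i, DT (w i)) ->
    DT (fun M r => meval (fun i => w i M r) t).
  move=> hw; elim: t => [i||t IH|t IHt u IHu|t IHt u IHu] /=;
  [exact: hw|exact: dt_0|exact: dt_S|exact: dt_add|exact: dt_mul].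
move=> h; elim: h v => {a} [t u|t u||a b _ IHa _ IHb|t a _ IHa] v hv /=.
- by apply: df_eq; exact: ht.
- by apply: df_le; exact: ht.
- exact: df_bot.
- by apply: df_imp; [exact: IHa|exact: IHb].
- pose v' : nat -> eterm := fun i M r =>
    if i is j.+1 then v j M (fun k => r k.+1) else r 0%N.
  have {}IHa : DF true (fun M r => msat (fun i => v' i M r) a).
    by apply: IHa => -[|i]; [exact: dt_var|exact: (dt_shift (hv i))].
  apply: df_iff (df_ball (Q := fun M r x => msat (pcons x (fun i => v i M r)) a)
    (ht t v hv) _) => [M r|].
    by split=> H x; have := H x; rewrite meval_subst.
  apply: df_iff IHa => M r; apply: msat_ext; by case.
Qed.

Lemma dt_venv i v : DT v -> DT (fun M r => venv (v M r) i).
Proof.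
move=> hv; apply: (dt_fst (v := fun M r => iter i (@sndM M) (v M r))).
by elim: i => [|i IH] //=; apply: dt_snd.
Qed.

(** The environments are coded by numbers, so that quantifiers can be contracted. *)
Definition refuted (a : form) : upred := fun M e => ~ msat (venv e) a.

Lemma refuted_All a (M : PAmodel) (e : M) :
  refuted (All a) e <-> exists x, refuted a ⟪x, e⟫.
Proof.
have E x : msat (venv ⟪x, e⟫) a <-> msat (pcons x (venv e)) a.
  by apply: msat_ext => i; exact: venv_pair.
split=> [h|[x hx] h]; last by apply/hx/E/h.
by apply: NNPP => N; apply: h => x; apply/E; apply: NNPP => h; apply: N; exists x.
Qed.

Lemma refuted_Ex a (M : PAmodel) (e : M) :
  refuted (Ex a) e <-> forall x, refuted a ⟪x, e⟫.
Proof.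
have E x : msat (venv ⟪x, e⟫) a <-> msat (pcons x (venv e)) a.
  by apply: msat_ext => i; exact: venv_pair.
rewrite /refuted msat_Ex; split=> [h x /E hx|h [x /E]]; [by apply: h; exists x|exact: h].
Qed.

Lemma refuted_Pi m a :
  (forall b, is_Sigma m.*2 b -> alt false m (refuted b)) -> is_Pi m.*2.+1 a ->
  exists2 R, alt false m R &
    forall (M : PAmodel) (e : M), refuted a e <-> exists q, R M ⟪e, q⟫.
Proof.
move=> hS; move E: m.*2.+1 => k h; elim: h E => {k a} [a _ //|k a ha [Ek]|k a _ IH Ek].
- exists (fun M w => refuted a (fstM w)).
    apply: (alt_comp (P := refuted a)); last by dt.
    by apply: hS; rewrite Ek.
  move=> M e; split=> [h|[q]]; last by rewrite fst_pair.
  by exists 0; rewrite fst_pair.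
- have [R hR ER] := IH Ek.
  exists (fun M w => R M ⟪⟪fstM (sndM w), fstM w⟫, sndM (sndM w)⟫).
    by apply: alt_comp => //; dt.
  move=> M e; rewrite refuted_All; split.
    by move=> [x /ER [q hq]]; exists ⟪x, q⟫; rewrite !(fst_pair, snd_pair).
  by move=> [q]; rewrite !(fst_pair, snd_pair) => h; eexists; apply/ER; eexists; exact: h.
Qed.

(** Blocks of like quantifiers are contracted by pairing, and missing ones are added. *)
Lemma refuted_Sigma m a : is_Sigma m.*2 a -> alt false m (refuted a).
Proof.
elim: m a => [|m IH] a.
  move E: 0.*2 => k h; case: h E => // b hb _; apply: df_neg.
  by apply: df_msat => // i; apply: dt_venv; dt.
move E: m.+1.*2 => k h; elim: h E => {k a} [a _ //|k a ha|k a _ IHa Ek].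
- rewrite doubleS => -[Ek]; rewrite -Ek in ha.
  have [R hR ER] := refuted_Pi IH ha.
  exists (fun M w => R M ⟪fstM (fstM w), sndM w⟫); split=> //.
    by apply: alt_comp => //; dt.
  move=> M e; rewrite ER; split=> [[q hq] p|h].
    by exists q; rewrite !(fst_pair, snd_pair).
  by have [q] := h 0; rewrite !(fst_pair, snd_pair) => hq; exists q.
- have [R [hR ER _]] := IHa Ek.
  exists (fun M w => R M ⟪⟪⟪fstM (sndM (fstM w)), fstM (fstM w)⟫,
    sndM (sndM (fstM w))⟫, sndM w⟫); split=> //.
    by apply: alt_comp => //; dt.
  move=> M e; rewrite refuted_Ex; split=> h.
    move=> p; have [q hq] := iffLR (ER M _) (h (fstM p)) (sndM p).
    by exists q; rewrite !(fst_pair, snd_pair).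
  move=> x; apply/ER => p; have [q] := h ⟪x, p⟫.
  by rewrite !(fst_pair, snd_pair) => hq; exists q.
Qed.

Lemma sentence_witness n phi : sentence phi -> is_Pi (2 * n).+1 phi ->
  exists2 B, alt true n B &
    forall (M : PAmodel) (r : nat -> M), ~ msat r phi <-> exists x, B M x.
Proof.
rewrite mul2n => hs /(refuted_Pi (@refuted_Sigma n)) [R hR ER].
exists (fun M w => R M ⟪0, w⟫).
  by apply: (alt_unique (alt_comp hR _)); dt.
move=> M r; rewrite -ER /refuted.
by rewrite (@msat_scoped M 0 r (venv 0) phi hs).
Qed.

(** * Trees of evidence *)

Section ExtendM.
Variable M : PAmodel.
Implicit Types (c e i j k p q v w x y : M).
Definition ExtM c c' : Prop := forall i v, EntM c i v -> EntM c' i v.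
End ExtendM.

(** The sequences that repeat one number x satisfying [B].  Entries are doubled here and
    below, to leave room for sequences of odd numbers. *)
Definition BaseM (B : upred) : upred := fun M c =>
  (CanM c /\ forall i, i <= c -> forall e, e <= c -> EntM c i e ->
    (exists x, x <= e /\ e = x + x) /\ EntM c 0 e) /\
  forall x, x <= c -> EntM c 0 (x + x) -> B M x.

Definition ShapeM (M : PAmodel) (c : M) : Prop :=
  forall i, i <= c -> forall e, e <= c -> EntM c i e -> exists w, w <= e /\
    (e = w + w /\ (CanM (fstM w) /\ lenM (fstM w) = sS i) /\
     (CanM (sndM w) /\ lenM (sndM w) = sS (fstM w)) /\
     (forall p, p <= c -> forall v, v <= c -> EntM (sndM w) p v -> i < fstM p -> v = 0) /\
     forall j, j <= i -> forall u, u <= c -> EntM c j (u + u) ->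
       forall k, k <= c -> forall v, v <= c -> EntM (fstM u) k v -> EntM (fstM w) k v).

(** The witnesses required along a path: the entry [p] of the list attached to a
    node concerns the node of index [fstM p] of the path and its challenge [sndM p]. *)
Definition DueM (M : PAmodel) (c y : M) : Prop :=
  exists i, i <= c /\ exists w, w <= c /\ (EntM c i (w + w) /\
    exists j, j <= i /\ exists u, u <= c /\ (EntM c j (u + u) /\
    exists p, p <= c /\ exists v, v <= c /\
      (EntM (sndM w) p v /\ fstM p = j /\ y = ⟪⟪fstM u, sndM p⟫, v⟫))).

(** [R] is the matrix of a tree: a node belongs to the tree if for each challenge p it has
    a witness q with [R].  The nodes of the next tree are the paths of candidates for
    nodes, each with witnesses for the challenges to it and its predecessors up to its
    own code.  A path through a candidate outside the tree cannot be continued once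
    the codes exceed the challenge that fails. *)
Definition NextM (R : upred) : upred := fun M c =>
  (CanM c /\ ShapeM c) /\ forall y, y <= ⟪⟪c, c⟫, c⟫ -> DueM c y -> R M y.

Lemma base_alt u m B : alt u m B -> alt u m (BaseM B).
Proof.
move=> hB; apply: (@alt_ball u m B (fun M c => CanM c /\ forall i, i <= c ->
  forall e, e <= c -> EntM c i e -> (exists x, x <= e /\ e = x + x) /\ EntM c 0 e)
  (fun M c x => EntM c 0 (x + x)) (fun M c => c)) => //; by [df|dt].
Qed.

Lemma next_alt u m R : alt u m R -> alt u m (NextM R).
Proof.
move=> hR; apply: (@alt_ball u m R (fun M c => CanM c /\ ShapeM c) DueM
  (fun M c => ⟪⟪c, c⟫, c⟫)) => //; rewrite /ShapeM /DueM; by [df|dt].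
Qed.

Section Nodes.
Variable M : PAmodel.
Implicit Types (c e i j k p q v w x y u : M).

Lemma ent_idx_le c i e : EntM c i e -> i <= c.
Proof. by case=> h _; apply: le_trans (len_le c); exact: lt_le. Qed.

Lemma double_ge w : w <= w + w.
Proof. exact: le_add. Qed.

Lemma ent_half c i w : EntM c i (w + w) -> w <= c.
Proof. by move=> h; apply: le_trans (ent_le h); exact: double_ge. Qed.

Lemma shapeE c : ShapeM c <-> forall i e, EntM c i e -> exists w,
  [/\ e = w + w, CanM (fstM w) /\ lenM (fstM w) = sS i,
      CanM (sndM w) /\ lenM (sndM w) = sS (fstM w),
      forall p v, EntM (sndM w) p v -> i < fstM p -> v = 0 &
      forall j u, j <= i -> EntM c j (u + u) -> ExtM (fstM u) (fstM w)].
Proof.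
split=> h i e.
- move=> hie; have [w [_ [E [h1 [h2 [h3 h4]]]]]] :=
    h i (ent_idx_le hie) e (ent_le hie) hie.
  have hw : w <= c by rewrite E in hie; exact: ent_half hie.
  exists w; split=> //.
    move=> p v hp; apply: (h3 p _ v _ hp); apply: le_trans hw; apply: le_trans (snd_le w).
      exact: ent_idx_le hp.
    exact: ent_le hp.
  move=> j u hj hu k v hk; have hc := ent_half hu.
  apply: (h4 j hj u hc hu k _ v _ hk); apply: le_trans hc; apply: le_trans (fst_le u).
    exact: ent_idx_le hk.
  exact: ent_le hk.
- move=> x _ /h [w [E h1 h2 h3 h4]]; exists w; split; first by rewrite E; exact: double_ge.
  split=> //; split=> //; split=> //; split=> [p _ v _|j hj u _ hu k _ v _]; first exact: h3.
  exact: (h4 j u hj hu k v).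
Qed.

Lemma base0 B : BaseM B (0 : M).
Proof.
split; [split; first exact: can0|]; [move=> i _ e _ /ent0 //|move=> x _ /ent0 //].
Qed.

Lemma next0 R : NextM R (0 : M).
Proof.
split; [split; first exact: can0|].
  by apply/shapeE => i e /ent0.
by move=> y _ [i [_ [w [_ [/ent0]]]]].
Qed.

Lemma next_evidence R c i w j u p v : NextM R c ->
  EntM c i (w + w) -> j <= i -> EntM c j (u + u) -> EntM (sndM w) p v -> fstM p = j ->
  R M ⟪⟪fstM u, sndM p⟫, v⟫.
Proof.
move=> [_ h] hi hj hu hp Ej; have hw := ent_half hi; have hu' := ent_half hu.
have hs : sndM w <= c := le_trans (snd_le w) hw.
have h1 : p <= c := le_trans (ent_idx_le hp) hs.
have h2 : v <= c := le_trans (ent_le hp) hs.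
apply: h; last first.
  exists i; split; first exact: ent_idx_le hi.
  exists w; split=> //; split=> //; exists j; split=> //; exists u; split=> //; split=> //.
  by exists p; split=> //; exists v.
apply: pair_le => //; apply: pair_le; first exact: le_trans (fst_le u) hu'.
exact: le_trans (snd_le p) h1.
Qed.

Lemma next_intro R c : CanM c -> ShapeM c ->
  (forall i w j u p v, EntM c i (w + w) -> j <= i -> EntM c j (u + u) ->
    EntM (sndM w) p v -> fstM p = j -> R M ⟪⟪fstM u, sndM p⟫, v⟫) ->
  NextM R c.
Proof.
move=> h1 h2 h; split=> // y _.
move=> [i [_ [w [_ [hi [j [hj [u [_ [hu [p [_ [v [_ [hp [E ->]]]]]]]]]]]]]]]].
exact: h hi hj hu hp E.
Qed.

Definition pathM (T D : upred) : Prop :=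
  [/\ D M 0, forall c, D M c -> T M c /\ CanM c &
      forall c, D M c -> exists d, [/\ D M d, lenM d = sS (lenM c) & ExtM c d]].

Lemma base_path B x : B M x -> pathM (BaseM B) (BaseM B).
Proof.
move=> hx; split; [exact: base0|by move=> c h; split=> //; case: h => -[]|].
move=> c [[cc hc] hB].
have [E|[n En]] := zero_or_succ (lenM c).
  have [d [h1 h2 h3 h4]] := can_append c (x + x); rewrite E in h2 h4.
  have U i e : EntM d i e -> i = 0 /\ e = x + x.
    move=> h; have : i < lenM d by case: h.
    rewrite h2 => /ltSx_le hi; have Ei : i = 0 := le_antisym hi (le0x i).
    by rewrite Ei in h *; rewrite (ent_uniq h h4).
  exists d; rewrite h2 E; split=> //; split=> [|y _ /U [_ Ey]].
    split=> // i _ e _ /U [_ ->]; split=> //; exists x; split=> //; exact: double_ge.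
  by rewrite (double_inj Ey).
have [e0 he0] : exists e, EntM c 0 e by apply: ent_ex; rewrite En; apply/le_SS; exact: le0x.
have [d [h1 h2 h3 h4]] := can_append c e0.
have U i e : EntM d i e -> e = e0.
  move=> h; have : i < lenM d by case: h.
  rewrite h2 => /ltSx_le /le_eq_lt [Ei|/ent_ex [e' he']].
    by rewrite Ei in h; exact: ent_uniq h h4.
  rewrite (ent_uniq h (h3 _ _ he')).
  by have [_ H] := hc i (ent_idx_le he') e' (ent_le he') he'; exact: ent_uniq H he0.
exists d; split=> //; split=> [|y _ /U Ey].
  split=> // i _ e _ /U ->; split; last exact: h3.
  by have [+ _] := hc 0 (le0x _) e0 (ent_le he0) he0.
by apply: hB; [apply: le_trans (ent_le he0); rewrite -Ey; exact: double_ge|rewrite Ey].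
Qed.

Definition LiftM (R D : upred) : upred := fun (M : PAmodel) (c : M) =>
  NextM R c /\ forall (i w : M), EntM c i (w + w) -> D M (fstM w).

(** The witnesses required for an extension exist since the nodes of [D] belong to [T],
    and are collected by comprehension. *)
Lemma next_path a (T R D : upred) :
  (forall c, T M c -> forall p, exists q, R M ⟪⟪c, p⟫, q⟫) -> alt true a R ->
  pathM T D -> pathM (NextM R) (LiftM R D).
Proof.
move=> hT hR [D0 D1 D2]; split.
- by split; [exact: next0|move=> i w /ent0].
- by move=> c [h _]; split=> //; case: h => -[].
move=> c' [h' hD'].
have [[cc' sc'] _] := h'; have sc := iffLR (shapeE c') sc'.
(* The last node of the path [c'] has a successor in [D]. *)
have [c [Dc lc ec]] : exists c, [/\ D M c, lenM c = lenM c' &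
    forall i w, EntM c' i (w + w) -> ExtM (fstM w) c].
  have [E|[n En]] := zero_or_succ (lenM c').
    by exists 0; split=> //; rewrite ?len0 // => i w [+ _]; rewrite E => /ltx0.
  have [e he] : exists e, EntM c' n e by apply: ent_ex; rewrite En; exact: le_refl.
  have [w [Ee [h1 h2] _ _ h4]] := sc _ _ he.
  exists (fstM w); split; [by apply: hD'; rewrite -Ee; exact: he|by rewrite h2 En|].
  move=> i u hu; apply: (h4 i u _ hu); apply/ltSx_le; rewrite -En; by case: hu.
have [d [Dd ld ed]] := D2 _ Dc; have [Td cd] := D1 _ Dd; set m := lenM c' in lc *.
pose Q : epred := fun M r =>
  (fstM (r 1%N) < r 3%N /\ exists (u : M), EntM (r 4%N) (fstM (r 1%N)) (u + u) /\
     R M ⟪⟪fstM u, sndM (r 1%N)⟫, r 0%N⟫) \/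
  (fstM (r 1%N) = r 3%N /\ R M ⟪⟪r 2%N, sndM (r 1%N)⟫, r 0%N⟫) \/
  (r 3%N < fstM (r 1%N) /\ r 0%N = 0).
have hQ : DF false Q.
  apply: df_or.
    apply: df_and; first by df.
    refine (@df_ex (fun M r (u : M) => _) _); apply: df_and; first by df.
    by apply: (df_app1 (alt_df hR)); dt.
  apply: df_or; last by df.
  by apply: df_and; [df|apply: (df_app1 (alt_df hR)); dt].
have exQ p : exists v, Q M (pcons v (pcons p (pcons d (pcons m (pcons c' (fun=> 0)))))).
  have [l|[l|l]] := lt_trichotomy (fstM p) m.
  - have [e he] := ent_ex l; have [u [Ee _ _ _ _]] := sc _ _ he; rewrite Ee in he.
    have [v hv] := hT _ (D1 _ (hD' _ _ he)).1 (sndM p).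
    by exists v; left; split=> //; exists u.
  - by have [v hv] := hT d Td (sndM p); exists v; right; left.
  - by exists 0; right; right.
have [k [k1 k2 k3]] := @seq_collect M _ _ (sS d) hQ (fun p _ => exQ p).
pose w := ⟪d, k⟫; have Ef : fstM w = d by exact: fst_pair.
have Es : sndM w = k by exact: snd_pair.
have [c2 [h1 h2 h3 h4]] := can_append c' (w + w); rewrite -/m in h2 h4.
have U i e : EntM c2 i e -> EntM c' i e \/ i = m /\ e = w + w.
  move=> h; have : i < lenM c2 by case: h.
  rewrite h2 => /ltSx_le /le_eq_lt [Ei|/ent_ex [e' he']].
    by right; split=> //; rewrite Ei in h; exact: ent_uniq h h4.
  by left; rewrite (ent_uniq h (h3 _ _ he')).
have nm i j e : EntM c' i e -> j <= i -> j <> m.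
  by move=> [hi _] hj E; apply: (@lt_irrefl _ i); rewrite E in hj; exact: lt_le_trans hi hj.
exists c2; split=> //; split; last first.
  move=> i u /U [/hD' //|[_ /double_inj ->]]; by rewrite Ef.
apply: next_intro => //; last first.
  move=> i x j u p v hi hj hu hp Ep.
  have [hx|[Ei /double_inj Ex]] := U _ _ hi.
    have [hu'|[/(nm _ _ _ hx hj)//]] := U _ _ hu.
    exact: next_evidence h' hx hj hu' hp Ep.
  subst x; rewrite Es in hp; subst i.
  have [[l [u' [hu1 hu2]]]|[[Em hv]|[l _]]] := k3 _ _ hp.
  - rewrite [_ 1%N]/= Ep in hu1; have := ent_uniq hu (h3 _ _ hu1) => /double_inj ->.
    exact: hu2.
  - have Ej : j = m by rewrite -Ep.
    have [hu'|[_ /double_inj ->]] := U _ _ hu; last by rewrite Ef.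
    by case: (nm _ _ _ hu' (le_refl _)).
  - by case: (le_not_lt hj); rewrite -Ep.
apply/shapeE => i e /U [he|[-> ->]].
- have [u [Ee hu1 hu2 hu3 hu4]] := sc _ _ he; exists u; split=> // j x hj /U [hu'|[Ej]].
    exact: hu4 hj hu'.
  by case: (nm _ _ _ he hj).
- exists w; rewrite Ef Es; split=> //; first by split=> //; rewrite ld lc.
  + move=> p v /k3 [[/= l _]|[[/= l _]|[_ //]]] l'.
      by case: (le_not_lt (lt_le l) l').
    by case: (@lt_irrefl _ m); rewrite -{2}l.
  + move=> j u _ /U [hu|[_ /double_inj ->]]; last by rewrite Ef.
    by move=> p v /(ec _ _ hu) /ed.
Qed.

End Nodes.

(** Each step removes one alternation from the definition of the tree. *)
Inductive tower (B : upred) : nat -> upred -> Prop :=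
| tower_base : tower B 0 (BaseM B)
| tower_next k m T R : tower B k T -> alt true m R ->
    (forall (M : PAmodel) (c : M), T M c <-> forall p, exists q, R M ⟪⟪c, p⟫, q⟫) ->
    (forall (M : PAmodel) (z q q' : M), R M ⟪z, q⟫ -> R M ⟪z, q'⟫ -> q = q') ->
    tower B k.+1 (NextM R).

Lemma tower_ex n B : alt true n B -> exists2 T, tower B n T & alt true 0 T.
Proof.
move=> hB; suff H k : (k <= n)%N -> exists2 T, tower B k T & alt true (n - k) T.
  by have := H n (leqnn n); rewrite subnn.
elim: k => [|k IH] hk.
  by exists (BaseM B); [exact: tower_base|rewrite subn0; exact: base_alt].
have [T hT] := IH (ltnW hk); have -> : (n - k = (n - k.+1).+1)%N by lia.
move=> [R [hR ER UR]]; exists (NextM R); last exact: next_alt.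
apply: tower_next hT hR ER _; exact: UR.
Qed.

Lemma tower0 B k T (M : PAmodel) : tower B k T -> T M 0.
Proof. by case=> *; [exact: base0|exact: next0]. Qed.

Lemma tower_can B k T (M : PAmodel) (c : M) : tower B k T -> T M c -> CanM c.
Proof. by case=> [[[]]|? ? ? ? ? ? ? ? [[]]]. Qed.

(** If [B] has an element, then the true witnesses give a definable class of nodes of the
    tree that can be continued forever. *)
Lemma tower_path B k T : alt true k B -> tower B k T -> exists2 D, DF false (fun M r => D M (r 0%N)) &
  forall (M : PAmodel) (x : M), B M x -> pathM M T D.
Proof.
move=> hB; have [j hB'] : exists j, alt true j B by exists k.
elim=> {k T hB} [|k m T R _ [D hD PD] hR ER _].
  by exists (BaseM B); [exact: alt_df (base_alt hB')|move=> M x; exact: base_path].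
exists (LiftM R D) => [|M x hx].
  apply: df_and; first exact: alt_df (next_alt hR).
  refine (@df_all (fun M r i => _) _); refine (@df_all (fun M r w => _) _).
  by apply: df_imp; [df|apply: (df_app1 hD); dt].
apply: next_path hR (PD M x hx) => c; exact: iffLR (ER M c).
Qed.

(** * The Kleene-Brouwer order *)

(** The Kleene-Brouwer order: longer sequences precede their initial segments, and
    sequences are compared lexicographically otherwise. *)
Definition BeforeM (M : PAmodel) (c d : M) : Prop :=
  exists i, i <= c /\
    ((forall j, j < i -> forall v, v <= c + d -> EntM c j v <-> EntM d j v) /\
     exists v, v <= c /\ (EntM c i v /\ forall w, w <= d -> EntM d i w -> v < w)).

(** These sequences ensure that the order is long enough: by themselves they have
    order type omega^n. *)
Definition OddM (n : nat) : upred := fun M c =>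
  (CanM c /\ lenM c = natM M n) /\
  forall i, i <= c -> forall v, v <= c -> EntM c i v -> exists y, y <= v /\ v = sS (y + y).

Definition FieldM (n : nat) (T : upred) : upred := fun M z =>
  z = 0 \/ exists c, c <= z /\ (z = sS c /\ (T M c \/ OddM n c)).

(** Nodes are shifted by one to make room for a least element 0, without which
    the root would be the only element when n = 0 and the sentence is true. *)
Definition OrderM (n : nat) (T : upred) (M : PAmodel) (y z : M) : Prop :=
  FieldM n T y /\ FieldM n T z /\
  (y = z \/ y = 0 \/ exists c, c <= y /\ exists d, d <= z /\
    (y = sS c /\ z = sS d /\ BeforeM c d)).

Lemma order_df n T : alt true 0 T ->
  DF true (fun M r => OrderM n T (r 0%N) (r 1%N)).
Proof.
move=> hT; have hF : DF true (fun M r => FieldM n T (r 0%N)).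
  apply: df_or; first by df.
  refine (@df_bex _ _ (fun M r c => _) (dt_var 0) _).
  apply: df_and; first by df.
  by apply: df_or; [apply: (df_app1 hT); dt|rewrite /OddM; df].
apply: df_and; first by apply: (df_app1 hF); dt.
apply: df_and; first by apply: (df_app1 hF); dt.
by rewrite /BeforeM; df.
Qed.

Section KleeneBrouwer.
Variable M : PAmodel.
Implicit Types (c d e i j k p q v w x y z u : M).

Lemma beforeE c d : BeforeM c d <-> exists i v,
  [/\ forall j, j < i -> forall w, EntM c j w <-> EntM d j w, EntM c i v &
      forall w, EntM d i w -> v < w].
Proof.
split=> [[i [_ [h [v [_ [hv hw]]]]]]|[i [v [h hv hw]]]].
  exists i, v; split=> // [j hj w|w hdw]; last by apply: hw => //; exact: ent_le hdw.
  by split=> H; apply/(h j hj w) => //; apply: (le_trans (ent_le H));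
    [|rewrite addC]; exact: le_add.
exists i; split; first exact: ent_idx_le hv.
split=> [j hj w _|]; first exact: h.
by exists v; split; [exact: ent_le hv|split=> // w _ /hw].
Qed.

Lemma before_irr c : ~ BeforeM c c.
Proof. by move=> /beforeE [i [v [_ h /(_ v h) /lt_irrefl]]]. Qed.

Lemma before_trans c d e : BeforeM c d -> BeforeM d e -> BeforeM c e.
Proof.
move=> /beforeE [i [v [h1 h2 h3]]] /beforeE [j [w [g1 g2 g3]]]; apply/beforeE.
have [l|[E|l]] := lt_trichotomy i j.
- exists i, v; split=> // [k hk u|u]; last by rewrite -(g1 i l) => /h3.
  by rewrite h1 // g1 //; exact: lt_le_trans hk (lt_le l).
- subst j; exists i, v; split=> // [k hk u|u /g3 l]; first by rewrite h1 // g1.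
  exact: lt_le_trans (h3 _ g2) (lt_le l).
- exists j, w; split=> // [k hk u|]; last by apply/h1.
  by rewrite h1 // ?g1 //; exact: lt_le_trans hk (lt_le l).
Qed.

(* The least place where the sequences differ exists by induction in the model. *)
Lemma before_total c d : CanM c -> CanM d -> c <> d -> BeforeM c d \/ BeforeM d c.
Proof.
move=> hc hd n; pose Q i := ~ forall v, EntM c i v <-> EntM d i v.
have [i hi] : exists i, Q i.
  apply: NNPP => N; apply: n; apply: can_same => //; apply/sameE.
  have H i v : EntM c i v <-> EntM d i v.
    by move: v; apply: NNPP => N'; apply: N; exists i.
  split=> //; have aux x y : (forall i v, EntM x i v -> EntM y i v) -> lenM x <= lenM y.
    move=> h; have [//|l] := le_or_lt (lenM x) (lenM y).
    have [v hv] := ent_ex l; by have [/lt_irrefl] := h _ _ hv.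
  by apply: le_antisym; apply: aux => j v /H.
have hD : DF false (fun M r => ~ forall (v : M), EntM (r 1%N) (r 0%N) v <-> EntM (r 2%N) (r 0%N) v).
  apply: df_neg; refine (@df_all (fun M r (v : M) => _) _); cbv beta; df.
have [k h1 h2] := @df_least _ M (pcons c (pcons d (fun=> 0))) i hD hi.
have E j : j < k -> forall w, EntM c j w <-> EntM d j w.
  by move=> hj; apply: NNPP; exact: h2 hj.
have {}h1 : ~ forall v, EntM c k v <-> EntM d k v by [].
have [[v hv]|nc] := classic (exists v, EntM c k v); last first.
  have [[w hw]|nd] := classic (exists w, EntM d k w).
    by right; apply/beforeE; exists k, w; split=> // [j /E h u|u hu]; [rewrite h|case: nc; exists u].
  by case: h1 => v; split=> h; [case: nc|case: nd]; exists v.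
have [[w hw]|nd] := classic (exists w, EntM d k w); last first.
  by left; apply/beforeE; exists k, v; split=> // u hu; case: nd; exists u.
have [l|[l|l]] := lt_trichotomy v w.
- by left; apply/beforeE; exists k, v; split=> // u hu; rewrite (ent_uniq hu hw).
- case: h1 => u; subst w; by split=> h; [rewrite (ent_uniq h hv)|rewrite (ent_uniq h hw)].
- right; apply/beforeE; exists k, w; split=> // [j /E h u|u hu]; first by rewrite h.
  by rewrite (ent_uniq hu hv).
Qed.

Lemma ext_before c d : lenM d = sS (lenM c) -> ExtM c d -> BeforeM d c.
Proof.
move=> hl h; have [v hv] : exists v, EntM d (lenM c) v.
  by apply: ent_ex; rewrite hl; exact: le_refl.
apply/beforeE; exists (lenM c), v; split=> // [j hj w|w [/lt_irrefl //]].
split=> [hw|]; last exact: h.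
by have [u hu] := ent_ex hj; rewrite (ent_uniq hw (h _ _ hu)).
Qed.

Variables (n : nat) (T : upred).
Hypothesis Tcan : forall c, @T M c -> CanM c.

Lemma field_can c : FieldM n T (sS c) -> CanM c.
Proof.
move=> [/succ_neq0 //|[d [_ [/succ_inj -> [/Tcan //|]]]]]; by case=> -[].
Qed.

Lemma order_succ c d : OrderM n T (sS c) (sS d) <->
  FieldM n T (sS c) /\ FieldM n T (sS d) /\ (c = d \/ BeforeM c d).
Proof.
split=> [[h1 [h2 h3]]|[h1 [h2 h3]]]; split=> //; split=> //.
  case: h3 => [/succ_inj ->|[/succ_neq0 //|]]; first by left.
  by move=> [c' [_ [d' [_ [/succ_inj -> [/succ_inj -> h]]]]]]; right.
case: h3 => [->|h]; first by left.
by right; right; exists c; split; [exact: leS|exists d; split; [exact: leS|]].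
Qed.

Lemma order_0 z : OrderM n T 0 z <-> FieldM n T z.
Proof.
split=> [[_ [h _]] //|h]; split; first by left.
by split=> //; right; left.
Qed.

Lemma order_to0 y : OrderM n T y 0 -> y = 0.
Proof.
by move=> [_ [_ [//|[//|[c [_ [d [_ [_ [/esym/succ_neq0]]]]]]]]]].
Qed.

Lemma order_refl y : FieldM n T y -> OrderM n T y y.
Proof. by move=> h; split=> //; split=> //; left. Qed.

Lemma order_dom y z : OrderM n T y z -> OrderM n T y y /\ OrderM n T z z.
Proof. by move=> [h1 [h2 _]]; split; exact: order_refl. Qed.

Lemma order_antisym y z : OrderM n T y z -> OrderM n T z y -> y = z.
Proof.
have [->|[c ->]] := zero_or_succ y; first by move=> _ /order_to0.
have [->|[d ->]] := zero_or_succ z; first by move=> /order_to0.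
move=> /order_succ [_ [_ [->//|h]]] /order_succ [_ [_ [->//|g]]].
by case: (before_irr (before_trans h g)).
Qed.

Lemma order_trans x y z : OrderM n T x y -> OrderM n T y z -> OrderM n T x z.
Proof.
have [->|[c ->]] := zero_or_succ x; first by move=> _ [_ [+ _]]; rewrite order_0.
have [->|[d ->]] := zero_or_succ y; first by move=> /order_to0 ->.
have [->|[e ->]] := zero_or_succ z; first by move=> _ /order_to0 /succ_neq0.
move=> /order_succ [h1 [h2 h3]] /order_succ [_ [g2 g3]]; apply/order_succ.
split=> //; split=> //; case: h3 g3 => [->//|h] [<-|g]; first by right.
by right; exact: before_trans h g.
Qed.

Lemma order_total y z : OrderM n T y y -> OrderM n T z z ->
  OrderM n T y z \/ OrderM n T z y.
Proof.
move=> [hy _] [hz _].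
have [Ey|[c Ey]] := zero_or_succ y; first by left; rewrite Ey order_0.
have [Ez|[d Ez]] := zero_or_succ z; first by right; rewrite Ez order_0.
subst y z; have [->|N] := classic (c = d); first by left; exact: order_refl.
have [h|h] := before_total (field_can hy) (field_can hz) N; [left|right];
  by apply/order_succ; split=> //; split=> //; right.
Qed.

End KleeneBrouwer.

(** * The standard model *)

Definition nat_structure : structure :=
  Structure 0%N S addn muln (fun m n => (m <= n)%N).

Lemma models_nat : models nat_structure PA.
Proof.
move=> a r ha; move: r; case: ha => {a} [i hi|a] r.
- do 7?[case: i hi => [|i] hi].
  + by move=> x /=.
  + by move=> x y /= -[].
  + by move=> x /=; rewrite addn0.
  + by move=> x y /=; rewrite addnS.
  + by move=> x /=; rewrite muln0.
  + by move=> x y /=; rewrite mulnS addnC.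
  + move=> x y; change (msat (S := nat_structure) (pcons y (pcons x r))
      (Iff (Le (Var 1) (Var 0)) (Ex (Eq (Add (Var 0) (Var 2)) (Var 1))))).
    rewrite msat_Iff msat_Ex /=; split=> [h|[z <-]].
      by exists (y - x)%N; exact: subnK.
    exact: leq_addl.
  + by [].
- rewrite /= !msat_subst => h0 hS x; elim: x => [|x IH].
    by apply: (@msat_ext1 nat_structure _ _ a _ h0) => -[].
  have := hS x IH; rewrite msat_subst => h.
  by apply: (@msat_ext1 nat_structure _ _ a _ h) => -[].
Qed.

Definition NN : PAmodel := PAModel models_nat.

Lemma sat_NN (r : nat -> NN) a : sat r a <-> msat r a.
Proof.
have E t (r' : nat -> NN) : eval r' t = meval r' t.
  by elim: t => [i||t IH|t IHt u IHu|t IHt u IHu] //=; rewrite ?IH ?IHt ?IHu.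
elim: a r => [t u|t u||a IHa b IHb|a IHa] r /=; rewrite ?E // ?IHa ?IHb //.
split=> h x; last apply/IHa.
  by have /IHa h' := h x; apply: (@msat_ext1 nat_structure _ _ a _ h') => -[].
by have h' := h x; apply: (@msat_ext1 nat_structure _ _ a _ h') => -[].
Qed.

Lemma natM_NN n : natM NN n = n.
Proof. by elim: n => //= n ->. Qed.

Lemma lo_le_NN l x y : lo_le l x y <-> LeqM (natM NN l) (natM NN x) (natM NN y).
Proof.
rewrite /lo_le /true_in_N (sat_NN (fun _ => 0%N)).
apply: (@fden_here NN (Ctx 0 (fun _ => 0%N : NN))).
by apply: den_le; exact: tden_num.
Qed.

Lemma proves_mono (S T : form -> Prop) a :
  (forall b, S b -> T b) -> proves S a -> proves T a.
Proof.
move=> h; elim=> {a} [a ha|a ha|a b _ h1 _ h2|a _ h1]; [|by apply: proves_log| |].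
- exact/proves_ax/h.
- exact: proves_mp h1 h2.
- exact: proves_gen.
Qed.

(** * The order proving a sentence *)

Section Assembly.
Variables (n : nat) (phi : form) (B T : upred).
Hypotheses (Btower : tower B n T) (Bn : alt true n B) (T0 : alt true 0 T).
Hypothesis Bphi : forall (M : PAmodel) (r : nat -> M), ~ msat r phi <-> exists x, @B M x.

Lemma theta_ex : exists theta, delta0 theta /\ forall (M : PAmodel) (x y : M),
  rel_of theta ⟪x, y⟫ <-> OrderM n T x y.
Proof.
have h : DF true (fun M r => OrderM n T (fstM (r 0%N)) (sndM (r 0%N))).
  by apply: (df_app2 (order_df n T0)); dt.
have [theta [h1 h2]] := h; exists theta; split=> [|M x y]; first exact: h1.
by rewrite /rel_of h2 /= fst_pair snd_pair.
Qed.

(** If the sentence fails in a model, then the nodes that can be continued forever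
    along true witnesses have no least element there, and the root is one of them; so reflection for
    the theory at the root proves the sentence. *)
Theorem order_proves : exists l,
  [/\ computable_LO l, PA_verifiable l,
      (forall x y : nat, lo_le l x y <-> OrderM n T (x : NN) (y : NN)) &
      proves (RFN_iter PA axPA l) phi].
Proof.
have [theta [hd hth]] := theta_ex.
pose l := cpair (fcode theta) (fcode theta).
have leq (M : PAmodel) (x y : M) : LeqM (natM M l) x y <-> OrderM n T x y.
  by rewrite leq_index // hth.
have can (M : PAmodel) (c : M) : T c -> CanM c by exact: tower_can Btower.
have lo (M : PAmodel) (r : nat -> M) : msat r (LO l).
  apply: LO_index => // [x y|x y|x y z|x y]; rewrite !hth.
  - exact: order_dom.
  - exact: order_antisym.
  - exact: order_trans.
  - exact: (order_total (can M)).
have lele (x y : nat) : lo_le l x y <-> OrderM n T (x : NN) (y : NN).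
  by rewrite lo_le_NN leq !natM_NN.
exists l; split=> //.
- by apply/(sat_NN (fun _ => 0%N)); exact: lo.
- by apply: PA_complete; exact: lo.
have [D hD PD] := tower_path Bn Btower.
have hH : DF false (fun M r => (exists x : M, B x) /\ exists c, r 0%N = sS c /\ D M c).
  apply df_and.
    refine (@df_ex (fun M r x => _) _).
    exact: (df_app1 (alt_df Bn) (dt_var 0)).
  refine (@df_ex (fun M r c => _) _); apply: df_and; first by df.
  exact: (df_app1 hD (dt_var 0)).
have [d0 [_ hd0]] := hH; pose d := fsubst only0 d0.
have d1 : fscoped 1 d by exact: fscoped_only0.
have holds (M : PAmodel) (x : M) : msat (pcons x (fun=> 0)) d <->
    (exists x : M, B x) /\ exists c, x = sS c /\ D M c.
  by rewrite /d msat_subst hd0.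
have descend (M : PAmodel) (x : M) : msat (pcons x (fun=> 0)) d ->
    exists y : M, [/\ LeqM (natM M l) y x, y <> x & msat (pcons y (fun=> 0)) d].
  move=> /holds [[b hb] [c [-> Dc]]]; have [_ P1 P2] := PD M b hb.
  have [e [De le ee]] := P2 c Dc.
  have F u : D M u -> FieldM n T (sS u).
    move=> /P1 [Tu _]; right; exists u; split; [exact: leS|by split=> //; left].
  exists (sS e); split.
  - apply/leq/order_succ; split; [exact: F|split; [exact: F|right]].
    exact: ext_before.
  - move=> /succ_inj E; rewrite E in le.
    by case: (@lt_irrefl M (lenM c)); rewrite -le; exact: le_refl.
  - by apply/holds; split; [exists b|exists e].
have refl (M : PAmodel) (x y : M) : LeqM (natM M l) y x -> LeqM (natM M l) x x.
  by rewrite !leq => /order_dom [].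
have key : proves PA (Imp (rfn (iter_ax_at axPA l 1) (Neg d)) phi).
  apply: PA_complete => M r h; apply: NNPP => /Bphi [b hb].
  apply: (reflection_refutes d1 descend refl h); apply/holds; split; first by exists b.
  by exists 0; split=> //; have [D0 _ _] := PD M b hb.
have top : lo_dom l 1.
  apply/lele; split; [|split; [|by left]]; right; exists 0%N; split=> //; split=> //; left;
    exact: tower0 Btower.
apply: proves_mp; first by apply: proves_mono key => b hb; left.
apply: proves_ax; right; exists 1%N => //; right; exists (Neg d); split=> //.
by rewrite /= andbT.
Qed.

End Assembly.

(** * Ranks of trees of finite sequences *)
Local Close Scope pa_scope.

Fixpoint kb (s t : seq nat) : bool :=
  match s, t with
  | [::], _ => false
  | _ :: _, [::] => true
  | x :: s', y :: t' => (x < y) || (x == y) && kb s' t'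
  end.

Lemma kb_cons x s y t : kb (x :: s) (y :: t) = (x < y) || (x == y) && kb s t.
Proof. by []. Qed.

Lemma kb_irr s : ~~ kb s s.
Proof. by elim: s => //= x s IH; rewrite ltnn eqxx. Qed.

Lemma kb_trans t s u : kb s t -> kb t u -> kb s u.
Proof.
elim: t s u => [|y t IH] [|x s] [|z u] //=.
case/orP=> [h|/andP [/eqP -> h]]; case/orP=> [g|/andP [/eqP <- g]].
- by rewrite (ltn_trans h g).
- by rewrite h.
- by rewrite g.
- by rewrite eqxx (IH _ _ h g) orbT.
Qed.

Lemma kb_total s t : s != t -> kb s t || kb t s.
Proof.
elim: s t => [|x s IH] [|y t] //=; rewrite eqseq_cons.
by case: (ltngtP x y) => //= _; exact: IH.
Qed.

Lemma kb_cat s t u : kb (s ++ t) (s ++ u) = kb t u.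
Proof. by elim: s => //= x s ->; rewrite ltnn eqxx. Qed.

Lemma kbP s t : reflect (exists i v, [/\ forall j, j < i -> onth s j = onth t j,
  onth s i = Some v & forall w, onth t i = Some w -> v < w]) (kb s t).
Proof.
elim: s t => [|x s IH] [|y t] /=.
- by constructor => -[[|i] [v []]].
- by constructor => -[[|i] [v []]].
- by apply: ReflectT; exists 0, x; split.
apply: (iffP orP) => [[h|/andP [/eqP -> /IH [i [v [h1 h2 h3]]]]]|[[|i] [v [h1 h2 h3]]]].
- by exists 0, x; split=> // w [<-].
- by exists i.+1, v; split=> // -[|j] //; exact: h1.
- by move: h2 => [->]; left; exact: h3.
- have /= [->] := h1 0 isT; right; rewrite eqxx /=; apply/IH; exists i, v.
  by split=> // j hj; exact: (h1 j.+1).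
Qed.

Section Rank.
Variable P : seq nat -> Prop.

Definition none (s : seq nat) : Prop := forall t, ~ P (s ++ t).

(** The part of [P] above [s] has order type below omega^j in the Kleene-Brouwer order:
    almost all subtrees at the children have type below omega^(j-1), and finitely many
    others have type below omega^j. *)
Inductive rank_lt : nat -> seq nat -> Prop :=
| rank_lt_none j s : none s -> rank_lt j s
| rank_lt_step j s N : (forall a, rank_lt j.+1 (rcons s a)) ->
    (forall a, N <= a -> rank_lt j (rcons s a)) -> rank_lt j.+1 s.

Lemma rank_lt_mono j s : rank_lt j s -> rank_lt j.+1 s.
Proof.
elim=> {j s} [j s h|j s N _ IH _ IH']; first exact: rank_lt_none.
exact: rank_lt_step IH IH'.
Qed.

Lemma rank_lt_mono_le j k s : j <= k -> rank_lt j s -> rank_lt k s.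
Proof. by move=> /subnK <- h; elim: (k - j) => //= d; rewrite addSn; exact: rank_lt_mono. Qed.

Definition sub (s t : seq nat) : Prop := P t /\ exists u, t = s ++ u.

Definition raise (k : nat) (s : seq nat) : seq nat :=
  if s is x :: s' then (k + x) :: s' else [::].

(** The ordinal omega^j is represented by the [j]-tuples of numbers, and a smaller ordinal
    by a bound for the leading entries. *)
Definition embeds (j : nat) (A : seq nat -> Prop) (f : seq nat -> seq nat) : Prop :=
  (forall t, A t -> size (f t) = j) /\
  (forall t u, A t -> A u -> kb t u -> kb (f t) (f u)).
Definition bounded (b : nat) (A : seq nat -> Prop) (f : seq nat -> seq nat) : Prop :=
  forall t, A t -> head 0 (f t) < b.

Lemma kb_raise k s t : kb (raise k s) (raise k t) = kb s t.
Proof. by case: s t => [|x s] [|y t] //=; rewrite ltn_add2l eqn_add2l. Qed.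

Lemma size_raise k s : size (raise k s) = size s.
Proof. by case: s. Qed.

Definition small (j : nat) (s : seq nat) : Prop :=
  (j = 0 -> none s) /\ exists f b, embeds j (sub s) f /\ bounded b (sub s) f.

(* The blocks of the children of [s] from [N] on are put one after the other by
   adding to the leading entries the sum of the earlier bounds. *)
Lemma embeds_children j s N : (forall a, N <= a -> small j (rcons s a)) ->
  exists f, embeds j (fun t => exists2 a, N <= a & sub (rcons s a) t) f /\
    forall M, exists b,
      bounded b (fun t => exists a, [/\ N <= a, a < M & sub (rcons s a) t]) f.
Proof.
move=> h.
have h' a : exists fb : (seq nat -> seq nat) * nat, N <= a ->
    embeds j (sub (rcons s a)) fb.1 /\ bounded fb.2 (sub (rcons s a)) fb.1.
  have [l|_] := leqP N a; last by exists (id, 0).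
  by have [_ [f [b H]]] := h a l; exists (f, b).
pose fb a := proj1_sig (constructive_indefinite_description _ (h' a)).
have hfb a : N <= a -> embeds j (sub (rcons s a)) (fb a).1 /\
    bounded (fb a).2 (sub (rcons s a)) (fb a).1.
  by rewrite /fb; case: constructive_indefinite_description.
pose C a := \sum_(i < a) (fb i).2.
have CS a : C a.+1 = C a + (fb a).2 by rewrite /C big_ord_recr.
have Cle a b : a <= b -> C a <= C b.
  by move=> /subnK <-; elim: (b - a) => // d IH; rewrite addSn CS; apply: leq_trans IH (leq_addr _ _).
pose f t := let a := nth 0 t (size s) in raise (C a) ((fb a).1 t).
have fE a t : sub (rcons s a) t -> f t = raise (C a) ((fb a).1 t).
  by move=> [_ [u ->]]; rewrite /f cat_rcons nth_cat ltnn subnn.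
have hd a t : N <= a -> sub (rcons s a) t -> size ((fb a).1 t) = j.
  by move=> l H; have [[g _] _] := hfb a l; exact: g.
have bd a t : N <= a -> sub (rcons s a) t -> head 0 ((fb a).1 t) < (fb a).2.
  by move=> l H; have [_ g] := hfb a l; exact: g.
exists f; split.
  split=> [t [a l H]|t u [a l H] [b l' H'] htu].
    by rewrite (fE _ _ H) size_raise (hd _ _ l H).
  rewrite (fE _ _ H) (fE _ _ H').
  have [E|n] := eqVneq a b.
    subst b; rewrite kb_raise; have [[_ g] _] := hfb a l; exact: g.
  have lab : a < b.
    case: H H' htu => [_ [v ->]] [_ [w ->]].
    by rewrite !cat_rcons kb_cat kb_cons (negbTE n) orbF.
  have [jz|jp] := posnP j.
    by have [/(_ jz) N0 _] := h a l; case: H => Pt [v E]; case: (N0 v); rewrite -E.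
  have := (hd _ _ l H, hd _ _ l' H', bd _ _ l H).
  case: ((fb a).1 t) ((fb b).1 u) => [|x x'] [|y y'] [] [] /= hs1 hs2;
    rewrite -?hs1 // -?hs2 // in jp *; move=> hx.
  suff -> : C a + x < C b + y by [].
  apply: (@leq_trans (C a.+1)); first by rewrite CS ltn_add2l.
  exact: leq_trans (Cle _ _ lab) (leq_addr _ _).
move=> M; exists (C M).+1 => t [a [l lM H]]; rewrite (fE _ _ H).
have := bd _ _ l H; case: ((fb a).1 t) => [|x x'] //= hx; rewrite ltnS.
apply: leq_trans (Cle _ _ lM); rewrite CS leq_add2l; exact: ltnW.
Qed.

(* The children below [N] are arranged first; the remaining ones together have type at
   most omega^j, so that they fit into one value of the new leading entry; [s] itself
   comes last. *)
Lemma rank_lt_small j s : rank_lt j s -> small j s.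
Proof.
elim=> {j s} [j s h|j s N _ IH _ IH'].
  have no t : ~ sub s t by move=> [+ [u E]]; rewrite E; exact: h.
  by split=> //; exists id, 0; split; [split=> [t /no|t u /no]|move=> t /no].
split=> //; have [f [ef bf]] := embeds_children (N := 0) (fun a _ => IH a).
have {bf} [b bf] := bf N.
have [g [eg _]] := embeds_children IH'.
pose k t := if size t == size s then b.+1 :: nseq j 0 else
  if nth 0 t (size s) < N then f t else b :: g t.
exists k, b.+2.
have cases t : sub s t -> t = s \/ exists a u, t = s ++ a :: u.
  by move=> [_ [[|a u] ->]]; [left; rewrite cats0|right; exists a, u].
have ks : k s = b.+1 :: nseq j 0 by rewrite /k eqxx.
have kc a u : k (s ++ a :: u) = if a < N then f (s ++ a :: u) else b :: g (s ++ a :: u).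
  rewrite /k size_cat -{2}(addn0 (size s)) eqn_add2l /= nth_cat ltnn subnn /=.
  by [].
have subc a u : P (s ++ a :: u) -> sub (rcons s a) (s ++ a :: u).
  by move=> h; split=> //; exists u; rewrite cat_rcons.
have sf a u : P (s ++ a :: u) -> size (f (s ++ a :: u)) = j.+1.
  by move=> h; apply: ef.1; exists a => //; exact: subc.
have sg a u : N <= a -> P (s ++ a :: u) -> size (g (s ++ a :: u)) = j.
  by move=> l h; apply: eg.1; exists a => //; exact: subc.
have bf' a u : a < N -> P (s ++ a :: u) -> head 0 (f (s ++ a :: u)) < b.
  by move=> l h; apply: bf; exists a; split=> //; exact: subc.
have hk a u : P (s ++ a :: u) -> exists x x', k (s ++ a :: u) = x :: x' /\ x <= b.
  move=> h; rewrite kc; case: ltnP => l; last by exists b, (g (s ++ a :: u)).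
  have := (sf a u h, bf' a u l h); case: (f _) => [|x x'] [] //= _ hx.
  by exists x, x'; split=> //; exact: ltnW.
split; last first.
  move=> t ht; have [->|[a [u Et]]] := cases t ht; first by rewrite ks.
  have [h _] := ht; rewrite Et in h *; have [x [x' [-> hx]]] := hk a u h.
  by rewrite /= ltnS; apply: leq_trans hx (leqnSn _).
split=> [t ht|t t' ht ht'].
  have [->|[a [u Et]]] := cases t ht; first by rewrite ks /= size_nseq.
  have [h _] := ht; rewrite Et in h *; rewrite kc; case: ltnP => l; first exact: sf.
  by rewrite /= sg.
have [->|[a [u Et]]] := cases t ht.
  by case: ht' => _ [v ->]; rewrite -{1}(cats0 s) kb_cat.
have [h _] := ht; rewrite Et in h *.
have [->|[a' [u' Et']]] := cases t' ht'.
  move=> _; have [x [x' [-> hx]]] := hk a u h; by rewrite ks /= ltnS hx.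
have [h' _] := ht'; rewrite Et' in h' *; rewrite kb_cat kb_cons !kc => H.
have K : kb (s ++ a :: u) (s ++ a' :: u') by rewrite kb_cat.
have laa : a <= a' by case/orP: H => [/ltnW|/andP [/eqP ->]].
case: (ltnP a N) => l.
  case: ltnP => l'.
    by apply: ef.2 => //; [exists a|exists a'] => //; exact: subc.
  have := (sf a u h, bf' a u l h); case: (f _) => [|x x'] [] //= _ ->.
  by [].
rewrite ltnNge (leq_trans l laa) /= ltnn eqxx /=.
by apply: eg.2 => //; [exists a|exists a'] => //; [exact: subc|exact: leq_trans l laa|exact: subc].
Qed.

End Rank.

(** * The trees in the standard model *)
Local Open Scope pa_scope.

Definition codes (c : NN) (s : seq nat) : Prop :=
  [/\ CanM c, lenM c = size s & forall i v : nat, EntM (M := NN) c i v <-> onth s i = Some v].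

Lemma onth_lt (s : seq nat) i v : onth s i = Some v -> (i < size s)%N.
Proof. by move=> h; rewrite -onthTE h. Qed.

Lemma onth_some (s : seq nat) i : (i < size s)%N -> exists v, onth s i = Some v.
Proof. by rewrite -onthTE; case: onth => // v _; exists v. Qed.

Lemma nth_onth (s : seq nat) i v : onth s i = Some v -> nth 0%N s i = v.
Proof. exact: onth_nth. Qed.

Lemma onth_rcons (s : seq nat) x : onth (rcons s x) (size s) = Some x.
Proof. by rewrite -cats1 onth_cat ltnn subnn. Qed.

Lemma onth_catl (s t : seq nat) i v : onth s i = Some v -> onth (s ++ t) i = Some v.
Proof. by move=> h; rewrite onth_cat (onth_lt h). Qed.

Lemma codes_intro (c : NN) (s : seq nat) : CanM c -> lenM c = size s ->
  (forall i v : nat, onth s i = Some v -> EntM (M := NN) c i v) -> codes c s.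
Proof.
move=> h1 h2 h; split=> // i v; split=> [hi|]; last exact: h.
have [l _] := hi; rewrite h2 in l; have [w hw] := onth_some l.
by rewrite hw (ent_uniq hi (h _ _ hw)).
Qed.

Lemma codes_ex s : exists c, codes c s.
Proof.
elim/last_ind: s => [|s x [c [h1 h2 h3]]].
  by exists 0%N; apply: codes_intro => //; [exact: (@len0 NN)|case].
have [d [g1 g2 g3 g4]] := can_append c (x : NN); exists d.
apply: codes_intro => //; first by rewrite g2 h2 size_rcons.
move=> i v; rewrite -cats1 onth_cat; case: ltnP => l; first by move/h3/g3.
move=> h; have := onth_lt h => /=; rewrite ltnS leqn0 => /eqP l'.
rewrite l' in h; case: h => <-; rewrite h2 in g4.
by have -> : i = size s by lia.
Qed.

Lemma can_codes (c : NN) : CanM c -> exists s, codes c s.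
Proof.
move=> hc; pose val (i : nat) : nat := epsilon (inhabits 0%N) (fun v => EntM (M := NN) c i v).
have hval i : (i < lenM c)%N -> EntM (M := NN) c i (val i).
  by move=> l; apply: epsilon_spec; exact: (@ent_ex NN).
exists (mkseq val (lenM c)); apply: codes_intro => //; first by rewrite size_mkseq.
move=> i v h; have l := onth_lt h; rewrite size_mkseq in l.
by have := nth_onth h; rewrite nth_mkseq // => <-; exact: hval.
Qed.

Lemma codes_inj c d s : codes c s -> codes d s -> c = d.
Proof.
move=> [h1 h2 h3] [g1 g2 g3]; apply: can_ext => //; first by rewrite h2.
by move=> i v /h3 /g3.
Qed.

Lemma codes_fun c s t : codes c s -> codes c t -> s = t.
Proof.
move=> [_ _ h] [_ _ g]; apply: eq_from_onth => i.
case E: (onth s i) => [v|]; first by move/h/g: E.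
by case E': (onth t i) => [v|] //; move/g/h: E'; rewrite E.
Qed.

Lemma before_kb c d s t : codes c s -> codes d t -> BeforeM c d <-> kb s t.
Proof.
move=> [_ _ h] [_ _ g]; rewrite beforeE; split=> [[i [v [h1 h2 h3]]]|/kbP [i [v [h1 h2 h3]]]].
  apply/kbP; exists i, v; split=> [j hj||w /g]; [|exact/h|exact: h3].
  case E: (onth s j) => [w|]; first by move/h/(h1 j hj)/g: E.
  by case E': (onth t j) => [w|] //; move/g/(h1 j hj)/h: E'; rewrite E.
exists i, v; split=> [j hj w||w /g]; [|exact/h|exact: h3].
by split=> [/h|/g] E; [apply/g; rewrite -h1|apply/h; rewrite h1].
Qed.

Lemma codes_ext c d s t : codes c s -> codes d t -> ExtM c d -> exists u, t = s ++ u.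
Proof.
move=> [_ _ h] [_ _ g] e; exists (drop (size s) t).
suff E : take (size s) t = s by rewrite -{1}E cat_take_drop.
have l : (size s <= size t)%N.
  rewrite leqNgt; apply/negP => l; have [v hv] := onth_some l.
  by move/h/e/g/onth_lt: hv; rewrite ltnn.
apply: (@eq_from_nth _ 0%N) => [|i]; rewrite size_takel // => hi.
have [v hv] := onth_some hi; rewrite (nth_onth hv) nth_take //.
by move/h/e/g: hv => /nth_onth.
Qed.

Definition enc (s : seq nat) : NN := epsilon (inhabits (0 : NN)) (fun c => codes c s).

Lemma encP s : codes (enc s) s.
Proof. exact: (epsilon_spec (inhabits (0 : NN)) _ (codes_ex s)). Qed.

Lemma enc_inj s t : enc s = enc t -> s = t.
Proof. by move=> E; have := encP t; rewrite -E; apply: codes_fun; exact: encP. Qed.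

Lemma enc_can (c : NN) : CanM c -> exists s, c = enc s.
Proof. by move=> /can_codes [s hs]; exists s; exact: codes_inj hs (encP s). Qed.

Lemma enc_ent s (i v : nat) : EntM (enc s) (i : NN) (v : NN) <-> onth s i = Some v.
Proof. by have [_ _ h] := encP s. Qed.

Lemma size_enc s : (size s <= enc s)%N.
Proof. have [_ <- _] := encP s; exact: (@len_le NN). Qed.

Lemma enc_nil : enc [::] = 0%N.
Proof. by have [h1 h2 _] := encP [::]; exact: (@len_eq0 NN). Qed.

Lemma base_enc (B : upred) s : (forall x : NN, ~ B NN x) -> BaseM B (enc s) -> s = [::].
Proof.
move=> nB [[_ h1] h2]; case: s h1 h2 => // e s h1 h2; exfalso.
have he : EntM (enc (e :: s)) (0 : NN) (e : NN) by apply/enc_ent.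
have [[x [_ E]] _] := h1 _ (ent_idx_le he) _ (ent_le he) he.
have he2 : EntM (enc (e :: s)) (0 : NN) (x + x) by rewrite -E.
by apply: (nB x); apply: (h2 _ _ he2); exact: ent_half he2.
Qed.

Definition node (e : nat) (c k : seq nat) : Prop :=
  e = (⟪enc c, enc k⟫ + ⟪enc c, enc k⟫ : NN).

Lemma node_inj e c k c' k' : node e c k -> node e c' k' -> c = c' /\ k = k'.
Proof. by move=> -> /(@double_inj NN)/(@pair_inj NN) [/enc_inj -> /enc_inj ->]. Qed.

Section Lifting.
Variables (T R : upred).
Hypothesis ER : forall c : NN, @T NN c <-> forall p, exists q, @R NN ⟪⟪c, p⟫, q⟫.
Hypothesis UR : forall z q q' : NN, @R NN ⟪z, q⟫ -> @R NN ⟪z, q'⟫ -> q = q'.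
Let P (s : seq nat) : Prop := @T NN (enc s).
Let P' (s : seq nat) : Prop := NextM R (enc s).

Lemma next_node s i e : P' s -> onth s i = Some e -> exists c k,
  [/\ node e c k, size c = i.+1, size k = (enc c).+1,
      forall p v : nat, onth k p = Some v -> (i < fstM (p : NN))%N -> v = 0%N &
      forall j e' c' k', (j <= i)%N -> onth s j = Some e' -> node e' c' k' ->
        (exists u, c = c' ++ u) /\
        forall p v : nat, onth k p = Some v -> fstM (p : NN) = j ->
          @R NN ⟪⟪enc c', sndM (p : NN)⟫, v⟫].
Proof.
move=> hP hi; have [[_ hs] _] := hP; move/shapeE: hs => hs.
have hi' : EntM (enc s) (i : NN) (e : NN) by apply/enc_ent.
have [w [Ee [h1 h2] [h3 h4] h5 h6]] := hs _ _ hi'.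
have [c Ec] := enc_can h1; have [k Ek] := enc_can h3; exists c, k.
have [_ lc _] := encP c; have [_ lk _] := encP k.
have Ew : w = ⟪enc c, enc k⟫ by rewrite -Ec -Ek pair_eta.
rewrite Ee in hi'; split.
- by rewrite /node Ee Ew.
- by rewrite -lc -Ec h2.
- by rewrite -lk -Ek h4 Ec.
- by move=> p v hp hj; apply: (h5 p v) hj; rewrite Ek; apply/enc_ent.
move=> j e' c' k' hj hj' hn.
have hj2 : EntM (enc s) (j : NN) (e' : NN) by apply/enc_ent.
have Ec' : fstM (⟪enc c', enc k'⟫ : NN) = enc c' by rewrite fst_pair.
rewrite hn in hj2; split.
  have := h6 _ _ hj hj2; rewrite Ec' Ec; exact: codes_ext (encP c') (encP c).
move=> p v hp Ep; rewrite -Ec'; apply: (next_evidence hP hi' hj hj2 _ Ep).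
by rewrite Ek; apply/enc_ent.
Qed.

Lemma evidence_unique s t t' e e' c k k' : P' (rcons s e ++ t) -> P' (rcons s e' ++ t') ->
  node e c k -> node e' c k' -> e = e'.
Proof.
move=> h h' hn hn'.
have hi : onth (rcons s e ++ t) (size s) = Some e by apply: onth_catl; exact: onth_rcons.
have hi' : onth (rcons s e' ++ t') (size s) = Some e' by apply: onth_catl; exact: onth_rcons.
have [c1 [k1 [n1 _ sk z1 H1]]] := next_node h hi.
have [c2 [k2 [n2 _ sk' z2 H2]]] := next_node h' hi'.
have [Ec1 Ek1] := node_inj hn n1; have [Ec2 Ek2] := node_inj hn' n2; subst c1 k1 c2 k2.
suff E : k = k' by rewrite hn hn' E.
apply: (@eq_from_nth _ 0%N); first by rewrite sk sk'.
move=> p hp; have [v hv] := onth_some hp.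
have [v' hv'] : exists v', onth k' p = Some v' by apply: onth_some; rewrite sk' -sk.
rewrite (nth_onth hv) (nth_onth hv').
have [l|l] := leqP (fstM (p : NN)) (size s); last by rewrite (z1 _ _ hv l) (z2 _ _ hv' l).
have [d [r1 r2]] : exists d, @R NN ⟪⟪enc d, sndM (p : NN)⟫, v⟫ /\ @R NN ⟪⟪enc d, sndM (p : NN)⟫, v'⟫.
  have := l; rewrite leq_eqVlt => /orP [/eqP E|l'].
    exists c; split; first by apply: (H1 _ _ _ _ (leqnn _) hi hn).2.
    by apply: (H2 _ _ _ _ (leqnn _) hi' hn').2.
  have [x hx] := onth_some l'.
  have hx1 : onth (rcons s e ++ t) (fstM (p : NN)) = Some x by rewrite -cats1 -catA; exact: onth_catl.
  have hx2 : onth (rcons s e' ++ t') (fstM (p : NN)) = Some x by rewrite -cats1 -catA; exact: onth_catl.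
  have [d [kd [nd _ _ _ _]]] := next_node h hx1; exists d.
  by split; [apply: (H1 _ _ _ _ l hx1 nd).2|apply: (H2 _ _ _ _ l hx2 nd).2].
exact: UR r1 r2.
Qed.

(** For each candidate there is at most one valid entry, as witnesses are unique. *)
Lemma finitely_many K s : exists N, forall e t c k, (N <= e)%N -> P' (rcons s e ++ t) ->
  node e c k -> (K <= enc c)%N.
Proof.
elim: K => [|K [N hN]]; first by exists 0%N.
have [[e0 [t0 [c0 [k0 [h0 [n0 E0]]]]]]|no] := classic (exists e t c k,
  P' (rcons s e ++ t) /\ node e c k /\ enc c = K).
  exists (maxn N e0.+1) => e t c k; rewrite geq_max => /andP [l1 l2] hP hn.
  have := hN e t c k l1 hP hn; rewrite leq_eqVlt => /orP [/eqP E|//].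
  have Ec : c0 = c by apply: enc_inj; rewrite E0 E.
  subst c0; by rewrite (evidence_unique hP h0 hn n0) ltnn in l2.
exists N => e t c k l hP hn; have := hN e t c k l hP hn.
rewrite leq_eqVlt => /orP [/eqP E|//]; by case: no; exists e, t, c, k.
Qed.

Definition above (s' s : seq nat) : Prop :=
  (s' = [::] /\ s = [::]) \/
  exists t e k, [/\ s' = rcons t e, node e s k & size s = size s'].

Lemma above_child s' s e : above s' s -> ~ none P' (rcons s' e) ->
  exists a, above (rcons s' e) (rcons s a) /\ exists t k,
    P' (rcons s' e ++ t) /\ node e (rcons s a) k.
Proof.
move=> ha hn; have [t ht] : exists t, P' (rcons s' e ++ t).
  by apply: NNPP => N; apply: hn => t ht; apply: N; exists t.
have hi : onth (rcons s' e ++ t) (size s') = Some e by apply: onth_catl; exact: onth_rcons.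
have [c [k [nd sc _ _ H]]] := next_node ht hi.
have [u Eu] : exists u, c = s ++ u.
  have [[_ ->]|[t' [e' [k' [Es nd' ss]]]]] := ha; first by exists c.
  apply: (H (size t') e' s k' _ _ nd').1; first by rewrite Es size_rcons.
  by rewrite Es -cats1 -catA onth_cat size_rcons leqnn onth_rcons.
have ss : size s = size s' by case: ha => [[-> ->]|[? [? [? [_ _ //]]]]].
have [a Ea] : exists a, u = [:: a].
  move: sc; rewrite Eu size_cat ss -addn1 => /eqP; rewrite eqn_add2l.
  by case: u {Eu} => [|a [|]] // _; exists a.
rewrite Ea cats1 in Eu; subst c; exists a; split; last by exists t, k.
by right; exists s', e, k; split=> //; rewrite !size_rcons ss.
Qed.

(** Above a node outside [T] there are finitely many nodes: their codes are bounded
    by the challenge that cannot be met. *)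
Lemma rank_lt_false s' s : s <> [::] -> ~ P s -> above s' s -> rank_lt P' 1 s'.
Proof.
move=> s0 nP [[_ /s0 //]|[t0 [e0 [k0 [Es nd0 ss]]]]].
have [J hJ] : exists J : NN, forall q, ~ @R NN ⟪⟪enc s, J⟫, q⟫.
  apply: NNPP => N; apply: nP; apply/ER => p; apply: NNPP => N'; apply: N; exists p.
  by move=> q hq; apply: N'; exists q.
pose K : nat := (⟪(size t0 : NN), J⟫ : NN).
have bound t i e c k : P' (s' ++ t) -> (size t0 <= i)%N -> onth (s' ++ t) i = Some e ->
    node e c k -> (enc c < K)%N.
  move=> hP hi he nd; rewrite ltnNge; apply/negP => hK.
  have [c1 [k1 [nd1 _ sk _ H]]] := next_node hP he.
  have [E1 E2] := node_inj nd nd1; subst c1 k1.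
  have [v hv] : exists v, onth k K = Some v by apply: onth_some; rewrite sk ltnS.
  have h0 : onth (s' ++ t) (size t0) = Some e0.
    by apply: onth_catl; rewrite Es onth_rcons.
  have [_ H'] := H _ _ _ _ hi h0 nd0; have EK : fstM (K : NN) = size t0 by exact: fst_pair.
  by have := H' K v hv EK; rewrite /K snd_pair; exact: hJ.
suff claim d t : (K <= size (s' ++ t) + d)%N -> rank_lt P' 1 (s' ++ t).
  by rewrite -(cats0 s'); apply: (claim K); exact: leq_addl.
elim: d t => [|d IH] t hd.
  apply: rank_lt_none => u; rewrite -catA => hP.
  have l : ((size (s' ++ t)).-1 < size (s' ++ t ++ u))%N.
    by rewrite !size_cat Es size_rcons /=; lia.
  have [e he] := onth_some l; have [c [k [nd sc _ _ _]]] := next_node hP he.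
  have := bound _ _ _ _ _ hP _ he nd; rewrite Es size_cat size_rcons /= => /(_ (leq_addr _ _)).
  have := size_enc c; rewrite sc; move: hd; rewrite Es !size_cat size_rcons; lia.
have [N hN] := finitely_many K (s' ++ t).
apply: (rank_lt_step (N := N)) => a; rewrite rcons_cat.
  by apply: IH; move: hd; rewrite !size_cat size_rcons; lia.
move=> ha; apply: rank_lt_none => u hP.
have hi : onth ((s' ++ rcons t a) ++ u) (size (s' ++ t)) = Some a.
  by apply: onth_catl; rewrite -rcons_cat onth_rcons.
have [c [k [nd _ _ _ _]]] := next_node hP hi.
have h1 : (K <= enc c)%N by apply: (hN a u c k ha) nd; rewrite rcons_cat.
rewrite -catA in hP hi.
have := bound _ _ _ _ _ hP _ hi nd; rewrite ltnNge h1 => H; apply: notF; apply: H.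
by rewrite size_cat Es size_rcons; lia.
Qed.

Hypothesis P0 : P [::].

(** The paths of the next tree branch like the given one, except for subtrees over
    candidates outside it, which have rank 1 instead of 0. *)
Lemma rank_lt_lift j s s' : rank_lt P j s -> above s' s -> rank_lt P' j.+1 s'.
Proof.
move=> h; elim: h s' => {j s} [j s hs|j s N _ IH _ IH'] s' ha.
  apply: (@rank_lt_mono_le _ 1) => //; apply: rank_lt_false ha.
    by move=> E; apply: (hs [::]); rewrite E.
  by move=> hP; apply: (hs [::]); rewrite cats0.
have [N' hN'] := finitely_many (\max_(a < N) enc (rcons s a)).+1 s'.
apply: (rank_lt_step (N := N')) => e.
  have [hn|hn] := classic (none P' (rcons s' e)); first exact: rank_lt_none.
  by have [a [h _]] := above_child ha hn; exact: IH h.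
move=> le; have [hn|hn] := classic (none P' (rcons s' e)); first exact: rank_lt_none.
have [a [h [t [k [hP nd]]]]] := above_child ha hn; apply: IH' h.
have := hN' e t _ k le hP nd; apply: contraLR; rewrite -ltnNge -leqNgt => l.
exact: (leq_bigmax (Ordinal l)).
Qed.

Lemma rank_lt_lift_root j : (forall a, rank_lt P j [:: a]) -> forall e, rank_lt P' j.+1 [:: e].
Proof.
move=> h e; have [hn|hn] := classic (none P' [:: e]); first exact: rank_lt_none.
have [a [ha _]] := @above_child [::] [::] e (or_introl (conj erefl erefl)) hn.
exact: rank_lt_lift (h a) ha.
Qed.

End Lifting.

(** Without elements of [B] the first tree consists of its root, and each step raises
    ranks by one. *)
Lemma tower_rank B k T : tower B k T -> (forall x : NN, ~ B NN x) ->
  forall a, rank_lt (fun s => T NN (enc s)) k [:: a].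
Proof.
move=> h nB; elim: h => {k T} [|k m T R hT IH hR ER UR] a.
  by apply: rank_lt_none => t /(base_enc nB).
apply: (rank_lt_lift_root (T := T)) => //; [exact: UR|].
by rewrite enc_nil; exact: tower0 hT.
Qed.

Lemma tower_even B k T e s : tower B k T -> T NN (enc (e :: s)) -> ~~ odd e.
Proof.
have he : EntM (enc (e :: s)) (0 : NN) (e : NN) by apply/enc_ent.
case=> [[[_ h] _]|k' m T' R _ _ _ _ [[_ /shapeE h] _]].
  have [[x [_ ->]] _] := h _ (ent_idx_le he) _ (ent_le he) he.
  by change (~~ odd (addn x x)); rewrite addnn odd_double.
have [w [-> _ _ _ _]] := h _ _ he.
by change (~~ odd (addn w w)); rewrite addnn odd_double.
Qed.

Lemma odd_enc n s : OddM n (enc s) <-> size s = n /\ all odd s.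
Proof.
have [h1 h2 _] := encP s; rewrite /OddM h2 natM_NN; split.
  move=> [[_ Es] h]; split=> //; apply/(all_nthP 0%N) => i hi.
  have [v hv] := onth_some hi; rewrite (nth_onth hv); move/enc_ent: hv => hv.
  have [y [_ ->]] := h _ (ent_idx_le hv) _ (ent_le hv) hv.
  by change (odd (addn y y).+1); rewrite addnn /= odd_double.
move=> [Es /(all_nthP 0%N) h]; split=> // i _ v _ /enc_ent hv.
have := h i (onth_lt hv); rewrite (nth_onth hv) => ov; exists v./2.
have E : v = (addn v./2 v./2).+1 by rewrite addnn -[LHS](odd_double_half v) ov.
by split=> //; change (is_true (v./2 <= v)%N); rewrite {2}E; lia.
Qed.

(** * The order type *)

Section Collapse.
Variables (U V : Type) (ltV : V -> V -> Prop) (X : U -> Prop) (ltX : U -> U -> Prop).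
Hypotheses (wfV : well_founded ltV) (trV : forall t s u, ltV s t -> ltV t u -> ltV s u).
Hypothesis totV : forall s t, ltV s t \/ s = t \/ ltV t s.
Hypothesis totX : forall x y, X x -> X y -> ltX x y \/ x = y \/ ltX y x.
Variables (f : U -> V) (e : V -> U).
Hypothesis fX : forall x y, X x -> X y -> ltX x y -> ltV (f x) (f y).
Hypotheses (Xe : forall t, X (e t)) (eV : forall s t, ltV s t -> ltX (e s) (e t)).

Let irrV t : ~ ltV t t.
Proof. by elim/(well_founded_ind wfV): t => t IH h; exact: (IH _ h h). Qed.

Let minV (Q : V -> Prop) t : Q t -> exists2 s, Q s & forall u, ltV u s -> ~ Q u.
Proof.
elim/(well_founded_ind wfV): t => t IH h; have [[s [h1 h2]]|N] := classic (exists s, ltV s t /\ Q s).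
  exact: IH h1 h2.
by exists t => // u hu Qu; apply: N; exists u.
Qed.

Let rel (y x : U) : Prop := X y /\ X x /\ ltX y x.

Let wfX : well_founded rel.
Proof.
move=> x; move: {2}(f x) (erefl (f x)) => t; elim/(well_founded_ind wfV): t x => t IH x E.
by constructor => y [hy [hx h]]; apply: IH erefl; rewrite -E; exact: fX.
Qed.

Let above_all x (h : forall y, rel y x -> V) t : Prop := forall y (p : rel y x), ltV (h y p) t.
Let least_above x (h : forall y, rel y x -> V) t : Prop :=
  above_all h t /\ forall s, ltV s t -> ~ above_all h s.
Let step (v : V) x (h : forall y, rel y x -> V) : V :=
  epsilon (inhabits v) (fun t => least_above h t).

(** Two well-orders that embed into each other are isomorphic: map each element to
    the least one above the images of its predecessors. *)
Lemma collapse : inhabited V -> exists g : V -> U,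
  [/\ forall t, X (g t), forall x, X x -> exists t, g t = x &
      forall s t, ltV s t -> ltX (g s) (g t)].
Proof.
move=> [v0]; pose h : U -> V := Fix wfX (fun _ => V) (step v0).
have hE x : h x = step v0 (fun y (_ : rel y x) => h y).
  rewrite /h Fix_eq // => y k1 k2 E; have -> // : k1 = k2.
  by apply: functional_extensionality_dep => z; apply: functional_extensionality_dep.
have hP x : X x -> least_above (fun y (_ : rel y x) => h y) (h x) /\ ~ ltV (f x) (h x).
  elim/(well_founded_ind wfX): x => x IH hx.
  have hf : above_all (fun y (_ : rel y x) => h y) (f x).
    move=> y p; have [hy [_ l]] := p; have [_ n] := IH y p hy.
    have lf := fX hy hx l.
    by have [l'|[->//|/n //]] := totV (h y) (f y); exact: trV l' lf.
  have [s h1 h2] := minV hf.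
  have hl : least_above (fun y (_ : rel y x) => h y) (h x).
    by rewrite hE; apply: epsilon_spec; exists s.
  by split=> // l; case: hl => _ /(_ _ l).
have hmono x y : X x -> X y -> ltX x y -> ltV (h x) (h y).
  by move=> hx hy l; have [[H _] _] := hP y hy; exact: (H x (conj hx (conj hy l))).
have hsurj t : exists2 x, X x & h x = t.
  apply: NNPP => N.
  have [s Ns mins] := minV (Q := fun t => ~ exists2 x, X x & h x = t) N.
  have below x : X x -> ltV (h x) s.
    elim/(well_founded_ind wfX): x => x IH hx.
    have [//|[E|l]] := totV (h x) s; first by case: Ns; exists x.
    have [[_ /(_ _ l) H] _] := hP x hx; case: H => y p; exact: IH p p.1.
  have [b hb minb] := minV (Q := fun t => ltV (h (e t)) t) (below _ (Xe s)).
  by apply: (minb _ hb); apply: hmono => //; exact: eV.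
pose g t := proj1_sig (constructive_indefinite_description _ (let: ex_intro2 x hx E := hsurj t in
  ex_intro (fun x => X x /\ h x = t) x (conj hx E))).
have gP t : X (g t) /\ h (g t) = t by rewrite /g; case: constructive_indefinite_description.
exists g; split=> [t|x hx|s t l]; first by case: (gP t).
  exists (h x); have [h1 h2] := gP (h x).
  have [l|[//|l]] := totX h1 hx; [have := hmono _ _ h1 hx l|have := hmono _ _ hx h1 l];
    by rewrite h2 => /irrV.
have [[h1 h2] [g1 g2]] := (gP s, gP t).
have [//|[E|l']] := totX h1 g1; first by case: (@irrV t); rewrite -{1}g2 -E h2.
by have := trV l (_ : ltV t s); rewrite -{1}g2 -{1}h2 => /(_ (hmono _ _ g1 h1 l'))/irrV.
Qed.

End Collapse.

Lemma kb_wf n : well_founded (fun s t : n.-tuple nat => is_true (kb s t)).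
Proof.
have H m : forall s, size s = m -> Acc (fun s t => size s = size t /\ kb s t) s.
  elim: m => [|m IH] s.
    by move=> /size0nil ->; constructor => -[|x t] [].
  case: s => [//|x s] [hs]; move: s hs; elim/ltn_ind: x => x IHx s hs.
  have A := IH s hs; move: hs; elim: A => {}s _ IHs hs.
  constructor => -[|y u] [hu]; first by move: hu.
  move: hu => [hu]; rewrite kb_cons => /orP [l|/andP [/eqP -> l]].
    by apply: IHx => //; rewrite hu.
  by apply: IHs => //; rewrite hu.
move=> t; have A := H n t (size_tuple t); move E: (tval t) A => s A.
elim: A t E => {}s _ IH t E; constructor => u hu.
by apply: (IH (tval u)) => //; rewrite -E !size_tuple.
Qed.

Lemma lexi_kb n (s t : n.-tuplelexi nat) : (s <= t)%O = (tval s == tval t) || kb s t.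
Proof.
have H (u v : seqlexi nat) : size u = size v -> (u <= v)%O = (u == v) || kb u v.
  elim: u v => [|x u IH] [|y v] // [/IH {}IH].
  have -> : ((x :: u : seqlexi nat) <= y :: v)%O =
    (x <= y)%N && ((y <= x)%N ==> ((u : seqlexi nat) <= v)%O) by [].
  rewrite IH kb_cons eqseq_cons.
  by case: (ltngtP x y).
by apply: (H s t); rewrite !size_tuple.
Qed.

Section OrderType.
Variables (n : nat) (B T : upred).
Hypotheses (Btower : tower B n T) (noB : forall x : NN, ~ @B NN x).

Let Q (s : seq nat) : Prop := @T NN (enc s) \/ OddM n (enc s).

Let Tcan (c : NN) : T c -> CanM c.
Proof. exact: tower_can Btower. Qed.

Lemma field_enc s : FieldM n T (sS (enc s)) <-> Q s.
Proof.
split=> [[//|[c [_ [/succ_inj <- //]]]]|h]; right; exists (enc s); split=> //.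
exact: (@leS NN).
Qed.

Lemma field_pos (c : NN) : FieldM n T (sS c) -> exists s, c = enc s.
Proof. by move=> /(field_can Tcan) /enc_can. Qed.

Lemma rank_lt_even j s : rank_lt (fun s => @T NN (enc s)) j s -> ~~ odd (head 1%N s) -> rank_lt Q j s.
Proof.
elim=> {j s} [j s h|j s N _ IH _ IH'] he.
  apply: rank_lt_none => t [/h //|/odd_enc [_]].
  by case: s he {h} => //= x s /negPf ->.
have he' a : ~~ odd (head 1%N (rcons s a)) by case: s he {IH IH'}.
by apply: (rank_lt_step (N := N)) => a => [|l]; [exact: IH|exact: IH'].
Qed.

Lemma rank_lt_odd d s : odd (head 0%N s) -> (size s + d)%N = n -> rank_lt Q d.+1 s.
Proof.
move=> ho; have noT t : ~ T (enc (s ++ t)).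
  by case: s ho => //= x s ho /(tower_even Btower); rewrite ho.
elim: d s ho noT => [|d IH] s ho noT hs.
  have no a : none Q (rcons s a).
    move=> t [|/odd_enc [E _]]; first by rewrite cat_rcons => /noT.
    by move: hs E; rewrite size_cat size_rcons; lia.
  by apply: (rank_lt_step (N := 0%N)) => a => [|_]; exact: rank_lt_none.
have kid a : rank_lt Q d.+1 (rcons s a).
  apply: IH; [by case: s ho {noT hs}|by move=> t; rewrite cat_rcons|].
  by rewrite size_rcons -hs; lia.
by apply: (rank_lt_step (N := 0%N)) => a => [|_]; [exact: rank_lt_mono|].
Qed.

Lemma rank_lt_root a : rank_lt Q n [:: a].
Proof.
have [ho|he] := boolP (odd a); last by apply: rank_lt_even => //; exact: (tower_rank Btower noB).
have [E|n0] := posnP n.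
  apply: rank_lt_none => t [/(tower_even Btower)|/odd_enc [+ _]]; first by rewrite ho.
  by rewrite E.
by rewrite -(prednK n0); apply: rank_lt_odd => //=; rewrite add1n prednK.
Qed.

Let X (x : nat) : Prop := FieldM n T (x : NN) /\ x <> 1%N.
Let ltX (x y : nat) : Prop := OrderM n T (x : NN) (y : NN) /\ x <> y.

Lemma root_field : FieldM n T (1 : NN).
Proof. by right; exists 0%N; split=> //; split=> //; left; exact: tower0 Btower. Qed.

Lemma below_root x : FieldM n T (x : NN) -> OrderM n T (x : NN) (1 : NN).
Proof.
case: x => [|c] hx; first by apply/order_0; exact: root_field.
have [s Es] := field_pos hx; apply/order_succ; split=> //; split; first exact: root_field.
rewrite Es -[s_zero NN]enc_nil; case: s {Es} => [|x s]; first by left.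
by right; apply/(before_kb (encP _) (encP _)).
Qed.

(* The blocks of the children of the root are arranged along the leading entries;
   these are raised by one to make room for the least element. *)
Lemma into_tuples : exists f : nat -> n.-tuple nat,
  forall x y, X x -> X y -> ltX x y -> kb (f x) (f y).
Proof.
have sm a : small Q n [:: a] := rank_lt_small (rank_lt_root a).
have [f [[fs fk] _]] := @embeds_children Q n [::] 0 (fun a _ => sm a).
pose dec (c : NN) : seq nat := epsilon (inhabits [::]) (fun s => c = enc s).
have decK s : dec (enc s) = s.
  apply/esym/enc_inj.
  exact: (@epsilon_spec _ (inhabits [::]) (fun t => enc s = enc t) (ex_intro _ s erefl)).
pose g (x : nat) : seq nat := if x is c.+1 then raise 1 (f (dec c)) else nseq n 0%N.
have nonroot d : X d.+1 -> exists a t, d = enc (a :: t) /\ Q (a :: t).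
  move=> [hd nd]; have [[|a t] Et] := field_pos hd; first by case: nd; rewrite Et enc_nil.
  by exists a, t; split=> //; apply/field_enc; rewrite -Et.
have inA a t : Q (a :: t) -> exists2 b, (0 <= b)%N & sub Q (rcons [::] b) (a :: t).
  by move=> h; exists a => //; split=> //; exists t.
have gs x : X x -> size (g x) = n.
  case: x => [|d] h; first by rewrite /= size_nseq.
  have [a [t [-> hQ]]] := nonroot d h; rewrite /= size_raise decK; exact: fs (inA _ _ hQ).
have gk x y : X x -> X y -> ltX x y -> kb (g x) (g y).
  move=> hx hy [l nxy]; case: y hy l nxy => [|d] hy l nxy; first by case: nxy; exact: order_to0 l.
  have [b [u [Ed hd]]] := nonroot d hy; subst d; rewrite /= decK.
  case: x hx l nxy => [|c] hx l nxy.
    have [n0|n0] := posnP n; first by have [/(_ n0) /(_ u) []] := sm b.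
    have := fs _ (inA _ _ hd); case: (f _) => [|z zs] /=; first by move=> E; rewrite -E in n0.
    by case: n n0.
  have [a [t [Ec hc]]] := nonroot c hx; subst c; rewrite /= decK kb_raise.
  move/order_succ: l => [_ [_ [E|h]]]; first by case: nxy; congr S.
  by apply: fk; [exact: inA|exact: inA|apply/(before_kb (encP _) (encP _))].
exists (fun x => insubd (nseq_tuple n 0%N) (g x)) => x y hx hy h.
by rewrite !insubdK ?gk // /in_mem /= gs.
Qed.

Lemma from_tuples : exists e : n.-tuple nat -> nat,
  (forall t, X (e t)) /\ forall s t : n.-tuple nat, kb s t -> ltX (e s) (e t).
Proof.
have [n0|n0] := posnP n.
  exists (fun _ => 0%N); split=> [t|s t]; first by split=> //; left.
  by move: (size_tuple s); case: (tval s) => // x s' E; rewrite -E in n0.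
pose m (s : seq nat) := [seq x.*2.+1 | x <- s].
have hm (s t : seq nat) : kb (m s) (m t) = kb s t.
  by elim: s t => [|x s IH] [|y t] //=; rewrite IH ltnS ltn_double eqSS -!addnn; congr (_ || _ && _); lia.
have fm (s : n.-tuple nat) : FieldM n T (sS (enc (m s))).
  apply/field_enc; right; apply/odd_enc; rewrite size_map size_tuple; split=> //.
  by rewrite all_map; apply/allP => x _ /=; rewrite odd_double.
exists (fun s => (enc (m s)).+1); split=> [t|s t h].
  split; first exact: fm.
  move=> [E]; have /esym E' : enc [::] = enc (m t) by rewrite enc_nil E.
  by have := size_tuple t; rewrite -(size_map (fun x => x.*2.+1)) -/(m t) (enc_inj E') => En; rewrite -En in n0.
split; last by move=> [/enc_inj E]; have := kb_irr (m s); rewrite {2}E hm h.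
apply/order_succ; split; first exact: fm; split; first exact: fm; right.
by apply/(before_kb (encP _) (encP _)); rewrite hm.
Qed.

Theorem order_type (l : nat) :
  (forall x y : nat, lo_le l x y <-> OrderM n T (x : NN) (y : NN)) ->
  has_order_type_omega_pow_succ l n.
Proof.
move=> hl; have [f hf] := into_tuples; have [e [Xe he]] := from_tuples.
have tot (s t : n.-tuple nat) : kb s t \/ s = t \/ kb t s.
  have [/eqP/val_inj ->|/kb_total /orP [h|h]] := boolP (tval s == tval t); tauto.
have totX x y : X x -> X y -> ltX x y \/ x = y \/ ltX y x.
  move=> [hx _] [hy _]; have [->|ne] := classic (x = y); first by tauto.
  have [h|h] := @order_total NN n T Tcan x y (order_refl hx) (order_refl hy); first by left.
  by right; right; split=> // E; apply: ne.
have trV (t s u : n.-tuple nat) : kb s t -> kb t u -> kb s u by exact: kb_trans.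
have [g [Xg sg mg]] := collapse (@kb_wf n) trV tot totX hf Xe he (inhabits (nseq_tuple n 0%N)).
have ginj s t : g s = g t -> s = t.
  by move=> E; have [/mg [_ []] //|[//|/mg [_ []]]] := tot s t.
exists (fun u : option (n.-tuplelexi nat) => if u is Some t then g t else 1%N); split.
- move=> [s|] [t|] //=; first by move=> /ginj ->.
  + by move=> E; have [_] := Xg s; rewrite E.
  + by move=> E; have [_] := Xg t; rewrite -E.
- move=> x; rewrite /lo_dom hl; split=> [[hx _]|[u <-]].
    have [->|ne] := classic (x = 1%N); first by exists None.
    by have [t <-] := sg x (conj hx ne); exists (Some t).
  apply: order_refl; case: u => [t|]; [by case: (Xg t)|exact: root_field].
- move=> [s|] [t|]; rewrite hl /=.
  + rewrite lexi_kb; split=> [h|/orP [/eqP/val_inj ->|/mg [] //]]; last first.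
      by apply: order_refl; case: (Xg t).
    have [->|[->|/mg [h' ne]]] := tot s t; rewrite ?eqxx ?orbT //.
    by case: ne; exact: order_antisym h' h.
  + by split=> // _; apply: below_root; case: (Xg s).
  + split=> // h; have [ft ne] := Xg t; case: ne.
    exact: order_antisym (below_root ft) h.
  + by split=> // _; apply: order_refl; exact: root_field.
Qed.

End OrderType.

Theorem theorem1 :
  forall (n : nat) (phi : form),
    sentence phi -> is_Pi (2 * n).+1 phi -> true_in_N phi ->
    exists l : nat,
      [/\ computable_LO l,
          PA_verifiable l,
          has_order_type_omega_pow_succ l n &
          proves (RFN_iter PA axPA l) phi].
Proof.
move=> n phi hs hp ht; have [B hB Bphi] := sentence_witness hs hp.
have [T hT T0] := tower_ex hB.
have [l [h1 h2 h3 h4]] := order_proves hT hB T0 Bphi.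
exists l; split=> //; apply: (order_type hT _ h3) => x hx.
by apply: (iffRL (Bphi NN (fun _ => 0%N))); [exists x|apply/sat_NN].
Qed.
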